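(* Let $M$ be a smooth manifold, $N\subseteq M$ a closed submanifold, $r\ge 1$, and let $Q\subseteq T_rM$ be a graded subbundle along $N$ (so $Q$ has base $Q\cap M=N$). Then $Q$ corresponds to a weighting, i.e. there is an order $r$ weighting of $M$ along $N$ with $$Q=\{\mathsf{u}\in T_rM\mid \forall f\in C^\infty(M)_{(i)},\ j<i\le r\ \Rightarrow\ f^{(j)}(\mathsf{u})=0\},$$ if and only if the following three conditions are satisfied: (i) $Q$ is $TM$-invariant; (ii) $TQ\subseteq T(T_rM)|_Q$ is $\mathbb{A}_r$-invariant; (iii) $TQ$ is spanned (at every point of $Q$) by lifts $X^{(-i)}$, $0\le i\le r$, of vector fields $X$ such that $X^{(-i)}$ is tangent to $Q$.
   Context: Weightings. A weight sequence of order $r$ is a sequence of integers $0\le w_1\le\dots\le w_n\le r$. Put $k_i=\#\{a: w_a\le i\}$. For a chart $U$ with coordinates $x_1,\dots,x_n$, let $C^\infty(U)_{(i)}$ be the ideal generated by monomials $x^s=x_1^{s_1}\cdots x_n^{s_n}$ with $s\cdot w=\sum_a s_aw_a\ge i$. An order $r$ weighting on an $n$-dimensional manifold $M$ is a filtration $C^\infty_M=C^\infty_{M,(0)}\supseteq C^\infty_{M,(1)}\supseteq\cdots$ of the structure sheaf by ideal sheaves such that every point has an open neighborhood $U$ with coordinates $x_a$ in which the filtration of $C^\infty(U)$ is given by this local model for a weight sequence of order $r$ (which may depend on the connected component of $N$ below). The ideal $C^\infty_{M,(1)}$ is the vanishing ideal of a closed submanifold $N$; one speaks of a weighting along $N$.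 Global sections are denoted $C^\infty(M)_{(i)}$. Graded bundles. A graded bundle is a manifold $E$ with a smooth action $t\mapsto\kappa_t$ of the multiplicative monoid $(\mathbb{R},\cdot)$; it is a fiber bundle over $\kappa_0(E)$. A graded subbundle is an $(\mathbb{R},\cdot)$-invariant submanifold; its base is its image under $\kappa_0$. Higher tangent bundles. Let $\mathbb{A}_r=\mathbb{R}[\epsilon]/(\epsilon^{r+1})$ and $T_rM=\mathrm{Hom}_{\mathrm{alg}}(C^\infty(M),\mathbb{A}_r)$ (equivalently, $r$-jets at $0$ of curves $\mathbb{R}\to M$). Elements are written $\mathsf{u}=\sum_{i=0}^r\mathsf{u}_i\epsilon^i$ with $\mathsf{u}_i:C^\infty(M)\to\mathbb{R}$ linear; $\mathsf{u}_0$ is evaluation at the base point of $\mathsf{u}$. It is a graded bundle over $M$ with $\kappa_t(\sum\mathsf{u}_j\epsilon^j)=\sum t^j\mathsf{u}_j\epsilon^j$. For $f\in C^\infty(M)$, $f^{(i)}\in C^\infty(T_rM)$ is $f^{(i)}(\mathsf{u})=\mathsf{u}_i(f)$ for $0\le i\le r$ (and $f^{(i)}=0$ for $i<0$). For a vector field $X$ on $M$ and $0\le i\le r$, the lift $X^{(-i)}$ is the unique vector field on $T_rM$ with $X^{(-i)}f^{(\ell)}=(Xf)^{(\ell-i)}$ for all $f,\ell$. $TM$-action: $v\in T_mM$ acts on $\mathsf{u}\in T_rM|_m$ by $\mathsf{u}\mapsto\mathsf{u}+v\epsilon^r$ ($v$ regarded as a derivation $C^\infty(M)\to\mathbb{R}$).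 $Q$ is $TM$-invariant if it is preserved by these maps. $\mathbb{A}_r$-action: identify $T(T_rM)=\mathrm{Hom}_{\mathrm{alg}}(C^\infty(M),\mathbb{A}_r\otimes\mathbb{A}_1)$. An element $x\in\mathbb{A}_r$ acts on tangent spaces of $T_rM$ by composition with the algebra endomorphism of $\mathbb{A}_r\otimes\mathbb{A}_1$ given by $\epsilon\otimes1\mapsto\epsilon\otimes1$, $1\otimes\epsilon\mapsto x\otimes\epsilon$. In particular $\epsilon\cdot X^{(-i)}=X^{(-i-1)}$ (zero for $i=r$).
   Formalization: A weighting may also be trivial (every ideal equal to all smooth functions) near a point; for manifolds of positive dimension this follows from the local model, and for dimension 0 it is needed to allow points outside N, where the literal statement fails. *)

(* Defs.v *)
From HB Require Import structures.
From mathcomp Require Import all_boot all_order all_algebra.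
From mathcomp Require Import qpoly.
From mathcomp Require Import all_classical all_reals topology normedtype derive.

Set Implicit Arguments.
Unset Strict Implicit.
Unset Printing Implicit Defensive.

Import Order.TTheory GRing.Theory Num.Theory.
Import numFieldNormedType.Exports.

Local Open Scope classical_set_scope.
Local Open Scope ring_scope.

Section euclidean.
Context {R : realType} {m : nat}.
Implicit Types (U : set 'rV[R]_m) (f g : 'rV[R]_m -> R).

(* [Ck k U f] is meant for open [U]; the values of [f] outside [U] are then
   irrelevant (lemma [Ck_ext]). *)
Fixpoint Ck (k : nat) U f : Prop :=
  (forall x, U x -> {for x, continuous f}) /\
  if k is k'.+1 then
    forall a : 'I_m,
      (forall x, U x -> derivable f x (delta_mx 0 a)) /\
      Ck k' U (fun x => 'D_(delta_mx 0 a) f x)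
  else True.

Definition smoothE U f := forall k, Ck k U f.

Definition smoothE_map (p : nat) U (h : 'rV[R]_m -> 'rV[R]_p) :=
  forall a, smoothE U (fun x => h x 0 a).

Lemma Ck_ext k U f g : open U -> (forall x, U x -> f x = g x) ->
  Ck k U f -> Ck k U g.
Proof.
move=> oU.
have nearU f' g' x : (forall y, U y -> f' y = g' y) -> U x -> {near x, f' =1 g'}.
  by move=> fg' Ux; near=> y; apply/fg'; near: y; exact: open_nbhs_nbhs.
have cts f' g' x : U x -> (forall y, U y -> f' y = g' y) ->
    {for x, continuous f'} -> {for x, continuous g'}.
  move=> Ux fg' cf; have : f' @ x --> g' x by rewrite -(fg' x Ux); exact: cf.
  by apply: cvg_trans; exact: (near_eq_cvg (nearU _ _ _ fg' Ux)).
elim: k f g => [|k IH] f g fg /= [cf Df].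
  by split=> // x Ux; exact: cts Ux fg (cf x Ux).
have fgn x : U x -> {near x, f =1 g} by move=> Ux; exact: nearU.
split=> [x Ux|a]; first exact: cts Ux fg (cf x Ux).
have [df Cf] := Df a; split=> [x Ux|].
  exact: near_eq_derivable (fgn x Ux) (df x Ux).
by apply: IH Cf => x Ux; exact: near_eq_derive (fgn x Ux).
Unshelve. all: by end_near. Qed.

Lemma CkW k U f : Ck k.+1 U f -> Ck k U f.
Proof.
elim: k f => [|k IH] f [cf Df]; split=> // a.
by have [df Cf] := Df a; split=> //; exact: IH.
Qed.

Lemma Ck_cst k U (c : R) : open U -> Ck k U (fun=> c).
Proof.
move=> oU; elim: k c => [|k IH] c.
  by split=> // x _; exact: cst_continuous.
split=> [x _|a]; first exact: cst_continuous.
split=> [x _|]; first exact: derivable_cst.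
by apply: Ck_ext (IH 0) => // x _; rewrite derive_cst.
Qed.

Lemma CkD k U f g : open U -> Ck k U f -> Ck k U g -> Ck k U (f + g).
Proof.
move=> oU; elim: k f g => [|k IH] f g [cf Df] [cg Dg].
  by split=> // x Ux; exact: continuousD (cf x Ux) (cg x Ux).
split=> [x Ux|a]; first exact: continuousD (cf x Ux) (cg x Ux).
have [df Cf] := Df a; have [dg Cg] := Dg a; split=> [x Ux|].
  by apply: derivableD; [exact: df|exact: dg].
apply: Ck_ext (IH _ _ Cf Cg) => // x Ux.
by rewrite deriveD //; [exact: df|exact: dg].
Qed.

Lemma CkM k U f g : open U -> Ck k U f -> Ck k U g -> Ck k U (f * g).
Proof.
move=> oU; elim: k f g => [|k IH] f g Hf Hg.
  have [cf _] := Hf; have [cg _] := Hg.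
  by split=> // x Ux; exact: continuousM (cf x Ux) (cg x Ux).
have [cf Df] := Hf; have [cg Dg] := Hg.
split=> [x Ux|a]; first exact: continuousM (cf x Ux) (cg x Ux).
have [df Cf] := Df a; have [dg Cg] := Dg a; split=> [x Ux|].
  by apply: derivableM; [exact: df|exact: dg].
have := CkD oU (IH _ _ (CkW Hf) Cg) (IH _ _ (CkW Hg) Cf).
by apply: Ck_ext => // x Ux; rewrite deriveM //; [exact: df|exact: dg].
Qed.

Definition diffeo U (psi psi' : 'rV[R]_m -> 'rV[R]_m) :=
  [/\ open U, open (psi @` U), (forall x, U x -> psi' (psi x) = x),
      smoothE_map U psi & smoothE_map (psi @` U) psi'].

(* Embedded submanifolds, whose dimension [k] may depend on the point. *)
Definition submanifoldE (S : set 'rV[R]_m) :=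
  forall x, S x -> exists U psi psi' k,
    [/\ diffeo U psi psi', U x &
        forall y, U y -> (S y <-> forall j : 'I_m, (k <= j)%N -> psi y 0 j = 0)].

End euclidean.

Record chart (R : realType) (n : nat) (M : topologicalType) := Chart {
  chart_dom : set M;
  chart_map : M -> 'rV[R]_n;
  chart_inv : 'rV[R]_n -> M;
  _ : open chart_dom;
  _ : open (chart_map @` chart_dom);
  _ : forall x, chart_dom x -> {for x, continuous chart_map};
  _ : forall y, (chart_map @` chart_dom) y -> {for y, continuous chart_inv};
  _ : forall x, chart_dom x -> chart_inv (chart_map x) = x }.

Definition smooth_transition (R : realType) n (M : topologicalType)
    (c d : chart R n M) :=
  smoothE_map (chart_map c @` (chart_dom c `&` chart_dom d))
    (chart_map d \o chart_inv c).

Definition compatible (R : realType) n (M : topologicalType)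
    (c d : chart R n M) :=
  smooth_transition c d /\ smooth_transition d c.

Record manifold (R : realType) (n : nat) := Manifold {
  manifold_sort :> topologicalType;
  atlas : set (chart R n manifold_sort);
  _ : hausdorff_space manifold_sort;
  _ : @second_countable manifold_sort;
  _ : forall x : manifold_sort, exists2 c, atlas c & chart_dom c x;
  _ : forall c d, atlas c -> atlas d -> compatible c d }.

Section smooth_functions.
Context {R : realType} {n : nat} (M : manifold R n).
Implicit Types (U : set M) (f g : M -> R).

(* Membership in the maximal atlas *)
Definition smooth_chart (c : chart R n M) := forall d, atlas d -> compatible c d.

(* Sections of the structure sheaf over an open [U] are represented by
   functions on [M] whose values outside [U] are irrelevant. *)
Definition smooth_on U f := forall c, atlas c ->
  smoothE (chart_map c @` (U `&` chart_dom c)) (f \o chart_inv c).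

Definition smooth : {pred M -> R} := mem [set f | smooth_on setT f].

Lemma smoothP f : reflect (smooth_on setT f) (f \in smooth).
Proof. by apply: (iffP idP); rewrite inE. Qed.

Let odom (c : chart R n M) : open (chart_map c @` (setT `&` chart_dom c)).
Proof. by rewrite setTI; case: c. Qed.

Lemma smooth_subring_closed : subring_closed smooth.
Proof.
have cst1 (k : R) : smooth_on setT (fun=> k) by move=> c _ j; exact: Ck_cst.
have mulS f g : smooth_on setT f -> smooth_on setT g -> smooth_on setT (f * g).
  by move=> sf sg c ac k; exact: CkM (@odom c) (sf c ac k) (sg c ac k).
split; first exact/smoothP/cst1.
- move=> f g /smoothP sf /smoothP sg; apply/smoothP => c ac k.
  have := CkD (@odom c) (sf c ac k)
    (CkM (@odom c) (Ck_cst k (-1) (@odom c)) (sg c ac k)).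
  by apply: Ck_ext => // x _; rewrite /GRing.add /GRing.mul /= mulN1r.
- by move=> f g /smoothP sf /smoothP sg; apply/smoothP/mulS.
Qed.

Lemma smooth_scaler_closed : GRing.scaler_closed smooth.
Proof.
move=> k f /smoothP sf; apply/smoothP => c ac j.
exact: CkM (@odom c) (Ck_cst j k (@odom c)) (sf c ac j).
Qed.

HB.instance Definition _ :=
  GRing.isSubringClosed.Build (M -> R) smooth smooth_subring_closed.
HB.instance Definition _ :=
  GRing.isScaleClosed.Build R (M -> R) smooth smooth_scaler_closed.

Record smooth_fun : predArgType :=
  SmoothFun { smooth_val :> M -> R; _ : smooth_val \in smooth }.

HB.instance Definition _ := [isSub for smooth_val].
HB.instance Definition _ := [Choice of smooth_fun by <:].
HB.instance Definition _ := GRing.SubChoice_isSubComPzRing.Build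
  (M -> R) smooth smooth_fun smooth_subring_closed.
HB.instance Definition _ := [SubZmodule_isSubLmodule of smooth_fun by <:].

End smooth_functions.

Notation "'C^oo' M" := (smooth_fun M) (at level 10, M at level 8).

Section geometry.
Context {R : realType} {n : nat} (M : manifold R n).

Definition submanifold (N : set M) :=
  forall c, atlas c -> submanifoldE (chart_map c @` (N `&` chart_dom c)).

Definition tangent_vector (m : M) (v : C^oo M -> R) :=
  linear_for *%R v /\ forall f g, v (f * g) = v f * g m + f m * v g.

Definition vector_field (X : C^oo M -> C^oo M) :=
  linear X /\ forall f g, X (f * g) = X f * g + f * X g.

End geometry.

(* The algebra A_r = R[epsilon]/(epsilon^(r+1)); 'qX is epsilon and [x`_i] is
   the coefficient of epsilon^i in [x]. *)
Notation trunc R r := {poly %/ ('X^(r.+1) : {poly R})}.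

Section higher_tangent.
Context {R : realType} {n : nat} (M : manifold R n) (r : nat).
Implicit Types (u v : C^oo M -> trunc R r) (Q : set (C^oo M -> trunc R r)).

Definition TrM : set (C^oo M -> trunc R r) :=
  [set u : C^oo M -> trunc R r | linear u /\ monoid_morphism u].

Definition jet_lift (f : C^oo M) (i : nat) u : R := (u f)`_i.

Definition base_point u (m : M) := forall f : C^oo M, jet_lift f 0 u = f m.

Definition zero_jet (m : M) : C^oo M -> trunc R r := fun f => qpolyC _ (f m).

Definition kappa (t : R) u : C^oo M -> trunc R r :=
  fun f => mk_npoly _ (fun j => t ^+ j * (u f)`_j).

Lemma kappaE t u f j : jet_lift f j (kappa t u) = t ^+ j * jet_lift f j u.
Proof.
rewrite /jet_lift /kappa coef_poly; case: ltnP => // jr.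
by rewrite big_coef_npoly ?mulr0.
Qed.

(* The coordinates of [TrM] induced by a chart [c] of [M] with coordinates
   x_a: the entry of [p] at [(i, a)] is u_i(x_a), where the local function x_a
   may be replaced by any element of C^oo M with the same germ at the base
   point. *)
Definition jet_coordinates (c : chart R n M) u (p : 'M[R]_(r.+1, n)) :=
  exists m, [/\ base_point u m, chart_dom c m &
    forall (a : 'I_n) (f : C^oo M), (\forall y \near m, f y = chart_map c y 0 a) ->
      forall i : 'I_r.+1, p i a = jet_lift f i u].

Definition TrM_submanifold Q :=
  Q `<=` TrM /\ forall c, atlas c ->
    submanifoldE [set mxvec p | p in [set p | exists2 u, Q u & jet_coordinates c u p]].

(* [N] is the base: under the identification of M with the zero jets,
   the image of [Q] under kappa_0 is [N]. *)
Definition graded_subbundle_along (N : set M) Q :=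
  [/\ TrM_submanifold Q, (forall t u, Q u -> Q (kappa t u)) &
      kappa 0 @` Q = zero_jet @` N].

Definition smooth_fun1 (g : R -> R) := forall k t, derivable (derive1n k g) t 1.

(* An algebra morphism C^oo M -> A_r (x) A_1 over [u] is of the form
   u (x) 1 + v (x) epsilon with [v] a derivation along [u]; the tangent vectors
   to T_r M at [u] are represented by these [v]. The coefficient of epsilon^i
   in [v f] is the derivative of f^(i) along the tangent vector. *)
Definition tangent_TrM u v :=
  linear v /\ forall f g, v (f * g) = v f * u g + u f * v g.

Definition tangent_at Q u v := tangent_TrM u v /\
  exists gamma : R -> C^oo M -> trunc R r,
    [/\ forall t, Q (gamma t), gamma 0 = u,
        forall f i, smooth_fun1 (fun t => jet_lift f i (gamma t)) &
        forall f i, (v f)`_i = derive1 (fun t => jet_lift f i (gamma t)) 0].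

(* The value at [u] of the lift X^(-i), see [lift_vfE] *)
Definition lift_vf (X : C^oo M -> C^oo M) (i : nat) u : C^oo M -> trunc R r :=
  fun f => 'qX ^+ i * u (X f).

(* X^(-i) f^(l) = (X f)^(l-i) *)
Lemma lift_vfE X i u (f : C^oo M) l : (l <= r)%N ->
  jet_lift f l (lift_vf X i u) =
  if (i <= l)%N then jet_lift (X f) (l - i) u else 0.
Proof.
move=> lr; have inK (x : trunc R r) : x = in_qpoly _ (x : {poly R}).
  by apply/val_inj/esym/in_qpoly_small/size_mk_monic.
have coef_in (p : {poly R}) : (in_qpoly 'X^(r.+1) p)`_l = p`_l.
  by rewrite /= mk_monic_Xn -Pdiv.RingMonic.take_poly_rmodp coef_take_poly ltnS lr.
rewrite /jet_lift /lift_vf {1}(inK (u (X f))) -rmorphXn -rmorphM coef_in.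
by rewrite coefXnM ltnNge; case: leqP.
Qed.

Definition TM_invariant Q := forall u m (v : C^oo M -> R),
  Q u -> base_point u m -> tangent_vector m v ->
  Q (fun f => u f + v f *: 'qX ^+ r).

(* x acts on A_r (x) A_1 by 1 (x) epsilon |-> x (x) epsilon, hence maps
   u (x) 1 + v (x) epsilon to u (x) 1 + (x * v) (x) epsilon. *)
Definition tangent_Ar_invariant Q := forall u v (x : trunc R r),
  Q u -> tangent_at Q u v -> tangent_at Q u (fun f => x * v f).

Definition lift_tangent_to Q X i :=
  forall u, Q u -> tangent_at Q u (lift_vf X i u).

Definition tangent_spanned_by_lifts Q := forall u v,
  Q u -> tangent_at Q u v ->
  exists k (X : 'I_k -> C^oo M -> C^oo M) (i : 'I_k -> 'I_r.+1) (b : 'I_k -> R),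
    (forall l, vector_field (X l) /\ lift_tangent_to Q (X l) (i l)) /\
    v = \sum_(l < k) b l *: lift_vf (X l) (i l) u.

End higher_tangent.

Section weightings.
Context {R : realType} {n : nat} (M : manifold R n).

Definition weight_sequence (r : nat) (w : 'I_n -> nat) :=
  {homo w : a b / (a <= b)%N} /\ forall a, (w a <= r)%N.

(* The ideal of smooth functions on the domain of [c] generated by the
   monomials x^s with s . w >= i *)
Definition weighted_ideal (c : chart R n M) (w : 'I_n -> nat) (i : nat) :
    set (M -> R) :=
  [set f | exists k (s : 'I_k -> 'I_n -> nat) (g : 'I_k -> M -> R),
    [/\ forall l, (i <= \sum_a s l a * w a)%N,
        forall l, smooth_on (chart_dom c) (g l) &
        forall y, chart_dom c y ->
          f y = \sum_(l < k) g l y * \prod_a chart_map c y 0 a ^+ s l a]].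

Record ideal_sheaf (I : set M -> set (M -> R)) : Prop := {
  ideal_sheaf_ext : forall U f g, open U -> (forall y, U y -> f y = g y) ->
    I U f -> I U g;
  ideal_sheaf_smooth : forall U f, open U -> I U f -> smooth_on U f;
  ideal_sheaf_zero : forall U, open U -> I U 0;
  ideal_sheaf_add : forall U f g, open U -> I U f -> I U g -> I U (f + g);
  ideal_sheaf_mul : forall U a f, open U -> smooth_on U a -> I U f -> I U (a * f);
  ideal_sheaf_restr : forall U V f, open U -> open V -> V `<=` U -> I U f -> I V f;
  ideal_sheaf_glue : forall U f, open U ->
    (forall y, U y -> exists V, [/\ open V, V y, V `<=` U & I V f]) -> I U f }.

(* [F i U] are the sections over [U] of the [i]-th term of the filtration. At a
   point near which the filtration is trivial, the last alternative is implied
   by the preceding one when [0 < n] and [0 < r]: take a chart around the point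
   on which a coordinate of weight 1 has no zero. It is only needed for
   0-dimensional manifolds, to allow points outside [N]. *)
Record weighting (r : nat) (F : nat -> set M -> set (M -> R)) : Prop := {
  weighting_sheaf : forall i, ideal_sheaf (F i);
  weighting_0 : forall U f, open U -> (F 0%N U f <-> smooth_on U f);
  weighting_decr : forall i U, open U -> F i.+1 U `<=` F i U;
  weighting_local : forall m : M,
    (exists c w, [/\ smooth_chart c, chart_dom c m, weight_sequence r w &
       forall i f, F i (chart_dom c) f <-> weighted_ideal c w i f]) \/
    (exists U, [/\ open U, U m & forall i f, F i U f <-> smooth_on U f]) }.

Definition weighting_along (N : set M) (F : nat -> set M -> set (M -> R)) :=
  forall U f, open U ->
    (F 1%N U f <-> smooth_on U f /\ forall y, U y -> N y -> f y = 0).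

Definition weighting_jets (r : nat) (F : nat -> set M -> set (M -> R)) :
    set (C^oo M -> trunc R r) :=
  [set u | TrM u /\ forall (f : C^oo M) i j, F i setT f -> (j < i <= r)%N ->
     jet_lift f j u = 0].

End weightings.

Arguments weighting_jets {R n M} r F.

(* Main.v *)
(** If (x_a) are coordinates adapted to the weighting, then Q is given by the
    equations u_j(x_a) = 0 for j < w_a, which are linear in the jet coordinates
    p_{j,a} = u_j(x_a); the tangent space of Q is then spanned by the lifts
    (d/dx_a)^(-j) with j >= w_a, and the three conditions can be read off.

    Conversely, let m be a point of N. By homogeneity, the tangent space of Q at
    the zero jet of m is a direct sum of V_j e^j; by (ii) and (i) these spaces
    form a flag V_0 <= ... <= V_r = T_m M, and linear coordinates x_b adapted to
    the flag get the weight w_b = #{j | dim V_j <= b}. One corrects the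
    coordinates inductively so that u_j(x_b) = 0 on Q for j < min(w_b, i). The
    functions z_{j,b} = u_j(x_b), j >= w_b, are coordinates of Q near the zero
    jet. If w_a > i, then u_i(x_a) is a function h of these which is homogeneous
    of degree i under the multiplicative action, while (ii) shows that h does
    not depend on z_{j,b} for j > w_b. Hence u_i(x_a) = H(z_{w_b,b}) with H
    weighted homogeneous of degree i, which means u_i(x_a) = u_i(H(x)) on Q, and
    x_a is replaced by x_a - H(x). The homogeneity of Q propagates the resulting
    description of Q from a neighbourhood of the zero jet to all jets based near
    m. The i-th ideal of the weighting consists of the functions all of whose
    derivatives of weight less than i in the adapted charts vanish on N, and
    Hadamard's lemma identifies it with the ideal of the local model. *)
Require Import Defs.
From HB Require Import structures.
From mathcomp Require Import all_boot all_order all_algebra.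
From mathcomp Require Import qpoly ring lra zify.
From mathcomp Require Import all_classical all_reals all_analysis.

Set Implicit Arguments.
Unset Strict Implicit.
Unset Printing Implicit Defensive.

Import Order.TTheory GRing.Theory Num.Theory.
Import numFieldNormedType.Exports.

Local Open Scope classical_set_scope.
Local Open Scope ring_scope.

Local Notation "'d_ a f" := (fun x => 'D_(delta_mx 0 a) f x)
  (at level 10, a at level 8, f at level 9, format "''d_' a  f").

(** * Differential calculus in coordinates *)

Section differentiability.
Context {R : realType}.

(** The points of T_rM are algebra morphisms, so each must first be shown to lie over a point of M
    and to be determined by its values on germs of coordinates. Jets of composites are never
    expanded: with E = epsilon d/d epsilon, the jet of f along p solves E y = \sum_a E p_a * jet
    (d_a f), and the product rule, the chain rule and the identification of morphisms with jets are
    inductions on the order of truncation in this equation. The slice charts of Q are unrelated to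
    the jet structure. They give the tangent spaces of Q and a chart near a zero jet in which the
    equations of Q remain arbitrary functions, while the other coordinates are jets of functions on
    M. Homogeneous functions are only available on balls around 0. They are not shown to be
    polynomials; Euler's identity is all that is used of them. Adapted charts are not compared
    through their transition maps. The filtration imposes its conditions in all these charts at
    once, and the coordinates of one chart have the right order in another because both describe the
    same Q. *)

Lemma near_normP (V : normedModType R) (x : V) (P : set V) :
  nbhs x P <-> exists2 d : R, 0 < d & forall y : V, `|y - x| < d -> P y.
Proof.
split=> [/nbhs_ballP|] [d d0 dP]; last apply/nbhs_ballP; exists d => // y yx; apply: dP.
  by rewrite -ball_normE /ball_ /= distrC.
by move: yx; rewrite -ball_normE /ball_ /= distrC.
Qed.

Lemma near_setI (V : normedModType R) (x : V) (P Q : set V) :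
  nbhs x P -> nbhs x Q -> nbhs x (P `&` Q).
Proof. exact: filterI. Qed.

Lemma near_setS (V : normedModType R) (x : V) (P Q : set V) :
  P `<=` Q -> nbhs x P -> nbhs x Q.
Proof. exact: filterS. Qed.

Lemma near_forall (V : normedModType R) (x : V) (I : finType) (P : I -> set V) :
  (forall i, nbhs x (P i)) -> nbhs x (fun y => forall i, P i y).
Proof. exact: filter_forall. Qed.

Lemma is_derive_ex (V : normedModType R) (f : V -> R) (x v : V) (d : R) :
  is_derive x v f d -> derivable f x v.
Proof. by case. Qed.

Lemma is_derive_eqE (V : normedModType R) (f : V -> R) (x v : V) (d : R) :
  is_derive x v f d -> 'D_v f x = d.
Proof. by case. Qed.

Lemma derive_mul (V : normedModType R) (f g : V -> R) (x v : V) :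
  derivable f x v -> derivable g x v ->
  'D_v (fun x => f x * g x) x = 'D_v f x * g x + f x * 'D_v g x.
Proof.
move=> df dg; have -> : (fun x => f x * g x) = f * g by [].
by rewrite deriveM // [LHS]addrC; congr (_ + _); exact: mulrC.
Qed.

Lemma differentiable_approx (V : normedModType R) (f : V -> R) (x : V)
    (L : {linear V -> R}) : continuous L ->
  (forall e, 0 < e -> \forall h \near 0, `|f (h + x) - f x - L h| <= e * `|h|) ->
  differentiable f x /\ ('d f x = L :> (V -> R)).
Proof.
move=> cL fL.
have E : f \o shift x = cst (f x) + L +o_ 0 id.
  by apply/eqaddoP => e e0; apply: filterS (fL e e0) => h /=; rewrite /= opprD addrA.
by have dE := diff_unique cL E; split => //; apply/diff_locallyP; rewrite dE.
Qed.


Lemma is_derive_cvg (V : normedModType R) (f : V -> R) (x v : V) (l : R) :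
  (forall e, 0 < e -> exists2 d : R, 0 < d & forall h : R, `|h| < d -> h != 0 ->
    `|l - h^-1 * (f (h *: v + x) - f x)| <= e) -> is_derive x v f l.
Proof.
move=> H; have C : h^-1 *: ((f \o shift x) (h *: v) - f x) @[h --> 0^'] --> l.
  apply/cvgrPdist_le => e /H[d d0 dP]; apply/nbhs_ballP; exists d => // h /=.
  by rewrite -ball_normE /ball_ /= sub0r normrN; exact: dP.
by apply: DeriveDef; [apply/cvg_ex; exists l | exact: cvg_lim].
Qed.

Lemma continuous_normP (T : topologicalType) (f : T -> R) x : {for x, continuous f} <->
  forall e : R, 0 < e -> nbhs x (fun y => `|f x - f y| <= e).
Proof. by split => [/cvgrPdist_le|H]; [|apply/cvgrPdist_le]; exact. Qed.

Lemma is_derive_line (V : normedModType R) (f : V -> R) (x v : V) (s : R) :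
  derivable f (s *: v + x) v ->
  is_derive s 1 (fun s => f (s *: v + x)) ('D_v f (s *: v + x)).
Proof.
have E : (fun h => h^-1 *: (f (h *: v + (s *: v + x)) - f (s *: v + x))) =
    (fun h => h^-1 *: (((fun s => f (s *: v + x)) \o shift s) (h *: 1)
      - f (s *: v + x))).
  by apply/funext => h /=; rewrite [h%:A]mulr1 scalerDl addrA.
by move=> df; apply: DeriveDef; rewrite /derivable /derive /= -E.
Qed.

Lemma MVT_line (V : normedModType R) (f : V -> R) (x v : V) :
  (forall s : R, 0 <= s <= 1 -> derivable f (s *: v + x) v) ->
  exists2 s : R, 0 <= s <= 1 & f (v + x) - f x = 'D_v f (s *: v + x).
Proof.
move=> df; have dg (s : R) : 0 <= s <= 1 -> is_derive s 1 (fun s => f (s *: v + x))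
    ('D_v f (s *: v + x)) by move=> s01; exact/is_derive_line/df.
have cg : {within `[0, 1], continuous (fun s : R => f (s *: v + x))}.
  apply: derivable_within_continuous => s s01.
  by apply: ex_derive; apply: dg.
have [s s01] := MVT_segment ler01 (fun s s01 => dg s (subset_itv_oo_cc s01)) cg.
by rewrite scale1r scale0r add0r subr0 mulr1 => E; exists s.
Qed.

(** The one-variable chain rule for [t |-> t * k] treats all [k] alike; a change of variable in the
    limit would have to exclude [k = 0]. *)
Lemma is_deriveZdir (V : normedModType R) (f : V -> R) (x v : V) (k : R) :
  derivable f x v -> is_derive x (k *: v) f (k * 'D_v f x).
Proof.
move=> dv; have dv' : derivable f (0 *: v + x) v by rewrite scale0r add0r.
have dk : is_derive (0 : R) 1 (fun t : R => t * k) k.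
  by apply: is_derive_eq; rewrite scaler0 add0r [_ *: _]mulr1.
have dg : is_derive ((fun t : R => t * k) 0) 1 (fun s : R => f (s *: v + x)) ('D_v f x).
  have := is_derive_line dv'; rewrite mul0r => H; apply: is_derive_eq.
  by rewrite scale0r add0r.
have H := @is_derive1_comp R (fun s : R => f (s *: v + x)) (fun t : R => t * k) 0 _ _ dg dk.
have E : (fun h => h^-1 *: (f (h *: (k *: v) + x) - f x)) =
    (fun h => h^-1 *: (((fun s : R => f (s *: v + x)) \o (fun t : R => t * k)) (h *: 1 + 0)
      - ((fun s : R => f (s *: v + x)) \o (fun t : R => t * k)) 0)).
  by apply/funext => h /=; rewrite [h%:A]mulr1 addr0 mul0r scale0r add0r scalerA.
have dH : derivable f x (k *: v) by rewrite /derivable E; exact: ex_derive.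
by apply: DeriveDef => //; rewrite /derive E mulrC; exact: derive_val.
Qed.

(** Go from [x] to [h + x] parallel to the axes, one coordinate at a time. On each segment the mean
    value theorem compares the increment with the partial derivative at [x], and continuity of that
    derivative bounds the error. *)
Lemma C1_differentiable m (U : set 'rV[R]_m) (f : 'rV[R]_m -> R) (x : 'rV[R]_m) : open U ->
  (forall y a, U y -> derivable f y (delta_mx 0 a)) ->
  (forall a, {for x, continuous ('d_a f)}) -> U x -> differentiable f x /\
  forall v, 'd f x v = \sum_a v 0 a * 'D_(delta_mx 0 a) f x.
Proof.
move=> oU df cf Ux.
have linL : linear (fun v : 'rV[R]_m => \sum_a v 0 a * 'D_(delta_mx 0 a) f x).
  move=> k u v; rewrite scaler_sumr -big_split /=; apply: eq_bigr => a _.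
  by rewrite !mxE mulrDl [_ *: _]mulrA.
pose LM := GRing.isLinear.Build _ _ _ _ _ linL.
pose L : {linear 'rV[R]_m -> R} := HB.pack
  (fun v : 'rV[R]_m => \sum_a v 0 a * 'D_(delta_mx 0 a) f x) LM.
have cL : continuous L.
  move=> y; rewrite [X in continuous_at _ X](_ : _ =
    \sum_a (fun v : 'rV[R]_m => v 0 a * 'D_(delta_mx 0 a) f x)); last first.
    by apply/funext => v /=; rewrite fct_sumE.
  elim/big_ind : _ => [|g h cg ch|a _]; first exact: cst_continuous.
    exact: continuousD.
  by apply: (@continuousM R _ (fun v : 'rV[R]_m => v 0 a)); [exact: coord_continuous | exact: cst_continuous].
suff H : forall e, 0 < e -> \forall h \near (0 : 'rV[R]_m), `|f (h + x) - f x - L h| <= e * `|h|.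
  by have [dx E] := differentiable_approx cL H; split => // v; rewrite E.
move=> e e0.
(* Each of the [m] segments contributes an error of at most e' times the norm of [h]; the [+ 1]
   keeps the denominator positive for [m = 0]. *)
pose e' := e / (m%:R + 1).
have e'0 : 0 < e' by rewrite divr_gt0 // ltr_wpDl.
have [d d0 dP] : exists2 d : R, 0 < d & forall y, `|y - x| < d ->
    U y /\ forall a, `|'D_(delta_mx 0 a) f y - 'D_(delta_mx 0 a) f x| <= e'.
  suff : \forall y \near x, U y /\
      forall a, `|'D_(delta_mx 0 a) f y - 'D_(delta_mx 0 a) f x| <= e'.
    by move=> /near_normP.
  apply: filterS2 (open_nbhs_nbhs (conj oU Ux)) _; first by move=> y Uy Hy; split; [exact: Uy | exact: Hy].
  suff : \forall y \near x, forall a : 'I_m, `|'D_(delta_mx 0 a) f y - 'D_(delta_mx 0 a) f x| <= e' by [].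
  have H (a : 'I_m) : \forall y \near x, `|'D_(delta_mx 0 a) f y - 'D_(delta_mx 0 a) f x| <= e'.
    have /cvgrPdist_le/(_ _ e'0) := cf a.
    by apply: filterS => y; rewrite distrC.
  exact: (near_forall H).
apply/near_normP; exists d => // h; rewrite subr0 => hd.
(* The corners of the path: the first [k] coordinates are those of [h + x], the others those of
   [x]. *)
pose c k := x + \row_j (if (j < k)%N then h 0 j else 0).
have c0 : c 0%N = x by rewrite /c (_ : \row__ _ = 0) ?addr0 //; apply/rowP => j; rewrite !mxE.
have cm : c m = h + x.
  by rewrite /c addrC; congr (_ + _); apply/rowP => j; rewrite !mxE ltn_ord.
have -> : f (h + x) - f x = \sum_(a < m) (f (c a.+1) - f (c a)).
  by rewrite -cm -{1}c0 -(telescope_sumr (fun k => f (c k))) // big_mkord.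
rewrite -sumrB; apply: le_trans (ler_norm_sum _ _ _) _.
have step (a : 'I_m) : `|f (c a.+1) - f (c a) - h 0 a * 'D_(delta_mx 0 a) f x| <= e' * `|h|.
  have cS : c a.+1 = h 0 a *: delta_mx 0 a + c a.
    rewrite /c addrCA; congr (_ + _); apply/rowP => j; rewrite !mxE eqxx /= ltnS.
    case: (ltngtP j a) => [ja|ja|/val_inj ->]; rewrite -?val_eqE /=.
    - by rewrite ltn_eqF // mulr0 add0r.
    - by rewrite gtn_eqF // mulr0 add0r.
    - by rewrite eqxx mulr1 addr0.
  have near_c (s : R) : 0 <= s <= 1 -> `|s *: (h 0 a *: delta_mx 0 a) + c a - x| < d.
    move=> /andP[s0 s1]; apply: le_lt_trans hd.
    rewrite [leLHS]/Num.Def.normr /= mx_normrE; apply: bigmax_le => // -[i j] _ /=.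
    have hj k : `|h 0 k| <= `|h|.
      by rewrite [leRHS]/Num.Def.normr /= mx_normrE; exact: (le_bigmax _ _ (0, k)).
    rewrite !mxE (ord1 i) eqxx /=; case: (ltngtP j a) => [ja|ja|/val_inj ->].
    - by rewrite -val_eqE /= ltn_eqF // !mulr0 add0r addrAC subrr add0r.
    - by rewrite -val_eqE /= gtn_eqF // !mulr0 add0r addr0 subrr normr0.
    - rewrite eqxx mulr1 addr0 addrK normrM ger0_norm //.
      by apply: le_trans (hj a); rewrite ler_piMl.
  have dfa (s : R) : 0 <= s <= 1 ->
      derivable f (s *: (h 0 a *: delta_mx 0 a) + c a) (delta_mx 0 a).
    by move=> s01; apply: df; have [] := dP _ (near_c s s01).
  have dZ (s : R) : 0 <= s <= 1 -> is_derive (s *: (h 0 a *: delta_mx 0 a) + c a)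
      (h 0 a *: delta_mx 0 a) f (h 0 a * 'D_(delta_mx 0 a) f (s *: (h 0 a *: delta_mx 0 a) + c a)).
    by move=> s01; exact/is_deriveZdir/dfa.
  have [s s01] := MVT_line (fun s s01 => is_derive_ex (dZ s s01)).
  rewrite -cS => ->; have -> := is_derive_eqE (dZ s s01).
  rewrite -mulrBr normrM mulrC ler_pM //.
    by have [_ ->] := dP _ (near_c s s01).
  by rewrite [leRHS]/Num.Def.normr /= mx_normrE; exact: (le_bigmax _ _ (0, a)).
apply: le_trans (ler_sum _ (fun a _ => step a)) _.
rewrite sumr_const card_ord -mulr_natl mulrA ler_wpM2r //.
rewrite /e' mulrCA ler_piMr ?(ltW e0) //.
have m0 : 0 < m%:R + 1 :> R by rewrite ltr_wpDl.
by rewrite ler_pdivrMr // mul1r lerDl.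
Qed.



Lemma is_derive_shift (V : normedModType R) (f : V -> R) (w x v : V) :
  derivable f (w + x) v ->
  is_derive x v (fun y => f (w + y)) ('D_v f (w + x)).
Proof.
have E : (fun h : R => h^-1 *: (f (h *: v + (w + x)) - f (w + x))) =
    (fun h => h^-1 *: (((fun y => f (w + y)) \o shift x) (h *: v) - f (w + x))).
  by apply/funext => h /=; rewrite addrCA.
by move=> df; apply: DeriveDef; rewrite /derivable /derive /= -E.
Qed.

Lemma continuous_rV (T : topologicalType) p (h : T -> 'rV[R]_p) x :
  (forall b, {for x, continuous (fun y => h y 0 b)}) -> {for x, continuous h}.
Proof.
move=> ch; apply/cvgrPdist_le => e e0.
have H : \forall t \near x, forall b, `|h x 0 b - h t 0 b| <= e.
  by apply: filter_forall => b; have /cvgrPdist_le/(_ e e0) := ch b.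
apply: filterS H => t H; rewrite [leLHS]/Num.Def.normr /= mx_normrE.
by apply: bigmax_le => [|[i j] _]; [exact: ltW | rewrite !mxE (ord1 i) /=; exact: H].
Qed.

Lemma differentiable_rV (V : normedModType R) p (h : V -> 'rV[R]_p) x :
  (forall b, differentiable (fun y => h y 0 b) x) -> differentiable h x.
Proof.
move=> dh; rewrite (_ : h = \sum_b (fun y => h y 0 b *: (delta_mx 0 b : 'rV[R]_p))).
  by apply: differentiable_sum => b; exact: differentiableZl.
by apply/funext => y; rewrite fct_sumE [LHS]row_sum_delta.
Qed.

Lemma diffE_rV p (f : 'rV[R]_p -> R) y v : differentiable f y ->
  'd f y v = \sum_b v 0 b * 'D_(delta_mx 0 b) f y.
Proof.
move=> df; rewrite {1}[v]row_sum_delta linear_sum; apply: eq_bigr => b _.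
by rewrite linearZ deriveE.
Qed.

Lemma diff_coord m (x v : 'rV[R]_m) (b : 'I_m) :
  'd (fun y : 'rV[R]_m => y 0 b) x v = v 0 b.
Proof.
have lg : linear (fun y : 'rV[R]_m => y 0 b) by move=> k u w; rewrite !mxE.
pose gM := GRing.isLinear.Build _ _ _ _ _ lg.
pose g : {linear 'rV[R]_m -> R} := HB.pack (fun y : 'rV[R]_m => y 0 b) gM.
by rewrite -[RHS]/(g v); congr (_ v); apply: (@diff_lin _ _ _ g); exact: coord_continuous.
Qed.

Lemma derive_coord m (x v : 'rV[R]_m) (b : 'I_m) :
  is_derive x v (fun y : 'rV[R]_m => y 0 b) (v 0 b).
Proof.
have dg : differentiable (fun y : 'rV[R]_m => y 0 b) x by exact: differentiable_coord.
by apply: DeriveDef; [exact: diff_derivable | rewrite deriveE // diff_coord].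
Qed.

Lemma chain_rule (V : normedModType R) p (h : V -> 'rV[R]_p) (f : 'rV[R]_p -> R) x v :
  (forall b, differentiable (fun y => h y 0 b) x) -> differentiable f (h x) ->
  differentiable (f \o h) x /\
  'D_v (f \o h) x = \sum_b 'D_(delta_mx 0 b) f (h x) * 'D_v (fun y => h y 0 b) x.
Proof.
move=> dhb df; have dh := differentiable_rV dhb.
have dfh : differentiable (f \o h) x by exact: differentiable_comp.
split=> //; rewrite deriveE // diff_comp //= diffE_rV //; apply: eq_bigr => b _.
rewrite mulrC; congr (_ * _); rewrite deriveE //.
have dc := differentiable_coord (h x) 0 b.
have -> : 'd (fun y => h y 0 b) x = 'd ((fun N : 'rV[R]_p => N 0 b) \o h) x :> (V -> R) by [].
by rewrite (diff_comp dh dc) /= diff_coord.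
Qed.

End differentiability.

(* Unification would otherwise unfold derivatives into limits. *)
Opaque derive.

Section smooth_calculus.
Context {R : realType}.
Implicit Types m p : nat.

Lemma Ck_cont k m (U : set 'rV[R]_m) f x : Ck k U f -> U x -> {for x, continuous f}.
Proof. by case: k => [|k] [cf _] Ux; exact: cf. Qed.

Lemma Ck_differentiable k m (U : set 'rV[R]_m) f x : open U -> Ck k.+1 U f -> U x ->
  differentiable f x.
Proof.
move=> oU [cf Df] Ux.
have H1 y a : U y -> derivable f y (delta_mx 0 a) by have [df _] := Df a; exact: df.
have H2 a : {for x, continuous ('d_a f)} by have [_ Cf] := Df a; exact: Ck_cont Cf Ux.
by have [] := C1_differentiable oU H1 H2 Ux.
Qed.

Lemma smoothE_differentiable m (U : set 'rV[R]_m) f x : open U -> smoothE U f -> U x ->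
  differentiable f x.
Proof. by move=> oU sf; exact: Ck_differentiable (sf 1%N). Qed.

Lemma smoothE_derivable m (U : set 'rV[R]_m) f x v : open U -> smoothE U f -> U x ->
  derivable f x v.
Proof. by move=> oU sf Ux; apply/diff_derivable/(smoothE_differentiable oU sf). Qed.

Lemma smoothE_cont m (U : set 'rV[R]_m) f x : smoothE U f -> U x -> {for x, continuous f}.
Proof. by move=> sf; exact: Ck_cont (sf 0%N). Qed.

Lemma smoothE_d m (U : set 'rV[R]_m) f a : smoothE U f -> smoothE U ('d_a f).
Proof. by move=> sf k; have [_ /(_ a)[]] := sf k.+1. Qed.

Lemma Ck_sub k m (U V : set 'rV[R]_m) f : V `<=` U -> Ck k U f -> Ck k V f.
Proof.
move=> VU; elim: k f => [|k IH] f [cf Df]; first by split=> // x /VU; exact: cf.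
split=> [x /VU|a]; first exact: cf.
by have [df Cf] := Df a; split=> [x /VU|]; [exact: df | exact: IH].
Qed.

Lemma smoothE_sub m (U V : set 'rV[R]_m) f : V `<=` U -> smoothE U f -> smoothE V f.
Proof. by move=> VU sf k; exact: Ck_sub (sf k). Qed.

Lemma smoothE_ext m (U : set 'rV[R]_m) f g : open U -> (forall x, U x -> f x = g x) ->
  smoothE U f -> smoothE U g.
Proof. by move=> oU fg sf k; exact: Ck_ext (sf k). Qed.

(** [Ck] speaks of derivatives in the ambient space, point by point, so any set [V] through the
    point will do. *)
Lemma Ck_local k m (U : set 'rV[R]_m) f :
  (forall x, U x -> exists V, V x /\ Ck k V f) -> Ck k U f.
Proof.
elim: k f => [|k IH] f H.
  by split=> // x Ux; have [V [Vx CV]] := H _ Ux; exact: Ck_cont CV Vx.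
split=> [x Ux|a]; first by have [V [Vx CV]] := H _ Ux; exact: Ck_cont CV Vx.
split=> [x Ux|]; first by have [V [Vx [_ /(_ a)[dV _]]]] := H _ Ux; exact: dV.
apply: IH => x Ux; have [V [Vx [_ /(_ a)[_ CV]]]] := H _ Ux.
by exists V.
Qed.

Lemma smoothE_local m (U : set 'rV[R]_m) f :
  (forall x, U x -> exists V, V x /\ smoothE V f) -> smoothE U f.
Proof.
by move=> H k; apply: Ck_local => x Ux; have [V [Vx sV]] := H _ Ux; exists V; split.
Qed.

Lemma smoothE_cst m (U : set 'rV[R]_m) c : open U -> smoothE U (fun=> c).
Proof. by move=> oU k; exact: Ck_cst. Qed.

Lemma smoothED m (U : set 'rV[R]_m) f g : open U -> smoothE U f -> smoothE U g ->
  smoothE U (fun x => f x + g x).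
Proof. by move=> oU sf sg k; exact: CkD. Qed.

Lemma smoothEM m (U : set 'rV[R]_m) f g : open U -> smoothE U f -> smoothE U g ->
  smoothE U (fun x => f x * g x).
Proof. by move=> oU sf sg k; exact: CkM. Qed.

Lemma smoothEZ m (U : set 'rV[R]_m) c f : open U -> smoothE U f ->
  smoothE U (fun x => c * f x).
Proof. by move=> oU sf; apply: smoothEM => //; exact: smoothE_cst. Qed.

Lemma smoothEN m (U : set 'rV[R]_m) f : open U -> smoothE U f ->
  smoothE U (fun x => - f x).
Proof.
move=> oU sf; apply: smoothE_ext (smoothEZ (-1) oU sf) => // x _.
by rewrite mulN1r.
Qed.

Lemma smoothEB m (U : set 'rV[R]_m) f g : open U -> smoothE U f -> smoothE U g ->
  smoothE U (fun x => f x - g x).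
Proof. by move=> oU sf sg; apply: smoothED => //; exact: smoothEN. Qed.

Lemma Ck_sum k m (U : set 'rV[R]_m) I (r : seq I) (P : pred I) (F : I -> 'rV[R]_m -> R) : open U ->
  (forall i, P i -> Ck k U (F i)) -> Ck k U (fun x => \sum_(i <- r | P i) F i x).
Proof.
move=> oU sF; rewrite (_ : (fun x => _) = \sum_(i <- r | P i) F i); last first.
  by apply/funext => x; rewrite fct_sumE.
elim/big_rec : _ => [|i f Pi sf]; first exact: Ck_cst.
by apply: CkD => //; exact: sF.
Qed.

Lemma smoothE_sum m (U : set 'rV[R]_m) I (r : seq I) (P : pred I) (F : I -> 'rV[R]_m -> R) : open U ->
  (forall i, P i -> smoothE U (F i)) -> smoothE U (fun x => \sum_(i <- r | P i) F i x).
Proof. by move=> oU sF k; apply: Ck_sum => // i Pi; exact: sF. Qed.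

Lemma smoothE_prod m (U : set 'rV[R]_m) I (r : seq I) (P : pred I) (F : I -> 'rV[R]_m -> R) : open U ->
  (forall i, P i -> smoothE U (F i)) -> smoothE U (fun x => \prod_(i <- r | P i) F i x).
Proof.
move=> oU sF; elim: r => [|i r IH].
  by under eq_fun do rewrite big_nil; exact: smoothE_cst.
under eq_fun do rewrite big_cons; case Pi : (P i) => //.
by apply: smoothEM => //; exact: sF.
Qed.

Lemma smoothEX m (U : set 'rV[R]_m) f n : open U -> smoothE U f ->
  smoothE U (fun x => f x ^+ n).
Proof.
move=> oU sf; elim: n => [|n IH].
  by under eq_fun do rewrite expr0; exact: smoothE_cst.
by under eq_fun do rewrite exprS; exact: smoothEM.
Qed.

Lemma smoothE_coord m (U : set 'rV[R]_m) b : open U -> smoothE U (fun x : 'rV[R]_m => x 0 b).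
Proof.
move=> oU [|k]; first by split=> // x _; exact: coord_continuous.
split=> [x _|a]; first exact: coord_continuous.
split=> [x _|]; first by apply: ex_derive; exact: derive_coord.
apply: Ck_ext (Ck_cst k ((delta_mx 0 a : 'rV[R]_m) 0 b) oU) => // x _.
by rewrite (is_derive_eqE (derive_coord x (delta_mx 0 a) b)).
Qed.

(** By the chain rule a partial derivative of the composite is a sum of products of ['d_b f] after
    [h], which is covered by the induction hypothesis, and derivatives of [h]. *)
Lemma Ck_comp k m p (V : set 'rV[R]_m) (U : set 'rV[R]_p) (h : 'rV[R]_m -> 'rV[R]_p) f :
  open V -> open U -> (forall x, V x -> U (h x)) ->
  (forall b, Ck k V (fun x => h x 0 b)) -> Ck k U f -> Ck k V (fun x => f (h x)).
Proof.
move=> oV oU hVU.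
have cts k' f' : (forall b, Ck k' V (fun x => h x 0 b)) -> Ck k' U f' ->
    forall x, V x -> {for x, continuous (fun x => f' (h x))}.
  move=> sh sf x Vx; apply: (@continuous_comp _ _ _ h f').
    by apply: continuous_rV => b; exact: Ck_cont (sh b) Vx.
  exact: Ck_cont sf (hVU _ Vx).
elim: k f => [|k IH] f sh sf; first by split=> //; exact: cts sf.
split=> [|a]; first exact: cts sf.
have chain x : V x -> differentiable (f \o h) x /\ 'D_(delta_mx 0 a) (f \o h) x =
    \sum_b 'D_(delta_mx 0 b) f (h x) * 'D_(delta_mx 0 a) (fun y => h y 0 b) x.
  move=> Vx; apply: chain_rule => [b|]; first exact: Ck_differentiable (sh b) Vx.
  exact: Ck_differentiable sf (hVU _ Vx).
split=> [x Vx|]; first by apply: diff_derivable; have [] := chain x Vx.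
apply: (@Ck_ext _ _ _ _ (fun x => \sum_b 'D_(delta_mx 0 b) f (h x) *
    'D_(delta_mx 0 a) (fun y => h y 0 b) x)) => // [x Vx|].
  by have [_ <-] := chain x Vx.
apply: Ck_sum => // b _; apply: CkM => //.
  by apply: (IH ('d_b f)) => [c|]; [exact/CkW/sh | have [_ /(_ b)[]] := sf].
by have [_ /(_ a)[]] := sh b.
Qed.

Lemma smoothE_comp m p (V : set 'rV[R]_m) (U : set 'rV[R]_p) (h : 'rV[R]_m -> 'rV[R]_p) f :
  open V -> open U -> (forall x, V x -> U (h x)) ->
  smoothE_map V h -> smoothE U f -> smoothE V (fun x => f (h x)).
Proof. by move=> oV oU hVU sh sf k; apply: (Ck_comp oV oU hVU) => // b; exact: sh. Qed.

Lemma Ck_inv k m (U : set 'rV[R]_m) f : open U -> (forall x, U x -> f x != 0) ->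
  Ck k U f -> Ck k U (fun x => (f x)^-1).
Proof.
move=> oU f0; elim: k => [|k IH] sf.
  by split=> // x Ux; apply: continuousV; [exact: (f0 x Ux) | exact: Ck_cont sf Ux].
split=> [x Ux|a]; first by apply: continuousV; [exact: (f0 x Ux) | exact: Ck_cont sf Ux].
have [_ /(_ a)[df Cf]] := sf.
split=> [x Ux|]; first by apply: derivableV; [exact: f0 | exact: df].
have Cv := IH (CkW sf).
apply: Ck_ext (CkM oU (Ck_cst k (-1) oU) (CkM oU (CkM oU Cv Cv) Cf)) => // x Ux.
rewrite deriveV ?f0 //; last exact: df.
rewrite -[LHS]/(-1 * ((f x)^-1 * (f x)^-1 * _)) -[RHS]/(_ * _).
by rewrite expr2 invfM; ring.
Qed.

Lemma smoothE_inv m (U : set 'rV[R]_m) f : open U -> (forall x, U x -> f x != 0) ->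
  smoothE U f -> smoothE U (fun x => (f x)^-1).
Proof. by move=> oU f0 sf k; exact: Ck_inv. Qed.

End smooth_calculus.

(** * Symmetry of second derivatives *)

Section Schwarz.
Context {R : realType} {m : nat}.
Variables (U : set 'rV[R]_m) (f : 'rV[R]_m -> R).
Hypotheses (oU : open U) (sf : smoothE U f).
Implicit Types (a b : 'I_m).

Let quad (x : 'rV[R]_m) (u v : 'rV[R]_m) :=
  f (u + (v + x)) - f (v + x) - (f (u + x) - f x).

Let quadC x u v : quad x u v = quad x v u.
Proof. by rewrite /quad [u + (v + x)]addrCA; ring. Qed.

(** Two applications of the mean value theorem: along [u] for the difference
    [g y = f (v + y) - f y], then along [v] for ['d_a f]. *)
Let quad_MVT x a b (d s : R) : 0 < d -> (forall y : 'rV[R]_m, `|y - x| < d -> U y) -> `|s| *+ 2 < d ->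
  exists y : 'rV[R]_m, `|y - x| <= `|s| *+ 2 /\
    quad x (s *: delta_mx 0 a) (s *: delta_mx 0 b) = s * (s * 'D_(delta_mx 0 b) ('d_a f) y).
Proof.
move=> d0 dU sd; set u := s *: delta_mx 0 a; set v := s *: delta_mx 0 b.
have ndelta c : `|(delta_mx 0 c : 'rV[R]_m)| <= 1.
  rewrite [leLHS]/Num.Def.normr /= mx_normrE; apply: bigmax_le => // -[i j] _ /=.
  by rewrite mxE; case: (_ && _); rewrite ?normr1 ?normr0.
have small (t1 t2 : R) : 0 <= t1 <= 1 -> 0 <= t2 <= 1 ->
    `|t1 *: u + (t2 *: v + x) - x| <= `|s| *+ 2.
  move=> t1P t2P; rewrite addrA addrK mulr2n.
  have H t c : 0 <= t <= 1 -> `|t *: (s *: (delta_mx 0 c : 'rV[R]_m))| <= `|s|.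
    move=> /andP[t0 t1']; rewrite !normrZ (ger0_norm t0) -[leRHS]mul1r ler_pM ?mulr_ge0 //.
    by rewrite -[leRHS]mulr1 ler_pM.
  by apply: le_trans (ler_normD _ _) _; apply: lerD; exact: H.
have U12 t1 t2 t1P t2P := dU _ (le_lt_trans (small t1 t2 t1P t2P) sd).
have i01 : (0 : R) <= (1 : R) <= 1 by rewrite ler01 lexx.
have i00 : (0 : R) <= (0 : R) <= 1 by rewrite ler01 lexx.
pose g y := f (v + y) - f y.
have dg (t : R) : 0 <= t <= 1 -> is_derive (t *: u + x) u g
    (s * ('D_(delta_mx 0 a) f (v + (t *: u + x)) - 'D_(delta_mx 0 a) f (t *: u + x))).
  move=> tP.
  have Uv : U (v + (t *: u + x)) by have := U12 t 1 tP i01; rewrite scale1r addrCA.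
  have Uw : U (t *: u + x) by have := U12 t 0 tP i00; rewrite scale0r add0r.
  have D1 := is_deriveZdir s (@smoothE_derivable _ _ _ _ _ (delta_mx 0 a) oU sf Uv).
  have D2 := is_deriveZdir s (@smoothE_derivable _ _ _ _ _ (delta_mx 0 a) oU sf Uw).
  have := is_derive_shift (is_derive_ex D1); rewrite (is_derive_eqE D1) => D3.
  by rewrite mulrBr; apply: is_deriveB.
have [t tP] := MVT_line (fun t tP => is_derive_ex (dg t tP)).
rewrite (is_derive_eqE (dg t tP)) => E1.
have dh (t2 : R) : 0 <= t2 <= 1 -> is_derive (t2 *: v + (t *: u + x)) v ('d_a f)
    (s * 'D_(delta_mx 0 b) ('d_a f) (t2 *: v + (t *: u + x))).
  move=> t2P; have Uw : U (t2 *: v + (t *: u + x)) by have := U12 t t2 tP t2P; rewrite addrCA.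
  exact: is_deriveZdir s (@smoothE_derivable _ _ _ _ _ (delta_mx 0 b) oU (smoothE_d a sf) Uw).
have [t2 t2P] := MVT_line (fun t tP => is_derive_ex (dh t tP)).
rewrite (is_derive_eqE (dh t2 t2P)) => E2.
exists (t2 *: v + (t *: u + x)); split; first by rewrite [_ + (_ + x)]addrCA; exact: small.
by rewrite -E2 -E1 /g /quad; rewrite [v + (u + x)]addrCA; ring.
Qed.

(** The second difference is symmetric in its two directions. Divided by [s * s], it is a value of
    either mixed derivative at some point close to [x], so continuity of both makes them agree at
    [x]. *)
Lemma derive_derive_comm a b x : U x ->
  'D_(delta_mx 0 b) ('d_a f) x = 'D_(delta_mx 0 a) ('d_b f) x.
Proof.
move=> Ux; apply/eqP; rewrite -subr_eq0 -normr_le0; apply/ler_addgt0Pr => e e0; rewrite add0r.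
have e20 : 0 < e / 2 by rewrite divr_gt0.
have [d d0 dP] : exists2 d : R, 0 < d & forall y, `|y - x| < d -> [/\ U y,
    `|'D_(delta_mx 0 b) ('d_a f) x - 'D_(delta_mx 0 b) ('d_a f) y| <= e / 2 &
    `|'D_(delta_mx 0 a) ('d_b f) x - 'D_(delta_mx 0 a) ('d_b f) y| <= e / 2].
  have /cvgrPdist_le/(_ _ e20) H1 := smoothE_cont (smoothE_d b (smoothE_d a sf)) Ux.
  have /cvgrPdist_le/(_ _ e20) H2 := smoothE_cont (smoothE_d a (smoothE_d b sf)) Ux.
  have H := near_setI (open_nbhs_nbhs (conj oU Ux)) (near_setI H1 H2).
  have [d d0 dP] := (near_normP _ _).1 H.
  exists d => // y yd; have [Uy [Hy1 Hy2]] := dP y yd; split; [exact: Uy | exact: Hy1 | exact: Hy2].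
pose s := d / 3.
have s0 : 0 < s by rewrite divr_gt0.
have sd : `|s| *+ 2 < d by rewrite gtr0_norm // /s; lra.
have dU y : `|y - x| < d -> U y by move=> /dP[].
have [y1 [y1x E1]] := quad_MVT a b d0 dU sd.
have [y2 [y2x E2]] := quad_MVT b a d0 dU sd.
have E : 'D_(delta_mx 0 b) ('d_a f) y1 = 'D_(delta_mx 0 a) ('d_b f) y2.
  have := E1; rewrite quadC E2 => /(mulfI (lt0r_neq0 s0))/(mulfI (lt0r_neq0 s0)) E.
  exact: esym E.
have [_ H1 _] := dP _ (le_lt_trans y1x sd).
have [_ _ H2] := dP _ (le_lt_trans y2x sd).
rewrite (splitr e) -(subrKA ('D_(delta_mx 0 b) ('d_a f) y1)).
by apply: le_trans (ler_normD _ _) _; apply: lerD; [exact: H1 | rewrite E distrC; exact: H2].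
Qed.

End Schwarz.

(** * Parametric integrals and Hadamard's lemma *)

Section unit_interval_integral.
Context {R : realType}.
Implicit Types (g h : R -> R).

Definition int01 g : R := \int[lebesgue_measure]_(t in `[0, 1]) g t.

Lemma int01_integrable g : (forall t : R, 0 <= t <= 1 -> {for t, continuous g}) ->
  lebesgue_measure.-integrable `[0, 1] (EFin \o g).
Proof.
move=> cg; apply: continuous_compact_integrable; first exact: segment_compact.
by apply: continuous_in_subspaceT => t /set_mem /=; rewrite in_itv /=; exact: cg.
Qed.

Lemma int01B g h : (forall t : R, 0 <= t <= 1 -> {for t, continuous g}) ->
  (forall t : R, 0 <= t <= 1 -> {for t, continuous h}) ->
  int01 (fun t => g t - h t) = int01 g - int01 h.
Proof. by move=> cg ch; apply: RintegralB => //; exact: int01_integrable. Qed.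

Lemma int01Z g c : (forall t : R, 0 <= t <= 1 -> {for t, continuous g}) ->
  int01 (fun t => c * g t) = c * int01 g.
Proof. by move=> cg; apply: RintegralZl => //; exact: int01_integrable. Qed.

Lemma int01_ext g h : (forall t : R, 0 <= t <= 1 -> g t = h t) -> int01 g = int01 h.
Proof.
by move=> gh; apply: eq_Rintegral => t /set_mem /=; rewrite in_itv /=; exact: gh.
Qed.

Lemma int01_cst c : int01 (fun=> c) = c.
Proof. by rewrite /int01 Rintegral_cst //= lebesgue_measure_itv /= lte_fin ltr01 oppr0 adde0 mulr1. Qed.

Lemma int01_norm_le g (e : R) : (forall t : R, 0 <= t <= 1 -> {for t, continuous g}) ->
  (forall t : R, 0 <= t <= 1 -> `|g t| <= e) -> `|int01 g| <= e.
Proof.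
move=> cg ge; have cc (c t : R) : 0 <= t <= 1 -> {for t, continuous (fun=> c)} by move=> _; exact: cst_continuous.
have H0 h : (forall t : R, 0 <= t <= 1 -> 0 <= h t) -> 0 <= int01 h.
  by move=> h0; apply: Rintegral_ge0 => t /=; rewrite in_itv /=; exact: h0.
rewrite ler_norml -{2}(int01_cst e) -(int01_cst (- e)) -![int01 _ <= _]subr_ge0 -!int01B //.
by rewrite !H0 // => t /ge; rewrite ler_norml; lra.
all: exact: cc.
Qed.

(** Continuity of the partial sums is proved along with the formula, since additivity of the
    integral asks for it at every step. *)
Lemma int01_sum I (r : seq I) (P : pred I) (G : I -> R -> R) :
  (forall i, P i -> forall t : R, 0 <= t <= 1 -> {for t, continuous (G i)}) ->
  int01 (fun t => \sum_(i <- r | P i) G i t) = \sum_(i <- r | P i) int01 (G i) /\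
  forall t : R, 0 <= t <= 1 -> {for t, continuous (fun t => \sum_(i <- r | P i) G i t)}.
Proof.
move=> cG; elim: r => [|i r [IH cr]].
  under eq_fun do rewrite big_nil; rewrite big_nil int01_cst; split=> // t _.
  exact: cst_continuous.
under eq_fun do rewrite big_cons; rewrite big_cons; case Pi : (P i) => //; split=> [|t t01].
  rewrite -IH; apply: RintegralD => //; apply: int01_integrable => //; exact: cG.
by apply: continuousD; [exact: cG | exact: cr].
Qed.

Lemma int01_FTC (G g : R -> R) : (forall t : R, 0 <= t <= 1 -> is_derive t 1 G (g t)) ->
  (forall t : R, 0 <= t <= 1 -> {for t, continuous g}) -> int01 g = G 1 - G 0.
Proof.
move=> dG cg.
have cG (t : R) : 0 <= t <= 1 -> {for t, continuous G}.
  by move=> t01; apply: differentiable_continuous; apply/derivable1_diffP/(is_derive_ex (dG t t01)).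
have E := @continuous_FTC2 R g G 0 1 ltr01.
rewrite /int01 /Rintegral E //.
- by apply: continuous_in_subspaceT => t /set_mem /=; rewrite in_itv /=; exact: cg.
- split.
  + by move=> t; rewrite in_itv /= => /andP[t0 t1]; apply: (is_derive_ex (dG t _)); rewrite !ltW.
  + by apply: cvg_at_right_filter; apply: cG; rewrite lexx ler01.
  + by apply: cvg_at_left_filter; apply: cG; rewrite lexx ler01.
- move=> t; rewrite in_itv /= => /andP[t0 t1]; rewrite derive1E.
  by apply: is_derive_eqE; apply: dG; rewrite !ltW.
Qed.

End unit_interval_integral.

Section parametric_integral.
Context {R : realType}.

(** Compactness of [0, 1] makes joint continuity uniform in [t]. *)
Lemma tube (V : normedModType R) (F : V -> R -> R) (x : V) :
  (forall t : R, 0 <= t <= 1 -> {for (x, t), continuous (fun p : V * R => F p.1 p.2)}) ->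
  forall e, 0 < e -> nbhs x (fun y => forall t : R, 0 <= t <= 1 -> `|F y t - F x t| <= e).
Proof.
move=> cF e e0.
have e20 : 0 < e / 2 by rewrite divr_gt0.
have /compact_near_coveringP nc := @segment_compact R 0 1.
suff H : \forall y \near x, `[0%R, 1%R] `<=` (fun t : R => `|F y t - F x t| <= e).
  by apply: filterS H => y Hy t t01; apply: Hy; rewrite /= in_itv.
  apply: (nc _ (nbhs x) (fun y t => `|F y t - F x t| <= e)).
  move=> t; rewrite /= in_itv /= => t01.
  have := (continuous_normP _ _).1 (cF t t01) _ e20.
  case=> -[A B] /= [nA nB] AB.
  exists (B, A) => //= -[t' y] /= [Bt' Ay].
  have H1 := AB (y, t') (conj Ay Bt'); have H2 := AB (x, t') (conj (nbhs_singleton nA) Bt').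
  rewrite (splitr e) -(subrKA (F x t)).
  by apply: le_trans (ler_normD _ _) _; apply: lerD; [rewrite distrC|].
Qed.

(** Regularity in the parameter [x] of an integrand. The derivatives [G] are asked to be continuous
    jointly in [x] and [t], as differentiation under the integral requires, and matter only for [t]
    in [0, 1]. *)
Fixpoint PCk m k (U : set 'rV[R]_m) (F : 'rV[R]_m -> R -> R) : Prop :=
  (forall x (t : R), U x -> 0 <= t <= 1 ->
     {for (x, t), continuous (fun p : 'rV[R]_m * R => F p.1 p.2)}) /\
  if k is k'.+1 then
    forall a : 'I_m,
exists G : 'rV[R]_m -> R -> R,
      (forall x (t : R), U x -> 0 <= t <= 1 -> is_derive x (delta_mx 0 a) (F ^~ t) (G x t)) /\
      PCk k' U G
  else True.

Lemma PCk_cont m k (U : set 'rV[R]_m) F : PCk k U F -> forall x (t : R), U x -> 0 <= t <= 1 ->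
     {for (x, t), continuous (fun p : 'rV[R]_m * R => F p.1 p.2)}.
Proof. by case: k => [|k] []. Qed.

Lemma slice_cont m (F : 'rV[R]_m -> R -> R) x t :
  {for (x, t), continuous (fun p : 'rV[R]_m * R => F p.1 p.2)} -> {for t, continuous (F x)}.
Proof.
move=> cF; apply: (@continuous_comp _ _ _ (fun t => (x, t)) (fun p : 'rV[R]_m * R => F p.1 p.2)) => //.
by apply: (@cvg_pair _ _ _ _ (nbhs x) (nbhs t)); [exact: cvg_cst | exact: cvg_id].
Qed.

(** For each [t] the difference quotient of [F] is a value of [G] at a nearby point, by the mean
    value theorem, and [tube] bounds its distance to [G x t] uniformly in [t]. *)
Lemma is_derive_int01 m (U : set 'rV[R]_m) (F G : 'rV[R]_m -> R -> R) x a : open U ->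
  (forall x (t : R), U x -> 0 <= t <= 1 ->
    {for (x, t), continuous (fun p : 'rV[R]_m * R => F p.1 p.2)}) ->
  (forall x (t : R), U x -> 0 <= t <= 1 ->
    {for (x, t), continuous (fun p : 'rV[R]_m * R => G p.1 p.2)}) ->
  (forall x (t : R), U x -> 0 <= t <= 1 -> is_derive x (delta_mx 0 a) (F ^~ t) (G x t)) ->
  U x -> is_derive x (delta_mx 0 a) (fun x => int01 (F x)) (int01 (G x)).
Proof.
move=> oU cF cG dF Ux; apply: is_derive_cvg => e e0.
have H1 := tube (cG x ^~ Ux) e0.
have /near_normP[d d0 dP] := near_setI H1 (open_nbhs_nbhs (conj oU Ux)).
exists d => // h hd h0.
have small (s : R) : 0 <= s <= 1 -> `|s *: (h *: (delta_mx 0 a : 'rV[R]_m)) + x - x| < d.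
  move=> /andP[s0 s1]; apply: le_lt_trans hd; rewrite addrK scalerA normrZ.
  rewrite -[leRHS]mulr1 ler_pM //.
    by rewrite normrM (ger0_norm s0) ler_piMl.
  rewrite [leLHS]/Num.Def.normr /= mx_normrE; apply: bigmax_le => // -[i j] _ /=.
  by rewrite mxE; case: (_ && _); rewrite ?normr1 ?normr0.
have Uy : U (h *: delta_mx 0 a + x).
  by have [|_] := dP (h *: delta_mx 0 a + x) => //; have := small 1; rewrite scale1r; apply; rewrite ler01 lexx.
rewrite -int01B => [|t t01|t t01]; try exact: slice_cont (cF _ _ _ t01).
rewrite -int01Z => [|t t01]; last by apply: continuousB; exact: slice_cont (cF _ _ _ t01).
have cL (t : R) : 0 <= t <= 1 -> {for t, continuous (fun t => h^-1 * (F (h *: delta_mx 0 a + x) t - F x t))}.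
  move=> t01; apply: continuousM; first exact: cst_continuous.
  by apply: continuousB; exact: slice_cont (cF _ _ _ t01).
rewrite -int01B => [|t t01|//]; last exact: slice_cont (cG _ _ _ t01).
apply: int01_norm_le => t t01.
  by apply: continuousB; [exact: slice_cont (cG _ _ _ t01) | exact: cL].
have dh (s : R) : 0 <= s <= 1 -> is_derive (s *: (h *: delta_mx 0 a) + x) (h *: delta_mx 0 a) (F ^~ t)
   (h * G (s *: (h *: delta_mx 0 a) + x) t).
  move=> s01; have [_ Us] := dP _ (small s s01).
  have Ds := dF _ t Us t01; rewrite -(is_derive_eqE Ds).
  by apply: is_deriveZdir; exact: is_derive_ex Ds.
have [s s01] := MVT_line (fun s s01 => is_derive_ex (dh s s01)).
rewrite (is_derive_eqE (dh s s01)) => ->; rewrite mulKf //.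
by have [Hs _] := dP _ (small s s01); rewrite distrC; exact: Hs.
Qed.

Lemma PCk_int01 m k (U : set 'rV[R]_m) F : open U -> PCk k U F ->
  Ck k U (fun x => int01 (F x)).
Proof.
move=> oU.
have cts (F' : 'rV[R]_m -> R -> R) x : (forall x (t : R), U x -> 0 <= t <= 1 ->
     {for (x, t), continuous (fun p : 'rV[R]_m * R => F' p.1 p.2)}) -> U x ->
     {for x, continuous (fun x => int01 (F' x))}.
  move=> cF Ux; apply/continuous_normP => e e0.
  have H1 := tube (cF x ^~ Ux) e0.
  apply: near_setS (near_setI H1 (open_nbhs_nbhs (conj oU Ux))) => y [Hy Uy].
  rewrite -int01B => [|t t01|t t01]; try exact: slice_cont (cF _ _ _ t01).
  apply: int01_norm_le => t t01; last by rewrite distrC; exact: Hy.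
  by apply: continuousB; exact: slice_cont (cF _ _ _ t01).
elim: k F => [|k IH] F PF; first by split=> // x; apply: cts; exact: PCk_cont PF.
split=> [x|a]; first by apply: cts; exact: PCk_cont PF.
have [cF /(_ a)[G [dF PG]]] := PF.
have D x := is_derive_int01 oU cF (PCk_cont PG) dF (x := x).
split=> [x Ux|]; first exact: is_derive_ex (D x Ux).
apply: Ck_ext (IH _ PG) => // x Ux.
by rewrite (is_derive_eqE (D x Ux)).
Qed.

End parametric_integral.

Section Hadamard.
Context {R : realType} {m : nat}.
Implicit Types (P : pred 'I_m) (U : set 'rV[R]_m) (f : 'rV[R]_m -> R).

Definition scl P (t : R) (x : 'rV[R]_m) : 'rV[R]_m :=
  \row_a (if P a then t * x 0 a else x 0 a).

Lemma scl1 P x : scl P 1 x = x.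
Proof. by apply/rowP => a; rewrite mxE mul1r if_same. Qed.

Lemma scl_cont P x t : {for (x, t), continuous (fun p : 'rV[R]_m * R => scl P p.2 p.1)}.
Proof.
apply: continuous_rV => b.
rewrite (_ : (fun y => _) = (fun y : 'rV[R]_m * R => if P b then y.2 * y.1 0 b else y.1 0 b)); last first.
  by apply/funext => y; rewrite mxE.
have c1 : {for (x, t), continuous (fun y : 'rV[R]_m * R => y.1 0 b)}.
  apply: (@continuous_comp _ _ _ (fun y : 'rV[R]_m * R => y.1) (fun y : 'rV[R]_m => y 0 b)).
    exact: cvg_fst.
  exact: coord_continuous.
case: (P b); last exact: c1.
by apply: (@continuousM R _ (fun y : 'rV[R]_m * R => y.2)); [exact: cvg_snd | exact: c1].
Qed.

(** The power of [t] makes the family stable under differentiation: each derivative in a direction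
    of [P] brings out one more factor [t]. *)
Definition hint j P f (x : 'rV[R]_m) := int01 (fun t => t ^+ j * f (scl P t x)).

(** Star-shapedness towards the subspace where the coordinates of [P] vanish. *)
Definition star P U := forall x (t : R), U x -> 0 <= t <= 1 -> U (scl P t x).

Lemma derive_scl P U f t x a : open U -> smoothE U f -> U (scl P t x) ->
  is_derive x (delta_mx 0 a) (fun x => f (scl P t x))
    ((if P a then t else 1) * 'D_(delta_mx 0 a) f (scl P t x)).
Proof.
move=> oU sf Ux.
have E b : (fun y => scl P t y 0 b) = (fun y : 'rV[R]_m => (if P b then t else 1) * y 0 b).
  by apply/funext => y; rewrite mxE; case: (P b); rewrite ?mul1r.
have D b : is_derive x (delta_mx 0 a) (fun y => scl P t y 0 b)
    ((if P b then t else 1) * (delta_mx 0 a : 'rV[R]_m) 0 b).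
  by rewrite E; apply: is_deriveZ; exact: derive_coord.
have [] := @chain_rule R _ m (scl P t) f x (delta_mx 0 a).
- move=> b; rewrite E; apply: differentiableM; [exact: differentiable_cst | exact: differentiable_coord].
- exact: smoothE_differentiable oU sf Ux.
move=> df De; apply: DeriveDef; first exact: diff_derivable.
rewrite De (bigD1 a) //= big1 ?addr0 => [|b ba]; rewrite (is_derive_eqE (D _)) mxE eqxx /=.
  by rewrite eqxx mulr1 mulrC.
by rewrite (negbTE ba) mulr0 mulr0.
Qed.

Lemma derive_scl_exp j P U f t x a : open U -> smoothE U f -> U (scl P t x) ->
  is_derive x (delta_mx 0 a) (fun x => t ^+ j * f (scl P t x))
    (t ^+ (j + P a) * 'D_(delta_mx 0 a) f (scl P t x)).
Proof.
move=> oU sf Ux; have D0 := derive_scl a oU sf Ux.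
have -> : t ^+ (j + P a) * 'D_(delta_mx 0 a) f (scl P t x) =
   t ^+ j * ((if P a then t else 1) * 'D_(delta_mx 0 a) f (scl P t x)).
  by rewrite mulrA; congr (_ * _); case: (P a); rewrite ?addn1 ?exprSr ?addn0 ?mulr1.
exact: is_deriveZ.
Qed.

Lemma hint_cont j P U f : open U -> star P U -> smoothE U f ->
  forall x (t : R), U x -> 0 <= t <= 1 ->
  {for (x, t), continuous (fun p : 'rV[R]_m * R => p.2 ^+ j * f (scl P p.2 p.1))}.
Proof.
move=> oU sU sf x t Ux t01; apply: (@continuousM R _ (fun p : 'rV[R]_m * R => p.2 ^+ j)).
  apply: (@continuous_comp _ _ _ (fun p : 'rV[R]_m * R => p.2) (fun t : R => t ^+ j)).
    exact: cvg_snd.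
  exact: exprn_continuous.
apply: (@continuous_comp _ _ _ (fun p : 'rV[R]_m * R => scl P p.2 p.1) f).
  exact: scl_cont.
by apply: smoothE_cont sf _; exact: sU.
Qed.

Lemma hint_PCk j P U f : open U -> star P U -> smoothE U f ->
  forall k, PCk k U (fun x t => t ^+ j * f (scl P t x)).
Proof.
move=> oU sU sf k; elim: k j f sf => [|k IH] j f sf; split=> //; try exact: hint_cont.
move=> a; exists (fun x t => t ^+ (j + P a) * 'D_(delta_mx 0 a) f (scl P t x)); split.
  by move=> x t Ux t01; exact: derive_scl_exp oU sf (sU x t Ux t01).
exact: IH (smoothE_d a sf).
Qed.

Lemma hint_smooth j P U f : open U -> star P U -> smoothE U f -> smoothE U (hint j P f).
Proof. by move=> oU sU sf k; apply: PCk_int01 => //; exact: hint_PCk. Qed.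

Lemma derive_hint j P U f a x : open U -> star P U -> smoothE U f -> U x ->
  'D_(delta_mx 0 a) (hint j P f) x = hint (j + P a) P ('d_a f) x.
Proof.
move=> oU sU sf Ux.
apply: is_derive_eqE.
apply: (@is_derive_int01 _ m U (fun x t => t ^+ j * f (scl P t x))
  (fun x t => t ^+ (j + P a) * 'D_(delta_mx 0 a) f (scl P t x)) x a oU) => //.
- exact: hint_cont.
- by move=> y t Uy t01; exact (hint_cont (j := (j + P a)%N) oU sU (smoothE_d a sf) Uy t01).
- by move=> y t Uy t01; exact: derive_scl_exp oU sf (sU y t Uy t01).
Qed.

Lemma hint_fixed j P f x : (forall t, scl P t x = x) -> f x = 0 -> hint j P f x = 0.
Proof.
move=> fx f0; rewrite -[RHS](int01_cst 0); apply: int01_ext => t _.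
by rewrite fx f0 mulr0.
Qed.

(** Fundamental theorem of calculus for [t |-> f (scl P t x)] on [0, 1]; only the coordinates in [P]
    move and contribute to the derivative. *)
Lemma hadamard P U f x : open U -> star P U -> smoothE U f -> U x ->
  f x = f (scl P 0 x) + \sum_(a | P a) x 0 a * hint 0 P ('d_a f) x.
Proof.
move=> oU sU sf Ux.
have cD a (t : R) : 0 <= t <= 1 -> {for t, continuous (fun t : R => 'D_(delta_mx 0 a) f (scl P t x))}.
  move=> t01; apply: (@continuous_comp _ _ _ (fun t : R => scl P t x) ('d_a f)).
    apply: (@continuous_comp _ _ _ (fun t => (x, t)) (fun p : 'rV[R]_m * R => scl P p.2 p.1)).
      by apply: (@cvg_pair _ _ _ _ (nbhs x) (nbhs t)); [exact: cvg_cst | exact: cvg_id].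
    exact: scl_cont.
  by apply: smoothE_cont (smoothE_d a sf) _; exact: sU.
have Dg (t : R) : 0 <= t <= 1 -> is_derive t 1 (fun t => f (scl P t x))
    (\sum_(a | P a) x 0 a * 'D_(delta_mx 0 a) f (scl P t x)).
  move=> t01.
  have E b : (fun t : R => scl P t x 0 b) = (fun t => (if P b then x 0 b else 0) * t + (if P b then 0 else x 0 b)).
    by apply/funext => y; rewrite mxE; case: (P b); rewrite ?mul0r ?addr0 ?add0r // mulrC.
  have Db b : is_derive t 1 (fun t : R => scl P t x 0 b) (if P b then x 0 b else 0).
    rewrite E; apply: is_derive_eq; rewrite addr0 [_ *: _]mulr1 //.
  have [] := @chain_rule R _ m (fun t : R => scl P t x) f t 1.
  - by move=> b; apply/derivable1_diffP; exact: is_derive_ex (Db b).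
  - by apply: smoothE_differentiable oU sf _; exact: sU.
  move=> df De; apply: DeriveDef; first exact: diff_derivable.
  etransitivity; first exact: De.
  rewrite [RHS]big_mkcond /=; apply: eq_bigr => b _; rewrite (is_derive_eqE (Db b)).
  by case: (P b); rewrite ?mulr0 // mulrC.
rewrite -{1}[x](scl1 P); apply/eqP; rewrite addrC -subr_eq; apply/eqP.
have cS a : P a -> forall t : R, 0 <= t <= 1 ->
    {for t, continuous (fun t : R => x 0 a * 'D_(delta_mx 0 a) f (scl P t x))}.
  by move=> Pa t t01; apply: (@continuousM R _ (fun=> x 0 a)); [exact: cst_continuous | exact: cD].
have [S1 S2] := @int01_sum R _ (index_enum 'I_m) P
  (fun a t => x 0 a * 'D_(delta_mx 0 a) f (scl P t x))  cS.
rewrite -(int01_FTC Dg S2) S1.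
apply: eq_bigr => a Pa; rewrite int01Z => [|t t01]; last exact: cD.
by congr (_ * _); apply: int01_ext => t _; rewrite expr0 mul1r.
Qed.

End Hadamard.

(* The join with the normed structure, for [banach_fixed_point] *)
HB.instance Definition _ (R : realType) m n := Complete.on 'M[R]_(m, n).

(** * Inverse functions near a point with identity differential *)

Section inverse_function.
Context {R : realType}.

Lemma diff_eps (V : normedModType R) (f : V -> R) (x : V) : differentiable f x ->
  forall e : R, 0 < e -> nbhs (0 : V) (fun h => `|f (h + x) - f x - 'd f x h| <= e * `|h|).
Proof.
move=> df e e0; have /eqaddoP/(_ _ e0) := diff_locally df.
by apply: near_setS => h; rewrite /= opprD addrA.
Qed.

Lemma rV_norm_coord m (x : 'rV[R]_m) b : `|x 0 b| <= `|x|.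
Proof. by rewrite [leRHS]/Num.Def.normr /= mx_normrE; exact: (le_bigmax _ _ (0, b)). Qed.

Lemma rV_norm_le m (x : 'rV[R]_m) (e : R) : 0 <= e -> (forall b, `|x 0 b| <= e) -> `|x| <= e.
Proof.
move=> e0 H; rewrite [leLHS]/Num.Def.normr /= mx_normrE.
by apply: bigmax_le => // -[i j] _ /=; rewrite (ord1 i); exact: H.
Qed.

Lemma smoothE_det m n (U : set 'rV[R]_m) (A : 'rV[R]_m -> 'M[R]_n) : open U ->
  (forall i j, smoothE U (fun x => A x i j)) -> smoothE U (fun x => \det (A x)).
Proof.
move=> oU sA; rewrite /determinant; apply: smoothE_sum => // s _.
by apply: smoothEM => //; [exact: smoothE_cst | apply: smoothE_prod].
Qed.

Lemma smoothE_adj m n (U : set 'rV[R]_m) (A : 'rV[R]_m -> 'M[R]_n) i j : open U ->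
  (forall i j, smoothE U (fun x => A x i j)) -> smoothE U (fun x => \adj (A x) i j).
Proof.
move=> oU sA; under eq_fun do rewrite mxE /cofactor; apply: smoothEZ => //.
apply: smoothE_det => // k l.
by under eq_fun do rewrite !mxE; exact: sA.
Qed.

Variables (m : nat) (U : set 'rV[R]_m) (F : 'rV[R]_m -> 'rV[R]_m).
Hypotheses (oU : open U) (U0 : U 0) (sF : smoothE_map U F) (F0 : F 0 = 0).
Hypothesis DF0 : forall a b, 'D_(delta_mx 0 a) (fun x => F x 0 b) 0 = (a == b)%:R.

Let DF x : 'M[R]_m := \matrix_(a, b) 'D_(delta_mx 0 a) (fun x => F x 0 b) x.

Let sDF a b : smoothE U (fun x => DF x a b).
Proof. by under eq_fun do rewrite mxE; exact: smoothE_d. Qed.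

(** The bound is chosen so that the [m] entries of a column of [DF x - 1] add up to at most 1/2 in
    absolute value; by the mean value theorem, [F - id] then has Lipschitz constant 1/2. *)
Let near_id : exists2 d : R, 0 < d & forall x : 'rV[R]_m, `|x| < d ->
  [/\ U x, \det (DF x) != 0 &
    forall a b, `|DF x a b - (a == b)%:R| <= (2 * (m%:R + 1))^-1].
Proof.
have c0 : 0 < (2 * (m%:R + 1))^-1 :> R by rewrite invr_gt0 mulr_gt0 // ltr_wpDl.
have DF01 : DF 0 = 1%:M by apply/matrixP => a b; rewrite !mxE DF0.
have H1 (a b : 'I_m) : nbhs (0 : 'rV[R]_m) (fun x => `|DF x a b - (a == b)%:R| <= (2 * (m%:R + 1))^-1).
  have := (continuous_normP _ _).1 (smoothE_cont (sDF a b) U0) _ c0.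
  by apply: near_setS => x; rewrite DF01 mxE distrC.
have H2 : nbhs (0 : 'rV[R]_m) (fun x => \det (DF x) != 0).
  have sdet := smoothE_det oU sDF.
  have := (continuous_normP _ _).1 (smoothE_cont sdet U0) _ (_ : 0 < 2^-1).
  rewrite invr_gt0 ltr0n => /(_ isT); apply: near_setS => x.
  rewrite DF01 det1; apply: contraTneq => ->; rewrite subr0 normr1 -ltNge.
  by rewrite invf_lt1 ?ltr1n.
have := near_setI (open_nbhs_nbhs (conj oU U0)) (near_setI H2 (near_forall (fun a => near_forall (H1 a)))).
by move=> /near_normP[d d0 dP]; exists d => // x xd; have [|Ux [Dx Hx]] := dP x; rewrite ?subr0.
Qed.

Let contr x y d : (forall x : 'rV[R]_m, `|x| < d ->
  [/\ U x, \det (DF x) != 0 & forall a b, `|DF x a b - (a == b)%:R| <= (2 * (m%:R + 1))^-1]) ->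
  `|x| < d -> `|y| < d -> `|(F y - y) - (F x - x)| <= 2^-1 * `|y - x|.
Proof.
move=> dP xd yd; apply: rV_norm_le; first by rewrite mulr_ge0 ?invr_ge0.
move=> b; set u := y - x.
have seg (s : R) : 0 <= s <= 1 -> `|s *: u + x| < d.
  move=> /andP[s0 s1]; have -> : s *: u + x = s *: y + (1 - s) *: x.
    by rewrite /u scalerBr scalerBl scale1r addrAC addrA addrAC.
  apply: le_lt_trans (ler_normD _ _) _; rewrite !normrZ (ger0_norm s0) ger0_norm ?subr_ge0 //.
  have [->|s0'] := eqVneq s 0; first by rewrite mul0r add0r subr0 mul1r.
  have sp : 0 < s by rewrite lt_neqAle eq_sym s0' s0.
  have -> : d = s * d + (1 - s) * d by rewrite -mulrDl addrCA subrr addr0 mul1r.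
  by rewrite ltr_leD ?ltr_pM2l // ler_wpM2l ?subr_ge0 // ltW.
pose g z := F z 0 b - z 0 b.
have dg z v : `|z| < d -> is_derive z v g (\sum_a v 0 a * (DF z a b - (a == b)%:R)).
  move=> zd; have [Uz _ _] := dP z zd.
  have dFz := smoothE_differentiable oU (sF b) Uz.
  have -> : \sum_a v 0 a * (DF z a b - (a == b)%:R) = 'D_v (fun x => F x 0 b) z - v 0 b.
    rewrite deriveE // diffE_rV // (bigD1 b) //= [in RHS](bigD1 b) //= eqxx mulrBr mulr1 mxE.
    rewrite addrAC; congr (_ + _ - _); apply: eq_bigr => a ab.
    by rewrite (negbTE ab) subr0 mxE.
  by apply: is_deriveB; [apply: derivableP; exact: diff_derivable | exact: derive_coord].
have [s s01] := MVT_line (fun s s01 => is_derive_ex (dg _ u (seg s s01))).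
rewrite (is_derive_eqE (dg _ u (seg s s01))) => E.
have -> : (F y - y - (F x - x)) 0 b = g (u + x) - g x by rewrite /g /u subrK !mxE.
rewrite E; apply: le_trans (ler_norm_sum _ _ _) _.
have [_ _ Hs] := dP _ (seg s s01).
apply: (@le_trans _ _ (\sum_(a < m) (2 * (m%:R + 1))^-1 * `|u|)).
  apply: ler_sum => a _; rewrite normrM mulrC ler_pM //; exact: rV_norm_coord.
rewrite sumr_const card_ord -[leLHS]mulr_natl mulrA ler_wpM2r //.
have m0 : 0 < m%:R + 1 :> R by rewrite ltr_wpDl.
by rewrite invfM mulrCA ler_piMr ?invr_ge0 // ler_pdivrMr // mul1r lerDl.
Qed.

(** A preimage of [z] is a fixed point of the contraction [x |-> z - (F x - x)]. The same Lipschitz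
    bound gives injectivity and makes the inverse Lipschitz with constant 2, from which its
    differentiability and then its smoothness follow. *)
Lemma near_identity_inverse : exists V F', [/\ V `<=` U, V 0 & diffeo V F F'].
Proof.
have [d d0 dP] := near_id.
have inj x y : `|x| < d -> `|y| < d -> `|y - x| <= 2 * `|F y - F x|.
  move=> xd yd; have H := contr dP xd yd.
  have E : y - x = (F y - F x) - ((F y - y) - (F x - x)).
    by apply/rowP => k; rewrite !mxE; ring.
  have := ler_normB (F y - F x) ((F y - y) - (F x - x)); rewrite -E.
  by move: H; set p := `|y - x|; set q := `|_ - _|; set r := `|F y - F x|; lra.
(* For [z] of norm below d/4, the contraction maps the closed ball of radius d/2 to itself, as d/4 +
   (1/2)(d/2) = d/2. *)
have d4 : 0 < d / 4 by rewrite divr_gt0.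
pose V := [set x : 'rV[R]_m | `|x| < d /\ `|F x| < d / 4].
pose W := [set z : 'rV[R]_m | `|z| < d / 4].
have oball (e : R) : open [set z : 'rV[R]_m | `|z| < e].
  rewrite (_ : [set z | _] = ball (0 : 'rV[R]_m) e); first exact: ball_open.
  by apply/funext => z; rewrite -ball_normE /ball_ /= sub0r normrN.
have VU : V `<=` U by move=> x [xd _]; have [] := dP x xd.
have V0 : V 0 by rewrite /V /= F0 normr0.
have surj z : W z -> exists2 x, V x & F x = z.
  move=> Wz; pose K := [set x : 'rV[R]_m | `|x| <= d / 2].
  have KF : set_fun K K (fun x => z - (F x - x)).
    move=> x Kx; rewrite /K /=; apply: le_trans (ler_normB _ _) _.
    have xd : `|x| < d by apply: le_lt_trans Kx _; lra.
    have n0 : `|0 : 'rV[R]_m| < d by rewrite normr0.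
    have := contr dP n0 xd; rewrite F0 !subr0.
    by move: Kx Wz; rewrite /K /W /= ; lra.
  pose fm := isFun.Build _ _ K K _ KF.
  pose f : {fun K >-> K} := HB.pack (fun x : 'rV[R]_m => z - (F x - x)) fm.
  have [|||x Kx xE] := @banach_fixed_point R 'rV[R]_m K f.
  - exists (2^-1)%:nng => /=; split; first by rewrite /= invf_lt1 ?ltr1n.
    move=> -[x y] /= [Kx Ky].
    have xd : `|x| < d by apply: le_lt_trans Kx _; lra.
    have yd : `|y| < d by apply: le_lt_trans Ky _; lra.
    have := contr dP yd xd; rewrite -normrN; congr (`| _ | <= _).
    by apply/rowP => k; rewrite !mxE; ring.
  - rewrite (_ : K = (fun z : 'rV[R]_m => `|z|) @^-1` [set t : R | t <= d / 2]) //.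
    apply: preimage_closed; last exact: closed_le.
    by move=> ? _; exact: norm_continuous.
  - by exists 0; rewrite /K /= normr0 divr_ge0 // ltW.
  have Fx : F x = z.
    by move: xE => /= /(congr1 (fun y => y + (F x - x))); rewrite subrK addrC subrK.
  exists x => //; rewrite /V /= Fx; split => //; apply: le_lt_trans Kx _; lra.
have cF x : V x -> {for x, continuous F}.
  by move=> Vx; apply: continuous_rV => b; apply: smoothE_cont (sF b) _; exact: VU.
have oV : open V.
  rewrite openE => x [xd Fx]; apply: near_setI.
    by have := open_nbhs_nbhs (conj (oball d) (xd : [set z : 'rV[R]_m | `|z| < d] x)).
  have cn : {for x, continuous (fun y => `|F y|)}.
    by apply: (@continuous_comp _ _ _ F (fun z : 'rV[R]_m => `|z|)); [exact: cF | exact: norm_continuous].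
  have e0 : 0 < (d / 4 - `|F x|) / 2 by rewrite divr_gt0 // subr_gt0.
  have := (continuous_normP _ _).1 cn _ e0; apply: near_setS => y /=.
  by rewrite ler_norml => /andP[H _]; move: Fx H; set p := `|F x|; set q := `|F y|; lra.
pose F' z := xget 0 [set x | V x /\ F x = z].
have F'P z : W z -> V (F' z) /\ F (F' z) = z.
  by move=> /surj[x Vx Fx]; apply: (@xgetPex _ 0 [set x | V x /\ F x = z]); exists x.
have FV : F @` V = W.
  apply/seteqP; split => [z [x [_ Fx] <-] //|z /F'P[Vx Fx]]; by exists (F' z).
have F'K x : V x -> F' (F x) = x.
  move=> Vx; have [[x'd _] E] := F'P (F x) Vx.2.
  by have := inj _ _ Vx.1 x'd; rewrite E subrr normr0 mulr0 normr_le0 subr_eq0 => /eqP.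
have lip z w : W z -> W w -> `|F' w - F' z| <= 2 * `|w - z|.
  move=> /F'P[[zd _] Ez] /F'P[[wd _] Ew].
  by have := inj _ _ zd wd; rewrite Ez Ew.
have oW : open W := oball _.
have DF' z c b : W z -> is_derive z (delta_mx 0 c) (fun z => F' z 0 b) (invmx (DF (F' z)) c b).
  move=> Wz; have [Vx Ez] := F'P z Wz; set x := F' z in Vx Ez *.
  have [xd _] := Vx; have [Ux detx _] := dP x xd.
  set A := DF x; set B := invmx A.
  have uA : A \in unitmx by rewrite unitmxE unitfE.
  apply: is_derive_cvg => e e0.
  pose C : R := \sum_k `|B k b| + 1.
  have C0 : 0 < C by rewrite ltr_wpDl // sumr_ge0.
  (* [u] is at most twice as long as [h], and the entries of [B] that occur add up to less than [C],
     so this relative error of linearization leaves [e] after division by [h]. *)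
  have e1 : 0 < e / (2 * C) by rewrite divr_gt0 // mulr_gt0.
  have /near_normP[d1 d10 d1P] := near_forall (fun k =>
    diff_eps (smoothE_differentiable oU (sF k) Ux) e1).
  have /near_normP[d2 d20 d2P] := open_nbhs_nbhs (conj oW Wz).
  exists (Num.min (d1 / 2) d2); first by rewrite lt_min d20 divr_gt0.
  move=> h; rewrite lt_min => /andP[h1 h2] h0.
  have ne : `|(delta_mx 0 c : 'rV[R]_m)| <= 1.
    by apply: rV_norm_le => // k; rewrite mxE; case: (_ && _); rewrite ?normr1 ?normr0.
  have nh : `|h *: (delta_mx 0 c : 'rV[R]_m)| <= `|h| by rewrite normrZ ler_piMr.
  have Wh : W (h *: delta_mx 0 c + z) by apply: d2P; rewrite addrK; exact: le_lt_trans h2.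
  have [Vy Ey] := F'P _ Wh.
  set u := F' (h *: delta_mx 0 c + z) - x.
  have u2 : `|u| <= 2 * `|h|.
    by apply: le_trans (lip _ _ Wz Wh) _; rewrite addrK ler_wpM2l.
  have ud : `|u - 0| < d1.
    by rewrite subr0; apply: le_lt_trans u2 _; rewrite mulrC -ltr_pdivlMr.
  have Hu := d1P u ud.
  pose rho : 'rV[R]_m := h *: delta_mx 0 c - u *m A.
  have rhoP k : `|rho 0 k| <= e / (2 * C) * (2 * `|h|).
    apply: le_trans (_ : e / (2 * C) * `|u| <= _); last by rewrite ler_wpM2l // ltW.
    apply: le_trans (Hu k); rewrite /u subrK Ey Ez.
    rewrite diffE_rV; last exact: smoothE_differentiable oU (sF k) Ux.
    rewrite le_eqVlt; apply/orP; left; apply/eqP; congr `| _ |.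
    rewrite !mxE addrK; congr (_ - _); apply: eq_bigr => a _.
    by rewrite [A a k]mxE.
  have ub : u 0 b = h * B c b - \sum_k rho 0 k * B k b.
    have : u *m A *m B = u by rewrite mulmxK.
    rewrite (_ : u *m A = h *: delta_mx 0 c - rho); last by rewrite /rho opprB addrC subrK.
    rewrite mulmxBl => /(congr1 (fun M : 'rV[R]_m => M 0 b)) <-.
    rewrite -scalemxAl -rowE 4!mxE; congr (_ - _); by rewrite mxE.
  have -> : F' (h *: delta_mx 0 c + z) 0 b - F' z 0 b = u 0 b by rewrite /u !mxE.
  rewrite ub mulrBr mulKf // opprB addrCA subrr addr0 normrM normfV.
  rewrite mulrC ler_pdivrMr ?normr_gt0 //; apply: le_trans (ler_norm_sum _ _ _) _.
  apply: (@le_trans _ _ (\sum_k e / (2 * C) * (2 * `|h|) * `|B k b|)).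
    by apply: ler_sum => k _; rewrite normrM ler_wpM2r.
  rewrite -mulr_sumr -/C.
  have -> : e * `|h| = e / (2 * C) * (2 * `|h|) * C.
    by field; rewrite lt0r_neq0.
  apply: ler_wpM2l; last by rewrite lerDl.
  by apply: mulr_ge0; [exact: ltW | rewrite mulr_ge0].
exists V, F'; split=> //; split=> //; rewrite ?FV //.
  by move=> b; exact: smoothE_sub VU (sF b).
have cF' b z : W z -> {for z, continuous (fun z => F' z 0 b)}.
  move=> Wz; apply/continuous_normP => e e0; apply/near_normP.
  have /near_normP[d2 d20 d2P] := open_nbhs_nbhs (conj oW Wz).
  exists (Num.min (e / 2) d2); first by rewrite lt_min d20 divr_gt0.
  move=> w; rewrite lt_min => /andP[w1 /d2P Ww].
  have := le_trans (rV_norm_coord _ b) (lip _ _ Ww Wz); rewrite !mxE distrC [`|z - w|]distrC => H.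
  by apply: le_trans H _; move: w1; set p := `|w - z|; lra.
(* Bootstrap: the derivatives of [F'] are smooth functions [q] of [F'], by Cramer's formula, so [F']
   gains one order of differentiability at each step. *)
move=> b k; elim: k b => [|k IH] b; first by split=> // z; exact: cF'.
split=> [z|c]; first exact: cF'.
split=> [z Wz|]; first exact: is_derive_ex (DF' z c b Wz).
pose q x := (\det (DF x))^-1 * \adj (DF x) c b.
have sq : smoothE V q.
  apply: smoothEM => //; last by apply: smoothE_adj => // i j; exact: smoothE_sub VU (sDF i j).
  apply: smoothE_inv => //; first by move=> x [xd _]; have [] := dP x xd.
  by apply: smoothE_det => // i j; exact: smoothE_sub VU (sDF i j).
have VF' z : W z -> V (F' z) by move=> /F'P[].
apply: Ck_ext (Ck_comp oW oV VF' IH (sq k)) => // z Wz.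
rewrite (is_derive_eqE (DF' z c b Wz)) /q /invmx unitmxE unitfE.
by have [[xd _] _] := F'P z Wz; have [_ -> _] := dP _ xd; rewrite [RHS]mxE.
Qed.

End inverse_function.

(** * Smooth functions of one variable *)

Section one_variable.
Context {R : realType}.

Lemma open_setT m : open [set: 'rV[R]_m].
Proof. exact: openT. Qed.
Hint Resolve open_setT : core.

Lemma derive_rV1 (g : R -> R) (x : 'rV[R]_1) :
  derivable (fun x : 'rV[R]_1 => g (x 0 0)) x (delta_mx 0 0) ->
  is_derive (x 0 0) 1 g ('D_(delta_mx 0 0) (fun x : 'rV[R]_1 => g (x 0 0)) x).
Proof.
move=> dg.
have E : (fun s : R => g (((s *: delta_mx 0 0 + x) : 'rV[R]_1) 0 0)) = (fun s => g (s + x 0 0)).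
  by apply/funext => s; rewrite !mxE eqxx mulr1.
have dg0 : derivable (fun x : 'rV[R]_1 => g (x 0 0)) ((0 : R) *: delta_mx 0 0 + x) (delta_mx 0 0).
  by rewrite scale0r add0r.
have := is_derive_line dg0; rewrite E scale0r add0r => D.
have D2 : is_derive (x 0 0) 1 (fun s : R => s - x 0 0) 1.
  by apply: is_derive_eq; rewrite subr0.
have D3 : is_derive ((fun s : R => s - x 0 0) (x 0 0)) 1 (fun s => g (s + x 0 0))
   ('D_(delta_mx 0 0) (fun x : 'rV[R]_1 => g (x 0 0)) x) by rewrite subrr.
have := @is_derive1_comp R (fun s => g (s + x 0 0)) (fun s : R => s - x 0 0) (x 0 0) _ _ D3 D2.
by rewrite mulr1 (_ : _ \o _ = g) //; apply/funext => s /=; rewrite subrK.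
Qed.

Lemma derive_rV1V (g : R -> R) (x : 'rV[R]_1) (d : R) : is_derive (x 0 0) 1 g d ->
  is_derive x (delta_mx 0 0) (fun x : 'rV[R]_1 => g (x 0 0)) d.
Proof.
move=> dg.
have := @chain_rule R 'rV[R]_1 1 (fun x : 'rV[R]_1 => x) (fun x : 'rV[R]_1 => g (x 0 0)) x (delta_mx 0 0).
have dc : differentiable (fun x : 'rV[R]_1 => x 0 0) x by exact: differentiable_coord.
have dg' : differentiable g (x 0 0) by apply/derivable1_diffP; exact: is_derive_ex dg.
have dgc : differentiable (g \o (fun x : 'rV[R]_1 => x 0 0)) x by exact: differentiable_comp.
move=> _; apply: DeriveDef; first exact: diff_derivable.
rewrite deriveE // [LHS](_ : _ = 'd (g \o (fun x : 'rV[R]_1 => x 0 0)) x (delta_mx 0 0)) //.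
rewrite diff_comp //= diff_coord mxE eqxx -deriveE //.
exact: is_derive_eqE dg.
Qed.

(** Expressed on row vectors of length 1, so that the closure properties of [smoothE] apply;
    [smooth_fun1P] translates to the notion used for curves. *)
Definition smooth1 (g : R -> R) := smoothE setT (fun x : 'rV[R]_1 => g (x 0 0)).

(** A class of functions that contains a derivative of each of its members consists of smooth
    functions; it is meant for the class of all [flatp p]. *)
Lemma smooth1_ind (P : (R -> R) -> Prop) :
  (forall g, P g -> exists h, P h /\ forall t : R, is_derive t 1 g (h t)) ->
  forall g, P g -> smooth1 g.
Proof.
move=> H g Pg k; elim: k g Pg => [|k IH] g Pg.
all: have [h [Ph Dg]] := H g Pg.
all: have Dx (x : 'rV[R]_1) := derive_rV1V (Dg (x 0 0)).
all: have cg (x : 'rV[R]_1) : setT x -> {for x, continuous (fun x : 'rV[R]_1 => g (x 0 0))}.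
1, 3: move=> _; apply: (@continuous_comp _ _ _ (fun x : 'rV[R]_1 => x 0 0) g);
  [exact: coord_continuous | by apply: differentiable_continuous; apply/derivable1_diffP; exact: is_derive_ex (Dg _)].
  by split.
split=> // a; rewrite (ord1 a); split=> [x _|]; first exact: is_derive_ex (Dx x).
by apply: Ck_ext (IH h Ph) => // x _; rewrite (is_derive_eqE (Dx x)).
Qed.

Lemma smooth1_derive (g : R -> R) : smooth1 g ->
  (forall t, derivable g t 1) /\ smooth1 (derive1 g).
Proof.
move=> sg; have D (x : 'rV[R]_1) := derive_rV1 (smoothE_derivable (v := delta_mx 0 0) (open_setT (m := 1)) sg (I : setT x)).
split=> [t|]; first by have := D (const_mx t); rewrite mxE => /is_derive_ex.
apply: smoothE_ext (smoothE_d 0 sg) => // x _.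
by rewrite derive1E (is_derive_eqE (D x)).
Qed.

Lemma smooth_fun1P (g : R -> R) : smooth1 g -> smooth_fun1 g.
Proof.
move=> sg k; have H : smooth1 (derive1n k g).
  by elim: k => [|k IH] //; rewrite derive1nS; have [] := smooth1_derive IH.
by have [] := smooth1_derive H.
Qed.

Lemma smooth1_comp m (U : set 'rV[R]_m) (g : R -> R) f : open U -> smooth1 g ->
  smoothE U f -> smoothE U (fun x => g (f x)).
Proof.
move=> oU sg sf.
have sh : smoothE_map U (fun x => const_mx (f x) : 'rV[R]_1).
  by move=> b; under eq_fun do rewrite mxE.
have := smoothE_comp oU (open_setT (m := 1)) (fun _ _ => I) sh sg.
by under eq_fun do rewrite mxE.
Qed.

Lemma smooth1_curve m (U : set 'rV[R]_m) (h : R -> 'rV[R]_m) f : open U ->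
  (forall t, U (h t)) -> (forall a, smooth1 (fun t => h t 0 a)) -> smoothE U f ->
  smooth1 (fun t => f (h t)).
Proof.
move=> oU Uh sh sf.
exact: (smoothE_comp (open_setT (m := 1)) oU (fun x _ => Uh (x 0 0)) sh sf).
Qed.

End one_variable.

(** * Bump functions *)

Section flat_function.
Context {R : realType}.

(* exp (-1/t) and its derivatives are of this form. *)
Definition flatp (p : {poly R}) (t : R) := if 0 < t then p.[t^-1] * expR (- t^-1) else 0.

Lemma poly_growth (p : {poly R}) : exists C n, 0 <= C /\
  forall s : R, 1 <= s -> `|p.[s]| <= C * s ^+ n.
Proof.
elim/poly_ind: p => [|p c [C [n [C0 H]]]].
  by exists 0, 0%N; split=> // s _; rewrite horner0 normr0 mul0r.
exists (C + `|c|), n.+1; split=> [|s s1]; first by rewrite addr_ge0.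
rewrite !hornerE mulrDl; apply: le_trans (ler_normD _ _) _; apply: lerD.
  rewrite normrM exprSr mulrA ler_pM ?H // ger0_norm //; lra.
by rewrite ler_peMr // exprn_ege1.
Qed.

Lemma flatp_bound p : exists2 C : R, 0 <= C & forall t, 0 < t <= 1 -> `|flatp p t| <= C * t ^+ 2.
Proof.
have [C [n [C0 H]]] := poly_growth p.
exists (C * (n.+2)`!%:R); first by rewrite mulr_ge0.
move=> t /andP[t0 t1]; rewrite /flatp t0 normrM (ger0_norm (expR_ge0 _)).
set s := t^-1; have s1 : 1 <= s by rewrite invf_ge1.
have s0 : 0 < s by exact: lt_le_trans s1.
have E : s ^+ n.+2 / (n.+2)`!%:R <= expR s.
  by apply: le_trans (expR_ge1Dxn n.+1 (ltW s0)); rewrite lerDr.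
have f0 : 0 < (n.+2)`!%:R :> R by rewrite ltr0n fact_gt0.
rewrite expRN; apply: le_trans (ler_wpM2r _ (H s s1)) _; first by rewrite invr_ge0 expR_ge0.
rewrite ler_pdivrMr ?expR_gt0 //.
have -> : t = s^-1 by rewrite invrK.
apply: le_trans (_ : C * (n.+2)`!%:R * s^-1 ^+ 2 * (s ^+ n.+2 / (n.+2)`!%:R) <= _); last first.
  by rewrite ler_wpM2l // !mulr_ge0 // ?exprn_ge0 // invr_ge0 ltW.
rewrite le_eqVlt; apply/orP; left; apply/eqP.
have sn0 := lt0r_neq0 s0; have fn0 := lt0r_neq0 f0.
rewrite !exprS; field; rewrite fn0 sn0 //.
Qed.

Lemma is_derive_flatp p (t : R) : is_derive t 1 (flatp p) (flatp (('X ^+ 2) * (p - p^`())) t).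
Proof.
have [t0|t0|->] := ltgtP t 0.
- have -> : flatp ('X^2 * (p - p^`())) t = 0 by rewrite /flatp ltNge (ltW t0).
  apply: (@near_eq_is_derive R R R (cst 0)).
    by near=> s; rewrite /flatp ltNge ltW //=; near: s; exact: lt_nbhsl.
- have D1 : is_derive t 1 (fun s : R => s^-1) (- t ^- 2).
    have t0' : (id t : R) != 0 by rewrite lt0r_neq0.
    have di : derivable (id : R -> R) t 1 by [].
    have dV := @derivableV R R (id : R -> R) t 1 t0' di.
    apply: DeriveDef; first exact dV.
    by rewrite (@deriveV R R (id : R -> R) t 1 t0' di) derive_id [LHS]mulr1.
  have D2 : is_derive (t^-1) 1 (horner p) (p^`().[t^-1]).
    by apply: DeriveDef; [exact: derivable_horner | rewrite -derive1E -derivE].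
  have D3 := @is_derive1_comp R (horner p) (fun s : R => s^-1) t _ _ D2 D1.
  have D4 : is_derive t 1 (fun s : R => - s^-1) (t ^- 2).
    by rewrite -[t ^- 2]opprK; apply: is_deriveN.
  have D5 := @is_derive1_comp R expR (fun s : R => - s^-1) t _ _ (is_derive_expR _) D4.
  have D6 := is_deriveM D3 D5.
  apply: (@near_eq_is_derive R R R ((horner p \o (fun s : R => s^-1)) * (expR \o (fun s : R => - s^-1)))).
    by near=> s; rewrite /flatp ifT //; near: s; exact: lt_nbhsr.
  apply: is_derive_eq; rewrite /flatp t0 /GRing.scale /= !hornerE /= expr2 exprVn.
  by ring.
- rewrite {2}/flatp ltxx; apply: is_derive_cvg => e e0.
  have [C C0 H] := flatp_bound p.
  exists (Num.min 1 (e / (C + 1))); first by rewrite lt_min ltr01 divr_gt0 // ltr_wpDl.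
  move=> h; rewrite lt_min => /andP[h1 he] h0.
  rewrite [_%:A]mulr1 addr0 {2}/flatp ltxx subr0 sub0r normrN normrM normfV.
  rewrite mulrC ler_pdivrMr ?normr_gt0 //.
  have [hp|hn] := ltP 0 h; last by rewrite /flatp ltNge hn /= normr0 mulr_ge0 // ltW.
  have h1' : 0 < h <= 1 by rewrite hp /=; move: h1; rewrite gtr0_norm // => /ltW.
  apply: le_trans (H h h1') _; rewrite expr2 mulrA gtr0_norm // ler_wpM2r ?(ltW hp) //.
  move: he; rewrite gtr0_norm // ltr_pdivlMr ?ltr_wpDl //; lra.
Unshelve. all: by end_near. Qed.

Definition flat := flatp 1.

Lemma smooth1_flat : smooth1 flat.
Proof.
apply: (smooth1_ind (P := fun g => exists p, g = flatp p)); last by exists 1.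
move=> _ [p ->]; exists (flatp ('X ^+ 2 * (p - p^`()))); split; first by eexists.
by move=> t; exact: is_derive_flatp.
Qed.

Lemma flat_gt0 t : (0 < flat t) = (0 < t).
Proof. by rewrite /flat /flatp hornerC mul1r; case: ifP; rewrite ?expR_gt0 ?ltxx. Qed.

Lemma flat_ge0 t : 0 <= flat t.
Proof. by rewrite /flat /flatp hornerC mul1r; case: ifP; rewrite ?expR_ge0. Qed.

Lemma flat_le0 t : t <= 0 -> flat t = 0.
Proof. by rewrite /flat /flatp leNgt => /negbTE ->. Qed.

Definition step01 t := flat t / (flat t + flat (1 - t)).

Lemma step01_den t : 0 < flat t + flat (1 - t).
Proof.
have [t0|t0] := ltP 0 t; first by rewrite ltr_pwDl ?flat_gt0 ?flat_ge0.
by rewrite ltr_wpDl ?flat_ge0 // flat_gt0 subr_gt0 (le_lt_trans t0).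
Qed.

Lemma smooth1_step01 : smooth1 step01.
Proof.
have o : open [set: 'rV[R]_1] by exact: openT.
have s1 : smooth1 (fun t => flat (1 - t)).
  apply: (smooth1_comp (g := flat) (f := fun x : 'rV[R]_1 => 1 - x 0 0)) => //; first exact: smooth1_flat.
  by apply: smoothEB => //; [exact: smoothE_cst | exact: smoothE_coord].
apply: smoothEM => //; first exact: smooth1_flat.
apply: smoothE_inv => // [x _|]; first by rewrite lt0r_neq0 // step01_den.
by apply: smoothED => //; exact: smooth1_flat.
Qed.

Lemma step01_0 t : t <= 0 -> step01 t = 0.
Proof. by move=> t0; rewrite /step01 flat_le0 // mul0r. Qed.

Lemma step01_1 t : 1 <= t -> step01 t = 1.
Proof.
move=> t1; rewrite /step01 [flat (1 - t)]flat_le0 ?subr_le0 // addr0 divff //.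
by rewrite lt0r_neq0 // flat_gt0 (lt_le_trans _ t1).
Qed.

(** The norm is the maximum norm, so a product over the coordinates suffices; squares replace
    absolute values, which are not smooth. The argument of [step01] is at least 1 for coordinates up
    to [d] and at most 0 from [2 * d] on. *)
Definition plateau m (d : R) (x : 'rV[R]_m) := \prod_a step01 ((4 * d ^+ 2 - x 0 a ^+ 2) / (3 * d ^+ 2)).

Lemma smoothE_plateau m d : smoothE setT (@plateau m d).
Proof.
have o : open [set: 'rV[R]_m] by exact: openT.
apply: smoothE_prod => // a _; apply: smooth1_comp => //; first exact: smooth1_step01.
apply: smoothEM => //; last exact: smoothE_cst.
apply: smoothEB => //; first exact: smoothE_cst.
by apply: smoothEX => //; exact: smoothE_coord.
Qed.

Lemma plateau1 m d (x : 'rV[R]_m) : 0 < d -> `|x| <= d -> plateau d x = 1.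
Proof.
move=> d0 xd; apply: big1 => a _; apply: step01_1.
have H : `|x 0 a| <= d by apply: le_trans xd; rewrite [leRHS]/Num.Def.normr /= mx_normrE; exact: (le_bigmax _ _ (0, a)).
have d20 : 0 < 3 * d ^+ 2 by rewrite mulr_gt0 // exprn_gt0.
rewrite ler_pdivlMr // mul1r; have := @lerXn2r _ 2 `|x 0 a| d; rewrite !nnegrE.
by move=> /(_ (normr_ge0 _) (ltW d0) H); rewrite real_normK ?num_real //; lra.
Qed.

Lemma plateau0 m d (x : 'rV[R]_m) : 0 < d -> 2 * d <= `|x| -> plateau d x = 0.
Proof.
move=> d0; rewrite [X in _ <= X -> _]/Num.Def.normr /= mx_normrE => /bigmax_geP[|[[i a] _ /= H]].
  by move=> H; exfalso; move: H; lra.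
rewrite (ord1 i) in H.
rewrite /plateau (bigD1 a) //= step01_0 ?mul0r //.
have d20 : 0 < 3 * d ^+ 2 by rewrite mulr_gt0 // exprn_gt0.
rewrite pmulr_lle0 ?invr_gt0 //; have := @lerXn2r _ 2 (2 * d) `|x 0 a|; rewrite !nnegrE.
by move=> /(_ _ (normr_ge0 _) H); rewrite real_normK ?num_real // exprMn; lra.
Qed.

End flat_function.

(** * Jets of functions in coordinates *)

Section truncated_equality.
Context {R : realType}.
Implicit Types (P Q : {poly R}) (k : nat).

(** Congruence modulo 'X^(k+1). *)
Definition eqX k P Q := forall i, (i <= k)%N -> P`_i = Q`_i.

Lemma eqX_sym k P Q : eqX k P Q -> eqX k Q P.
Proof. by move=> PQ i ik; rewrite PQ. Qed.

Lemma eqX_trans k P Q S : eqX k P Q -> eqX k Q S -> eqX k P S.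
Proof. by move=> PQ QS i ik; rewrite PQ ?QS. Qed.

Lemma eqX_refl k P : eqX k P P. Proof. by []. Qed.

Lemma eqXW k l P Q : (l <= k)%N -> eqX k P Q -> eqX l P Q.
Proof. by move=> lk PQ i il; apply: PQ; exact: leq_trans lk. Qed.

Lemma eqXD k P P' Q Q' : eqX k P P' -> eqX k Q Q' -> eqX k (P + Q) (P' + Q').
Proof. by move=> H1 H2 i ik; rewrite !coefD H1 ?H2. Qed.

Lemma eqX_sum k I (r : seq I) (F G : I -> {poly R}) : (forall i, eqX k (F i) (G i)) ->
  eqX k (\sum_(i <- r) F i) (\sum_(i <- r) G i).
Proof. by move=> FG i ik; rewrite !coef_sum; apply: eq_bigr => a _; exact: FG. Qed.

Lemma eqXM k P P' Q Q' : eqX k P P' -> eqX k Q Q' -> eqX k (P * Q) (P' * Q').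
Proof.
move=> H1 H2 i ik; rewrite !coefM; apply: eq_bigr => j _.
rewrite H1 ?H2 //; first exact: leq_trans (leq_subr _ _) ik.
by apply: leq_trans ik; rewrite -ltnS.
Qed.

(** A factor without constant term gains one order of precision. Every Eul (jcoord p a) is such a
    factor, which is why inductions along the Euler equation advance. *)
Lemma eqXM_gain k P P' Q Q' : P`_0 = 0 -> eqX k.+1 P P' -> eqX k Q Q' ->
  eqX k.+1 (P * Q) (P' * Q').
Proof.
move=> P0 HP H i ik; rewrite !coefM; apply: eq_bigr => -[[|j] /= ji] _.
  by rewrite -HP // P0 !mul0r.
rewrite HP ?H //; last by apply: leq_trans ik; rewrite -ltnS.
by rewrite leq_subLR addSn (leq_trans ik) // ltnS leq_addl.
Qed.

Definition Eul P := 'X * P^`().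

Lemma coef_Eul P i : (Eul P)`_i = i%:R * P`_i.
Proof. by rewrite /Eul coefXM; case: i => [|i] /=; rewrite ?mul0r // coef_deriv mulr_natl. Qed.

Lemma Eul_sum I (r : seq I) (F : I -> {poly R}) : Eul (\sum_(i <- r) F i) = \sum_(i <- r) Eul (F i).
Proof. by rewrite /Eul raddf_sum mulr_sumr. Qed.

Lemma EulM P Q : Eul (P * Q) = Eul P * Q + P * Eul Q.
Proof. by rewrite /Eul derivM; ring. Qed.

Lemma Eul_eqX k P Q : P`_0 = Q`_0 -> eqX k (Eul P) (Eul Q) -> eqX k P Q.
Proof.
move=> H0 H [|i] ik //; have := H i.+1 ik; rewrite !coef_Eul.
by apply: mulfI; rewrite pnatr_eq0.
Qed.

Lemma Eul0 P : (Eul P)`_0 = 0.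
Proof. by rewrite coef_Eul mul0r. Qed.

End truncated_equality.

Section jets.
Context {R : realType} {r : nat}.

Section fixed_dimension.
Context {n : nat}.
Implicit Types (f g : 'rV[R]_n -> R) (p : 'M[R]_(r.+1, n)) (U : set 'rV[R]_n).

Definition jbase p : 'rV[R]_n := row ord0 p.

Definition jcoord p (a : 'I_n) : {poly R} := \poly_(j < r.+1) p (inord j) a.

(** Inverse of the Euler operator on polynomials without constant term. At [j = 0] the division by
    zero returns 0, so the result has no constant term either. *)
Definition invE (P : {poly R}) : {poly R} := \poly_(j < r.+1) (P`_j / j%:R).

(* The jet of f along p is the solution of the Euler equation
   E (jet f p) = \sum_a E p_a * jet (d_a f) p, where E = 'X * d/d'X, with constant
   term [f (jbase p)]; the fuel [s] bounds the degree in 'X. *)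
Fixpoint Jn s f p : {poly R} := (f (jbase p))%:P +
  if s is s'.+1 then invE (\sum_a Eul (jcoord p a) * Jn s' ('d_a f) p) else 0.

Definition jet f p := Jn r f p.

Lemma coef_jcoord p a (i : 'I_r.+1) : (jcoord p a)`_i = p i a.
Proof. by rewrite coef_poly ltn_ord inord_val. Qed.

Lemma jcoord0 p a : (jcoord p a)`_0 = jbase p 0 a.
Proof. by rewrite coef_poly mxE; congr (p _ a); apply: val_inj; rewrite /= inordK. Qed.

Lemma invE0 P : (invE P)`_0 = 0.
Proof. by rewrite coef_poly invr0 mulr0. Qed.

Lemma Jn0 s f p : (Jn s f p)`_0 = f (jbase p).
Proof. by case: s => [|s]; rewrite coefD coefC eqxx ?invE0 ?coef0 addr0. Qed.

Lemma size_Jn s f p : (size (Jn s f p) <= r.+1)%N.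
Proof.
case: s => [|s]; rewrite (leq_trans (size_polyD _ _)) // geq_max.
all: by rewrite (leq_trans (size_polyC_leq1 _)) //= ?size_poly0 // size_poly.
Qed.

(** More fuel only changes coefficients above [s]: the recursive call enters with a factor that has
    no constant term, so its precision grows by one. *)
Lemma Jn_stable s f p : (s <= r)%N -> eqX s (Jn s f p) (jet f p).
Proof.
rewrite /jet => sr; have [k ->] : exists k, r = (s + k)%N by exists (r - s)%N; rewrite subnKC.
elim: s f {sr} => [|s IH] f [|j] //; rewrite ?Jn0 // => js.
rewrite addSn /= !coefD !coefC /= !coef_poly; case: ifP => // _; congr (_ + _ / _).
apply: (_ : eqX s.+1 _ _) (js); apply: eqX_sum => a.
by apply: eqXM_gain; rewrite ?Eul0.
Qed.

Lemma jet0 f p : (jet f p)`_0 = f (jbase p).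
Proof. exact: Jn0. Qed.

Lemma size_jet f p : (size (jet f p) <= r.+1)%N.
Proof. exact: size_Jn. Qed.

Lemma jet_Eul f p : eqX r (Eul (jet f p)) (\sum_a Eul (jcoord p a) * jet ('d_a f) p).
Proof.
have S : r = 0%N \/ exists s, r = s.+1 by case: (r) => [|s]; [left|right; exists s].
case: S => [r0 | [s rs]] [|j] jr.
- by rewrite coef_sum coef_Eul mul0r big1 // => a _; rewrite coefM big_ord1 Eul0 mul0r.
- by move: jr; rewrite r0.
- by rewrite coef_sum coef_Eul mul0r big1 // => a _; rewrite coefM big_ord1 Eul0 mul0r.
have -> : jet f p = (f (jbase p))%:P + invE (\sum_a Eul (jcoord p a) * Jn s ('d_a f) p).
  by rewrite /jet [X in Jn X]rs.
rewrite coef_Eul coefD coefC /= add0r coef_poly ltnS jr.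
rewrite mulrC divfK ?pnatr_eq0 //.
apply: (_ : eqX s.+1 _ _) _; last by rewrite -rs.
apply: eqX_sum => a; apply: eqXM_gain; rewrite ?Eul0 //.
by apply: Jn_stable; rewrite rs.
Qed.

Lemma Jn_ext s U f g p : open U -> U (jbase p) -> (forall x, U x -> f x = g x) ->
  Jn s f p = Jn s g p.
Proof.
move=> oU Up; elim: s f g => [|s IH] f g fg; first by rewrite /= (fg _ Up).
rewrite /= (fg _ Up); congr (_ + invE _).
apply: eq_bigr => a _; congr (_ * _); apply: IH => x Ux.
apply: near_eq_derive; near=> y; apply: fg; near: y; exact: open_nbhs_nbhs.
Unshelve. all: by end_near. Qed.

Lemma jet_ext U f g p : open U -> U (jbase p) -> (forall x, U x -> f x = g x) ->
  jet f p = jet g p.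
Proof. exact: Jn_ext. Qed.

Lemma invED P Q : invE (P + Q) = invE P + invE Q.
Proof.
by apply/polyP => i; rewrite coefD !coef_poly coefD; case: ifP => _; rewrite ?addr0 ?mulrDl.
Qed.

Lemma invEZ c P : invE (c *: P) = c *: invE P.
Proof. by apply/polyP => i; rewrite coefZ !coef_poly coefZ; case: ifP => _; rewrite ?mulr0 ?mulrA. Qed.

Lemma invE00 : invE 0 = 0.
Proof. by apply/polyP => i; rewrite coef_poly coef0 mul0r if_same. Qed.

Lemma Jn_lin s U c f g p : open U -> U (jbase p) -> smoothE U f -> smoothE U g ->
  Jn s (fun x => c * f x + g x) p = c *: Jn s f p + Jn s g p.
Proof.
move=> oU Up; elim: s f g => [|s IH] f g sf sg /=.
  by rewrite !addr0 polyCD polyCM mul_polyC.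
rewrite polyCD polyCM mul_polyC scalerDr addrACA; congr (_ + _).
rewrite -invEZ -invED scaler_sumr -big_split /=; congr invE; apply: eq_bigr => a _.
rewrite scalerAr -mulrDr -IH; try exact: smoothE_d.
congr (_ * _); apply: (Jn_ext _ oU Up) => x Ux.
have df := smoothE_derivable (v := delta_mx 0 a) oU sf Ux.
have dg := smoothE_derivable (v := delta_mx 0 a) oU sg Ux.
apply: is_derive_eqE; apply: is_deriveD; last exact: derivableP.
by apply: is_deriveZ; exact: derivableP.
Qed.

Lemma Jn_cst s c p : Jn s (fun=> c) p = c%:P.
Proof.
elim: s c => [|s IH] c /=; first by rewrite addr0.
rewrite big1 ?invE00 ?addr0 // => a _.
have -> : 'd_a (fun=> c) = (fun=> 0) :> ('rV[R]_n -> R) by apply/funext => x; exact: derive_cst.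
by rewrite IH mulr0.
Qed.

Lemma jet_cst c p : jet (fun=> c) p = c%:P.
Proof. exact: Jn_cst. Qed.

Lemma jet_lin U c f g p : open U -> U (jbase p) -> smoothE U f -> smoothE U g ->
  jet (fun x => c * f x + g x) p = c *: jet f p + jet g p.
Proof. exact: Jn_lin. Qed.

Lemma jetD U f g p : open U -> U (jbase p) -> smoothE U f -> smoothE U g ->
  jet (fun x => f x + g x) p = jet f p + jet g p.
Proof.
move=> oU Up sf sg; rewrite -[jet f p]scale1r -(jet_lin 1 oU) //.
by apply: (jet_ext oU) => // x _; rewrite mul1r.
Qed.

Lemma jet_sum U I (s : seq I) (F : I -> 'rV[R]_n -> R) p : open U -> U (jbase p) ->
  (forall i, smoothE U (F i)) -> jet (fun x => \sum_(i <- s) F i x) p = \sum_(i <- s) jet (F i) p.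
Proof.
move=> oU Up sF; elim: s => [|i s IH].
  by under eq_fun do rewrite big_nil; rewrite big_nil jet_cst.
under eq_fun do rewrite big_cons; rewrite big_cons (jetD oU) ?IH //.
exact: smoothE_sum.
Qed.

Lemma jet_coord a p : jet (fun x => x 0 a) p = jcoord p a.
Proof.
suff H : eqX r (jet (fun x => x 0 a) p) (jcoord p a).
  apply/polyP => i; have [|ir] := leqP i r; first exact: H.
  by rewrite !nth_default // ?size_poly // (leq_trans _ ir) ?size_jet // size_poly.
apply: Eul_eqX; first by rewrite jet0 jcoord0.
apply: eqX_trans (jet_Eul _ _) _; rewrite (bigD1 a) //= big1 ?addr0 => [|b ba].
  have -> : 'd_a (fun x : 'rV[R]_n => x 0 a) = (fun=> 1) :> ('rV[R]_n -> R).
    by apply/funext => x; rewrite (is_derive_eqE (derive_coord _ _ _)) mxE !eqxx.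
  by rewrite jet_cst mulr1.
have -> : 'd_b (fun x : 'rV[R]_n => x 0 a) = (fun=> 0) :> ('rV[R]_n -> R).
  by apply/funext => x; rewrite (is_derive_eqE (derive_coord _ _ _)) mxE eqxx eq_sym (negbTE ba).
by rewrite jet_cst mulr0.
Qed.

(** Both sides have the same constant term and satisfy the same Euler equation: the Leibniz rules
    for [Eul] and for ['d_a] match, and the induction hypothesis treats the products of lower
    precision. *)
Lemma jetM U f g p : open U -> U (jbase p) -> smoothE U f -> smoothE U g ->
  eqX r (jet (fun x => f x * g x) p) (jet f p * jet g p).
Proof.
move=> oU Up sf sg; have : (r <= r)%N by [].
move: {1 3}r => k; elim: k f g sf sg => [|k IH] f g sf sg kr.
  by case=> // _; rewrite coefM big_ord1 subn0 !jet0.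
apply: Eul_eqX; first by rewrite coefM big_ord1 subn0 !jet0.
apply: eqX_trans (eqXW kr (jet_Eul _ _)) _; rewrite EulM.
apply: eqX_trans _ (eqX_sym (eqXD (eqXM (eqXW kr (jet_Eul f p)) (@eqX_refl _ _ _))
  (eqXM (@eqX_refl _ _ _) (eqXW kr (jet_Eul g p))))).
rewrite mulr_suml mulr_sumr -big_split /=; apply: eqX_sum => a.
rewrite -mulrA [jet f p * _]mulrCA -mulrDr; apply: eqXM_gain; rewrite ?Eul0 //.
have sfa := smoothE_d a sf; have sga := smoothE_d a sg.
rewrite (jet_ext (g := fun x => 'D_(delta_mx 0 a) f x * g x + f x * 'D_(delta_mx 0 a) g x) oU) //.
  rewrite (jetD oU) //; try exact: smoothEM.
  by apply: eqXD; apply: IH => //; exact: ltnW.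
move=> x Ux; have df := smoothE_derivable (v := delta_mx 0 a) oU sf Ux.
have dg := smoothE_derivable (v := delta_mx 0 a) oU sg Ux.
exact: derive_mul.
Qed.

Definition jkappa t p : 'M[R]_(r.+1, n) := \matrix_(j, a) (t ^+ j * p j a).

Lemma jbase_kappa t p : jbase (jkappa t p) = jbase p.
Proof. by apply/rowP => a; rewrite !mxE expr0 mul1r. Qed.

Lemma Jn_kappa s t f p i : (Jn s f (jkappa t p))`_i = t ^+ i * (Jn s f p)`_i.
Proof.
elim: s f i => [|s IH] f i /=; rewrite !coefD !coefC jbase_kappa mulrDr; congr (_ + _).
1, 3: by case: i => [|i] /=; rewrite ?expr0 ?mul1r ?mulr0.
  by case: i => [|i] /=; rewrite mulr0.
rewrite !coef_poly; case: ifP => [ir|_]; last by rewrite mulr0.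
rewrite mulrA; congr (_ / _); rewrite !coef_sum mulr_sumr; apply: eq_bigr => a _.
rewrite !coefM mulr_sumr; apply: eq_bigr => -[l /= li] _.
rewrite IH !coef_Eul !coef_poly.
have lr : (l < r.+1)%N by rewrite (leq_trans li).
rewrite lr !mxE inordK //.
have -> : t ^+ i = t ^+ l * t ^+ (i - l) by rewrite -exprD subnKC.
by ring.
Qed.

Lemma jet_kappa t f p i : (jet f (jkappa t p))`_i = t ^+ i * (jet f p)`_i.
Proof. exact: Jn_kappa. Qed.


Local Notation jdim := (r.+1 * n)%N.

Lemma open_linear_preimage m k (L : 'rV[R]_m -> 'rV[R]_k) (O : set 'rV[R]_k) :
  (forall b, smoothE setT (fun x => L x 0 b)) -> open O -> open (L @^-1` O).
Proof.
move=> sL oO; apply: open_comp => // x _.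
by apply: continuous_rV => b; apply: smoothE_cont (sL b) _.
Qed.

Lemma smoothE_vec_entry (O : set 'rV[R]_jdim) (i : 'I_r.+1) a : open O ->
  smoothE O (fun q => vec_mx q i a).
Proof. by move=> oO; under eq_fun do rewrite mxE; exact: smoothE_coord. Qed.

Definition jdom U : set 'rV[R]_jdim := [set q | U (jbase (vec_mx q))].

Lemma open_jdom U : open U -> open (jdom U).
Proof.
apply: (@open_linear_preimage _ _ (fun q : 'rV[R]_jdim => jbase (vec_mx q))) => b.
under eq_fun do rewrite mxE.
by apply: smoothE_vec_entry; exact: openT.
Qed.

Lemma smoothE_jcoord (O : set 'rV[R]_jdim) a i : open O ->
  smoothE O (fun q => (jcoord (vec_mx q) a)`_i).
Proof.
move=> oO; under eq_fun do rewrite coef_poly.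
by case: (i < r.+1)%N; [exact: smoothE_vec_entry | exact: smoothE_cst].
Qed.

Lemma smoothE_Jn s U f i : open U -> smoothE U f ->
  smoothE (jdom U) (fun q => (Jn s f (vec_mx q))`_i).
Proof.
move=> oU; have oJ := open_jdom oU; elim: s f i => [|s IH] f i sf /=.
all: under eq_fun do rewrite coefD; apply: smoothED => //.
1, 3: under eq_fun do rewrite coefC; case: (i == 0%N); last exact: smoothE_cst.
1, 2: apply: (smoothE_comp oJ oU (h := fun q => jbase (vec_mx q))) => // b;
  by under eq_fun do rewrite mxE; exact: smoothE_vec_entry.
- by under eq_fun do rewrite coef0; exact: smoothE_cst.
under eq_fun do rewrite coef_poly; case: (i < r.+1)%N; last exact: smoothE_cst.
apply: smoothEM => //; last exact: smoothE_cst.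
under eq_fun do rewrite coef_sum; apply: smoothE_sum => // a _.
under eq_fun do rewrite coefM; apply: smoothE_sum => // l _.
apply: smoothEM => //; last by apply: IH; exact: smoothE_d.
under eq_fun do rewrite coef_Eul; apply: smoothEM => //; first exact: smoothE_cst.
exact: smoothE_jcoord.
Qed.

Lemma smoothE_jet U f i : open U -> smoothE U f ->
  smoothE (jdom U) (fun q => (jet f (vec_mx q))`_i).
Proof. exact: smoothE_Jn. Qed.

Definition jets_derive (A : 'rV[R]_jdim -> {poly R}) (A' : {poly R}) q v :=
  forall j, is_derive q v (fun q => (A q)`_j) A'`_j.

Lemma jets_deriveM A A' B B' q v : jets_derive A A' q v -> jets_derive B B' q v ->
  jets_derive (fun q => A q * B q) (A' * B q + A q * B') q v.
Proof.
move=> dA dB j.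
have -> : (fun q => (A q * B q)`_j) = \sum_(i < j.+1) (fun q => (A q)`_i * (B q)`_(j - i)).
  by apply/funext => y; rewrite fct_sumE coefM.
rewrite coefD !coefM -big_split /=; apply: is_derive_sum => i.
have -> : A'`_i * (B q)`_(j - i) + (A q)`_i * B'`_(j - i) =
    'D_v (fun q => (A q)`_i * (B q)`_(j - i)) q.
  by rewrite derive_mul ?(is_derive_eqE (dA _)) ?(is_derive_eqE (dB _)) //; exact: is_derive_ex.
by apply: derivableP; apply: derivableM; [exact: is_derive_ex (dA _) | exact: is_derive_ex (dB _)].
Qed.

Lemma jets_derive_sum I (s : seq I) (A : I -> _ -> {poly R}) A' q v :
  (forall i, jets_derive (A i) (A' i) q v) ->
  jets_derive (fun q => \sum_(i <- s) A i q) (\sum_(i <- s) A' i) q v.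
Proof.
move=> dA j; elim: s => [|i s IH].
  under eq_fun do rewrite big_nil; rewrite big_nil coef0; exact: is_derive_cst.
under eq_fun do rewrite big_cons coefD; rewrite big_cons coefD.
exact: is_deriveD (dA i j) IH.
Qed.

Lemma jets_derive_Eul A A' q v : jets_derive A A' q v ->
  jets_derive (fun q => Eul (A q)) (Eul A') q v.
Proof.
move=> dA j; under eq_fun do rewrite coef_Eul; rewrite coef_Eul; exact: is_deriveZ.
Qed.

Lemma jets_derive_jcoord a q v :
  jets_derive (fun q => jcoord (vec_mx q) a) (jcoord (vec_mx v) a) q v.
Proof.
move=> j; under eq_fun do rewrite coef_poly; rewrite coef_poly; case: ifP => _; last exact: is_derive_cst.
by under eq_fun do rewrite mxE; rewrite mxE; exact: derive_coord.
Qed.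

(** The Euler equation is differentiated along [v] and compared with the one satisfied by the
    right-hand side; the terms with two derivatives of [f] agree by the symmetry of second
    derivatives. The formula shows that the differential of a jet is linear over the truncated
    polynomials. *)
Lemma jet_derive U f q v : open U -> smoothE U f -> U (jbase (vec_mx q)) ->
  forall j, (j <= r)%N -> is_derive q v (fun q => (jet f (vec_mx q))`_j)
   (\sum_a jcoord (vec_mx v) a * jet ('d_a f) (vec_mx q))`_j.
Proof.
move=> oU sf Uq.
pose DJ f : {poly R} := \poly_(j < r.+1) 'D_v (fun q => (jet f (vec_mx q))`_j) q.
have dJ f' : smoothE U f' -> jets_derive (fun q => jet f' (vec_mx q)) (DJ f') q v.
  move=> sf' j; rewrite coef_poly; case: ltnP => jr.
    by apply: derivableP; exact: smoothE_derivable (open_jdom oU) (smoothE_jet j oU sf') Uq.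
  rewrite (_ : (fun q => _) = cst 0); first exact: is_derive_cst.
  by apply/funext => y; rewrite nth_default // (leq_trans (size_jet _ _)).
suff H k : (k <= r)%N -> forall f', smoothE U f' ->
    eqX k (DJ f') (\sum_a jcoord (vec_mx v) a * jet ('d_a f') (vec_mx q)).
  by move=> j jr; rewrite -(H r (leqnn r) f sf j jr); exact: dJ.
have base f' : smoothE U f' -> (DJ f')`_0 =
    (\sum_a jcoord (vec_mx v) a * jet ('d_a f') (vec_mx q))`_0.
  move=> sf'; rewrite -(is_derive_eqE (dJ _ sf' 0%N)).
  have -> : (fun q => (jet f' (vec_mx q))`_0) = f' \o (fun q : 'rV[R]_jdim => jbase (vec_mx q)).
    by apply/funext => y; rewrite jet0.
  have [|_ ->] := @chain_rule R _ n (fun q : 'rV[R]_jdim => jbase (vec_mx q)) f' q v _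
    (smoothE_differentiable oU sf' Uq).
    move=> b; have oT : open [set: 'rV[R]_jdim] by exact: openT.
    under eq_fun do rewrite mxE.
    exact: (smoothE_differentiable oT (smoothE_vec_entry _ _ oT)).
  rewrite coef_sum; apply: eq_bigr => a _; rewrite coefM big_ord1 subn0 jet0 jcoord0 mulrC; congr (_ * _).
  under eq_fun do rewrite !mxE; rewrite !mxE.
  exact: is_derive_eqE (derive_coord _ _ _).
elim: k => [|k IH] kr f' sf'; first by case=> // _; exact: base.
apply: Eul_eqX; first exact: base.
have E1 : eqX k.+1 (Eul (DJ f')) (\sum_a (Eul (jcoord (vec_mx v) a) * jet ('d_a f') (vec_mx q)
    + Eul (jcoord (vec_mx q) a) * DJ ('d_a f'))).
  move=> j jk; rewrite -(is_derive_eqE (jets_derive_Eul (dJ _ sf') j)).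
  have -> : (fun q => (Eul (jet f' (vec_mx q)))`_j) =
      (fun q => (\sum_a Eul (jcoord (vec_mx q) a) * jet ('d_a f') (vec_mx q))`_j).
    by apply/funext => y; rewrite (jet_Eul _ _ (leq_trans jk kr)).
  apply: is_derive_eqE; apply: jets_derive_sum => a; apply: jets_deriveM; last exact/dJ/smoothE_d.
  by apply: jets_derive_Eul; exact: jets_derive_jcoord.
apply: eqX_trans E1 _; rewrite Eul_sum.
under [X in eqX _ _ X]eq_bigr do rewrite EulM.
rewrite !big_split /=; apply: eqXD => //.
have E2 : eqX k.+1 (\sum_a Eul (jcoord (vec_mx q) a) * DJ ('d_a f'))
    (\sum_a Eul (jcoord (vec_mx q) a) * (\sum_b jcoord (vec_mx v) b * jet ('d_b ('d_a f')) (vec_mx q))).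
  by apply: eqX_sum => a; apply: eqXM_gain; [exact: Eul0 | | apply: IH; [exact: ltnW | exact: smoothE_d]].
apply: eqX_trans E2 _.
have E3 : eqX k.+1 (\sum_b jcoord (vec_mx v) b * Eul (jet ('d_b f') (vec_mx q)))
    (\sum_b jcoord (vec_mx v) b * (\sum_a Eul (jcoord (vec_mx q) a) * jet ('d_a ('d_b f')) (vec_mx q))).
  by apply: eqX_sum => b; apply: eqXM => //; apply: eqXW kr _; exact: jet_Eul.
apply: eqX_trans _ (eqX_sym E3).
rewrite (eq_bigr (fun a => \sum_b jcoord (vec_mx v) b * (Eul (jcoord (vec_mx q) a) *
   jet ('d_a ('d_b f')) (vec_mx q)))) => [|a _]; last first.
  have C b : jet ('d_b ('d_a f')) (vec_mx q) = jet ('d_a ('d_b f')) (vec_mx q).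
    by apply: (jet_ext oU Uq) => x Ux; exact: (derive_derive_comm oU sf' a b Ux).
  rewrite mulr_sumr; apply: eq_bigr => b _.
  have CA (A B X Y : {poly R}) : X = Y -> A * (B * X) = B * (A * Y) by move=> ->; exact: mulrCA.
  exact: CA (C b).
rewrite exchange_big /=.
by under [X in eqX _ _ X]eq_bigr do rewrite mulr_sumr.
Qed.

End fixed_dimension.

Section composition.
Context {n m : nat}.
Variables (U : set 'rV[R]_n) (V : set 'rV[R]_m) (h : 'rV[R]_n -> 'rV[R]_m).
Hypotheses (oU : open U) (oV : open V) (sh : smoothE_map U h) (hUV : forall x, U x -> V (h x)).

Definition jmap (h : 'rV[R]_n -> 'rV[R]_m) (p : 'M[R]_(r.+1, n)) : 'M[R]_(r.+1, m) :=
  \matrix_(j, b) (jet (fun x => h x 0 b) p)`_j.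

Lemma jcoord_jmap p b : jcoord (jmap h p) b = jet (fun x => h x 0 b) p.
Proof.
apply/polyP => i; rewrite coef_poly; case: ltnP => ir; last first.
  by rewrite nth_default // (leq_trans (size_jet _ _)).
by rewrite mxE inordK.
Qed.

Lemma jbase_jmap p : jbase (jmap h p) = h (jbase p).
Proof. by apply/rowP => b; rewrite !mxE jet0. Qed.

(** Expand the Euler equation of the left-hand side by the chain rule and exchange the two sums: the
    inner one becomes the Euler equation for a component of [h], and what remains is that of [f]
    along [jmap h p]. *)
Lemma jet_comp f p : smoothE V f -> U (jbase p) ->
  jet (fun x => f (h x)) p = jet f (jmap h p).
Proof.
move=> sf Up.
suff H : eqX r (jet (fun x => f (h x)) p) (jet f (jmap h p)).
  apply/polyP => i; have [|ir] := leqP i r; first exact: H.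
  by rewrite !nth_default // (leq_trans _ ir) // size_jet.
have : (r <= r)%N by []; move: {1 3}r => k.
elim: k f sf => [|k IH] f sf kr; first by case=> // _; rewrite !jet0 jbase_jmap.
apply: Eul_eqX; first by rewrite !jet0 jbase_jmap.
apply: eqX_trans (eqXW kr (jet_Eul _ _)) _.
apply: eqX_trans _ (eqX_sym (eqXW kr (jet_Eul _ _))).
have E a : eqX k (jet ('d_a (fun x => f (h x))) p)
    (\sum_b jet ('d_b f) (jmap h p) * jet ('d_a (fun x => h x 0 b)) p).
  have sdh b := smoothE_d a (sh b).
  have sdf b : smoothE U (fun x => 'D_(delta_mx 0 b) f (h x)).
    exact: (smoothE_comp oU oV hUV sh (smoothE_d b sf)).
  rewrite (jet_ext (g := fun x => \sum_b 'D_(delta_mx 0 b) f (h x) * 'D_(delta_mx 0 a) (fun x => h x 0 b) x) oU) //.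
    rewrite (jet_sum _ oU) // => [|b]; last exact: smoothEM.
    apply: eqX_sum => b; apply: eqX_trans (eqXW (ltnW kr) (jetM oU Up (sdf b) (sdh b))) _.
    by apply: eqXM => //; apply: IH; [exact: smoothE_d | exact: ltnW].
  move=> x Ux; have [|_ ->] // := @chain_rule R _ m h f x (delta_mx 0 a) _
    (smoothE_differentiable oV sf (hUV Ux)).
  by move=> b; exact: smoothE_differentiable oU (sh b) Ux.
have E2 : eqX k.+1 (\sum_a Eul (jcoord p a) * jet ('d_a (fun x => f (h x))) p)
    (\sum_a Eul (jcoord p a) * (\sum_b jet ('d_b f) (jmap h p) * jet ('d_a (fun x => h x 0 b)) p)).
  by apply: eqX_sum => a; apply: eqXM_gain; [exact: Eul0 | | exact: E].
apply: eqX_trans E2 _.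
under [X in eqX _ X _]eq_bigr do rewrite mulr_sumr.
rewrite exchange_big /=; apply: eqX_sum => b.
rewrite jcoord_jmap; under [X in eqX _ X _]eq_bigr do rewrite mulrCA.
rewrite -mulr_sumr mulrC; apply: eqXM => //.
by apply: eqX_sym; exact: eqXW kr (jet_Eul _ _).
Qed.

End composition.
End jets.

(** * Smooth functions on manifolds *)

Section manifold_smoothness.
Context {R : realType} {n : nat} {M : manifold R n}.
Implicit Types (c d : chart R n M) (U V : set M) (f g : M -> R) (m : M).

Lemma chart_dom_open c : open (chart_dom c).
Proof. by case: c. Qed.

Lemma chart_img_open c U : open U -> open (chart_map c @` (U `&` chart_dom c)).
Proof.
case: c => D h k oD ohD ch ck hk /= oU; rewrite openE => _ [x [Ux Dx] <-].
have I : (h @` D) (h x) by exists x.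
have H1 : nbhs (h x) (h @` D) by exact: open_nbhs_nbhs.
have H2 : nbhs (h x) (k @^-1` U).
  by apply: ck => //; rewrite hk //; exact: open_nbhs_nbhs.
apply: near_setS (near_setI H1 H2) => _ [[z Dz <-] /= Uz]; exists z => //.
by rewrite hk in Uz.
Qed.

Lemma chart_full_open c : open (chart_map c @` chart_dom c).
Proof. by case: c. Qed.

Lemma chart_invK c m : chart_dom c m -> chart_inv c (chart_map c m) = m.
Proof. by case: c => D h k oD ohD ch ck hk /= /hk. Qed.

Lemma chart_cont c m : chart_dom c m -> {for m, continuous (chart_map c)}.
Proof. by case: c => D h k oD ohD ch ck hk /= /ch. Qed.

Lemma chart_inv_cont c y : (chart_map c @` chart_dom c) y -> {for y, continuous (chart_inv c)}.
Proof. by case: c => D h k oD ohD ch ck hk /= /ck. Qed.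

Lemma chart_invKK c y : (chart_map c @` chart_dom c) y ->
  chart_dom c (chart_inv c y) /\ chart_map c (chart_inv c y) = y.
Proof. by move=> [x Dx <-]; rewrite chart_invK. Qed.

Lemma atlas_smooth_chart c : atlas c -> smooth_chart c.
Proof. by case: M c => S A hS sS cov cmp c ac d ad; exact (cmp c d ac ad). Qed.

Lemma atlas_cover m : exists2 c, atlas c & chart_dom c m.
Proof. by case: M m => S A hS sS cov comp m; exact: cov. Qed.

Lemma manifold_hausdorff : hausdorff_space M.
Proof. by case: M. Qed.

Lemma manifold_second_countable : @second_countable M.
Proof. by case: M. Qed.

Lemma smooth_on_chart c U f : smooth_chart c -> open U -> smooth_on U f ->
  smoothE (chart_map c @` (U `&` chart_dom c)) (f \o chart_inv c).
Proof.
move=> sc oU sf; apply: smoothE_local => _ [x [Ux Dx] <-].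
have [d ad Ex] := atlas_cover x; have [tcd _] := sc d ad.
set W := U `&` (chart_dom c `&` chart_dom d).
have oW : open W by apply: openI => //; apply: openI; exact: chart_dom_open.
exists (chart_map c @` (W `&` chart_dom c)); split; first by exists x.
have oW1 := chart_img_open (c := c) oW.
have oW2 := chart_img_open (c := d) oU.
apply: (@smoothE_ext _ _ _ (fun y => (f \o chart_inv d) ((chart_map d \o chart_inv c) y))) => //.
  by move=> _ [z [[Uz [Dz Ez]] _] <-] /=; rewrite !chart_invK.
apply: smoothE_comp (sf d ad) => //.
  by move=> _ [z [[Uz [Dz Ez]] _] <-] /=; rewrite chart_invK //; exists z.
move=> a; apply: smoothE_sub (tcd a) => _ [z [[Uz [Dz Ez]] _] <-].
by exists z.
Qed.

Lemma smooth_on_local U f :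
  (forall x, U x -> exists c V, [/\ smooth_chart c, chart_dom c x, open V, V x &
     smoothE (chart_map c @` (V `&` chart_dom c)) (f \o chart_inv c)]) -> smooth_on U f.
Proof.
move=> H d ad; apply: smoothE_local => _ [x [Ux Ex] <-].
have [c [V [sc Dx oV Vx sf]]] := H x Ux; have [_ tdc] := sc d ad.
set W := V `&` (chart_dom c `&` chart_dom d).
have oW : open W by apply: openI => //; apply: openI; exact: chart_dom_open.
exists (chart_map d @` (W `&` chart_dom d)); split; first by exists x.
have oW1 := chart_img_open (c := d) oW.
have oW2 := chart_img_open (c := c) oV.
apply: (@smoothE_ext _ _ _ (fun y => (f \o chart_inv c) ((chart_map c \o chart_inv d) y))) => //.
  by move=> _ [z [[Uz [Dz Ez]] _] <-] /=; rewrite !chart_invK.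
apply: smoothE_comp sf => //.
  by move=> _ [z [[Uz [Dz Ez]] _] <-] /=; rewrite chart_invK //; exists z.
move=> a; apply: smoothE_sub (tdc a) => _ [z [[Uz [Dz Ez]] _] <-].
by exists z.
Qed.

Lemma smooth_on_sub U V f : V `<=` U -> smooth_on U f -> smooth_on V f.
Proof.
by move=> VU sf c ac; apply: smoothE_sub (sf c ac) => _ [x [/VU Ux Dx] <-]; exists x.
Qed.

Lemma smooth_on_ext U f g : open U -> (forall x, U x -> f x = g x) ->
  smooth_on U f -> smooth_on U g.
Proof.
move=> oU fg sf c ac; apply: smoothE_ext (sf c ac); first exact: chart_img_open.
by move=> _ [x [Ux Dx] <-] /=; rewrite chart_invK ?fg.
Qed.

Lemma smooth_on_glue U f : (forall x, U x -> exists V g, [/\ open V, V x, smooth_on V g &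
  forall y, V y -> f y = g y]) -> smooth_on U f.
Proof.
move=> H; apply: smooth_on_local => x Ux; have [V [g [oV Vx sg fg]]] := H x Ux.
have [c ac Dx] := atlas_cover x; exists c, V; split=> //; first exact: atlas_smooth_chart.
by apply: (@smooth_on_ext V g f) => // y Vy; rewrite fg.
Qed.

Lemma smooth_on_cst U (k : R) : open U -> smooth_on U (fun=> k).
Proof. by move=> oU d ad; apply: smoothE_cst; exact: chart_img_open. Qed.

Lemma smooth_onD U f g : open U -> smooth_on U f -> smooth_on U g -> smooth_on U (f + g).
Proof.
by move=> oU sf sg c ac; apply: smoothED (sf c ac) (sg c ac); exact: chart_img_open.
Qed.

Lemma smooth_onM U f g : open U -> smooth_on U f -> smooth_on U g -> smooth_on U (f * g).
Proof.
by move=> oU sf sg c ac; apply: smoothEM (sf c ac) (sg c ac); exact: chart_img_open.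
Qed.

Lemma smooth_on_pullback c (h : 'rV[R]_n -> R) (W : set 'rV[R]_n) : smooth_chart c ->
  open W -> smoothE W h ->
  smooth_on (chart_dom c `&` chart_map c @^-1` W) (h \o chart_map c).
Proof.
move=> sc oW sh; apply: smooth_on_local => x [Dx Wx].
have oV : open (chart_dom c `&` chart_map c @^-1` W).
  rewrite openE => y [Dy Wy]; apply: filterI; first by apply: open_nbhs_nbhs; split => //; exact: chart_dom_open.
  by apply: (chart_cont Dy); exact: open_nbhs_nbhs.
exists c, (chart_dom c `&` chart_map c @^-1` W); split => //.
apply: (@smoothE_ext _ _ _ h); first exact: chart_img_open.
  by move=> _ [y [[Dy Wy] _] <-] /=; rewrite chart_invK.
by apply: smoothE_sub sh => _ [y [[Dy Wy] _] <-].
Qed.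

Lemma smooth_on_coord c a : smooth_chart c -> smooth_on (chart_dom c) (fun x => chart_map c x 0 a).
Proof.
move=> sc; have := @smooth_on_pullback c (fun y => y 0 a) setT sc openT (smoothE_coord a openT).
by apply: smooth_on_sub => x Dx; split.
Qed.

Lemma smooth_fun_on U (f : C^oo M) : smooth_on U f.
Proof. by apply: (@smooth_on_sub setT) => //; case: f => f /= /smoothP. Qed.

Definition extz U f : M -> R := fun x => if `[< U x >] then f x else 0.

Lemma extzE U f x : U x -> extz U f x = f x.
Proof. by move=> Ux; rewrite /extz asboolT. Qed.

Lemma extz_out U f x : ~ U x -> extz U f x = 0.
Proof. by move=> Ux; rewrite /extz asboolF. Qed.

Lemma smooth_extz U K f : open U -> closed K -> smooth_on U f ->
  (forall x, U x -> ~ K x -> f x = 0) -> K `<=` U -> extz U f \in @smooth R n M.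
Proof.
move=> oU cK sf f0 KU; apply/smoothP; apply: smooth_on_glue => x _.
have [Ux|nUx] := pselect (U x).
  by exists U, f; split => // y Uy; rewrite extzE.
exists (~` K), (fun=> 0); split => //; first exact: closed_openC.
- by move=> /KU.
- by apply: smooth_on_cst; exact: closed_openC.
- move=> y Ky; have [Uy|Uy] := pselect (U y); last by rewrite extz_out.
  by rewrite extzE // f0.
Qed.

(** [b] is a plateau transported by a chart. Its support lies in the image [K] of a compact ball,
    and [K] is closed in [M] because [M] is Hausdorff; this allows extension by zero. *)
Lemma bump_exists U m : open U -> U m -> exists (b : C^oo M) (K : set M),
  [/\ closed K, K `<=` U, (forall x, ~ K x -> b x = 0) & \forall x \near m, b x = 1].
Proof.
move=> oU Um; have [c ac Dm] := atlas_cover m.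
have oW := chart_img_open (c := c) oU.
have Wm : (chart_map c @` (U `&` chart_dom c)) (chart_map c m) by exists m.
have /near_normP[d d0 dP] := open_nbhs_nbhs (conj oW Wm).
(* The plateau of size [e] vanishes from distance [2 * e] on, still inside the ball of radius
   [d]. *)
pose e := d / 3; have e0 : 0 < e by rewrite divr_gt0.
pose B : set 'rV[R]_n := [set y | `|y - chart_map c m| <= 2 * e].
pose K := chart_inv c @` B.
have BW : B `<=` chart_map c @` (U `&` chart_dom c).
  by move=> y By; apply: dP; apply: le_lt_trans By _; rewrite /e; lra.
have BD : B `<=` chart_map c @` chart_dom c by move=> y /BW[x [Ux Dx] <-]; exists x.
have cB : compact B.
  apply: bounded_closed_compact.
    exists (2 * e + `|chart_map c m|); split; first exact: num_real.
    move=> t ht y By; apply: ltW; apply: le_lt_trans ht.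
    by rewrite -[y](subrK (chart_map c m)); apply: le_trans (ler_normD _ _) _; rewrite lerD2r.
  rewrite (_ : B = (fun y => `|y - chart_map c m|) @^-1` [set t : R | t <= 2 * e]) //.
  apply: preimage_closed; last exact: closed_le.
  move=> y _; apply: (@continuous_comp _ _ _ (fun y => y - chart_map c m) (fun y : 'rV[R]_n => `|y|)).
    by apply: continuousB; [exact: cvg_id | exact: cst_continuous].
  exact: norm_continuous.
have cK : closed K.
  apply: compact_closed; first exact: manifold_hausdorff.
  apply: continuous_compact => //; apply: continuous_in_subspaceT => y /set_mem /BD.
  exact: chart_inv_cont.
have KU : K `<=` U by move=> _ [y /BW[x [Ux Dx] <-] <-]; rewrite chart_invK.
have KD : K `<=` chart_dom c by move=> _ [y /BD[x Dx <-] <-]; rewrite chart_invK.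
pose h := fun y : 'rV[R]_n => plateau e (y - chart_map c m).
have sh : smoothE setT h.
  apply: (smoothE_comp (h := fun y => y - chart_map c m) openT openT) => //; last exact: smoothE_plateau.
  move=> a; under eq_fun do rewrite !mxE; apply: smoothED => //; try exact: openT.
    by apply: smoothE_coord; exact: openT.
  by apply: smoothE_cst; exact: openT.
have sb : smooth_on (chart_dom c) (h \o chart_map c).
  by apply: smooth_on_sub (smooth_on_pullback (atlas_smooth_chart ac) openT sh) => x Dx; split.
have b0 x : chart_dom c x -> ~ K x -> (h \o chart_map c) x = 0.
  move=> Dx nK; apply: plateau0 => //; rewrite leNgt; apply/negP => /ltW xe; apply: nK.
  by exists (chart_map c x); rewrite ?chart_invK.
exists (SmoothFun (smooth_extz (chart_dom_open c) cK sb b0 KD)), K; split => //=.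
  move=> x nK; have [Dx|Dx] := pselect (chart_dom c x); last by rewrite extz_out.
  by rewrite extzE // b0.
have H : nbhs (chart_map c m) (fun y => `|y - chart_map c m| < e).
  by apply/near_normP; exists e.
have H1 : nbhs m (fun x => `|chart_map c x - chart_map c m| < e) := chart_cont Dm H.
have H2 : nbhs m (chart_dom c) by apply: open_nbhs_nbhs; split => //; exact: chart_dom_open.
apply: filterS2 H1 H2 => x /= xe Dx; rewrite extzE //=.
by apply: plateau1 => //; exact: ltW.
Qed.

Lemma extension_exists U f m : open U -> U m -> smooth_on U f ->
  exists F : C^oo M, \forall x \near m, F x = f x.
Proof.
move=> oU Um sf; have [b [K [cK KU b0 b1]]] := bump_exists oU Um.
have sbf : smooth_on U ((b : M -> R) * f) by apply: smooth_onM => //; exact: smooth_fun_on.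
have H x : U x -> ~ K x -> ((b : M -> R) * f) x = 0.
  by move=> Ux /b0; rewrite -[(_ * _) x]/(b x * f x) => ->; rewrite mul0r.
exists (SmoothFun (smooth_extz oU cK sbf H KU)) => /=.
apply: filterS2 b1 (open_nbhs_nbhs (conj oU Um)) => x bx Ux.
by rewrite extzE // -[(_ * _) x]/(b x * f x) bx mul1r.
Qed.


(** The hypotheses stand under the quantifier so that choice yields a total function [extend], with
    0 as the value for improper arguments. *)
Lemma extension_ex U f m : exists F : C^oo M, open U -> U m -> smooth_on U f ->
  \forall x \near m, F x = f x.
Proof.
have [[oU Um sf]|H] := pselect [/\ open U, U m & smooth_on U f].
  by have [F HF] := extension_exists oU Um sf; exists F.
by exists 0 => oU Um sf; case: H.
Qed.

Definition extend U f m : C^oo M := projT1 (cid (extension_ex U f m)).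

Lemma extendP U f m : open U -> U m -> smooth_on U f -> \forall x \near m, extend U f m x = f x.
Proof. by rewrite /extend; case: cid. Qed.

Definition chart_pd c a f : M -> R :=
  fun x => 'D_(delta_mx 0 a) (f \o chart_inv c) (chart_map c x).

Lemma smooth_chart_pd c a U f : smooth_chart c -> open U -> smooth_on U f ->
  smooth_on (U `&` chart_dom c) (chart_pd c a f).
Proof.
move=> sc oU sf; apply: smooth_on_local => x [Ux Dx].
have oV : open (U `&` chart_dom c) by apply: openI => //; exact: chart_dom_open.
exists c, (U `&` chart_dom c); split => //.
apply: (@smoothE_ext _ _ _ ('d_a (f \o chart_inv c))); first exact: chart_img_open.
  by move=> _ [y [[Uy Dy] _] <-] /=; rewrite /chart_pd /= chart_invK.
apply: smoothE_d; apply: smoothE_sub (smooth_on_chart sc oU sf).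
by move=> _ [y [[Uy Dy] _] <-]; exists y.
Qed.

Lemma chart_pd_near c a f g m : chart_dom c m -> (\forall x \near m, f x = g x) ->
  \forall x \near m, chart_pd c a f x = chart_pd c a g x.
Proof.
move=> Dm fg; have : nbhs m (fun x => f x = g x) by [].
rewrite nbhsE /= => -[V [oV Vm] VP].
suff : nbhs m (fun x => chart_pd c a f x = chart_pd c a g x) by []; rewrite nbhsE /=.
have oW := chart_img_open (c := c) oV.
exists (V `&` chart_dom c).
  by split; [apply: openI => //; exact: chart_dom_open | split].
move=> x [Vx Dx]; apply: near_eq_derive.
have : nbhs (chart_map c x) (chart_map c @` (V `&` chart_dom c)).
  by apply: open_nbhs_nbhs; split => //; exists x.
apply: near_setS => _ [y [Vy Dy] <-] /=; rewrite chart_invK //; exact: VP.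
Qed.

End manifold_smoothness.

(** * Points and derivations *)

Section truncated_algebra.
Context {R : realType} {r : nat}.
Implicit Types (x y : trunc R r) (P : {poly R}).

Definition ptrunc P : trunc R r := in_qpoly _ P.

Lemma trunc_inK x : x = ptrunc (x : {poly R}).
Proof. exact/val_inj/esym/in_qpoly_small/size_mk_monic. Qed.

Lemma coef_ptrunc P i : (i <= r)%N -> (ptrunc P)`_i = P`_i.
Proof.
by move=> ir; rewrite /= mk_monic_Xn -Pdiv.RingMonic.take_poly_rmodp coef_take_poly ltnS ir.
Qed.

Lemma trunc_size x : (size (x : {poly R}) <= r.+1)%N.
Proof. by rewrite -ltnS; apply: leq_trans (size_mk_monic x) _; rewrite mk_monic_Xn size_polyXn. Qed.

Lemma trunc_coef_out x i : (r < i)%N -> x`_i = 0.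
Proof. by move=> ri; rewrite nth_default // (leq_trans (trunc_size x)). Qed.

Lemma trunc_eq x y : (forall i, (i <= r)%N -> x`_i = y`_i) -> x = y.
Proof.
move=> H; apply: val_inj; apply/polyP => i; have [|ir] := leqP i r; first exact: H.
by rewrite [LHS]trunc_coef_out // [RHS]trunc_coef_out.
Qed.

Lemma trunc_coefM x y i : (i <= r)%N -> (x * y)`_i = ((x : {poly R}) * (y : {poly R}))`_i.
Proof. by move=> ir; rewrite {1}[x]trunc_inK {1}[y]trunc_inK -rmorphM coef_ptrunc. Qed.

Lemma trunc_coefD x y i : (x + y)`_i = x`_i + y`_i.
Proof. by rewrite -coefD. Qed.

Lemma trunc_coefZ k x i : (k *: x)`_i = k * x`_i.
Proof. by rewrite -coefZ. Qed.

Lemma trunc_coef0 i : (0 : trunc R r)`_i = 0.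
Proof. by rewrite coef0. Qed.

Lemma trunc_coef1 i : (1 : trunc R r)`_i = (i == 0%N)%:R.
Proof.
have [ir|ir] := leqP i r; last by rewrite trunc_coef_out //; case: i ir.
by rewrite (_ : 1 = ptrunc 1) ?coef_ptrunc ?coef1 // /ptrunc rmorph1.
Qed.

Lemma trunc_coef_sum I (s : seq I) (F : I -> trunc R r) i :
  (\sum_(j <- s) F j)`_i = \sum_(j <- s) (F j)`_i.
Proof.
elim: s => [|j s IH]; first by rewrite !big_nil trunc_coef0.
by rewrite !big_cons trunc_coefD IH.
Qed.

Lemma trunc_coefXnM x k i : (i <= r)%N ->
  ('qX ^+ k * x)`_i = if (k <= i)%N then x`_(i - k) else 0.
Proof.
move=> ir; rewrite [x in LHS]trunc_inK -rmorphXn -rmorphM coef_ptrunc //.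
by rewrite coefXnM ltnNge; case: leqP.
Qed.

(** Membership in the ideal generated by epsilon^k. *)
Definition trunc_ord k x := forall i, (i < k)%N -> x`_i = 0.

Lemma trunc_ordM k l x y : trunc_ord k x -> trunc_ord l y -> trunc_ord (k + l) (x * y).
Proof.
move=> xk yl i ikl; have [ir|/trunc_coef_out -> //] := leqP i r.
rewrite trunc_coefM // coefM big1 // => -[j /= ji] _.
have [jk|kj] := ltnP j k; first by rewrite xk // mul0r.
by rewrite yl ?mulr0 // ltn_subLR // (leq_trans ikl) // leq_add2r.
Qed.

Lemma trunc_ord_sum k I (s : seq I) (F : I -> trunc R r) :
  (forall i, trunc_ord k (F i)) -> trunc_ord k (\sum_(i <- s) F i).
Proof. by move=> H i ik; rewrite trunc_coef_sum big1 // => j _; exact: H. Qed.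

Lemma trunc_ordW k l x : (l <= k)%N -> trunc_ord k x -> trunc_ord l x.
Proof. by move=> lk H i il; apply: H; exact: leq_trans lk. Qed.

Lemma trunc_ord0 x : trunc_ord 0 x. Proof. by []. Qed.

Lemma trunc_ordX k x s : trunc_ord k x -> trunc_ord (s * k) (x ^+ s).
Proof. by move=> H; elim: s => [|s IH] //; rewrite exprS mulSn; exact: trunc_ordM. Qed.

Lemma trunc_ord_prod I (s : seq I) (k : I -> nat) (F : I -> trunc R r) :
  (forall i, trunc_ord (k i) (F i)) -> trunc_ord (\sum_(i <- s) k i) (\prod_(i <- s) F i).
Proof.
by move=> H; elim: s => [|i s IH]; rewrite ?big_nil // !big_cons; exact: trunc_ordM.
Qed.

(** Solve for the coefficients of [y] one by one. With [x] the image of a bump function that kills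
    [f], this shows that morphisms and derivations depend on germs only. *)
Lemma trunc_unit x y : x`_0 = 1 -> x * y = 0 -> y = 0.
Proof.
move=> x0 xy; apply: trunc_eq => i; rewrite trunc_coef0.
elim/ltn_ind: i => i IH ir.
have : (x * y)`_i = 0 by rewrite xy trunc_coef0.
rewrite trunc_coefM // coefM big_ord_recl /= x0 mul1r subn0 big1 ?addr0 // => -[j /= ji] _.
by rewrite IH ?mulr0 // /bump /= ?add1n; lia.
Qed.

End truncated_algebra.

Section points_and_derivations.
Context {R : realType} {n : nat} {M : manifold R n} {r : nat}.
Implicit Types (u D : C^oo M -> trunc R r) (f g : C^oo M) (m : M) (c : chart R n M).

Lemma smooth_funM f g m : (f * g) m = f m * g m.
Proof. by []. Qed.

Lemma smooth_funD f g m : (f + g) m = f m + g m.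
Proof. by []. Qed.

Lemma smooth_funB f g m : (f - g) m = f m - g m.
Proof. by []. Qed.

Lemma smooth_funZ (k : R) f m : (k *: f) m = k * f m.
Proof. by []. Qed.

Lemma smooth_fun1E m : (1 : C^oo M) m = 1.
Proof. by []. Qed.

Lemma smooth_fun_sum I (s : seq I) (F : I -> C^oo M) m : (\sum_(i <- s) F i) m = \sum_(i <- s) F i m.
Proof. by elim: s => [|i s IH]; rewrite ?big_nil // !big_cons -IH. Qed.

Lemma smooth_fun_prod I (s : seq I) (F : I -> C^oo M) m : (\prod_(i <- s) F i) m = \prod_(i <- s) F i m.
Proof. by elim: s => [|i s IH]; rewrite ?big_nil // !big_cons -IH. Qed.

Lemma smooth_fun_ext f g : (forall m, f m = g m) -> f = g.
Proof. by move=> H; apply: val_inj; apply/funext. Qed.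

Definition cstf (k : R) : C^oo M := k *: (1 : C^oo M).

Lemma cstfE k m : cstf k m = k.
Proof. by rewrite smooth_funZ smooth_fun1E mulr1. Qed.

Lemma linear_props u : linear u -> [/\ (forall f g, u (f + g) = u f + u g),
  (forall k f, u (k *: f) = k *: u f), (forall f g, u (f - g) = u f - u g) & u 0 = 0].
Proof.
move=> lu.
have u0 : u 0 = 0 by have := lu (-1) 0 0; rewrite scaler0 addr0 scaleN1r addNr.
have uD f g : u (f + g) = u f + u g by have := lu 1 f g; rewrite !scale1r.
split=> // [k f|f g]; first by have := lu k f 0; rewrite !addr0 u0 addr0.
by apply/eqP; rewrite eq_sym subr_eq -uD subrK.
Qed.

Lemma tangent_1 u D : TrM u -> tangent_TrM u D -> D 1 = 0.
Proof.
move=> [_ [u1 _]] [_ DM]; have := DM 1 1; rewrite !u1 !mulr1 mul1r => /eqP.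
by rewrite -[X in X == _]addr0 (inj_eq (addrI _)) eq_sym => /eqP.
Qed.

Lemma near_open (P : M -> Prop) m : (\forall x \near m, P x) ->
  exists U, [/\ open U, U m & forall x, U x -> P x].
Proof.
move=> H; have : nbhs m P by []; rewrite nbhsE => -[U [oU Um] UP].
by exists U.
Qed.

Lemma germ_kill f m : (\forall x \near m, f x = 0) -> exists b : C^oo M, b m = 1 /\ b * f = 0.
Proof.
move=> /near_open[U [oU Um Uf]]; have [b [K [cK KU b0 b1]]] := bump_exists oU Um.
exists b; split; first exact: nbhs_singleton b1.
apply: smooth_fun_ext => x; rewrite smooth_funM.
have [/KU/Uf ->|/b0 ->] := pselect (K x); [exact: mulr0 | exact: mul0r].
Qed.

Lemma TrM_germ u m f g : TrM u -> base_point u m -> (\forall x \near m, f x = g x) -> u f = u g.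
Proof.
move=> tu bu fg; have [lu [u1 uM]] := tu; have [uD uZ uB u0] := linear_props lu.
have [|b [bm bfg]] := @germ_kill (f - g) m.
  by apply: filterS fg => x E; rewrite smooth_funB E subrr.
have H : u (f - g) = 0.
  apply: (@trunc_unit _ _ (u b)); first by have := bu b; rewrite /jet_lift bm.
  by rewrite -uM bfg.
by apply/eqP; rewrite -subr_eq0 -uB H.
Qed.

Lemma tangent_germ u D m f g : TrM u -> base_point u m -> tangent_TrM u D ->
  (\forall x \near m, f x = g x) -> D f = D g.
Proof.
move=> tu bu tD fg; have [lu [u1 uM]] := tu; have [uD uZ uB u0] := linear_props lu.
have [lD DM] := tD; have [DD DZ DB D0] := linear_props lD.
have fg0 : \forall x \near m, (f - g) x = (0 : C^oo M) x.
  by apply: filterS fg => x E; rewrite smooth_funB E subrr.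
have [b [bm bfg]] := germ_kill fg0.
have H : D (f - g) = 0.
  apply: (@trunc_unit _ _ (u b)); first by have := bu b; rewrite /jet_lift bm.
  have := DM b (f - g); rewrite bfg (TrM_germ tu bu fg0).
  by rewrite D0 u0 mulr0 add0r => /esym.
by apply/eqP; rewrite -subr_eq0 -DB H.
Qed.

Lemma hadamard_manifold c f m : smooth_chart c -> chart_dom c m -> exists h : 'I_n -> C^oo M,
  \forall x \near m, f x = f m + \sum_a (chart_map c x 0 a - chart_map c m 0 a) * h a x.
Proof.
move=> sc Dm.
have Wm : (chart_map c @` chart_dom c) (chart_map c m) by exists m.
have /near_normP[e e0 eP] := open_nbhs_nbhs (conj (@chart_full_open _ _ _ c) Wm).
pose U0 : set 'rV[R]_n := [set y | `|y| < e].
have oU0 : open U0.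
  rewrite (_ : U0 = ball (0 : 'rV[R]_n) e); first exact: ball_open.
  by apply/funext => z; rewrite -ball_normE /ball_ /= sub0r normrN.
have sclE t y : scl predT t y = t *: y by apply/rowP => a; rewrite !mxE.
have sU0 : star predT U0.
  move=> y t Uy /andP[t0 t1]; rewrite /U0 /= sclE normrZ ger0_norm //.
  by apply: le_lt_trans Uy; rewrite ler_piMl.
pose phi y := f (chart_inv c (y + chart_map c m)).
have sphi : smoothE U0 phi.
  have sf := smooth_on_chart sc openT (@smooth_fun_on _ _ _ setT f).
  apply: (smoothE_comp (h := fun y => y + chart_map c m) oU0 (chart_img_open (c := c) openT)) sf.
    by move=> y Uy; rewrite setTI; apply: eP; rewrite addrK.
  move=> a; under eq_fun do rewrite mxE; apply: smoothED => //; [exact: smoothE_coord | exact: smoothE_cst].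
pose V := chart_dom c `&` chart_map c @^-1` [set y | `|y - chart_map c m| < e].
have oV0 : open [set y | `|y - chart_map c m| < e].
  rewrite (_ : [set y | _] = ball (chart_map c m) e); first exact: ball_open.
  by apply/funext => z; rewrite -ball_normE /ball_ /= distrC.
pose h a y := hint 0 predT ('d_a phi) (y - chart_map c m).
have sh a : smoothE [set y | `|y - chart_map c m| < e] (h a).
  apply: (smoothE_comp (h := fun y => y - chart_map c m) oV0 oU0) => //.
    move=> b; apply: (@smoothE_ext _ _ _ (fun y : 'rV[R]_n => y 0 b - chart_map c m 0 b)) => //.
      by move=> y _; rewrite !mxE.
    by apply: smoothEB => //; [exact: smoothE_coord | exact: smoothE_cst].
  by apply: hint_smooth => //; exact: smoothE_d.
have sH a : smooth_on V (h a \o chart_map c) by exact: smooth_on_pullback.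
have Vm : V m by split => //=; rewrite subrr normr0.
have oV : open V.
  rewrite openE => x [Dx Wx]; apply: filterI; first by apply: open_nbhs_nbhs; split => //; exact: chart_dom_open.
  by apply: (chart_cont Dx); exact: open_nbhs_nbhs.
exists (fun a => extend V (h a \o chart_map c) m).
have H : \forall x \near m, forall a, extend V (h a \o chart_map c) m x = h a (chart_map c x).
  by apply: filter_forall => a; exact: extendP.
apply: filterS2 H (open_nbhs_nbhs (conj oV Vm)) => x Hx [Dx Vx].
have := @hadamard R n predT U0 phi (chart_map c x - chart_map c m) oU0 sU0 sphi Vx.
rewrite /phi subrK chart_invK // sclE scale0r add0r chart_invK // => ->; congr (_ + _).
by apply: eq_bigr => a _; rewrite !mxE Hx.
Qed.

(* Elements of C^oo M with the germs at [m] of x_a and of the derivative of f by x_a *)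
Definition Xc c m a : C^oo M := extend (chart_dom c) (fun x => chart_map c x 0 a) m.
Definition pdx c m (f : M -> R) a : C^oo M := extend (chart_dom c) (chart_pd c a f) m.

Lemma XcP c m a : smooth_chart c -> chart_dom c m -> \forall x \near m, Xc c m a x = chart_map c x 0 a.
Proof. by move=> sc Dm; apply: extendP => //; [exact: chart_dom_open | exact: smooth_on_coord]. Qed.

Lemma pdxP c m (f : C^oo M) a : smooth_chart c -> chart_dom c m ->
  \forall x \near m, pdx c m f a x = chart_pd c a f x.
Proof.
move=> sc Dm; apply: extendP => //; first exact: chart_dom_open.
by rewrite -[chart_dom c]setTI; apply: smooth_chart_pd => //; [exact: openT | exact: smooth_fun_on].
Qed.

Lemma chart_derivable c a f x : smooth_chart c -> chart_dom c x ->
  derivable (f \o chart_inv c) (chart_map c x) (delta_mx 0 a).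
Proof.
move=> sc Dx; have oW := chart_img_open (c := c) (openT (T := M)).
by apply: (smoothE_derivable oW (smooth_on_chart sc openT (@smooth_fun_on _ _ _ setT f))); exists x.
Qed.

Lemma chart_pdD c a f g x : smooth_chart c -> chart_dom c x ->
  chart_pd c a (f + g) x = chart_pd c a f x + chart_pd c a g x.
Proof.
by move=> sc Dx; rewrite -[RHS]deriveD //; exact: chart_derivable.
Qed.

Lemma chart_pdM c a f g x : smooth_chart c -> chart_dom c x ->
  chart_pd c a (f * g) x = chart_pd c a f x * g x + f x * chart_pd c a g x.
Proof.
move=> sc Dx; have := derive_mul (chart_derivable (a := a) (f := f) sc Dx) (chart_derivable (a := a) (f := g) sc Dx).
by rewrite /= !chart_invK.
Qed.

Lemma chart_pd_cst c a (k : R) x : chart_pd c a (fun=> k) x = 0.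
Proof. exact: derive_cst. Qed.

Lemma chart_pd_coord c a b x : chart_dom c x ->
  chart_pd c a (fun x => chart_map c x 0 b) x = (a == b)%:R.
Proof.
move=> Dx; have -> : chart_pd c a (fun x => chart_map c x 0 b) x =
    'D_(delta_mx 0 a) (fun y : 'rV[R]_n => y 0 b) (chart_map c x).
  apply: near_eq_derive.
  have : nbhs (chart_map c x) (chart_map c @` chart_dom c).
    by apply: open_nbhs_nbhs; split; [exact: chart_full_open | exists x].
  by apply: near_setS => _ [y Dy <-] /=; rewrite chart_invK.
by rewrite (is_derive_eqE (derive_coord _ _ _)) mxE eqxx eq_sym.
Qed.

Lemma near_dom c m : chart_dom c m -> \forall x \near m, chart_dom c x.
Proof. by move=> Dm; apply: open_nbhs_nbhs; split => //; exact: chart_dom_open. Qed.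

(** The difference [E] of the two sides is a derivation along [u] that kills constants and
    coordinates. Hadamard's lemma writes [f] as a constant plus a sum of products (x_a - x_a(m))
    h_a, so [E f] is a sum of terms u(x_a - x_a(m)) E(h_a). The first factor has no constant term,
    so the order of [E f] exceeds every [k]. *)
Lemma derivation_coords u m c D f : TrM u -> base_point u m -> smooth_chart c -> chart_dom c m ->
  tangent_TrM u D -> D f = \sum_a D (Xc c m a) * u (pdx c m f a).
Proof.
move=> tu bu sc Dm tD; have [lu [u1 uM]] := tu; have [uD uZ uB u0] := linear_props lu.
have [lD DM] := tD; have [DD DZ DB D0] := linear_props lD.
have D1 := tangent_1 tu tD.
pose E f := D f - \sum_a D (Xc c m a) * u (pdx c m f a).
suff H k : forall f, trunc_ord k (E f).
  apply/eqP; rewrite -subr_eq0; apply/eqP; apply: trunc_eq => i ir.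
  by rewrite (H r.+1) // trunc_coef0.
have E_germ f1 f2 : (\forall x \near m, f1 x = f2 x) -> E f1 = E f2.
  move=> f12; rewrite /E (tangent_germ tu bu tD f12); congr (_ - _); apply: eq_bigr => a _.
  congr (_ * _); apply: (TrM_germ tu bu).
  apply: filterS3 (pdxP f1 a sc Dm) (pdxP f2 a sc Dm) (chart_pd_near a Dm f12) => x.
  by move=> -> -> ->.
have ED f1 f2 : E (f1 + f2) = E f1 + E f2.
  rewrite /E DD.
  have -> : \sum_a D (Xc c m a) * u (pdx c m (f1 + f2)%R a) =
      \sum_a D (Xc c m a) * u (pdx c m f1 a) + \sum_a D (Xc c m a) * u (pdx c m f2 a).
    rewrite -big_split /=; apply: eq_bigr => a _; rewrite -mulrDr -uD; congr (_ * _).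
    apply: (TrM_germ tu bu).
    apply: filterS2 (filterI (pdxP f1 a sc Dm) (pdxP f2 a sc Dm)) (filterI (pdxP (f1 + f2) a sc Dm) (near_dom Dm)) => x.
    by move=> [E1 E2] [E3 Dx]; rewrite smooth_funD E1 E2 E3 chart_pdD.
  by ring.
have EM f1 f2 : E (f1 * f2) = E f1 * u f2 + u f1 * E f2.
  rewrite /E DM.
  have -> : \sum_a D (Xc c m a) * u (pdx c m (f1 * f2)%R a) =
      (\sum_a D (Xc c m a) * u (pdx c m f1 a)) * u f2 +
      u f1 * (\sum_a D (Xc c m a) * u (pdx c m f2 a)).
    rewrite mulr_suml mulr_sumr -big_split /=; apply: eq_bigr => a _.
    rewrite -mulrA [u f1 * _]mulrCA -mulrDr -!uM -uD; congr (_ * _).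
    apply: (TrM_germ tu bu).
    apply: filterS2 (filterI (pdxP f1 a sc Dm) (pdxP f2 a sc Dm)) (filterI (pdxP (f1 * f2) a sc Dm) (near_dom Dm)) => x.
    by move=> [E1 E2] [E3 Dx]; rewrite smooth_funD !smooth_funM E1 E2 E3 chart_pdM.
  by ring.
have uk k' f1 : (\forall x \near m, f1 x = k') -> u f1 = k' *: 1.
  move=> H; rewrite -u1 -uZ; apply: (TrM_germ tu bu); apply: filterS H => x ->.
  by rewrite smooth_funZ smooth_fun1E mulr1.
have Ek k' : E (cstf k') = 0.
  rewrite /E {1}/cstf DZ D1 scaler0 big1 ?subr0 // => a _; rewrite (uk 0) ?scale0r ?mulr0 //.
  have H : \forall x \near m, cstf k' x = (fun=> k') x.
    by near=> x; rewrite cstfE.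
  apply: filterS2 (pdxP (cstf k') a sc Dm) (chart_pd_near a Dm H) => x -> ->.
  exact: chart_pd_cst.
have EX b : E (Xc c m b) = 0.
  rewrite /E (bigD1 b) //= big1 ?addr0 => [|a ab].
    rewrite (uk 1) ?scale1r ?mulr1 ?subrr //.
    apply: filterS3 (pdxP (Xc c m b) b sc Dm) (chart_pd_near b Dm (XcP b sc Dm)) (near_dom Dm) => x.
    by move=> -> -> Dx; rewrite chart_pd_coord // eqxx.
  rewrite (uk 0) ?scale0r ?mulr0 //.
  apply: filterS3 (pdxP (Xc c m b) a sc Dm) (chart_pd_near a Dm (XcP b sc Dm)) (near_dom Dm) => x.
  by move=> -> -> Dx; rewrite chart_pd_coord // (negbTE ab).
have Esum I (s : seq I) (F : I -> C^oo M) : E (\sum_(i <- s) F i) = \sum_(i <- s) E (F i).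
  elim: s => [|i s IH]; last by rewrite !big_cons ED IH.
  by rewrite !big_nil; have := Ek 0; rewrite /cstf scale0r.
elim: k => [|k IH] f0; first exact: trunc_ord0.
have [h Hh] := hadamard_manifold f0 sc Dm.
pose Y a : C^oo M := Xc c m a + cstf (- chart_map c m 0 a).
rewrite (E_germ _ (cstf (f0 m) + \sum_a Y a * h a)).
  rewrite ED Ek add0r Esum; apply: trunc_ord_sum => a.
  rewrite EM ED EX Ek addr0 mul0r add0r -add1n; apply: trunc_ordM => //.
  case=> // _; have := bu (Y a); rewrite /jet_lift => ->.
  rewrite smooth_funD cstfE (nbhs_singleton (XcP a sc Dm)).
  exact: subrr.
have HX : \forall x \near m, forall a, Xc c m a x = chart_map c x 0 a.
  by apply: filter_forall => a; exact: XcP.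
apply: filterS2 Hh HX => x -> EXx.
rewrite smooth_funD cstfE smooth_fun_sum; congr (_ + _).
apply: eq_bigr => a _; rewrite smooth_funM smooth_funD cstfE EXx.
by [].
Unshelve. all: by end_near. Qed.


Definition coords c m u : 'M[R]_(r.+1, n) := \matrix_(j, a) (u (Xc c m a))`_j.

Lemma jbase_coords c m u : base_point u m -> smooth_chart c -> chart_dom c m ->
  jbase (coords c m u) = chart_map c m.
Proof.
move=> bu sc Dm; apply/rowP => a; rewrite !mxE.
by have := bu (Xc c m a); rewrite /jet_lift /= => ->; exact: nbhs_singleton (XcP a sc Dm).
Qed.

Lemma jet_near c m (f g : M -> R) (p : 'M[R]_(r.+1, n)) : chart_dom c m -> jbase p = chart_map c m ->
  (\forall x \near m, f x = g x) -> jet (f \o chart_inv c) p = jet (g \o chart_inv c) p.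
Proof.
move=> Dm pm /near_open[U [oU Um Ufg]].
apply: (jet_ext (chart_img_open (c := c) oU)); first by rewrite pm; exists m.
by move=> _ [x [Ux Dx] <-] /=; rewrite chart_invK // Ufg.
Qed.

Lemma smooth_chart_comp c (f : C^oo M) : smooth_chart c ->
  smoothE (chart_map c @` chart_dom c) (f \o chart_inv c).
Proof.
move=> sc; have := smooth_on_chart sc openT (@smooth_fun_on _ _ _ setT f).
by rewrite setTI.
Qed.

Definition trunc_Eul (x : trunc R r) : trunc R r := ptrunc (Eul (x : {poly R})).

Lemma coef_trunc_Eul x i : (i <= r)%N -> (trunc_Eul x)`_i = i%:R * x`_i.
Proof. by move=> ir; rewrite coef_ptrunc // coef_Eul. Qed.

(** This is the velocity at [t = 1] of the curve [kappa t u]. *)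
Lemma Eul_tangent u : TrM u -> tangent_TrM u (fun f => trunc_Eul (u f)).
Proof.
move=> [lu [u1 uM]]; split=> [k f g|f g]; apply: trunc_eq => i ir.
  rewrite coef_trunc_Eul // lu !trunc_coefD !trunc_coefZ !coef_trunc_Eul //; ring.
rewrite trunc_coefD !trunc_coefM // coef_trunc_Eul // uM trunc_coefM // -coef_Eul EulM coefD.
have H x y : ((Eul (x : trunc R r) : {poly R}) * y)`_i = ((trunc_Eul x : {poly R}) * y)`_i.
  apply: (_ : eqX r _ _) ir; apply: eqXM => // j jr.
  by rewrite coef_ptrunc.
by rewrite H; congr (_ + _); rewrite mulrC H mulrC.
Qed.

(** Applied to the Euler derivation, [derivation_coords] is the equation that defines jets, so [u f]
    and the jet agree by induction on the order. *)
Lemma TrM_jet u m c f : TrM u -> base_point u m -> smooth_chart c -> chart_dom c m ->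
  forall i, (i <= r)%N -> (u f)`_i = (jet (f \o chart_inv c) (coords c m u))`_i.
Proof.
move=> tu bu sc Dm; set p := coords c m u.
have pm : jbase p = chart_map c m by exact: jbase_coords.
have jc a : eqX r (jcoord p a) (u (Xc c m a)).
  by move=> i ir; rewrite coef_poly ltnS ir mxE inordK.
suff H k : (k <= r)%N -> forall f, eqX k (u f) (jet (f \o chart_inv c) p) by exact: H.
elim: k {f} => [|k IH] kr f.
  case=> // _; rewrite jet0 pm /= chart_invK //; exact: bu.
apply: Eul_eqX.
  by rewrite jet0 pm /= chart_invK //; exact: bu.
apply: eqX_trans _ (eqX_sym (eqXW kr (jet_Eul _ _))).
have E := derivation_coords f tu bu sc Dm (Eul_tangent tu).
have E1 : eqX k.+1 (Eul (u f)) (\sum_a (trunc_Eul (u (Xc c m a)) : {poly R}) * (u (pdx c m f a) : {poly R})).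
  move=> i ik; have ir := leq_trans ik kr.
  have -> : (Eul (u f))`_i = (trunc_Eul (u f))`_i by rewrite coef_ptrunc.
  rewrite E trunc_coef_sum coef_sum; apply: eq_bigr => a _.
  by rewrite trunc_coefM.
apply: eqX_trans E1 _; apply: eqX_sum => a; apply: eqXM_gain.
- by rewrite coef_ptrunc // Eul0.
- move=> i ik; have ir := leq_trans ik kr; rewrite coef_ptrunc // !coef_Eul.
  by rewrite -(jc a i ir).
- have -> : jet ('d_a (f \o chart_inv c)) p = jet (pdx c m f a \o chart_inv c) p.
    rewrite (jet_near Dm pm (pdxP f a sc Dm)).
    have oW := @chart_full_open _ _ _ c.
    apply: (jet_ext oW); first by rewrite pm; exists m.
    by move=> _ [x Dx <-] /=; rewrite /chart_pd chart_invK.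
  by apply: IH; exact: ltnW.
Qed.

(* The point of T_r M with coordinates [p] in the chart [c] *)
Definition Tp c (p : 'M[R]_(r.+1, n)) : C^oo M -> trunc R r :=
  fun f => ptrunc (jet (f \o chart_inv c) p).

Lemma TrM_Tp u m c : TrM u -> base_point u m -> smooth_chart c -> chart_dom c m ->
  u = Tp c (coords c m u).
Proof.
move=> tu bu sc Dm; apply/funext => f; apply: trunc_eq => i ir.
by rewrite coef_ptrunc // (TrM_jet f tu bu sc Dm).
Qed.

Lemma Tp_TrM c p : smooth_chart c -> (chart_map c @` chart_dom c) (jbase p) -> TrM (Tp c p).
Proof.
move=> sc Wp; have oW := @chart_full_open _ _ _ c; split=> [k f g|].
  apply: trunc_eq => i ir; rewrite trunc_coefD trunc_coefZ !coef_ptrunc //.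
  rewrite -coefZ -coefD -(jet_lin k oW) //; exact: smooth_chart_comp.
split=> [|f g]; apply: trunc_eq => i ir; rewrite ?trunc_coefM // coef_ptrunc //.
  rewrite trunc_coef1 (_ : _ \o _ = fun=> 1) // jet_cst coefC.
  by case: i ir.
have sf := smooth_chart_comp f sc; have sg := smooth_chart_comp g sc.
rewrite (jetM oW Wp sf sg ir).
apply: (_ : eqX r _ _) ir; apply: eqXM => j jr; by rewrite coef_ptrunc.
Qed.

Lemma Tp_base c p : smooth_chart c -> (chart_map c @` chart_dom c) (jbase p) ->
  base_point (Tp c p) (chart_inv c (jbase p)).
Proof. by move=> sc Wp f; rewrite /jet_lift coef_ptrunc // jet0. Qed.

Lemma Tp_coord c p m (X : C^oo M) a : smooth_chart c -> chart_dom c m -> jbase p = chart_map c m ->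
  (\forall x \near m, X x = chart_map c x 0 a) ->
  forall i, (i <= r)%N -> (Tp c p X)`_i = (jcoord p a)`_i.
Proof.
move=> sc Dm pm HX i ir; rewrite coef_ptrunc // (jet_near Dm pm HX).
have -> // : jet ((fun x => chart_map c x 0 a) \o chart_inv c) p = jcoord p a.
rewrite -jet_coord; apply: (jet_ext (@chart_full_open _ _ _ c)).
  by rewrite pm; exists m.
by move=> _ [x Dx <-] /=; rewrite chart_invK.
Qed.

Lemma coords_Tp c p m : smooth_chart c -> chart_dom c m -> jbase p = chart_map c m ->
  coords c m (Tp c p) = p.
Proof.
move=> sc Dm pm; apply/matrixP => j a; have jr : (j <= r)%N by rewrite -ltnS ltn_ord.
by rewrite mxE (Tp_coord sc Dm pm (XcP a sc Dm)) // coef_jcoord.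
Qed.

Lemma base_unique u m m' : base_point u m -> base_point u m' -> m = m'.
Proof.
move=> bu bu'; apply: contrapT => mm'.
have /hausdorff_accessible/accessible_closed_set1 cm := @manifold_hausdorff _ _ M.
have oU : open (~` [set m']) by exact: closed_openC.
have [b [K [cK KU b0 b1]]] := bump_exists oU (mm' : (~` [set m']) m).
have := bu b; rewrite bu' (nbhs_singleton b1) b0; last by move=> /KU; apply.
by move/eqP; rewrite eq_sym oner_eq0.
Qed.

Lemma jet_coordinatesP c u p : TrM u -> smooth_chart c ->
  jet_coordinates c u p <-> exists m, [/\ base_point u m, chart_dom c m & p = coords c m u].
Proof.
move=> tu sc; split=> [[m [bu Dm H]]|[m [bu Dm ->]]]; exists m; split => //.
  by apply/matrixP => i a; rewrite mxE; exact: H (XcP a sc Dm) i.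
move=> a f fc i; rewrite mxE /jet_lift.
have -> // : u (Xc c m a) = u f; apply: (TrM_germ tu bu).
by apply: filterS2 fc (XcP a sc Dm) => x -> ->.
Qed.

Lemma coords_kappa c m t u : coords c m (kappa t u) = jkappa t (coords c m u).
Proof.
by apply/matrixP => j a; rewrite !mxE; have := kappaE t u (Xc c m a) j.
Qed.

Lemma kappa_base t u m : base_point u m -> base_point (kappa t u) m.
Proof. by move=> bu f; rewrite kappaE expr0 mul1r; exact: bu. Qed.

Lemma zero_jet_base m : base_point (@zero_jet _ _ M r m) m.
Proof. by move=> f; rewrite /jet_lift /zero_jet /= coefC. Qed.

End points_and_derivations.

(** * Characters of the algebra of smooth functions *)

Section evaluation_characters.
Context {R : realType} {n : nat} {M : manifold R n}.
Implicit Types (f g : C^oo M) (m : M).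

Lemma smooth_fun_comp1 (rho : R -> R) f : smooth1 rho -> exists g, forall m, g m = rho (f m).
Proof.
move=> srho.
have H : (fun m => rho (f m)) \in @smooth R n M.
  apply/smoothP => c ac.
  exact: (smooth1_comp (chart_img_open (c := c) openT) srho (@smooth_fun_on _ _ _ setT f c ac)).
by exists (SmoothFun H).
Qed.

Lemma smooth_fun_inv f : (forall m, f m != 0) -> exists g, forall m, g m = (f m)^-1.
Proof.
move=> f0.
have H : (fun m => (f m)^-1) \in @smooth R n M.
  apply/smoothP => c ac.
  apply: (smoothE_inv (chart_img_open (c := c) openT) _ (@smooth_fun_on _ _ _ setT f c ac)).
  by move=> y _; exact: f0.
by exists (SmoothFun H).
Qed.

Lemma smooth_cont f m : {for m, continuous (f : M -> R)}.
Proof.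
have [c ac Dm] := atlas_cover m.
have sf := @smooth_fun_on _ _ _ setT f c ac.
have cf : {for chart_map c m, continuous (f \o chart_inv c)}.
  by apply: smoothE_cont sf _; exists m.
have H : {for m, continuous ((f \o chart_inv c) \o chart_map c)}.
  by apply: continuous_comp => //; exact: chart_cont.
apply/continuous_normP => e e0.
have := (continuous_normP _ _).1 H e e0 => H2.
have nD : nbhs m (chart_dom c) by apply: open_nbhs_nbhs; split => //; exact: chart_dom_open.
by apply: filterS2 H2 nD => x /= + Dx; rewrite !chart_invK.
Qed.

Lemma open_pos f : open [set m | 0 < f m].
Proof.
rewrite openE => m /= fm.
have e0 : 0 < f m / 2 by rewrite divr_gt0.
have := (continuous_normP _ _).1 (@smooth_cont f m) _ e0.
by apply: filterS => y /=; rewrite ler_norml => /andP[_ H]; lra.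
Qed.

(** The cover is indexed by the codes of those basic open sets that lie in some [U m']; integers
    that are not such codes get [None]. *)
Lemma countable_subcover (U : M -> set M) : (forall m, open (U m)) -> (forall m, U m m) ->
  exists s : nat -> option M, forall m, exists k m', s k = Some m' /\ U m' m.
Proof.
move=> oU Um; have [B cB [oB HB]] := @manifold_second_countable _ _ M.
have /countable_injP[g gI] := cB.
pose P k m' := exists b, [/\ B b, g b = k & b `<=` U m'].
exists (fun k => if pselect (exists m', P k m') is left H then Some (projT1 (cid H)) else None) => m.
have [b [Bb bm] bU] := HB m (U m) (open_nbhs_nbhs (conj (oU m) (Um m))).
exists (g b); case: pselect => [H|[]]; last by exists m, b.
exists (projT1 (cid H)); split => //; case: (cid H) => m' /= [b' [Bb' gb' b'U]].
by apply: b'U; rewrite (gI b' b _ _ gb') ?inE.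
Qed.

Section locally_finite_sum.
Variable psi : nat -> C^oo M.
Hypothesis lf : forall m, exists K, \forall x \near m, forall k, (K <= k)%N -> psi k x = 0.

Let N m := projT1 (cid (lf m)).

Let NP m : \forall x \near m, forall k, (N m <= k)%N -> psi k x = 0.
Proof. by rewrite /N; case: cid. Qed.

Definition lfsum (a : nat -> R) (m : M) : R := \sum_(k < N m) a k * psi k m.

(** The chosen bound [N m] may jump with [m], but every bound valid at [m] gives the same value, so
    one finite sum serves on a whole neighbourhood. *)
Lemma lfsumE a K m : (forall k, (K <= k)%N -> psi k m = 0) -> lfsum a m = \sum_(k < K) a k * psi k m.
Proof.
move=> HK; have HN := nbhs_singleton (NP m).
rewrite /lfsum; wlog NK : / (N m <= K)%N.
  move=> W; have [NK|/ltnW KN] := leqP (N m) K; first exact: W.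
  rewrite -!(big_mkord xpredT (fun k => a k * psi k m)) (@big_cat_nat _ _ _ K 0 (N m) _ _ (leq0n _) KN) //=.
  rewrite [X in _ + X]big_nat [X in _ + X]big1 ?addr0 // => k /andP[Kk _].
  by rewrite HK // mulr0.
rewrite -!(big_mkord xpredT (fun k => a k * psi k m)) [RHS](@big_cat_nat _ _ _ (N m) 0 K _ _ (leq0n _) NK) //=.
rewrite [X in _ = _ + X]big_nat [X in _ = _ + X]big1 ?addr0 // => k /andP[Kk _].
by rewrite HN // mulr0.
Qed.

Lemma lfsum_smooth a : exists F : C^oo M, forall m, F m = lfsum a m.
Proof.
have H : lfsum a \in @smooth R n M.
  apply/smoothP; apply: smooth_on_glue => m _.
  have [V [oV Vm VP]] := near_open (NP m).
  exists V, (\sum_(k < N m) a k *: psi k : C^oo M); split => //; first exact: smooth_fun_on.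
  move=> y Vy; rewrite (lfsumE a (VP y Vy)) smooth_fun_sum.
  by apply: eq_bigr => k _; rewrite smooth_funZ.
by exists (SmoothFun H).
Qed.

End locally_finite_sum.

(* Otherwise every point has a neighbourhood on which some nonnegative element of
   the kernel is positive. From a countable cover by such neighbourhoods, one
   obtains a locally finite family psi_k of nonnegative elements of the kernel with
   positive sum. Put f = (\sum_k k psi_k) / (\sum_k psi_k): where psi_0, ..., psi_(K-1)
   vanish, f is at least K. Hence (f - chi f)^2 + \sum_(k < K) psi_k is a unit in the
   kernel if K > chi f. *)
Lemma character_eval (chi : C^oo M -> R) : (forall f g, chi (f + g) = chi f + chi g) ->
  (forall k f, chi (k *: f) = k * chi f) -> (forall f g, chi (f * g) = chi f * chi g) ->
  chi 1 = 1 -> exists m, forall f, chi f = f m.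
Proof.
move=> chiD chiZ chiM chi1; apply: contrapT => nex.
have sep m : exists f, chi f <> f m.
  apply: contrapT => H; apply: nex; exists m => f; apply: contrapT => Hf.
  by apply: H; exists f.
have chi_sum (K : nat) (F : nat -> C^oo M) : (forall k, chi (F k) = 0) -> chi (\sum_(k < K) F k) = 0.
  move=> HF; elim: K => [|K IH]; last by rewrite big_ord_recr chiD IH HF addr0.
  by rewrite big_ord0; have := chiZ 0 0; rewrite scale0r mul0r.
pose sq f := (f - cstf (chi f)) * (f - cstf (chi f)).
have chisq f : chi (sq f) = 0.
  rewrite /sq chiM (_ : f - cstf (chi f) = f + (- chi f) *: (1 : C^oo M)); last first.
    by apply: smooth_fun_ext => x; rewrite smooth_funB smooth_funD smooth_funZ cstfE smooth_fun1E mulr1.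
  by rewrite chiD chiZ chi1 mulr1 subrr mul0r.
have sq0 f m : 0 <= sq f m by rewrite smooth_funM -expr2 sqr_ge0.
have sqp f m : chi f <> f m -> 0 < sq f m.
  move=> H; rewrite lt_neqAle sq0 andbT eq_sym smooth_funM mulf_eq0 orbb smooth_funB cstfE subr_eq0.
  by apply/eqP => E; apply: H.
pose sepf m := projT1 (cid (sep m)).
have sepP m : 0 < sq (sepf m) m by apply: sqp; rewrite /sepf; case: cid.
have [s sP] := countable_subcover (fun m => open_pos (sq (sepf m))) sepP.
pose phi k : C^oo M := if s k is Some m' then sq (sepf m') else 0.
have phi0 k m : 0 <= phi k m by rewrite /phi; case: (s k) => // m'; exact: lexx.
have phip m : exists k, 0 < phi k m.
  by have [k [m' [sk Hm]]] := sP m; exists k; rewrite /phi sk.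
have chiphi k : chi (phi k) = 0.
  by rewrite /phi; case: (s k) => [m'|]; rewrite ?chisq //; have := chiZ 0 0; rewrite scale0r mul0r.
have cut_ex (k j : nat) : exists g : C^oo M, forall m, g m = flat (k.+1%:R^-1 - phi j m).
  have [g gE] := smooth_fun_comp1 (cstf k.+1%:R^-1 - phi j) (@smooth1_flat R).
  by exists g => m; rewrite gE smooth_funB cstfE.
pose cut k j := projT1 (cid (cut_ex k j)).
have cutE k j m : cut k j m = flat (k.+1%:R^-1 - phi j m) by rewrite /cut; case: cid.
(* The cut-off factors make the family locally finite: near a point with [phi j] positive, the
   factor of index [j] vanishes for large [k]. No positivity is lost, since at a point [psi k] is
   positive for the least [k] with [phi k] positive. *)
pose psi k := phi k * \prod_(j < k) cut k j.
have psiE k m : psi k m = phi k m * \prod_(j < k) flat (k.+1%:R^-1 - phi j m).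
  by rewrite smooth_funM smooth_fun_prod; congr (_ * _); apply: eq_bigr => j _; rewrite cutE.
have psi0 k m : 0 <= psi k m.
  by rewrite psiE mulr_ge0 // prodr_ge0 // => j _; exact: flat_ge0.
have chipsi k : chi (psi k) = 0 by rewrite chiM chiphi mul0r.
have psip m : exists k, 0 < psi k m.
  have [k kP] := ex_minnP (phip m : exists k, (fun k => 0 < phi k m) k).
  move=> kmin; exists k; rewrite psiE pmulr_rgt0 //; apply: prodr_gt0 => j _.
  rewrite flat_gt0 subr_gt0; have -> : phi j m = 0.
    apply/eqP; rewrite eq_le phi0 andbT leNgt; apply/negP => /kmin.
    by rewrite leqNgt ltn_ord.
  by rewrite invr_gt0 ltr0n.
have lf m : exists K, \forall x \near m, forall k, (K <= k)%N -> psi k x = 0.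
  have [j pj] := phip m.
  have e0 : 0 < phi j m / 2 by rewrite divr_gt0.
  have [K0 K0P] : exists K0 : nat, (phi j m / 2)^-1 < K0%:R.
    by exists (Num.bound (phi j m / 2)^-1); rewrite archi_boundP // invr_ge0 ltW.
  exists (maxn K0 j.+1).
  have := (continuous_normP _ _).1 (@smooth_cont (phi j) m) _ e0.
  apply: filterS => x; rewrite ler_norml => /andP[_ H] k; rewrite geq_max => /andP[Kk jk].
  rewrite psiE (bigD1 (Ordinal jk)) //= flat_le0 ?mul0r ?mulr0 // subr_le0.
  apply: (@le_trans _ _ (phi j m / 2)); last by move: H; lra.
  rewrite -[leRHS]invrK lef_pV2 ?posrE ?invr_gt0 ?ltr0n //.
  by apply: ltW; apply: lt_le_trans K0P _; rewrite ler_nat ltnW.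
have [S1 S1E] := lfsum_smooth lf (fun=> 1).
have [S2 S2E] := lfsum_smooth lf (fun k => k%:R).
have S1p m : 0 < S1 m.
  have [k pk] := psip m; have [K HK] : exists K, forall l, (K <= l)%N -> psi l m = 0.
    by have [K HK] := lf m; exists K; exact: nbhs_singleton HK.
  rewrite S1E (lfsumE _ _ HK).
  have kK : (k < K)%N by rewrite ltnNge; apply/negP => /HK E; move: pk; rewrite E ltxx.
  rewrite (bigD1 (Ordinal kK)) //= mul1r ltr_wpDr // sumr_ge0 // => i _.
  by rewrite mul1r; exact: psi0.
have [S1i S1iE] : exists g : C^oo M, forall m, g m = (S1 m)^-1.
  by apply: smooth_fun_inv => m; rewrite lt0r_neq0.
pose f := S2 * S1i.
have [K KP] : exists K : nat, chi f < K%:R.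
  by exists (Num.bound `|chi f|); apply: le_lt_trans (ler_norm _) _; rewrite archi_boundP.
pose g := sq f + \sum_(k < K) psi k.
have gp m : 0 < g m.
  rewrite smooth_funD smooth_fun_sum.
  have [[k pk]|H] := pselect (exists k : 'I_K, 0 < psi k m).
    rewrite ltr_wpDl // (bigD1 k) //= ltr_wpDr // sumr_ge0 // => i _; exact: psi0.
  have psi0m k : (k < K)%N -> psi k m = 0.
    move=> kK; apply/eqP; rewrite eq_le psi0 andbT leNgt; apply/negP => pk.
    by apply: H; exists (Ordinal kK).
  rewrite big1 ?addr0 => [|k _]; last by rewrite psi0m.
  apply: sqp => E; have : K%:R <= f m.
    rewrite smooth_funM S1iE ler_pdivlMr // S1E S2E.
    have [L HL] : exists L, forall l, (L <= l)%N -> psi l m = 0.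
      by have [L HL] := lf m; exists L; exact: nbhs_singleton HL.
    rewrite !(lfsumE _ _ HL) mulr_sumr; apply: ler_sum => k _; rewrite mul1r.
    have [kK|Kk] := ltnP k K; first by rewrite psi0m // !mulr0.
    by rewrite ler_wpM2r // ler_nat.
  by rewrite -E leNgt KP.
have [gi giE] : exists h : C^oo M, forall m, h m = (g m)^-1.
  by apply: smooth_fun_inv => m; rewrite lt0r_neq0.
have g1 : g * gi = 1.
  by apply: smooth_fun_ext => m; rewrite smooth_funM giE smooth_fun1E divff // lt0r_neq0.
have chig : chi g = 0 by rewrite chiD chisq add0r (chi_sum K psi).
by have := chi1; rewrite -g1 chiM chig mul0r => /eqP; rewrite eq_sym oner_eq0.
Qed.

Lemma TrM_base_point r (u : C^oo M -> trunc R r) : TrM u -> exists m, base_point u m.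
Proof.
move=> [ul [u1 uM]]; have [uD uZ _ _] := linear_props ul.
apply: (character_eval (chi := fun f => (u f)`_0)).
- by move=> f g; rewrite uD trunc_coefD.
- by move=> k f; rewrite uZ trunc_coefZ.
- by move=> f g; rewrite uM trunc_coefM // coefM big_ord1.
- by rewrite u1 trunc_coef1.
Qed.

End evaluation_characters.

(** * Weighted homogeneous functions *)

Section weighted_homogeneous.
Context {R : realType}.
Implicit Types (m : nat) (t d : R).

Definition nball m d : set 'rV[R]_m := [set y | `|y| < d].

Lemma open_nball m d : open (@nball m d).
Proof.
have -> : @nball m d = ball (0 : 'rV[R]_m) d.
  by apply/seteqP; split=> y; rewrite -ball_normE /= add0r normrN.
exact: ball_open.
Qed.

Lemma derive_rVE m (f : 'rV[R]_m -> R) x v : differentiable f x ->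
  'D_v f x = \sum_b v 0 b * 'D_(delta_mx 0 b) f x.
Proof. by move=> df; rewrite deriveE // diffE_rV. Qed.

Lemma constant_directions m d (K : pred 'I_m) (f : 'rV[R]_m -> R) y z : smoothE (nball d) f ->
  (forall b x, ~~ K b -> nball d x -> 'D_(delta_mx 0 b) f x = 0) ->
  nball d y -> nball d z -> (forall b, K b -> y 0 b = z 0 b) -> f y = f z.
Proof.
move=> sf D0 dy dz E.
have seg (s : R) : 0 <= s <= 1 -> nball d (s *: (y - z) + z).
  move=> /andP[s0 s1]; rewrite /nball /=.
  have -> : s *: (y - z) + z = s *: y + (1 - s) *: z.
    by apply/rowP => k; rewrite !mxE; ring.
  apply: le_lt_trans (ler_normD _ _) _; rewrite !normrZ (ger0_norm s0) ger0_norm ?subr_ge0 //.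
  have [->|sn] := eqVneq s 0; first by rewrite mul0r add0r subr0 mul1r.
  have sp : 0 < s by rewrite lt_def sn.
  have : s * `|y| < s * d by rewrite ltr_pM2l.
  have : (1 - s) * `|z| <= (1 - s) * d by rewrite ler_wpM2l ?subr_ge0 // ltW.
  lra.
have df x : nball d x -> differentiable f x.
  by move=> dx; exact: smoothE_differentiable (open_nball (d := d)) sf dx.
have [s s01] : exists2 s : R, 0 <= s <= 1 & f (y - z + z) - f z = 'D_(y - z) f (s *: (y - z) + z).
  by apply: MVT_line => s s01; apply: smoothE_derivable (open_nball (d := d)) sf (seg s s01).
rewrite (derive_rVE _ (df _ (seg s s01))) big1 => [|b _].
  by rewrite subrK => /eqP; rewrite subr_eq0 => /eqP.
rewrite !mxE; have [Kb|nK] := boolP (K b); first by rewrite E // subrr mul0r.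
by rewrite (D0 b _ nK (seg s s01)) mulr0.
Qed.

Definition dscl m (c : 'I_m -> R) (y : 'rV[R]_m) : 'rV[R]_m := \row_b (c b * y 0 b).

Lemma derive_dscl m (c : 'I_m -> R) U H y a : open U -> smoothE U H -> U (dscl c y) ->
  is_derive y (delta_mx 0 a) (fun y => H (dscl c y)) (c a * 'D_(delta_mx 0 a) H (dscl c y)).
Proof.
move=> oU sf Ux.
have E b : (fun y => dscl c y 0 b) = (fun y : 'rV[R]_m => c b * y 0 b).
  by apply/funext => z; rewrite mxE.
have D b : is_derive y (delta_mx 0 a) (fun y => dscl c y 0 b)
    (c b * (delta_mx 0 a : 'rV[R]_m) 0 b).
  by rewrite E; apply: is_deriveZ; exact: derive_coord.
have [] := @chain_rule R _ m (dscl c) H y (delta_mx 0 a).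
- move=> b; rewrite E; apply: differentiableM; [exact: differentiable_cst | exact: differentiable_coord].
- exact: smoothE_differentiable oU sf Ux.
move=> df De; apply: DeriveDef; first exact: diff_derivable.
rewrite De (bigD1 a) //= big1 ?addr0 => [|b ba]; rewrite (is_derive_eqE (D _)) mxE eqxx /=.
  by rewrite eqxx mulr1 mulrC.
by rewrite (negbTE ba) mulr0 mulr0.
Qed.

Section dilation.
Context {m : nat}.
Variable w : 'I_m -> nat.
Implicit Types (y : 'rV[R]_m) (H : 'rV[R]_m -> R).

Definition wscl t y : 'rV[R]_m := dscl (fun b => t ^+ w b) y.

Lemma wscl_norm t y : 0 <= t <= 1 -> `|wscl t y| <= `|y|.
Proof.
move=> /andP[t0 t1]; apply: rV_norm_le => // b; rewrite mxE normrM.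
apply: le_trans (rV_norm_coord y b); rewrite ler_piMl // normrX exprn_ile1 //.
by rewrite ger0_norm.
Qed.

Lemma wscl_nball d t y : 0 <= t <= 1 -> nball d y -> nball d (wscl t y).
Proof. by move=> t01; apply: le_lt_trans; exact: wscl_norm. Qed.

Lemma derive_wscl U H t y a : open U -> smoothE U H -> U (wscl t y) ->
  is_derive y (delta_mx 0 a) (fun y => H (wscl t y)) (t ^+ w a * 'D_(delta_mx 0 a) H (wscl t y)).
Proof. exact: derive_dscl. Qed.

(** Only contractions are tested, because these preserve the ball on which [H] is given. *)
Definition whom d i H := forall y t, nball d y -> 0 < t <= 1 -> H (wscl t y) = t ^+ i * H y.

Lemma derive_whom d i H b y t : smoothE (nball d) H -> whom d i H -> nball d y -> 0 < t <= 1 ->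
  t ^+ w b * 'D_(delta_mx 0 b) H (wscl t y) = t ^+ i * 'D_(delta_mx 0 b) H y.
Proof.
move=> sH hH dy t01; have ob := @open_nball m d.
have t01' : 0 <= t <= 1 by have /andP[t0 t1] := t01; rewrite (ltW t0).
have D1 := derive_wscl b ob sH (wscl_nball t01' dy).
rewrite -(is_derive_eqE D1); apply: is_derive_eqE.
have D2 : is_derive y (delta_mx 0 b) (fun y => t ^+ i * H y) (t ^+ i * 'D_(delta_mx 0 b) H y).
  by apply: is_deriveZ; apply: DeriveDef => //; exact: smoothE_derivable ob sH dy.
apply: DeriveDef.
  apply: (near_eq_derivable (f := fun y => t ^+ i * H y)); last exact: is_derive_ex D2.
  by have : nbhs y (nball d) by [apply: open_nbhs_nbhs]; apply: filterS => z dz; rewrite hH.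
rewrite -(is_derive_eqE D2); apply: near_eq_derive.
by have : nbhs y (nball d) by [apply: open_nbhs_nbhs]; apply: filterS => z dz; rewrite hH.
Qed.

Lemma whom_d d i H b : smoothE (nball d) H -> whom d i H -> (w b <= i)%N ->
  whom d (i - w b) ('d_b H).
Proof.
move=> sH hH wi y t dy t01; have t0 : 0 < t by case/andP: t01.
have := derive_whom b sH hH dy t01; rewrite -{1}(subnK wi) exprD.
have tn : t ^+ w b != 0 by rewrite expf_neq0 // gt_eqF.
by rewrite [t ^+ (i - w b) * _]mulrC -mulrA => /(mulfI tn).
Qed.

Lemma continuous_wscl y t : {for t, continuous (fun t => wscl t y)}.
Proof.
apply: continuous_rV => b; rewrite (_ : (fun t => _) = (fun t => t ^+ w b * y 0 b)); last first.
  by apply/funext => s; rewrite mxE.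
by apply: continuousM; [exact: exprn_continuous | exact: cst_continuous].
Qed.

(** By homogeneity the derivative at [y] is t^(w b - i) times its value at [wscl t y]. The exponent
    is positive and the values stay bounded, so letting [t] tend to 0 gives 0. *)
Lemma whom_d0 d i H b y : smoothE (nball d) H -> whom d i H -> (i < w b)%N -> nball d y ->
  'D_(delta_mx 0 b) H y = 0.
Proof.
move=> sH hH iw dy; pose g t := 'D_(delta_mx 0 b) H (wscl t y).
have cg : {for 0, continuous g}.
  apply: (@continuous_comp _ _ _ (fun t => wscl t y) ('d_b H)); first exact: continuous_wscl.
  apply: smoothE_cont (smoothE_d b sH) _; apply: wscl_nball dy.
  by rewrite lexx ler01.
have /near_normP[e e0 He] := (continuous_normP _ _).1 cg 1 ltr01.
have bnd t : 0 < t <= 1 -> t < e -> `|'D_(delta_mx 0 b) H y| <= t * (`|g 0| + 1).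
  move=> /andP[t0 t1] te.
  have E : t ^+ w b * g t = t ^+ i * 'D_(delta_mx 0 b) H y.
    by apply: (derive_whom b sH hH dy); rewrite t0.
  have {}E : 'D_(delta_mx 0 b) H y = t ^+ (w b - i) * g t.
    apply: (mulfI (expf_neq0 i (lt0r_neq0 t0))); rewrite -E mulrA -exprD subnKC //.
    exact: ltnW.
  rewrite E normrM; apply: ler_pM => //.
    rewrite ger0_norm; last by rewrite exprn_ge0 // ltW.
    have : t ^+ (w b - i) <= t ^+ 1 by apply: ler_wiXn2l; [exact: ltW| |rewrite subn_gt0].
    by rewrite expr1.
  have H1 : `|g 0 - g t| <= 1 by apply: He; rewrite subr0 [`|_|](gtr0_norm t0).
  rewrite -[g t](subrK (g 0)) addrC; apply: le_trans (ler_normD _ _) _.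
  by rewrite lerD2l distrC.
apply/eqP; rewrite -normr_le0; apply/ler_addgt0Pr => k k0; rewrite add0r.
have c0 : 0 < `|g 0| + 1 by rewrite ltr_wpDl.
pose t := Num.min 1 (Num.min (e / 2) (k / (`|g 0| + 1))).
have t0 : 0 < t by rewrite !lt_min ltr01 !divr_gt0.
have := bnd t; rewrite t0 !ge_min lexx /= => /(_ isT) H1.
apply: le_trans (H1 _) _.
  apply: (@le_lt_trans _ _ (e / 2)); first by rewrite !ge_min lexx !orbT.
  by rewrite ltr_pdivrMr // ltr_pMr // ltr1n.
by rewrite -ler_pdivlMr // !ge_min lexx !orbT.
Qed.

Lemma is_derive_cpow (c s : R) k : is_derive s 1 (fun t => c * t ^+ k) (c * (k%:R * s ^+ k.-1)).
Proof.
apply: is_deriveZ; elim: k => [|k IH].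
  by rewrite mul0r (_ : (fun t => _) = cst 1); [exact: is_derive_cst | apply/funext => t; rewrite expr0].
rewrite (_ : (fun t => _) = (fun t => t * t ^+ k)); last by apply/funext => t; rewrite exprS.
have D1 : is_derive s 1 (fun t : R => t) 1 by exact: is_derive_id.
apply: DeriveDef; first exact: derivableM (is_derive_ex D1) (is_derive_ex IH).
rewrite derive_mul; [|exact: is_derive_ex D1|exact: is_derive_ex IH].
rewrite (is_derive_eqE D1) (is_derive_eqE IH) mul1r /=.
by case: k {IH} => [|k]; rewrite ?expr0 ?mul0r ?mulr0 ?addr0 ?mul1r // mulrCA -exprS [k.+2%:R]mulrS mulrDl mul1r.
Qed.

(** The homogeneity relation holds only for [0 < t <= 1], so it is differentiated at the interior
    point [t = 1/2]; the homogeneity of the partial derivatives carries the result back to [y]. *)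
Lemma whom_Euler d i H y : smoothE (nball d) H -> whom d i H -> nball d y ->
  \sum_b (w b)%:R * y 0 b * 'D_(delta_mx 0 b) H y = i%:R * H y.
Proof.
move=> sH hH dy; have h0 : (0 : R) < 2^-1 by rewrite invr_gt0.
have h1 : (2^-1 : R) <= 1 by lra.
have h01 : 0 < (2^-1 : R) <= 1 by rewrite h0.
have h01' : 0 <= (2^-1 : R) <= 1 by rewrite ltW.
have ob := @open_nball m d; have db := wscl_nball h01' dy.
have Dc b : is_derive (2^-1 : R) 1 (fun t => wscl t y 0 b) ((w b)%:R * 2^-1 ^+ (w b).-1 * y 0 b).
  rewrite (_ : (fun t => _) = (fun t => y 0 b * t ^+ w b)); last by apply/funext => s; rewrite mxE mulrC.
  rewrite mulrC; exact: is_derive_cpow.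
have df b : differentiable (fun t => wscl t y 0 b) (2^-1 : R).
  by apply/derivable1_diffP; exact: is_derive_ex (Dc b).
have [dH DH] := chain_rule (1 : R) df (smoothE_differentiable ob sH db).
have D2 : is_derive (2^-1 : R) 1 (fun t => t ^+ i * H y) (i%:R * 2^-1 ^+ i.-1 * H y).
  by rewrite [X in is_derive _ _ _ X]mulrC (_ : (fun t => _) = (fun t => H y * t ^+ i));
    [exact: is_derive_cpow | apply/funext => t; rewrite mulrC].
have E : 'D_1 (H \o (fun t => wscl t y)) 2^-1 = i%:R * 2^-1 ^+ i.-1 * H y.
  rewrite -(is_derive_eqE D2); apply: near_eq_derive.
  have : nbhs (2^-1 : R) [set t | `|t - 2^-1| < 2^-1].
    by apply/near_normP; exists 2^-1.
  apply: filterS => t /=; rewrite ltr_norml => /andP[t0 t1]; apply: hH => //.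
  by apply/andP; split; move: t0 t1; lra.
have key : 2^-1 * (2^-1 ^+ i.-1 * (i%:R * H y)) =
    2^-1 ^+ i * \sum_b (w b)%:R * y 0 b * 'D_(delta_mx 0 b) H y.
  rewrite [2^-1 ^+ i.-1 * _](_ : _ = 'D_1 (H \o (fun t => wscl t y)) 2^-1); last first.
    by rewrite E; ring.
  rewrite DH !mulr_sumr; apply: eq_bigr => b _; rewrite (is_derive_eqE (Dc b)).
  have := derive_whom b sH hH dy h01.
  case: (w b) => [_|k Hk]; first by rewrite !mul0r !mulr0.
  have -> : 2^-1 * ('D_(delta_mx 0 b) H (wscl 2^-1 y) * (k.+1%:R * 2^-1 ^+ k.+1.-1 * y 0 b)) =
    (2^-1 ^+ k.+1 * 'D_(delta_mx 0 b) H (wscl 2^-1 y)) * (k.+1%:R * y 0 b).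
    by rewrite exprS /=; ring.
  by rewrite Hk; ring.
case: i hH D2 E key => [|i] hH D2 E; first by rewrite expr0 mul0r mulr0 mulr0 mul1r.
rewrite mulrA -exprS => /(mulfI _) -> //.
Qed.

(** If each p_b starts with z_b epsilon^(w b), then H(p) starts with H(z) epsilon^i. The induction
    on [j] uses the Euler equation for the jet, where the partial derivatives are homogeneous of
    smaller degree, and Euler's identity for [H z]. Coordinates of weight above [i] do not enter
    into [H]. *)
Lemma jet_whom r d (p : 'M[R]_(r.+1, m)) (z : 'rV[R]_m) j i H :
  smoothE (nball d) H -> whom d i H -> (j <= i)%N -> (j <= r)%N ->
  nball d (jbase p) -> nball d z ->
  (forall b l, (l < w b)%N -> (w b <= i)%N -> (jcoord p b)`_l = 0) ->
  (forall b, (w b <= i)%N -> z 0 b = (jcoord p b)`_(w b)) ->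
  (jet H p)`_j = if j == i then H z else 0.
Proof.
move=> + + + + dp dz; have ob := @open_nball m d.
elim/ltn_ind: j i H => j IH i H sH hH ji jr pz zE.
have indep b x : ~~ (w b <= i)%N -> nball d x -> 'D_(delta_mx 0 b) H x = 0.
  by rewrite -ltnNge => wb dx; exact: whom_d0 sH hH wb dx.
have [j0|j0] := posnP j.
  move: ji; rewrite j0 jet0; have [i0 _|i0 _] := eqVneq 0%N i.
    apply: (constant_directions (K := fun b => (w b <= i)%N) sH indep dp dz) => b wb.
    by rewrite zE // -jcoord0; move: wb; rewrite -i0 leqn0 => /eqP ->.
  (* This point is fixed by all dilations, so homogeneity of positive degree forces [H y0 = 0]. *)
  pose y0 : 'rV[R]_m := \row_b (if w b == 0%N then jbase p 0 b else 0).
  have dy0 : nball d y0.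
    apply: le_lt_trans dp; apply: rV_norm_le => // b; rewrite mxE; case: eqP => _.
      exact: rV_norm_coord.
    by rewrite normr0.
  rewrite (constant_directions (K := fun b => (w b <= i)%N) (z := y0) sH indep dp dy0); last first.
    by move=> b wb; rewrite [RHS]mxE; case: (posnP (w b)) => // wp; rewrite -jcoord0 pz.
  have h1 : 0 < (2^-1 : R) <= 1 by rewrite invr_gt0 ltr0n invf_le1 ?ltr0n // ler1n.
  have := hH y0 2^-1 dy0 h1; rewrite (_ : wscl 2^-1 y0 = y0); last first.
    by apply/rowP => b; rewrite !mxE; case: eqP => [->|]; rewrite ?expr0 ?mul1r ?mulr0.
  move=> E; have : (1 - 2^-1 ^+ i) * H y0 = 0 by rewrite mulrBl mul1r -E subrr.
  move/eqP; rewrite mulf_eq0 => /orP[|/eqP //]; rewrite subr_eq0 => /eqP E1.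
  have : (2^-1 : R) ^+ i < 1 by rewrite exprn_ilt1 ?invr_ge0 ?ler0n ?invf_lt1 ?ltr0n ?ltr1n // eq_sym.
  by rewrite -E1 ltxx.
(* In the convolution only [l = w a] can contribute: below it p_a vanishes, and above it, or for
   [j < i], the other factor has order below its degree of homogeneity. *)
have term a : (Eul (jcoord p a) * jet ('d_a H) p)`_j =
    if j == i then (w a)%:R * z 0 a * 'D_(delta_mx 0 a) H z else 0.
  have [wi|wi] := leqP (w a) i; last first.
    have -> : jet ('d_a H) p = 0.
      rewrite (jet_ext (g := fun=> 0) ob dp) ?jet_cst // => x dx.
      exact: whom_d0 sH hH wi dx.
    by rewrite mulr0 coef0 (whom_d0 sH hH wi dz) mulr0; case: eqP.
  have IHa l : (0 < l <= j)%N -> (w a <= l)%N ->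
      (jet ('d_a H) p)`_(j - l) = if (j - l == i - w a)%N then 'D_(delta_mx 0 a) H z else 0.
    move=> /andP[l0 lj] wl; apply: (IH (j - l)%N _ (i - w a)%N).
    - by rewrite ltn_subrL l0.
    - exact: smoothE_d.
    - exact: whom_d sH hH wi.
    - exact: leq_sub.
    - by apply: leq_trans (leq_subr _ _) jr.
    - by move=> b k kw wb; apply: pz => //; apply: leq_trans wb (leq_subr _ _).
    - by move=> b wb; apply: zE; apply: leq_trans wb (leq_subr _ _).
  have zero (l : 'I_j.+1) : l != w a :> nat \/ j != i ->
      (Eul (jcoord p a))`_l * (jet ('d_a H) p)`_(j - l) = 0.
    move=> hl; rewrite coef_Eul; have [->|l0] := posnP l; first by rewrite !mul0r.
    have [lw|wl] := ltnP l (w a); first by rewrite pz // mulr0 mul0r.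
    have lj : (l <= j)%N by rewrite -ltnS.
    have lj' : (0 < l <= j)%N by rewrite l0 lj.
    rewrite (IHa l lj' wl); case: eqP => [E|_]; last by rewrite mulr0.
    by clear - hl E lj wl ji wi; exfalso; case: hl => /eqP []; lia.
  rewrite coefM; case: eqP => [ji'|ji']; last first.
    by rewrite big1 // => l _; apply: zero; right; apply/eqP.
  have wj : (w a < j.+1)%N by rewrite ltnS ji'.
  rewrite (bigD1 (Ordinal wj)) //= big1 ?addr0 => [|l ll]; last first.
    by apply: zero; left; apply: contra_neq ll => E; apply/val_inj.
  rewrite coef_Eul; have [w0|w0] := posnP (w a); first by rewrite w0 !mul0r.
  have wj' : (0 < w a <= j)%N by rewrite w0 -ltnS.
  by rewrite (IHa _ wj' (leqnn _)) ji' eqxx zE.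
have := @jet_Eul _ _ _ H p j jr; rewrite coef_Eul coef_sum (eq_bigr _ (fun a _ => term a)).
have jn : (j%:R : R) != 0 by rewrite pnatr_eq0 -lt0n.
case: eqP => [->|_]; last by rewrite big1 // => /eqP; rewrite mulf_eq0 (negbTE jn) => /eqP.
rewrite (whom_Euler sH hH dz) => /mulfI; apply.
by move: jn; rewrite pnatr_eq0 -lt0n => jp; rewrite pnatr_eq0 -lt0n; apply: leq_trans jp ji.
Qed.

End dilation.

End weighted_homogeneous.

(** * Straightening a homogeneous family of jets *)

Section jet_vectors.
Context {R : realType} {n r : nat}.
Local Notation jdim := (r.+1 * n)%N.
Implicit Types (q v : 'rV[R]_jdim) (k l : 'I_jdim).

(** The power of epsilon to which a flattened jet coordinate belongs. It is also its weight under
    [kappa], see [vec_mx_wscl]. *)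
Definition jrow k : nat := (enum_val (cast_ord (esym (mxvec_cast r.+1 n)) k)).1.
Definition jcol k : 'I_n := (enum_val (cast_ord (esym (mxvec_cast r.+1 n)) k)).2.

Lemma jrowE i a : jrow (mxvec_index i a) = i.
Proof. by rewrite /jrow cast_ordK enum_rankK. Qed.

Lemma jcolE i a : jcol (mxvec_index i a) = a.
Proof. by rewrite /jcol cast_ordK enum_rankK. Qed.

Lemma jrow_le k : (jrow k <= r)%N.
Proof. by rewrite -ltnS /jrow ltn_ord. Qed.

Lemma jrow_jcol k : mxvec_index (inord (jrow k)) (jcol k) = k.
Proof. by case/mxvec_indexP: k => i a; rewrite jrowE jcolE inord_val. Qed.

Lemma jindex_inj k l : jrow k = jrow l -> jcol k = jcol l -> k = l.
Proof. by move=> E1 E2; rewrite -(jrow_jcol k) E1 E2 jrow_jcol. Qed.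

Lemma vec_mx_entry q k : q 0 k = (jcoord (vec_mx q) (jcol k))`_(jrow k).
Proof.
case/mxvec_indexP: k => i a; rewrite jrowE jcolE coef_jcoord mxE //.
Qed.

Lemma vec_mx_wscl t q : vec_mx (wscl jrow t q) = jkappa t (vec_mx q).
Proof. by apply/matrixP => i a; rewrite !mxE jrowE. Qed.

Lemma jbase_norm q : `|jbase (vec_mx q)| <= `|q|.
Proof. by apply: rV_norm_le => // b; rewrite !mxE; exact: rV_norm_coord. Qed.

Lemma jet_vec0 f i : (jet f (vec_mx (0 : 'rV[R]_jdim)))`_i = if i == 0%N then f 0 else 0.
Proof.
have E : jkappa 0 (vec_mx (0 : 'rV[R]_jdim)) = vec_mx 0.
  by apply/matrixP => j a; rewrite !mxE mulr0.
case: eqP => [->|/eqP i0]; last by rewrite -E jet_kappa expr0n (negbTE i0) mul0r.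
by rewrite jet0; congr f; apply/rowP => a; rewrite !mxE.
Qed.

(** Multiplication of a tangent vector by epsilon. *)
Definition jshift v : 'rV[R]_jdim := mxvec (\matrix_(i < r.+1, a < n)
  if nat_of_ord i is j.+1 then vec_mx v (inord j) a else 0).

Lemma jcoord_jshift v a : eqX r (jcoord (vec_mx (jshift v)) a) ('X * jcoord (vec_mx v) a).
Proof.
move=> i ir; rewrite mxvecK coefXM !coef_poly ltnS ir mxE inordK //.
by case: i ir => //= i ir; rewrite ltnS (ltnW ir).
Qed.

Lemma derive_jet_vec U f q v j : open U -> smoothE U f -> U (jbase (vec_mx q)) -> (j <= r)%N ->
  'D_v (fun q => (jet f (vec_mx q))`_j) q =
  (\sum_a jcoord (vec_mx v) a * jet ('d_a f) (vec_mx q))`_j.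
Proof. by move=> oU sf Uq jr; apply: is_derive_eqE; exact: jet_derive oU sf Uq _ jr. Qed.

(** The differential of a jet is linear over the truncated polynomials, so multiplying [v] by
    epsilon shifts the coefficients of the derivative by one. *)
Lemma derive_jet_jshift U f q v j : open U -> smoothE U f -> U (jbase (vec_mx q)) -> (j <= r)%N ->
  'D_(jshift v) (fun q => (jet f (vec_mx q))`_j) q =
  if j is j'.+1 then 'D_v (fun q => (jet f (vec_mx q))`_j') q else 0.
Proof.
move=> oU sf Uq jr; rewrite (derive_jet_vec _ oU sf Uq jr).
have E : eqX r (\sum_a jcoord (vec_mx (jshift v)) a * jet ('d_a f) (vec_mx q))
    ('X * \sum_a jcoord (vec_mx v) a * jet ('d_a f) (vec_mx q)).
  rewrite mulr_sumr; apply: eqX_sum => a; rewrite mulrA.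
  by apply: eqXM; [exact: jcoord_jshift | exact: eqX_refl].
rewrite (E j jr) coefXM; case: j jr => //= j jr.
by rewrite (derive_jet_vec _ oU sf Uq (ltnW jr)).
Qed.

Lemma derive_jet_vec0 U f k v : open U -> smoothE U f -> U 0 ->
  'D_v (fun q => (jet f (vec_mx q))`_(jrow k)) 0 =
  \sum_a (jcoord (vec_mx v) a)`_(jrow k) * 'D_(delta_mx 0 a) f 0.
Proof.
move=> oU sf U0; have b0 : U (jbase (vec_mx (0 : 'rV[R]_jdim))).
  by rewrite (_ : jbase _ = 0) //; apply/rowP => a; rewrite !mxE.
rewrite (derive_jet_vec _ oU sf b0 (jrow_le k)) coef_sum; apply: eq_bigr => a _.
rewrite coefM big_ord_recr /= subnn jet_vec0 eqxx big1 ?add0r // => i _.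
by rewrite jet_vec0 subn_eq0 leqNgt ltn_ord mulr0.
Qed.

Lemma continuous_jet_vec U f q i : open U -> smoothE U f -> U (jbase (vec_mx q)) ->
  {for q, continuous (fun q => (jet f (vec_mx q))`_i)}.
Proof. by move=> oU sf Uq; exact: smoothE_cont (@smoothE_jet _ _ _ U f i oU sf) Uq. Qed.

End jet_vectors.

Lemma open_smooth_preimage {R : realType} m p (V : set 'rV[R]_m) (X : 'rV[R]_m -> 'rV[R]_p) O :
  open V -> smoothE_map V X -> open O -> open (V `&` X @^-1` O).
Proof.
move=> oV sX oO; rewrite openE => x [Vx Ox]; apply: near_setI; first exact: open_nbhs_nbhs.
have cX : {for x, continuous X} by apply: continuous_rV => c; exact: smoothE_cont (sX c) Vx.
by apply: cX; exact: open_nbhs_nbhs.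
Qed.

Section normal_form.
Context {R : realType} {n r : nat}.
Local Notation jdim := (r.+1 * n)%N.
(* The entries of q : 'rV_jdim are the coordinates q_{j,b} of a jet. [S] is cut out
   near 0 by the equations Sig_{j,b} = 0 for j < w b, and [Sshift] is the invariance
   of its tangent spaces under multiplication by epsilon. *)
Variables (w : 'I_n -> nat) (S : set 'rV[R]_jdim) (U : set 'rV[R]_jdim)
  (Sig : 'rV[R]_jdim -> 'rV[R]_jdim).
Hypotheses (wr : forall a, (w a <= r)%N) (oU : open U) (U0 : U 0).
Hypotheses (sSig : smoothE_map U Sig) (Sig0 : Sig 0 = 0).
Hypothesis DSig0 : forall k l, 'D_(delta_mx 0 k) (fun q => Sig q 0 l) 0 = (k == l)%:R.

Let low (k : 'I_jdim) := (jrow k < w (jcol k))%N.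

Hypothesis SP : forall q, U q -> (S q <-> forall k, low k -> Sig q 0 k = 0).
Hypothesis Skappa : forall t q, S q -> S (wscl jrow t q).
Hypothesis Sshift : forall q v, U q -> S q ->
  (forall k, low k -> 'D_v (fun q => Sig q 0 k) q = 0) ->
  forall k, low k -> 'D_(jshift v) (fun q => Sig q 0 k) q = 0.

Let jX (X : 'rV[R]_n -> 'rV[R]_n) (k : 'I_jdim) (q : 'rV[R]_jdim) :=
  (jet (fun x => X x 0 (jcol k)) (vec_mx q))`_(jrow k).

Section straightening.
Variables (V : set 'rV[R]_n) (X : 'rV[R]_n -> 'rV[R]_n).
Hypotheses (oV : open V) (V0 : V 0) (sX : smoothE_map V X) (X0 : X 0 = 0).
Hypothesis DX0 : forall a b, 'D_(delta_mx 0 a) (fun x => X x 0 b) 0 = (a == b)%:R.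

(** On [S] the low entries vanish, so the high ones, which are jets of [X], parametrize [S] near
    0. *)
Definition straight (q : 'rV[R]_jdim) : 'rV[R]_jdim := \row_k (if low k then Sig q 0 k else jX X k q).

Lemma straight_low k : low k -> (fun q => straight q 0 k) = (fun q => Sig q 0 k).
Proof. by move=> lk; apply/funext => q; rewrite mxE lk. Qed.

Lemma straight_high k : ~~ low k -> (fun q => straight q 0 k) = jX X k.
Proof. by move=> lk; apply/funext => q; rewrite mxE (negbTE lk). Qed.

Lemma straight0 : straight 0 = 0.
Proof.
apply/rowP => k; rewrite [LHS]mxE [RHS]mxE; case: (low k); first by rewrite Sig0 mxE.
by rewrite /jX jet_vec0 X0 mxE; case: eqP.
Qed.

Lemma smooth_jX k : smoothE (jdom V) (jX X k).
Proof. exact: smoothE_jet. Qed.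

Lemma smooth_straight : smoothE_map (U `&` jdom V) straight.
Proof.
move=> k; have [lk|lk] := boolP (low k).
  by rewrite straight_low //; apply: smoothE_sub (sSig k); exact: subIsetl.
by rewrite straight_high //; apply: smoothE_sub (@smooth_jX k); exact: subIsetr.
Qed.

Lemma derive_jX0 k l : 'D_(delta_mx 0 k) (jX X l) 0 = (k == l)%:R.
Proof.
rewrite /jX (derive_jet_vec0 l _ oV (sX (jcol l)) V0) (bigD1 (jcol l)) //= big1 ?addr0 => [|a al].
  by rewrite DX0 eqxx mulr1 -vec_mx_entry mxE eqxx eq_sym.
by rewrite DX0 (negbTE al) mulr0.
Qed.

Lemma derive_straight0 k l : 'D_(delta_mx 0 k) (fun q => straight q 0 l) 0 = (k == l)%:R.
Proof.
by have [lk|lk] := boolP (low l); [rewrite straight_low | rewrite straight_high // derive_jX0].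
Qed.

Lemma straight_inverse : exists W F', [/\ W `<=` U `&` jdom V, W 0 & diffeo W straight F'].
Proof.
apply: near_identity_inverse smooth_straight straight0 derive_straight0.
  by apply: openI => //; exact: open_jdom.
split=> //; rewrite /jdom /= (_ : jbase _ = 0) //.
by apply/rowP => a; rewrite !mxE.
Qed.

End straightening.


Definition straightened (X : 'rV[R]_n -> 'rV[R]_n) (i : nat) (d : R) := forall q, S q -> nball d q ->
  forall b j, (j < w b)%N -> (j < i)%N -> (jet (fun x => X x 0 b) (vec_mx q))`_j = 0.

Definition near_identity V (X : 'rV[R]_n -> 'rV[R]_n) := [/\ open V, V 0, smoothE_map V X, X 0 = 0 &
  forall a b, 'D_(delta_mx 0 a) (fun x => X x 0 b) 0 = (a == b)%:R].

(** [d] is a radius for jets and [e] one for their coordinates. The inverse [F'] maps the [e]-ball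
    into the [d]-ball, so that everything needed is defined on balls. *)
Definition straight_chart (X : 'rV[R]_n -> 'rV[R]_n) V d e W F' := [/\ W `<=` U `&` jdom V,
   diffeo W (straight X) F', nball d `<=` W, 0 < e &
   forall z, nball e z -> [/\ nball d (F' z), straight X (F' z) = z &
     (S (F' z) <-> forall k, low k -> z 0 k = 0)]].

Lemma straight_chart_exists V X (d0 : R) : near_identity V X -> 0 < d0 -> exists (d e : R) W F',
  [/\ 0 < d <= d0, straight_chart X V d e W F' &
      forall q : 'rV[R]_jdim, nball d q -> nball d0 (jbase (vec_mx q))].
Proof.
move=> [oV V0 sX X0 DX0] d0p.
have [W [F' [WU W0 dW]]] := straight_inverse oV V0 sX X0 DX0.
have [oW oFW FK _ sF'] := dW.
have /near_normP[d1 d1p Hd1] : nbhs (0 : 'rV[R]_jdim) W by exact: open_nbhs_nbhs.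
pose d := Num.min d0 d1; have dp : 0 < d by rewrite lt_min d0p.
have dW' : nball d `<=` W.
  by move=> q qd; apply: Hd1; rewrite subr0; apply: lt_le_trans qd _; rewrite ge_min lexx orbT.
have FW0 : (straight X @` W) 0 by exists 0 => //; exact: straight0.
have cF' : {for 0, continuous F'}.
  by apply: continuous_rV => b; exact: smoothE_cont (sF' b) FW0.
have F'0 : F' 0 = 0 by rewrite -[in LHS](straight0 X0) FK.
have nd : nbhs (F' 0) (nball d).
  by rewrite F'0; apply: open_nbhs_nbhs; split; [exact: open_nball | rewrite /nball /= normr0].
have n1 : nbhs (0 : 'rV[R]_jdim) (F' @^-1` nball d) by exact: cF'.
have n2 : nbhs (0 : 'rV[R]_jdim) (straight X @` W) by exact: open_nbhs_nbhs.
have /near_normP[e ep He] := near_setI n1 n2.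
exists d, e, W, F'; split.
- by rewrite dp ge_min lexx.
- split=> // z ze; have := He z; rewrite subr0 => /(_ ze) [/= dz [q Wq Fq]].
  have E : straight X (F' z) = z by rewrite -Fq FK.
  split=> //; have [Uz _] := WU _ (dW' _ dz); apply: (iff_trans (SP Uz)).
  by split=> H k lk; have := H k lk; rewrite -[in z 0 k]E mxE lk.
- move=> q qd; apply: le_lt_trans (jbase_norm q) _; apply: lt_le_trans qd _.
  by rewrite ge_min lexx.
Qed.

(** * Correction of the coordinates at order i *)

Section improvement.
Variables (V : set 'rV[R]_n) (X : 'rV[R]_n -> 'rV[R]_n) (i : nat) (d e : R) (W : set 'rV[R]_jdim)
  (F' : 'rV[R]_jdim -> 'rV[R]_jdim).
Hypotheses (nX : near_identity V X) (sc : straight_chart X V d e W F').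
Hypothesis Si : straightened X i d.

(** Projection to the coordinate subspace that corresponds to [S] in the chart [straight X]. *)
Let prj : 'rV[R]_jdim -> 'rV[R]_jdim := dscl (fun k => (~~ low k)%:R).

Let prj_nball z : nball e z -> nball e (prj z).
Proof.
apply: le_lt_trans; apply: rV_norm_le => // k; rewrite mxE.
by case: (low k); rewrite /= ?mul0r ?normr0 // mul1r; exact: rV_norm_coord.
Qed.

Let prj_S z : nball e z -> S (F' (prj z)).
Proof.
move=> ze; have [_ _ _ _ H] := sc; have [_ _ ->] := H _ (prj_nball ze).
by move=> k lk; rewrite mxE lk mul0r.
Qed.

Let leading a (z : 'rV[R]_jdim) := (jet (fun x => X x 0 a) (vec_mx (F' z)))`_i.

Let smooth_leading a : smoothE (nball e) (leading a).
Proof.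
have [oV _ sX _ _] := nX; have [WU [oW oFW FK _ sF'] dW ep H] := sc.
apply: (smoothE_comp (@open_nball _ _ e) (open_jdom oV) _ _ (@smoothE_jet _ _ _ _ _ i oV (sX a))).
  by move=> z ze; have [dz _ _] := H z ze; have [] := WU _ (dW _ dz).
move=> k; apply: smoothE_sub (sF' k) => z ze; have [dz Fz _] := H z ze.
by exists (F' z) => //; exact: dW.
Qed.

(** The high entries of [straight X], being jets, scale with their weights, but the low entries
    [Sig] need not. After [prj] the latter are 0 and stay so, because [S] is preserved by
    dilations. *)
Lemma leading_whom a : whom jrow e i (fun z => leading a (prj z)).
Proof.
have [WU [oW oFW FK _ sF'] dW ep H] := sc; have [_ _ _ _ _] := nX.
move=> z t ze t01; have t01' : 0 <= t <= 1 by case/andP: t01 => t0 ->; rewrite ltW.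
rewrite /leading -jet_kappa -vec_mx_wscl; congr ((jet _ (vec_mx _))`_i).
set q := F' (prj z); have [dq Fq _] := H _ (prj_nball ze).
have dtq : nball d (wscl jrow t q) by exact: wscl_nball.
rewrite -[RHS]FK; last exact: dW.
congr F'; apply/rowP => k; rewrite [LHS]mxE [RHS]mxE.
have [lk|lk] := boolP (low k); rewrite /= ?mul0r ?mul1r.
  have [Uq _] := WU _ (dW _ dtq).
  by rewrite ((SP Uq).1 (Skappa t (prj_S ze)) k lk).
rewrite mxE /jX vec_mx_wscl jet_kappa; congr (_ * _).
have := congr1 (fun z : 'rV[R]_jdim => z 0 k) Fq.
by rewrite /straight !mxE (negbTE lk) /= mul1r => <-.
Qed.


Let derive_prj (f : 'rV[R]_jdim -> R) k z : smoothE (nball e) f -> nball e z ->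
  'D_(delta_mx 0 k) (fun z => f (prj z)) z = (~~ low k)%:R * 'D_(delta_mx 0 k) f (prj z).
Proof.
move=> sf ze; apply: is_derive_eqE; apply: derive_dscl sf (prj_nball ze).
exact: open_nball.
Qed.

Let dF' k z : 'rV[R]_jdim := \row_l 'D_(delta_mx 0 k) (fun z => F' z 0 l) (prj z).

Let derive_F' (f : 'rV[R]_jdim -> R) k z : smoothE W f -> nball e z ->
  'D_(delta_mx 0 k) (fun z => f (F' z)) (prj z) = 'D_(dF' k z) f (F' (prj z)).
Proof.
move=> sf ze; have [WU [oW oFW FK _ sF'] dW ep H] := sc.
have [dq Fq _] := H _ (prj_nball ze); have Wq := dW _ dq.
have df := smoothE_differentiable oW sf Wq.
have dF b : differentiable (fun z => F' z 0 b) (prj z).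
  by apply: (smoothE_differentiable oFW (sF' b)); rewrite -Fq; exists (F' (prj z)).
have [_ ->] := chain_rule (delta_mx 0 k) dF df.
by rewrite (derive_rVE _ df); apply: eq_bigr => l _; rewrite !mxE mulrC.
Qed.

Let derive_near (f g : 'rV[R]_jdim -> R) (rho : R) v x : (forall y, nball rho y -> f y = g y) -> nball rho x ->
  'D_v f x = 'D_v g x.
Proof.
move=> fg rx; apply: near_eq_derive.
have : nbhs x (nball rho) by apply: open_nbhs_nbhs; split=> //; exact: open_nball.
by apply: filterS.
Qed.

Let smooth_straightW l : smoothE W (fun q => straight X q 0 l).
Proof.
have [oV _ sX _ _] := nX; have [WU _ _ _ _] := sc.
exact: smoothE_sub WU (smooth_straight oV sX l).
Qed.

Let derive_straight_dF' k l z : nball e z ->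
  'D_(dF' k z) (fun q => straight X q 0 l) (F' (prj z)) = (k == l)%:R.
Proof.
move=> ze; rewrite -derive_F' //; have [_ _ _ _ H] := sc.
rewrite (@derive_near _ (fun y : 'rV[R]_jdim => y 0 l) e); last exact: prj_nball.
  by rewrite (is_derive_eqE (derive_coord _ _ _)) mxE eqxx /= eq_sym.
by move=> y ye; have [_ -> _] := H y ye.
Qed.

(** The composite of [f] with [F'] and [prj] vanishes on the whole ball, and [prj] does not affect a
    high direction. *)
Let derive_vanish (f : 'rV[R]_jdim -> R) k z : smoothE W f -> (forall q, S q -> nball d q -> f q = 0) ->
  ~~ low k -> nball e z -> 'D_(dF' k z) f (F' (prj z)) = 0.
Proof.
move=> sf f0 lk ze; have [WU [oW oFW FK _ sF'] dW ep H] := sc.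
rewrite -derive_F' //; have := @derive_prj (fun z => f (F' z)) k z.
rewrite lk mul1r => <- //; last first.
  apply: smoothE_comp (@open_nball _ _ e) oW _ _ sf.
    by move=> y ye; have [dy _ _] := H y ye; exact: dW.
  move=> b; apply: smoothE_sub (sF' b) => y ye; have [dy Fy _] := H y ye.
  by exists (F' y) => //; exact: dW.
rewrite (@derive_near _ (fun=> 0) e) // ?derive_cst // => y ye.
by apply: f0; [exact: prj_S | have [] := H _ (prj_nball ye)].
Qed.

(** A homogeneous function of degree [i] cannot depend on coordinates of weight above [i]. *)
Let derive_leading_high a l z : (i < jrow l)%N -> ~~ low l -> nball e z ->
  'D_(delta_mx 0 l) (leading a) (prj z) = 0.
Proof.
move=> il ll ze; have := derive_prj l (smooth_leading a) ze; rewrite ll mul1r => <-.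
apply: (whom_d0 (w := jrow)) (leading_whom a) il ze.
have [_ _ _ ep _] := sc.
apply: smoothE_comp (@open_nball _ _ e) (@open_nball _ _ e) prj_nball _ (smooth_leading a) => k.
rewrite (_ : (fun x => _) = (fun x : 'rV[R]_jdim => (~~ low k)%:R * x 0 k)).
  by apply: smoothEZ; [exact: open_nball | apply: smoothE_coord; exact: open_nball].
by apply/funext => x; rewrite mxE.
Qed.

(* Let k = (j + 1, b) with w b <= j < i and let v be the tangent vector of S with
   coordinates e_{j,b} in the chart [straight X]. Then epsilon v is tangent to S with
   coordinates e_{j+1,b}, up to e_{w c,c} with w c > i, along which [leading a] is
   constant by homogeneity. But the derivative of u_i(X_a) along epsilon v is that
   of u_(i-1)(X_a) along v, which is 0 as u_(i-1)(X_a) vanishes on S. *)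
Lemma derive_leading a k z : (i < w a)%N -> nball e z -> ~~ ((jrow k == w (jcol k)) && (w (jcol k) <= i)%N) ->
  'D_(delta_mx 0 k) (fun z => leading a (prj z)) z = 0.
Proof.
move=> ia ze nk; rewrite (derive_prj _ (smooth_leading a) ze).
have [lk|lk] := boolP (low k); first by rewrite mul0r.
rewrite mul1r; have [ik|ki] := ltnP i (jrow k); first exact: derive_leading_high.
have wk : (w (jcol k) < jrow k)%N.
  rewrite ltn_neqAle leqNgt lk andbT; apply: contra nk => /eqP E.
  by rewrite -E eqxx /= E.
case Ej : (jrow k) (wk) => [//|j0] wj; rewrite ltnS in wj.
have j0r : (j0 < r.+1)%N by have := jrow_le k; rewrite Ej ltnS => /ltnW.
pose k0 : 'I_jdim := mxvec_index (inord j0) (jcol k).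
have r0 : jrow k0 = j0 by rewrite jrowE inordK.
have c0 : jcol k0 = jcol k by rewrite jcolE.
have lk0 : ~~ low k0 by rewrite /low r0 c0 -leqNgt.
have [oV V0 sX X0 DX0] := nX; have [WU [oW oFW FK _ sF'] dW ep H] := sc.
set q := F' (prj z); pose v := dF' k0 z; have [dq Fq _] := H _ (prj_nball ze).
have Wq := dW _ dq; have [Uq Vq] := WU _ Wq; have Sq : S q := prj_S ze.
have Dlow l : low l -> 'D_(jshift v) (fun q => Sig q 0 l) q = 0.
  apply: (Sshift Uq Sq) => m lm; rewrite -(straight_low X lm) derive_straight_dF' //.
  by case: eqP => // E; move: lm; rewrite -E (negbTE lk0).
have Dvan b j : (j < w b)%N -> (j < i)%N ->
    'D_v (fun q => (jet (fun x => X x 0 b) (vec_mx q))`_j) q = 0.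
  move=> jw ji; apply: derive_vanish => //; last by move=> p Sp dp; exact: Si.
  by apply: smoothE_sub (@smoothE_jet _ _ _ _ _ j oV (sX b)) => p /WU[].
have E0 : 'D_(jshift v) (fun q => (jet (fun x => X x 0 a) (vec_mx q))`_i) q = 0.
  rewrite (derive_jet_jshift _ oV (sX a) Vq (leq_trans (ltnW ia) (wr a))).
  case Ei : i => [//|i0]; apply: Dvan; rewrite ?Ei //.
  by rewrite -Ei in ia *; apply: leq_trans _ (ltnW ia); rewrite Ei.
have df : differentiable (leading a) (straight X q).
  by rewrite Fq; exact: smoothE_differentiable (@open_nball _ _ e) (smooth_leading a) (prj_nball ze).
have dS l : differentiable (fun q => straight X q 0 l) q.
  exact: smoothE_differentiable oW (smooth_straightW l) Wq.
have [_ CR] := chain_rule (jshift v) dS df.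
have : 'D_(jshift v) (leading a \o straight X) q = 0.
  rewrite -[RHS]E0; apply: (@derive_near _ _ d) => // y dy /=.
  by rewrite /leading FK //; exact: dW.
rewrite CR (bigD1 k) //= big1 ?addr0 => [|l lk'].
  rewrite (straight_high X lk) /jX Ej (derive_jet_jshift _ oV (sX _) Vq); last by rewrite -Ej jrow_le.
  have := derive_straight_dF' k0 k0 ze; rewrite (straight_high X lk0) eqxx /jX r0 c0 => ->.
  by rewrite mulr1 Fq.
have [ll|ll] := boolP (low l); first by rewrite (straight_low X ll) Dlow // mulr0.
rewrite (straight_high X ll) /jX (derive_jet_jshift _ oV (sX _) Vq (jrow_le l)).
case El : (jrow l) => [|j1]; first by rewrite mulr0.
have j1r : (j1 < r.+1)%N by have := jrow_le l; rewrite El ltnS => /ltnW.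
have [wl|lw] := leqP (w (jcol l)) j1.
  pose l1 : 'I_jdim := mxvec_index (inord j1) (jcol l).
  have r1 : jrow l1 = j1 by rewrite jrowE inordK.
  have c1 : jcol l1 = jcol l by rewrite jcolE.
  have ll1 : ~~ low l1 by rewrite /low r1 c1 -leqNgt.
  have := derive_straight_dF' k0 l1 ze; rewrite (straight_high X ll1) /jX r1 c1 => ->.
  case: eqP => [E|]; rewrite ?mulr0 //; case/eqP: lk'; apply: jindex_inj.
    by rewrite El Ej -r0 -r1 E.
  by rewrite -c0 -c1 E.
have [ji|ij] := ltnP j1 i; first by rewrite Dvan // mulr0.
by rewrite Fq derive_leading_high ?mul0r // El ltnS.
Qed.


Let sel (k : 'I_jdim) := (jrow k == w (jcol k)) && (w (jcol k) <= i)%N.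

(** Places y_b at position (w b, b) when [w b] is at most [i]; the weights of the two dilations then
    correspond. *)
Let emb (y : 'rV[R]_n) : 'rV[R]_jdim := \row_k (if sel k then y 0 (jcol k) else 0).

Let emb_nball y : nball e y -> nball e (emb y).
Proof.
apply: le_lt_trans; apply: rV_norm_le => // k; rewrite mxE.
by case: (sel k); rewrite ?normr0 //; exact: rV_norm_coord.
Qed.

Let smooth_prj_emb O k : open O -> smoothE O (fun y => prj (emb y) 0 k).
Proof.
move=> oO; rewrite (_ : (fun y => _) = (fun y : 'rV[R]_n => ((~~ low k)%:R * (sel k)%:R) * y 0 (jcol k))).
  by apply: smoothEZ => //; exact: smoothE_coord.
by apply/funext => y; rewrite !mxE; case: (sel k); rewrite ?mulr1 // !mulr0 mul0r.
Qed.

(** By [derive_leading], [leading a] on [S] depends only on the entries that [emb] fills, so it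
    becomes a function on R^n into which the coordinates [X] themselves can be substituted. *)
Definition correction a y := leading a (prj (emb y)).

Let correction_nball y : nball e y -> nball e (prj (emb y)).
Proof. by move=> ye; exact/prj_nball/emb_nball. Qed.

Lemma smooth_correction a : smoothE (nball e) (correction a).
Proof.
apply: smoothE_comp (@open_nball _ _ e) (@open_nball _ _ e) correction_nball _ (smooth_leading a).
by move=> k; apply: smooth_prj_emb; exact: open_nball.
Qed.

Lemma whom_correction a : whom w e i (correction a).
Proof.
move=> y t ye t01; rewrite /correction -(leading_whom _ (emb_nball ye) t01).
congr (leading a (prj _)); apply/rowP => k; rewrite !mxE.
by case: ifP => [/andP[/eqP -> _]|]; rewrite ?mulr0.
Qed.

Lemma near0_straight : exists2 rho : R, 0 < rho & forall q, nball rho q ->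
  [/\ nball d q, nball e (straight X q) & nball e (X (jbase (vec_mx q)))].
Proof.
have [oV V0 sX X0 DX0] := nX; have [WU dfW dW ep H] := sc.
have e0 m : nbhs (0 : 'rV[R]_m) (nball e).
  by apply: open_nbhs_nbhs; split; [exact: open_nball | rewrite /nball /= normr0].
have [dF0 F0 _] := H 0 (nbhs_singleton (e0 jdim)).
(* The ball [nball d] contains [F' 0], so its radius is positive and it contains 0. *)
have W0 : W 0.
  have [oW oFW FK _ sF'] := dfW; have [q0 [Uq0 Vq0]] : exists q0, U q0 /\ jdom V q0.
    by exists (F' 0); apply: WU; exact: dW.
  apply: dW; apply: le_lt_trans dF0; rewrite normr0 //.
have [U0' Vj0] := WU _ W0.
have n1 : nbhs (0 : 'rV[R]_jdim) (nball d).
  apply: open_nbhs_nbhs; split; [exact: open_nball | apply: le_lt_trans dF0; rewrite normr0 //].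
have cS : {for 0, continuous (straight X)}.
  by apply: continuous_rV => b; exact: smoothE_cont (smooth_straightW b) W0.
have n2 : nbhs (0 : 'rV[R]_jdim) (straight X @^-1` nball e).
  by apply: cS; rewrite (straight0 X0); exact: e0.
have cX : {for 0, continuous (fun q : 'rV[R]_jdim => X (jbase (vec_mx q)))}.
  apply: continuous_rV => b; have := continuous_jet_vec (i := 0%N) oV (sX b) Vj0.
  by rewrite (_ : (fun q => _) = (fun q => X (jbase (vec_mx q)) 0 b)) //; apply/funext => q; rewrite jet0.
have n3 : nbhs (0 : 'rV[R]_jdim) ((fun q => X (jbase (vec_mx q))) @^-1` nball e).
  apply: cX; rewrite (_ : jbase _ = 0) ?X0; first exact: e0.
  by apply/rowP => b; rewrite !mxE.
have /near_normP[rho rp Hr] := near_setI n1 (near_setI n2 n3).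
by exists rho => // q qr; have [|? []] := Hr q; rewrite ?subr0.
Qed.

(** By [Si], the jet of X_c along [q] starts at order [w c] whenever [w c] is at most [i]. So
    [jet_whom] applies with [z] the coefficients at these orders, and the value there is [leading b]
    at the chart coordinates of [q], that is u_i(X_b). *)
Lemma jet_correction q b j : S q -> nball d q -> nball e (straight X q) ->
  nball e (X (jbase (vec_mx q))) -> (j <= i)%N -> (i < w b)%N ->
  (jet (fun x => correction b (X x)) (vec_mx q))`_j =
  if j == i then (jet (fun x => X x 0 b) (vec_mx q))`_i else 0.
Proof.
move=> Sq dq eq eX ji ib; have [oV V0 sX X0 DX0] := nX; have [WU [oW oFW FK _ _] dW ep H] := sc.
have [Uq Vq] := WU _ (dW _ dq).
have jir : (j <= r)%N by apply: leq_trans ji (leq_trans (ltnW ib) (wr b)).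
pose V' := V `&` X @^-1` nball e.
have oV' : open V' by apply: open_smooth_preimage oV sX (@open_nball _ _ e).
have sX' : smoothE_map V' X by move=> c; apply: smoothE_sub (sX c) => x [].
rewrite (jet_comp oV' (@open_nball _ _ e) sX' _ (smooth_correction b)) //; last by move=> x [].
have iw c (wc : (w c <= i)%N) : (w c < r.+1)%N.
  by rewrite ltnS (leq_trans wc) // (leq_trans (ltnW ib)).
pose z : 'rV[R]_n := \row_c (if (w c <= i)%N then straight X q 0 (mxvec_index (inord (w c)) c) else 0).
have ze : nball e z.
  apply: le_lt_trans eq; apply: rV_norm_le => // c; rewrite mxE; case: leqP => _; last by rewrite normr0.
  exact: rV_norm_coord.
have hz c : (w c <= i)%N -> z 0 c = (jet (fun x => X x 0 c) (vec_mx q))`_(w c).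
  move=> wc; rewrite mxE wc [LHS]mxE /low /jX jrowE jcolE inordK ?iw //.
  by rewrite ltnn.
have Si' c l : (l < w c)%N -> (w c <= i)%N -> (jet (fun x => X x 0 c) (vec_mx q))`_l = 0.
  by move=> lw wc; apply: Si => //; exact: leq_trans lw wc.
rewrite (jet_whom (z := z) (smooth_correction b) (@whom_correction b)) //.
- case: eqP => // _; rewrite /correction.
  have -> : leading b (prj (emb z)) = leading b (prj (straight X q)).
    apply: (constant_directions (d := e) (K := sel) (f := fun z => leading b (prj z))) => //.
    + apply: smoothE_comp (@open_nball _ _ e) (@open_nball _ _ e) prj_nball _ (smooth_leading b) => k.
      rewrite (_ : (fun x => _) = (fun x : 'rV[R]_jdim => (~~ low k)%:R * x 0 k)).
        by apply: smoothEZ; [exact: open_nball | apply: smoothE_coord; exact: open_nball].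
      by apply/funext => x; rewrite mxE.
    + by move=> k x nk xe; exact: derive_leading.
    + exact: emb_nball.
    + move=> k sk; rewrite mxE sk; have /andP[/eqP rk wk] := sk; rewrite hz // -rk.
      have lk : ~~ low k by rewrite /low rk ltnn.
      by rewrite [RHS]mxE (negbTE lk).
  have -> : prj (straight X q) = straight X q.
    apply/rowP => k; rewrite mxE; have [lk|_] := boolP (low k); rewrite ?mul1r // mul0r mxE lk.
    by rewrite ((SP Uq).1 Sq k lk).
  by rewrite /leading FK //; exact: dW.
- by rewrite jbase_jmap.
- by move=> c l lw wc; rewrite jcoord_jmap Si'.
- by move=> c wc; rewrite jcoord_jmap hz.
Qed.

(** This keeps the corrected coordinates tangent to the identity. In the chart [straight X], whose
    differential at 0 is the identity, the differential of [leading a] at 0 is the coordinate (i,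
    a). That coordinate is low because [i < w a], and [prj] kills it. *)
Lemma derive_correction0 a c : (i < w a)%N -> 'D_(delta_mx 0 c) (correction a) 0 = 0.
Proof.
move=> ia; have [oV V0 sX X0 DX0] := nX; have [WU [oW oFW FK _ _] dW ep H] := sc.
have e0 m : nball e (0 : 'rV[R]_m) by rewrite /nball /= normr0.
have E0 : prj (emb 0) = 0 by apply/rowP => k; rewrite !mxE; case: (sel k); rewrite ?mxE mulr0.
have [rho rp Hr] := near0_straight.
have r0 : nball rho (0 : 'rV[R]_jdim) by rewrite /nball /= normr0.
have [d0 _ _] := Hr 0 r0; have W0 := dW _ d0.
have dl : differentiable (leading a) (prj (emb 0)).
  by rewrite E0; exact: smoothE_differentiable (@open_nball _ _ e) (smooth_leading a) (e0 _).
have dl' : differentiable (leading a) (straight X 0) by rewrite (straight0 X0) -E0.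
have dpe b : differentiable (fun y => prj (emb y) 0 b) 0.
  by exact: smoothE_differentiable (@open_nball _ _ e) (smooth_prj_emb b (@open_nball _ _ e)) (e0 _).
have [_ ->] := chain_rule (delta_mx 0 c) dpe dl.
rewrite E0 big1 // => k _; have [lk|lk] := boolP (low k).
  rewrite (_ : (fun y => _) = (fun=> 0)) ?derive_cst ?mulr0 //.
  by apply/funext => y; rewrite mxE lk mul0r.
suff -> : 'D_(delta_mx 0 k) (leading a) 0 = 0 by rewrite mul0r.
have dS l : differentiable (fun q => straight X q 0 l) 0.
  exact: smoothE_differentiable oW (smooth_straightW l) W0.
have [_ CR] := chain_rule (delta_mx 0 k) dS dl'.
have ir : (i < r.+1)%N by rewrite ltnS (leq_trans (ltnW ia)).
pose k1 : 'I_jdim := mxvec_index (inord i) a.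
have : 'D_(delta_mx 0 k) (leading a \o straight X) 0 = (k == k1)%:R.
  rewrite -(derive_jX0 oV V0 sX DX0 k k1) /jX jrowE jcolE inordK //.
  apply: (@derive_near _ _ d) => // y dy /=; rewrite /leading FK //; exact: dW.
rewrite CR (straight0 X0) (bigD1 k) //= big1 ?addr0 => [|l lk'].
  rewrite (derive_straight0 oV V0 sX DX0) eqxx mulr1 => ->; case: eqP => // E.
  by move: lk; rewrite E /low jrowE jcolE inordK // ia.
by rewrite (derive_straight0 oV V0 sX DX0) eq_sym (negbTE lk') mulr0.
Qed.

End improvement.

Let S0 : S 0.
Proof. by apply/(SP U0) => k _; rewrite Sig0 mxE. Qed.

Lemma improve V X i (d0 : R) : near_identity V X -> 0 < d0 -> straightened X i d0 ->
  exists V' X' (d' : R), [/\ near_identity V' X', 0 < d' & straightened X' i.+1 d'].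
Proof.
move=> nX d0p Si0; have [d [e [W [F' [/andP[dp dd0] sc _]]]]] := straight_chart_exists nX d0p.
have Si : straightened X i d by move=> q Sq dq; apply: Si0 => //; exact: lt_le_trans dd0.
have [rho rp Hr] := near0_straight nX sc.
have [oV V0 sX X0 DX0] := nX.
pose corr := correction X i F'.
pose V' := V `&` X @^-1` nball e.
have e0 m : nball e (0 : 'rV[R]_m) by have [_ _ _ ep _] := sc; rewrite /nball /= normr0.
have oV' : open V' by exact: open_smooth_preimage oV sX (@open_nball _ _ e).
have V'0 : V' 0 by split=> //; rewrite /= X0.
have sX' : smoothE_map V' X by move=> c; apply: smoothE_sub (sX c) => x [].
have sc' a : smoothE V' (fun x => corr a (X x)).
  have hV x : V' x -> nball e (X x) by case.
  exact: (smoothE_comp oV' (@open_nball _ _ e) hV sX' (smooth_correction i nX sc a)).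
pose X' x : 'rV[R]_n := \row_a (if (i < w a)%N then X x 0 a - corr a (X x) else X x 0 a).
have X'lo a : (i < w a)%N -> (fun x => X' x 0 a) = (fun x => X x 0 a - corr a (X x)).
  by move=> ia; apply/funext => x; rewrite mxE ia.
have X'hi a : ~~ (i < w a)%N -> (fun x => X' x 0 a) = (fun x => X x 0 a).
  by move=> ia; apply/funext => x; rewrite mxE (negbTE ia).
have r0 : nball rho (0 : 'rV[R]_jdim) by rewrite /nball /= normr0.
have [d00 eS0 eX0] := Hr 0 r0.
have b0 : jbase (vec_mx (0 : 'rV[R]_jdim)) = 0 by apply/rowP => a; rewrite !mxE.
have c0 a : (i < w a)%N -> corr a 0 = 0.
  move=> ia; have := jet_correction nX sc Si S0 d00 eS0 eX0 (leq0n i) ia.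
  by rewrite /corr jet0 b0 X0 => ->; case: eqP => // <-; rewrite jet0 b0 X0 mxE.
exists V', X', rho; split=> //.
  split=> //.
  - move=> a; have [ia|ia] := boolP (i < w a)%N; last by rewrite X'hi.
    by rewrite X'lo //; apply: smoothEB.
  - apply/rowP => a; rewrite [LHS]mxE [RHS]mxE X0; have [ia|_] := boolP (i < w a)%N; last by rewrite mxE.
    by rewrite c0 // mxE subr0.
  - move=> a b; have [ib|ib] := boolP (i < w b)%N; last by rewrite X'hi.
    rewrite X'lo // (_ : (fun x => _) = (fun x => X x 0 b) - (fun x => corr b (X x))) //.
    rewrite deriveB; [|exact: smoothE_derivable oV' (sX' b) V'0|exact: smoothE_derivable oV' (sc' b) V'0].
    rewrite DX0; have dX c : differentiable (fun x => X x 0 c) 0.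
      exact: smoothE_differentiable oV' (sX' c) V'0.
    have dc : differentiable (corr b) (X 0).
      rewrite X0; exact: smoothE_differentiable (@open_nball _ _ e) (smooth_correction i nX sc b) (e0 _).
    have [_ ->] := chain_rule (delta_mx 0 a) dX dc.
    rewrite X0 big1 ?subr0 // => c _.
    by rewrite (derive_correction0 nX sc) // mul0r.
move=> q Sq qr b j jw ji; have [dq eq eX] := Hr q qr.
have [ib|ib] := boolP (i < w b)%N; last first.
  rewrite X'hi //; apply: Si => //; apply: leq_trans jw _; by rewrite leqNgt.
rewrite X'lo // (_ : (fun x => _) = (fun x => (-1) * corr b (X x) + X x 0 b)); last first.
  by apply/funext => x; ring.
have Vq : V' (jbase (vec_mx q)).
  split=> //; have [WU _ dW _ _] := sc; by have [] := WU _ (dW _ dq).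
rewrite (jet_lin (-1) oV' Vq (sc' b) (sX' b)) coefD coefZ.
rewrite (jet_correction nX sc Si Sq dq eq eX ji ib).
case: eqP => [->|/eqP ji']; first by rewrite mulN1r addNr.
by rewrite mulr0 add0r Si // ltn_neqAle ji' -ltnS.
Qed.

Lemma straightened_exists i : exists V X (d : R), [/\ near_identity V X, 0 < d & straightened X i d].
Proof.
elim: i => [|i [V [X [d [nX dp Si]]]]]; last exact: improve nX dp Si.
exists setT, id, 1; split=> //; split=> //; first exact: openT.
- by move=> a; apply: smoothE_coord; exact: openT.
- by move=> a b; rewrite (is_derive_eqE (derive_coord _ _ _)) mxE eqxx eq_sym.
Qed.

Lemma jet_map_injective V X X' q q' : diffeo V X X' -> V (jbase (vec_mx q)) -> V (jbase (vec_mx q')) ->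
  (forall k, jX X k q = jX X k q') -> q = q'.
Proof.
move=> [oV oXV XK sX sX'] Vq Vq' E.
have jm : jmap X (vec_mx q) = jmap X (vec_mx q') :> 'M[R]_(r.+1, n).
  apply/matrixP => j b; rewrite !mxE; have := E (mxvec_index j b).
  by rewrite /jX jrowE jcolE.
have jc (p : 'rV[R]_jdim) a : V (jbase (vec_mx p)) -> jcoord (vec_mx p) a = jet (fun x => X' x 0 a) (jmap X (vec_mx p)) :> {poly R}.
  have hV x : V x -> (X @` V) (X x) by move=> Vx; exists x.
  move=> Vp; rewrite -(jet_comp oV oXV sX hV (sX' a) Vp).
  by rewrite -jet_coord; apply: jet_ext oV Vp _ => x Vx; rewrite XK.
by apply/rowP => k; rewrite !vec_mx_entry !jc // jm.
Qed.

(** The straightened coordinates describe [S] first in a ball around the zero jet. A jet that is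
    merely based near 0 is contracted into this ball by a dilation, which preserves both [S] and the
    vanishing of the coefficients. *)
Lemma normal_form_chart D : open D -> D 0 -> exists V X X', [/\ V `<=` D, V 0, diffeo V X X' &
  forall q, V (jbase (vec_mx q)) ->
    (S q <-> forall b j, (j < w b)%N -> (jet (fun x => X x 0 b) (vec_mx q))`_j = 0)].
Proof.
move=> oD D0; have [V [X [d0 [nX d0p Sr]]]] := straightened_exists r.
have [oV V0 sX X0 DX0] := nX.
have [V1 [X1 [V1V V10 dX1]]] := near_identity_inverse oV V0 sX X0 DX0.
have [oV1 _ _ _ _] := dX1.
have /near_normP[d1 d1p Hd1] : nbhs (0 : 'rV[R]_n) V1 by exact: open_nbhs_nbhs.
have d01 : 0 < Num.min d0 d1 by rewrite lt_min d0p.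
have [d [e [W [F' [/andP[dp dd0] sc Wj]]]]] := straight_chart_exists nX d01.
have V1j (q : 'rV[R]_jdim) : nball d q -> V1 (jbase (vec_mx q)).
  by move=> dq; apply: Hd1; rewrite subr0; apply: lt_le_trans (Wj q dq) _; rewrite ge_min lexx orbT.
have Sd q b j : S q -> nball d q -> (j < w b)%N -> (jet (fun x => X x 0 b) (vec_mx q))`_j = 0.
  move=> Sq dq jw; apply: Sr => //; last exact: leq_trans jw (wr b).
  by apply: lt_le_trans dq _; apply: le_trans dd0 _; rewrite ge_min lexx.
have [WU _ dW ep H] := sc.
have Vj0 : jdom V (0 : 'rV[R]_jdim).
  by rewrite /jdom /= (_ : jbase _ = 0) //; apply/rowP => a; rewrite !mxE.
have [eta etap Heta] : exists2 eta : R, 0 < eta & forall q, nball eta q ->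
    nball d q /\ forall k, `|jX X k q| <= e / 2.
  have n1 : nbhs (0 : 'rV[R]_jdim) (nball d).
    by apply: open_nbhs_nbhs; split; [exact: open_nball | rewrite /nball /= normr0].
  have n2 : nbhs (0 : 'rV[R]_jdim) (fun q => forall k, `|jX X k q| <= e / 2).
    apply: near_forall => k; have c := smoothE_cont (@smooth_jX V X oV sX k) Vj0.
    have e2 : 0 < e / 2 by rewrite divr_gt0.
    have := (continuous_normP _ _).1 c _ e2; apply: filterS => q.
    by rewrite {1}/jX jet_vec0 X0 mxE; case: ifP => _; rewrite sub0r normrN.
  have /near_normP[eta etap He] := near_setI n1 n2.
  by exists eta => // q qe; have [|] := He q; rewrite ?subr0.
have local q : nball eta q ->
    (S q <-> forall b j, (j < w b)%N -> (jet (fun x => X x 0 b) (vec_mx q))`_j = 0).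
  move=> qe; have [dq jq] := Heta q qe; split=> [Sq b j jw|cond]; first exact: Sd.
  (* The low entries of [z] are 0, so [F' z] is a point of [S] with the high jets of [q]. The low
     jets of both vanish, and a jet is determined by its image under [X]. *)
  pose z : 'rV[R]_jdim := \row_k jX X k q.
  have ze : nball e z.
    apply: (@le_lt_trans _ _ (e / 2)); last by rewrite ltr_pdivrMr // ltr_pMr // ltr1n.
    by apply: rV_norm_le => [|k]; [rewrite divr_ge0 // ltW | rewrite mxE].
  have [dz Fz SFz] := H z ze.
  have Sz : S (F' z) by apply/SFz => k lk; rewrite mxE; exact: cond.
  suff -> : q = F' z by [].
  apply: jet_map_injective dX1 (V1j _ dq) (V1j _ dz) _ => k.
  have [lk|lk] := boolP (low k); first by rewrite /jX cond // (Sd _ _ _ Sz dz).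
  have := congr1 (fun z : 'rV[R]_jdim => z 0 k) Fz.
  by rewrite !mxE (negbTE lk).
pose U2 := V `&` (D `&` nball eta).
have oU2 : open U2 by apply: openI => //; apply: openI => //; exact: open_nball.
have U20 : U2 0 by split=> //; split=> //; rewrite /nball /= normr0.
have sX2 : smoothE_map U2 X by move=> a; apply: smoothE_sub (sX a) => x [].
have [V2 [X2 [V2U V20 dX2]]] := near_identity_inverse oU2 U20 sX2 X0 DX0.
exists V2, X, X2; split=> //; first by move=> x /V2U[_ []].
move=> q V2q; have [_ [_ bq]] := V2U _ V2q.
(* Rows of positive weight shrink at least by the factor [t]. Row 0, the base point, is fixed by the
   dilation and is small because [q] is based in [V2]. *)
pose t : R := Num.min 1 (eta / 2 / (`|q| + 1)).
have q1 : 0 < `|q| + 1 by rewrite ltr_wpDl.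
have t0 : 0 < t by rewrite lt_min ltr01 !divr_gt0.
have t1 : t <= 1 by rewrite ge_min lexx.
have small : nball eta (wscl jrow t q).
  apply: (@le_lt_trans _ _ (Num.max `|jbase (vec_mx q)| (t * `|q|))); last first.
    rewrite gt_max bq; apply: (@le_lt_trans _ _ (eta / 2)); last by rewrite ltr_pdivrMr // ltr_pMr // ltr1n.
    apply: (@le_trans _ _ (t * (`|q| + 1))); first by apply: ler_wpM2l; [exact: ltW | rewrite lerDl].
    by rewrite -ler_pdivlMr // ge_min lexx orbT.
  apply: rV_norm_le => [|k]; first by rewrite le_max normr_ge0.
  rewrite mxE le_max; case Ek : (jrow k) => [|j].
    apply/orP; left; rewrite expr0 mul1r vec_mx_entry Ek jcoord0; exact: rV_norm_coord.
  apply/orP; right; rewrite normrM; apply: ler_pM => //; last exact: rV_norm_coord.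
  rewrite normrX (gtr0_norm t0) exprS.
  by apply: ler_piMr; [exact: ltW | exact: exprn_ile1 (ltW t0) t1].
have St : S q <-> S (wscl jrow t q).
  split; first exact: Skappa.
  move=> /(Skappa t^-1); rewrite (_ : wscl jrow t^-1 _ = q) //.
  apply/rowP => k; rewrite !mxE mulrA -exprMn mulVf ?expr1n ?mul1r // gt_eqF //.
rewrite St (local _ small) vec_mx_wscl.
split=> C b j jw; have := C b j jw; rewrite jet_kappa; last by move=> ->; rewrite mulr0.
by move/eqP; rewrite mulf_eq0 expf_eq0 (gt_eqF t0) andbF => /eqP.
Qed.

End normal_form.

(** * Coordinates adapted to a flag of subspaces *)

Section flags.
Context {R : realType} {n : nat}.
Implicit Types (V : nat -> {vspace 'rV[R]_n}).

(** The bases are nested, so an initial part of the last one is a basis of each member of the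
    flag. *)
Fixpoint flag_basis V (j : nat) : seq 'rV[R]_n :=
  if j is i.+1 then flag_basis V i ++ vbasis (V i.+1 :\: V i)%VS else vbasis (V 0%N).

Lemma flag_basisP V j : (forall i, (i < j)%N -> (V i <= V i.+1)%VS) -> basis_of (V j) (flag_basis V j).
Proof.
elim: j => [|j IH] VS /=; first exact: vbasisP.
have -> : V j.+1 = (V j + (V j.+1 :\: V j))%VS.
  by rewrite addvC addv_diff; apply/esym/addv_idPl/VS.
have -> : ((V j + (V j.+1 :\: V j)) :\: V j = V j.+1 :\: V j)%VS.
  by rewrite addvC addv_diff (addv_idPl (VS j (ltnSn j))).
apply: cat_basis; last exact: vbasisP.
  by apply/directv_addP; rewrite capvC capv_diff.
by apply: IH => i ij; exact/VS/ltnW.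
Qed.

Lemma size_flag_basis V j : (forall i, (i < j)%N -> (V i <= V i.+1)%VS) ->
  size (flag_basis V j) = \dim (V j).
Proof. by move=> VS; have := @size_basis _ _ (V j) _ (in_tuple (flag_basis V j)) (flag_basisP VS). Qed.

Lemma take_flag_basis V i j : (i <= j)%N -> (forall i, (i < j)%N -> (V i <= V i.+1)%VS) ->
  take (\dim (V i)) (flag_basis V j) = flag_basis V i.
Proof.
elim: j => [|j IH] ij VS; first by move: ij; rewrite leqn0 => /eqP ->; rewrite -size_flag_basis ?take_size.
have [ij'|ji] := leqP i j; last first.
  by have -> : i = j.+1 by [apply/eqP; rewrite eqn_leq ij]; rewrite -size_flag_basis ?take_size.
have VS' k : (k < j)%N -> (V k <= V k.+1)%VS by move=> kj; exact/VS/ltnW.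
rewrite /= takel_cat; first exact: IH.
rewrite size_flag_basis // dimvS //.
elim: {IH ij VS} j ij' VS' => [|j IH] ij VS; first by move: ij; rewrite leqn0 => /eqP ->.
move: ij; rewrite leq_eqVlt ltnS => /orP[/eqP -> //|ij].
by apply: subv_trans (VS j (ltnSn j)); apply: IH => // k kj; exact/VS/ltnW.
Qed.

(** The rows of [B] form a basis adapted to the flag. As [V j] is spanned by the first [\dim (V j)]
    of them, it is cut out by the remaining coordinates. *)
Lemma flag_coordinates V r : (forall i, (i < r)%N -> (V i <= V i.+1)%VS) -> V r = fullv ->
  exists B L : 'M[R]_n, [/\ B *m L = 1%:M, L *m B = 1%:M & forall j u, (j <= r)%N ->
    (u \in V j <-> forall b : 'I_n, (\dim (V j) <= b)%N -> (u *m L) 0 b = 0)].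
Proof.
move=> VS Vr; have bX := flag_basisP VS.
have sX : size (flag_basis V r) = n by rewrite size_flag_basis // Vr dimvf /dim /= mul1n.
pose B : 'M[R]_n := \matrix_(i, j) (flag_basis V r)`_i 0 j.
have rowB u : u *m B = \sum_(i < n) u 0 i *: (flag_basis V r)`_i.
  apply/rowP => j; rewrite !mxE summxE; apply: eq_bigr => i _; by rewrite !mxE.
have uB : B \in unitmx.
  rewrite -row_free_unit -kermx_eq0; apply/eqP/row_matrixP => i; rewrite row0.
  set u := row i _; have : u *m B = 0 by rewrite -row_mul mulmx_ker row0.
  rewrite rowB => /= E; have sXb : size (flag_basis V r) == n by rewrite sX.
  have fX : free (Tuple sXb) := basis_free bX.
  apply/rowP => j; rewrite [RHS]mxE; move/freeP: fX => /(_ (fun i => u 0 i) E).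
  exact.
exists B, (invmx B); rewrite mulmxV // mulVmx //; split=> // j u jr.
have bj : basis_of (V j) (flag_basis V j).
  by apply: flag_basisP => i ij; apply: VS; exact: leq_trans ij jr.
have Ej := take_flag_basis jr VS.
have dn : (\dim (V j) <= n)%N.
  have := dimvS (subvf (V j)); by rewrite dimvf /dim /= mul1n.
have nthE i : (i < \dim (V j))%N -> (flag_basis V j)`_i = (flag_basis V r)`_i.
  by move=> id; rewrite -Ej nth_take.
have sj : size (flag_basis V j) = \dim (V j).
  by apply: size_flag_basis => i ij; apply: VS; exact: leq_trans ij jr.
split=> [uV b db|H].
  have := uV; rewrite -(span_basis bj).
  have sjb : size (flag_basis V j) == \dim (V j) by rewrite sj.
  move=> /(coord_span (X := Tuple sjb)); set c := coord _ => E.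
  pose v : 'rV[R]_n := \sum_i c i u *: delta_mx 0 (widen_ord dn i).
  have -> : u = v *m B.
    rewrite mulmx_suml [LHS]E; apply: eq_bigr => i _; rewrite -scalemxAl -rowE.
    congr (_ *: _); apply/rowP => k; rewrite !mxE /=; by rewrite -nthE.
  rewrite mulmxK // summxE big1 // => i _; rewrite !mxE eqxx /=.
  case: eqP => [Eb|]; last by rewrite mulr0.
  by move: db; rewrite Eb /= leqNgt ltn_ord.
rewrite -(mulmxKV uB u) rowB; apply: rpred_sum => b _; have [db|bd] := leqP (\dim (V j)) b.
  by rewrite H // scale0r mem0v.
rewrite memvZ // -nthE //; rewrite -(span_basis bj); apply: memv_span.
by apply: mem_nth; rewrite sj.
Qed.

End flags.

(** * Tangent vectors as velocities of curves *)

Section curves.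
Context {R : realType}.

(* The line t |-> t u, slowed down to stay bounded without changing its velocity at 0 *)
Definition retract (c t : R) : R := t / (1 + c ^+ 2 * t ^+ 2).

Lemma retract_den (c t : R) : 0 < 1 + c ^+ 2 * t ^+ 2.
Proof. by rewrite ltr_wpDr // mulr_ge0 // sqr_ge0. Qed.

Lemma smooth1_retract c : smooth1 (retract c).
Proof.
have o := @open_setT R 1; rewrite /smooth1 /retract; apply: (smoothEM o); first exact: smoothE_coord.
apply: (smoothE_inv o); first by move=> x _; rewrite gt_eqF // retract_den.
apply: (smoothED o); first exact: smoothE_cst.
by apply: (smoothEZ _ o); apply: (smoothEX _ o); exact: smoothE_coord.
Qed.

(** This is the inequality [0 <= (1 - c * |t|) ^+ 2]. *)
Lemma retract_bound (c t : R) : 0 < c -> `|retract c t| <= (2 * c)^-1.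
Proof.
move=> c0; rewrite normrM normfV (gtr0_norm (retract_den c t)).
rewrite ler_pdivrMr ?retract_den // ler_pdivlMl ?mulr_gt0 //.
have := sqr_ge0 (1 - c * `|t|); rewrite sqrrB expr1n mul1r exprMn real_normK ?num_real //.
by rewrite mulrA; lra.
Qed.

Lemma derive_retract0 c : is_derive (0 : R) 1 (retract c) 1.
Proof.
have [dr _] := smooth1_derive (smooth1_retract c).
pose g (t : R) := 1 + c ^+ 2 * t ^+ 2.
have dg : derivable g 0 1.
  have D1 : is_derive (0 : R) 1 (fun t : R => 1 : R) 0 by exact: is_derive_cst.
  exact: is_derive_ex (is_deriveD D1 (is_derive_cpow (c ^+ 2) 0 2)).
apply: DeriveDef; first exact: dr.
have := derive_mul (dr 0) dg; rewrite (_ : (fun t => retract c t * g t) = id); last first.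
  by apply/funext => t; rewrite /retract divfK // gt_eqF // retract_den.
rewrite derive_id /retract mul0r mul0r addr0 /g expr0n mulr0 addr0 mulr1.
by move=> <-.
Qed.

(** [tangent_at] asks for curves defined on all of R, so a line with a given velocity is slowed down
    until it fits into the [e]-ball. It still moves only along the coordinates in which [u] is
    nonzero. *)
Lemma bounded_curve m (y u : 'rV[R]_m) (e : R) : 0 < e -> exists h : R -> 'rV[R]_m,
  [/\ h 0 = y, forall t, `|h t - y| < e, forall a, smooth1 (fun t => h t 0 a),
      forall a, is_derive (0 : R) 1 (fun t => h t 0 a) (u 0 a) &
      forall t a, u 0 a = 0 -> h t 0 a = y 0 a].
Proof.
move=> e0; pose c := (`|u| + 1) / e.
have u1 : 0 < `|u| + 1 by rewrite ltr_wpDl.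
have c0 : 0 < c by rewrite divr_gt0.
have hE a : (fun t => (y + retract c t *: u) 0 a) = (fun t => y 0 a + u 0 a * retract c t).
  by apply/funext => t; rewrite !mxE mulrC.
exists (fun t => y + retract c t *: u); split.
- by rewrite /retract mul0r scale0r addr0.
- move=> t; rewrite addrC addKr normrZ; apply: (@le_lt_trans _ _ ((2 * c)^-1 * `|u|)).
    by rewrite ler_wpM2r // retract_bound.
  rewrite [X in X < _]mulrC ltr_pdivrMr; last by rewrite mulr_gt0.
  have -> : e * (2 * c) = 2 * (`|u| + 1) by rewrite /c; field; rewrite gt_eqF.
  by have := normr_ge0 u; lra.
- move=> a; rewrite hE; have o := @open_setT R 1; apply: (smoothED o); first exact: smoothE_cst.
  by apply: (smoothEZ _ o); exact: smooth1_retract.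
- move=> a; rewrite hE; have D := derive_retract0 c.
  have D2 : is_derive (0 : R) 1 (fun t => u 0 a * retract c t) (u 0 a * 1) by apply: is_deriveZ.
  have D1 : is_derive (0 : R) 1 (fun t : R => y 0 a) 0 by exact: is_derive_cst.
  by have := is_deriveD D1 D2; rewrite add0r mulr1.
- by move=> t a u0; rewrite !mxE u0 mulr0 addr0.
Qed.

(** Differentiability at 0 is all that is required, so that a curve may be modified away from 0
    without regard to smoothness; one derivative suffices for [curve_slice]. *)
Definition dcurve m (S : set 'rV[R]_m) (q v : 'rV[R]_m) (g : R -> 'rV[R]_m) :=
  [/\ forall t, S (g t), g 0 = q & forall a, is_derive (0 : R) 1 (fun t => g t 0 a) (v 0 a)].

Definition scurve m (S : set 'rV[R]_m) (q v : 'rV[R]_m) (g : R -> 'rV[R]_m) :=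
  dcurve S q v g /\ forall a, smooth1 (fun t => g t 0 a).

Section slice.
Variables (m k : nat) (S U : set 'rV[R]_m) (psi psi' : 'rV[R]_m -> 'rV[R]_m).
Hypotheses (dpsi : diffeo U psi psi').
Hypothesis SU : forall y, U y -> (S y <-> forall j : 'I_m, (k <= j)%N -> psi y 0 j = 0).

Lemma diffeo_differentiable q a : U q -> differentiable (fun x => psi x 0 a) q.
Proof. by case: dpsi => oU _ _ s _ Uq; exact: smoothE_differentiable oU (s a) Uq. Qed.

Lemma diffeo_differentiable' q a : U q -> differentiable (fun x => psi' x 0 a) (psi q).
Proof.
by case: dpsi => _ oU _ _ s Uq; apply: (smoothE_differentiable oU (s a)); exists q.
Qed.

Lemma derive_diffeoK q v b : U q ->
  \sum_l 'D_(delta_mx 0 l) (fun x => psi' x 0 b) (psi q) * 'D_v (fun x => psi x 0 l) q = v 0 b.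
Proof.
move=> Uq; have [_ <-] := chain_rule v (fun a => diffeo_differentiable a Uq) (diffeo_differentiable' b Uq).
rewrite -(is_derive_eqE (derive_coord q v b)); apply: near_eq_derive.
have [oU _ K _ _] := dpsi.
by have : nbhs q U by [apply: open_nbhs_nbhs]; apply: filterS => x Ux; rewrite /= K.
Qed.

(** In the slice chart, follow a slowed-down line with the transported velocity; the coordinates
    from [k] on remain 0. *)
Lemma slice_curve q v : U q -> S q -> (forall l : 'I_m, (k <= l)%N -> 'D_v (fun x => psi x 0 l) q = 0) ->
  exists g, scurve S q v g.
Proof.
move=> Uq Sq Dv; have [oU opU K spsi spsi'] := dpsi.
have : nbhs (psi q) (psi @` U) by apply: open_nbhs_nbhs; split=> //; exists q.
move=> /near_normP[e e0 He].
have [h [h0 hb sh dh hc]] := bounded_curve (psi q) (\row_l 'D_v (fun x => psi x 0 l) q) e0.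
have hU t : (psi @` U) (h t) by apply: He.
have S1 : forall t, S (psi' (h t)).
  move=> t; have [x Ux E] := hU t; rewrite -E K //; apply/(SU Ux) => j kj; rewrite E.
  by rewrite hc ?mxE ?Dv //; exact: (SU Uq).1.
exists (fun t => psi' (h t)); split; last first.
  by move=> a; exact: smooth1_curve opU hU sh (spsi' a).
split=> //; first by rewrite h0 K.
move=> b; have dhb a : differentiable (fun t => h t 0 a) (0 : R).
  by apply/derivable1_diffP; exact: is_derive_ex (dh a).
have dp' : differentiable (fun x => psi' x 0 b) (h 0) by rewrite h0; exact: diffeo_differentiable'.
have [dc De] := chain_rule (1 : R) dhb dp'.
apply: DeriveDef; first exact: diff_derivable dc.
rewrite De h0 -(derive_diffeoK v b Uq); apply: eq_bigr => l _.
by rewrite (is_derive_eqE (dh l)) mxE.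
Qed.

Lemma curve_slice q v g : U q -> dcurve S q v g ->
  forall l : 'I_m, (k <= l)%N -> 'D_v (fun x => psi x 0 l) q = 0.
Proof.
move=> Uq [Sg g0 dg] l kl; have [oU opU K spsi spsi'] := dpsi.
have dgb a : differentiable (fun t => g t 0 a) (0 : R).
  by apply/derivable1_diffP; exact: is_derive_ex (dg a).
have dpl : differentiable (fun x => psi x 0 l) (g 0) by rewrite g0; exact: diffeo_differentiable.
have [dc De] := chain_rule (1 : R) dgb dpl.
have <- : 'D_1 ((fun x => psi x 0 l) \o g) (0 : R) = 'D_v (fun x => psi x 0 l) q.
  rewrite De g0 (derive_rVE _ (diffeo_differentiable l Uq)); apply: eq_bigr => b _.
  by rewrite (is_derive_eqE (dg b)) mulrC.
transitivity ('D_(1 : R) (fun=> 0 : R) (0 : R)); last by rewrite derive_cst.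
apply: near_eq_derive.
have cg : {for 0, continuous g} by apply: continuous_rV => b; exact: differentiable_continuous (dgb b).
have : nbhs (0 : R) (g @^-1` U) by apply: cg; rewrite g0; exact: open_nbhs_nbhs.
by apply: filterS => t Ut /=; apply: (SU Ut).1.
Qed.

End slice.

End curves.

(** * Adapted coordinates for a slice of jets *)

Section embedded_rows.
Context {R : realType} {n r : nat}.
Local Notation jdim := (r.+1 * n)%N.

(** The vector [u] times epsilon^j; for [j = 0] it also represents the zero jet at [u]. *)
Definition jemb (j : 'I_r.+1) (u : 'rV[R]_n) : 'rV[R]_jdim :=
  mxvec (\matrix_(i < r.+1, a < n) if i == j then u 0 a else 0).

Lemma jembE j u i a : jemb j u 0 (mxvec_index i a) = if i == j then u 0 a else 0.
Proof. by rewrite mxvecE mxE. Qed.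

Lemma jemb_sum j u : jemb j u = \sum_a u 0 a *: delta_mx 0 (mxvec_index j a).
Proof.
under eq_bigr => a _ do rewrite -mxvec_delta -linearZ.
rewrite -linear_sum; congr mxvec; apply/matrixP => i b; rewrite mxE summxE (bigD1 b) //= big1 ?addr0.
  by rewrite !mxE eqxx andbT; case: (i == j); rewrite ?mulr1 ?mulr0.
by move=> a ab; rewrite !mxE [b == a]eq_sym (negbTE ab) andbF mulr0.
Qed.

Lemma wscl_jemb0 t x : wscl jrow t (jemb ord0 x) = jemb ord0 x.
Proof.
apply/rowP => k; case/mxvec_indexP: k => i b; rewrite mxE jembE jrowE.
by case: eqP => [->|]; rewrite ?expr0 ?mul1r ?mulr0.
Qed.

Lemma wscl_rows t v : wscl jrow t v = \sum_(j < r.+1) t ^+ j *: jemb j (row j (vec_mx v)).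
Proof.
apply/rowP => k; case/mxvec_indexP: k => i b; rewrite mxE jrowE summxE (bigD1 i) //= big1 ?addr0.
  by rewrite mxE jembE eqxx !mxE.
by move=> j ji; rewrite mxE jembE eq_sym (negbTE ji) mulr0.
Qed.

Lemma sum_rows v : v = \sum_(j < r.+1) jemb j (row j (vec_mx v)).
Proof.
have := wscl_rows 1 v; rewrite (_ : wscl jrow 1 v = v); last first.
  by apply/rowP => k; rewrite mxE expr1n mul1r.
by move=> {1}->; apply: eq_bigr => j _; rewrite expr1n scale1r.
Qed.

Lemma jbase_jemb0 x : jbase (vec_mx (jemb ord0 x)) = x.
Proof. by apply/rowP => a; rewrite mxE mxE jembE eqxx. Qed.

Lemma jet_affine (L : 'M[R]_n) (x0 : 'rV[R]_n) (q : 'rV[R]_jdim) :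
  jmap (fun x => (x - x0) *m L) (vec_mx q) = vec_mx (q - jemb ord0 x0) *m L.
Proof.
have o : open [set: 'rV[R]_n] by exact: openT.
apply/matrixP => i b; rewrite mxE.
have -> : (fun x : 'rV[R]_n => ((x - x0) *m L) 0 b) =
    (fun x => (1 : R) * (\sum_a L a b * x 0 a) + - (x0 *m L) 0 b).
  by apply/funext => x; rewrite mul1r mulmxBl [LHS]mxE [X in _ + X]mxE; congr (_ + _);
    rewrite mxE; apply: eq_bigr => a _; rewrite mulrC.
have sc a : smoothE setT (fun x : 'rV[R]_n => L a b * x 0 a).
  by apply: (smoothEZ _ o); exact: (smoothE_coord _ o).
have ss : smoothE setT (fun x : 'rV[R]_n => \sum_a L a b * x 0 a) 
  by apply: smoothE_sum => // a _; exact: sc.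
rewrite (jet_lin (r := r) 1 o (I : setT (jbase (vec_mx q))) ss (smoothE_cst _ o)) scale1r jet_cst.
rewrite (jet_sum (r := r) _ o) // coefD coefC coef_sum [RHS]mxE.
have Ea a : (jet (fun x : 'rV[R]_n => L a b * x 0 a) (vec_mx q))`_i = L a b * vec_mx q i a.
  rewrite (_ : (fun x => _) = (fun x : 'rV[R]_n => L a b * x 0 a + 0)); last by apply/funext => x; rewrite addr0.
  rewrite (jet_lin (r := r) _ o (I : setT (jbase (vec_mx q))) (smoothE_coord a o) (smoothE_cst 0 o)).
  by rewrite jet_cst addr0 coefZ jet_coord coef_jcoord.
rewrite (eq_bigr _ (fun a _ => Ea a)).
rewrite [RHS](eq_bigr (fun a => L a b * vec_mx q i a - (if i == ord0 then x0 0 a else 0) * L a b)); last first.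
  move=> a _; rewrite mxE [in LHS]mxE [X in (_ + X) * _]mxE jembE mxE; ring.
rewrite sumrB; congr (_ + _); have [->|i0] := eqVneq i ord0; first by rewrite mxE.
rewrite (negbTE (_ : (i : nat) != 0%N)) ?big1 ?oppr0 // => a _; by rewrite mul0r.
Qed.

End embedded_rows.

Section affine_maps.
Context {R : realType}.

Lemma is_derive_affine m (f : 'rV[R]_m -> R) (y v : 'rV[R]_m) (l : R) :
  (forall h : R, f (h *: v + y) = f y + h * l) -> is_derive y v f l.
Proof.
move=> E; apply: is_derive_cvg => e e0; exists 1 => // h _ h0.
rewrite E (_ : f y + h * l - f y = h * l); last by ring.
by rewrite mulKf // subrr normr0 ltW.
Qed.

Lemma smoothE_mulmx m p (A : 'M[R]_(m, p)) (c : 'rV[R]_p) O b : open O -> smoothE O (fun x : 'rV[R]_m => (c + x *m A) 0 b).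
Proof.
move=> oO; rewrite (_ : (fun x => _) = (fun x : 'rV[R]_m => c 0 b + \sum_a x 0 a * A a b)); last first.
  by apply/funext => x; rewrite !mxE.
apply: smoothED; [exact: oO | exact: smoothE_cst | ].
apply: smoothE_sum => // a _; apply: smoothEM; [exact: oO | exact: smoothE_coord | exact: smoothE_cst].
Qed.

Lemma derive_mulmx m p (A : 'M[R]_(m, p)) (c : 'rV[R]_p) x v b :
  'D_v (fun x : 'rV[R]_m => (c + x *m A) 0 b) x = (v *m A) 0 b.
Proof.
apply: is_derive_eqE; apply: is_derive_affine => h.
by rewrite mulmxDl -scalemxAl !mxE; ring.
Qed.

End affine_maps.

Section adapted_coordinates.
Context {R : realType} {n r : nat}.
Local Notation jdim := (r.+1 * n)%N.
Variables (S U : set 'rV[R]_jdim) (psi psi' : 'rV[R]_jdim -> 'rV[R]_jdim) (k0 : nat) (x0 : 'rV[R]_n).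
Hypotheses (dpsi : diffeo U psi psi').
Hypothesis SU : forall y, U y -> (S y <-> forall j : 'I_jdim, (k0 <= j)%N -> psi y 0 j = 0).

Let p0 : 'rV[R]_jdim := jemb ord0 x0.

Hypotheses (Up0 : U p0) (Sp0 : S p0) (Skappa : forall t q, S q -> S (wscl jrow t q)).
Hypothesis Stop : forall q u, S q -> S (q + jemb ord_max u).
Hypothesis Sshift : forall q v g, scurve S q v g -> exists g', dcurve S q (jshift v) g'.

Definition slice_tangent (q v : 'rV[R]_jdim) := forall l : 'I_jdim, (k0 <= l)%N -> 'D_v (fun x => psi x 0 l) q = 0.

Lemma slice_tangentP q v : U q -> S q -> (slice_tangent q v <-> exists g, dcurve S q v g).
Proof.
move=> Uq Sq; split=> [T|[g gq]]; last exact: (curve_slice dpsi SU Uq gq).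
by have [g [gq _]] := slice_curve dpsi SU Uq Sq T; exists g.
Qed.

Lemma slice_tangent_shift q v : U q -> S q -> slice_tangent q v -> slice_tangent q (jshift v).
Proof.
move=> Uq Sq T; have [g gq] := slice_curve dpsi SU Uq Sq T.
by apply/slice_tangentP => //; exact: Sshift gq.
Qed.

Let M0 : 'M[R]_jdim := \matrix_(k, l) 'D_(delta_mx 0 k) (fun x => psi x 0 l) p0.

Let T0E v : slice_tangent p0 v <-> forall l : 'I_jdim, (k0 <= l)%N -> (v *m M0) 0 l = 0.
Proof.
have E l : 'D_v (fun x => psi x 0 l) p0 = (v *m M0) 0 l.
  rewrite (derive_rVE _ (diffeo_differentiable dpsi l Up0)) mxE.
  by apply: eq_bigr => b _; rewrite mxE.
by split=> H l kl; have := H l kl; rewrite E.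
Qed.

Let T0_kappa t v : slice_tangent p0 v -> slice_tangent p0 (wscl jrow t v).
Proof.
move=> /(slice_tangentP _ Up0 Sp0)[g [Sg g0 dg]]; apply/(slice_tangentP _ Up0 Sp0).
exists (fun s => wscl jrow t (g s)); split.
- by move=> s; exact: Skappa.
- by rewrite g0 wscl_jemb0.
- move=> a; rewrite mxE (_ : (fun s => _) = (fun s => t ^+ jrow a * g s 0 a)).
    by apply: is_deriveZ; exact: dg.
  by apply/funext => s; rewrite mxE.
Qed.

Let T0_top u : slice_tangent p0 (jemb ord_max u).
Proof.
apply/(slice_tangentP _ Up0 Sp0); exists (fun t => p0 + jemb ord_max (t *: u)); split.
- by move=> t; exact: Stop.
- rewrite scale0r (_ : jemb _ 0 = 0) ?addr0 //.
  by apply/rowP => k; case/mxvec_indexP: k => i b; rewrite jembE !mxE; case: (i == _).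
- move=> k; case/mxvec_indexP: k => i b.
  have D1 : is_derive (0 : R) 1 (fun t : R => p0 0 (mxvec_index i b)) 0 by exact: is_derive_cst.
  have D2 : is_derive (0 : R) 1 (fun t : R => jemb ord_max u 0 (mxvec_index i b) * t)
      (jemb ord_max u 0 (mxvec_index i b) * 1) by apply: is_deriveZ; exact: is_derive_id.
  have := is_deriveD D1 D2; rewrite add0r mulr1; congr (is_derive _ _ _ _).
  apply/funext => t; transitivity (p0 0 (mxvec_index i b) + jemb ord_max u 0 (mxvec_index i b) * t) => //.
  by rewrite [RHS]mxE !jembE mxE; case: (i == ord_max); rewrite ?mul0r // mulrC.
Qed.

(** The tangent space at the zero jet is stable under dilations. An equation of it, evaluated on the
    dilations of [v], is a polynomial in [t] that vanishes identically, so it holds for each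
    coefficient, that is for each row of [v]. *)
Let T0_row v (j : 'I_r.+1) : slice_tangent p0 v -> slice_tangent p0 (jemb j (row j (vec_mx v))).
Proof.
move=> Tv; apply/T0E => l kl; pose c i := (jemb i (row i (vec_mx v)) *m M0) 0 l.
pose P : {poly R} := \poly_(i < r.+1) c (inord i).
have P0 t : P.[t] = 0.
  have := (T0E _).1 (T0_kappa t Tv) l kl; rewrite wscl_rows mulmx_suml summxE => <-.
  rewrite horner_poly; apply: eq_bigr => i _; rewrite inord_val -scalemxAl mxE.
  by rewrite mulrC.
have : P = 0.
  (* The integers below the size of [P] are more roots than a nonzero polynomial of this size can
     have. *)
  apply: (@roots_geq_poly_eq0 _ P [seq k%:R | k <- iota 0 (size P)]).
  - by apply/allP => x _; rewrite /root P0.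
  - rewrite map_inj_uniq ?iota_uniq // => a b /eqP; rewrite eqr_nat => /eqP //.
  - by rewrite size_map size_iota.
move=> /(congr1 (fun p : {poly R} => p`_j)); rewrite coef0 coef_poly ltn_ord inord_val //.
Qed.

Let T0_rows v : slice_tangent p0 v <-> forall j, slice_tangent p0 (jemb j (row j (vec_mx v))).
Proof.
split=> [Tv j|H]; first exact: T0_row.
apply/T0E => l kl; rewrite [v]sum_rows mulmx_suml summxE big1 // => j _.
by have := (T0E _).1 (H j) l kl.
Qed.

Let A (j : 'I_r.+1) : 'M[R]_(n, jdim) :=
  \matrix_(a, l) if (k0 <= l)%N then M0 (mxvec_index j a) l else 0.

(** The vectors [u] for which u epsilon^j is tangent to [S] at the zero jet. *)
Let Vs (j : nat) : {vspace 'rV[R]_n} := lker (linfun (mulmxr (A (inord j)))).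

Let memVs j u : u \in Vs j <-> slice_tangent p0 (jemb (inord j) u).
Proof.
have E (l : 'I_jdim) : (k0 <= l)%N -> (u *m A (inord j)) 0 l = (jemb (inord j) u *m M0) 0 l.
  move=> kl; rewrite jemb_sum mulmx_suml summxE mxE; apply: eq_bigr => a _.
  by rewrite -scalemxAl -rowE !mxE kl.
have -> : (u \in Vs j) = (u *m A (inord j) == 0) by rewrite memv_ker lfunE.
split=> [/eqP H|/T0E H].
  by apply/T0E => l kl; rewrite -E // H mxE.
apply/eqP/rowP => l; rewrite [RHS]mxE; have [kl|kl] := leqP k0 l; first by rewrite E // H.
by rewrite mxE big1 // => a _; rewrite mxE leqNgt kl mulr0.
Qed.

(** Multiplication by epsilon preserves tangent vectors and turns u epsilon^j into u
    epsilon^(j+1). *)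
Let VsS j : (j < r)%N -> (Vs j <= Vs j.+1)%VS.
Proof.
move=> jr; apply/subvP => u /memVs /(slice_tangent_shift Up0 Sp0) H; apply/memVs.
rewrite (_ : jemb _ _ = jshift (jemb (inord j) u)) //.
apply/rowP => k; case/mxvec_indexP: k => i b; rewrite jembE mxvecE mxE.
have -> : (i == inord j.+1) = (i == j.+1 :> nat) by rewrite -val_eqE /= inordK.
case: i => -[|i] /= ir; first by [].
rewrite mxE jembE -val_eqE /= !inordK ?eqSS //; first exact: ltnW.
exact: ltnW.
Qed.

Let Vs_top : Vs r = fullv.
Proof.
apply/eqP; rewrite eqEsubv subvf /=; apply/subvP => u _; apply/memVs.
rewrite (_ : inord r = ord_max); first exact: T0_top.
by apply: val_inj; rewrite /= inordK.
Qed.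

Let dimVs_le i j : (i <= j <= r)%N -> (\dim (Vs i) <= \dim (Vs j))%N.
Proof.
elim: j => [|j IH] /andP[ij jr]; first by move: ij; rewrite leqn0 => /eqP ->.
move: ij; rewrite leq_eqVlt => /orP[/eqP -> //|ij].
by apply: leq_trans (dimvS (VsS jr)); apply: IH; rewrite -ltnS ij ltnW.
Qed.

Let w_ex (b : 'I_n) : exists j, (b < \dim (Vs j))%N.
Proof. by exists r; rewrite Vs_top dimvf /dim /= mul1n. Qed.

(** The dimensions increase with [j], so the least such index is the number of [j] with
    [\dim (Vs j) <= b]. *)
Let w b := ex_minn (w_ex b).

Let wP (b : 'I_n) j : (j <= r)%N -> (\dim (Vs j) <= b)%N = (j < w b)%N.
Proof.
rewrite /w; case: ex_minnP => m mP mmin jr; apply/idP/idP => [H|jm].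
  rewrite ltnNge; apply/negP => mj; have := leq_trans mP (@dimVs_le m j _).
  by rewrite mj jr => /(_ isT); rewrite ltnNge H.
by rewrite leqNgt; apply/negP => /mmin; rewrite leqNgt jm.
Qed.

Let w_weight : weight_sequence r w.
Proof.
split=> [a b ab|a].
  rewrite /w; case: ex_minnP => m mP mmin; case: ex_minnP => m' mP' mmin'.
  by apply: mmin; apply: leq_ltn_trans mP'.
by rewrite /w; case: ex_minnP => m _; apply; rewrite Vs_top dimvf /dim /= mul1n.
Qed.


(** An affine change of coordinates on R^n moves the point to 0 and the flag to a coordinate flag.
    It acts row by row on jets, hence commutes with dilations and with multiplication by epsilon,
    and [normal_form_chart] applies. *)
Lemma adapted_map D : open D -> D x0 -> exists (w : 'I_n -> nat) V X X', [/\ weight_sequence r w,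
  V `<=` D, V x0, diffeo V X X' & forall q : 'rV[R]_jdim, V (jbase (vec_mx q)) ->
    (S q <-> forall b j, (j < w b)%N -> (jet (fun x => X x 0 b) (vec_mx q))`_j = 0)].
Proof.
move=> oD Dx0; have [oU opU psiK spsi spsi'] := dpsi.
have [B [L [BL LB HV]]] := flag_coordinates VsS Vs_top.
pose G : 'M[R]_jdim := lin1_mx (mxvec \o mulmxr B \o vec_mx).
pose G' : 'M[R]_jdim := lin1_mx (mxvec \o mulmxr L \o vec_mx).
have GE q : q *m G = mxvec (vec_mx q *m B) by rewrite mul_rV_lin1.
have G'E q : q *m G' = mxvec (vec_mx q *m L) by rewrite mul_rV_lin1.
have GG' : G *m G' = 1%:M.
  by apply/row_matrixP => i; rewrite !rowE mulmxA GE G'E mxvecK -mulmxA BL !mulmx1 vec_mxK.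
have G'G : G' *m G = 1%:M by exact: mulmx1C.
pose M0' : 'M[R]_jdim := \matrix_(k, l) 'D_(delta_mx 0 k) (fun x => psi' x 0 l) (psi p0).
have MM : M0 *m M0' = 1%:M.
  apply/matrixP => k m; rewrite mxE -[RHS](_ : (delta_mx 0 k : 'rV[R]_jdim) 0 m = _); last first.
    by rewrite !mxE eqxx eq_sym.
  rewrite -(derive_diffeoK dpsi (delta_mx 0 k) m Up0); apply: eq_bigr => l _.
  by rewrite !mxE mulrC.
have uM : M0 \in unitmx by have [] := mulmx1_unit MM.
have lowE v : slice_tangent p0 v <-> forall k, (jrow k < w (jcol k))%N -> (v *m G') 0 k = 0.
  rewrite T0_rows; split=> [H k|H j].
    case/mxvec_indexP: k => j b; rewrite jrowE jcolE -wP; last by rewrite -ltnS ltn_ord.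
    move=> jb; rewrite G'E mxvecE -[LHS](_ : (row j (vec_mx v) *m L) 0 b = _); last by rewrite -row_mul mxE.
    apply: (HV j _ _).1 jb; first by rewrite -ltnS ltn_ord.
    by apply/memVs; rewrite inord_val.
  rewrite -{1}(inord_val j); apply/memVs; apply/HV; first by rewrite -ltnS ltn_ord.
  move=> b jb; rewrite -row_mul mxE; have := H (mxvec_index j b).
  by rewrite jrowE jcolE -wP ?G'E ?mxvecE; [apply | rewrite -ltnS ltn_ord].
pose aff q := p0 + q *m G.
pose S1 := aff @^-1` S; pose U1 := aff @^-1` U.
(* The linear factor undoes the differential of [psi] at [p0] and passes to the flag coordinates, so
   that [Sig] has identity differential at 0. *)
pose Sig q := (psi (aff q) - psi p0) *m (invmx M0 *m G').
have oU1 : open U1.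
  have -> : U1 = setT `&` aff @^-1` U by rewrite setTI.
  by apply: open_smooth_preimage => //; [exact: openT | move=> b; apply: smoothE_mulmx; exact: openT].
have aff0 : aff 0 = p0 by rewrite /aff mul0mx addr0.
have U10 : U1 0 by rewrite /U1 /= aff0.
have spa b : smoothE U1 (fun q => psi (aff q) 0 b).
  apply: (smoothE_comp (U := U) oU1 oU _ _ (spsi b)) => // c; exact: smoothE_mulmx.
have SigE b : (fun q => Sig q 0 b) = (fun q => (- (psi p0 *m (invmx M0 *m G')) + psi (aff q) *m (invmx M0 *m G')) 0 b).
  by apply/funext => q; rewrite /Sig mulmxBl addrC.
have sSig : smoothE_map U1 Sig.
  move=> b; rewrite SigE.
  exact: (smoothE_comp (h := fun q => psi (aff q)) oU1 openT (fun _ _ => I) spa (smoothE_mulmx _ _ _ openT)).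
have Sig0 : Sig 0 = 0 by rewrite /Sig aff0 subrr mul0mx.
pose dpsi_at q v : 'rV[R]_jdim := \row_l 'D_(v *m G) (fun x => psi x 0 l) (aff q).
have DSig q v b : U1 q -> 'D_v (fun q => Sig q 0 b) q = (dpsi_at q v *m (invmx M0 *m G')) 0 b.
  move=> Uq; rewrite SigE.
  have d1 c : differentiable (fun q => psi (aff q) 0 c) q by exact: smoothE_differentiable oU1 (spa c) Uq.
  have d2 y : differentiable (fun y : 'rV[R]_jdim => (- (psi p0 *m (invmx M0 *m G')) + y *m (invmx M0 *m G')) 0 b) y.
    by apply: (smoothE_differentiable openT (smoothE_mulmx _ _ _ openT)).
  have [_ ->] := chain_rule v d1 (d2 _); rewrite [RHS]mxE; apply: eq_bigr => c _.
  rewrite derive_mulmx -rowE mxE mulrC mxE; congr (_ * _).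
  have d3 l : differentiable (fun q => aff q 0 l) q.
    by apply: (smoothE_differentiable openT (smoothE_mulmx _ _ _ openT)).
  have [_ ->] := chain_rule v d3 (diffeo_differentiable dpsi c Uq).
  rewrite [RHS]mxE (derive_rVE _ (diffeo_differentiable dpsi c Uq)); apply: eq_bigr => l _.
  by rewrite derive_mulmx mulrC.
(* A row [u] is the image under [M0] of a tangent vector at [p0] exactly if its entries from [k0] on
   vanish, and tangent vectors at [p0] are the ones whose low flag coordinates vanish. The statement
   is linear in [u], hence also converts the nonlinear equations of [S]. *)
have lowSig (u : 'rV[R]_jdim) : (forall k, (jrow k < w (jcol k))%N -> (u *m (invmx M0 *m G')) 0 k = 0) <->
    forall l : 'I_jdim, (k0 <= l)%N -> u 0 l = 0.
  rewrite mulmxA; apply: (iff_trans (iff_sym (lowE (u *m invmx M0)))).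
  by have := T0E (u *m invmx M0); rewrite mulmxKV.
have DSig0 k l : 'D_(delta_mx 0 k) (fun q => Sig q 0 l) 0 = (k == l)%:R.
  rewrite DSig // (_ : dpsi_at 0 _ = delta_mx 0 k *m G *m M0).
    by rewrite -!mulmxA [M0 *m _]mulmxA mulmxV // mul1mx GG' mulmx1 mxE eqxx eq_sym.
  apply/rowP => m; rewrite [LHS]mxE [RHS]mxE aff0.
  rewrite (derive_rVE _ (diffeo_differentiable dpsi m Up0)); apply: eq_bigr => b _.
  by congr (_ * _); rewrite [RHS]mxE.
have SP q : U1 q -> (S1 q <-> forall k, (jrow k < w (jcol k))%N -> Sig q 0 k = 0).
  move=> Uq; rewrite /S1 /= (SU Uq) /Sig lowSig.
  have p00 (l : 'I_jdim) : (k0 <= l)%N -> psi p0 0 l = 0 by exact: (SU Up0).1.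
  by split=> H l kl; have := H l kl; rewrite !mxE p00 // subr0.
have Sk1 t q : S1 q -> S1 (wscl jrow t q).
  rewrite /S1 /= => /(Skappa t); congr S; apply/rowP => k.
  rewrite mxE /aff !GE vec_mx_wscl; case/mxvec_indexP: k => j b.
  rewrite [RHS]mxE [in LHS]mxE !mxvecE !mxE jrowE mulrDr; congr (_ + _).
    by case: eqP => [->|]; rewrite ?mulr0 ?expr0 ?mul1r.
  by rewrite mulr_sumr; apply: eq_bigr => a _; rewrite !mxE mulrA.
have Ss1 q v : U1 q -> S1 q -> (forall k, (jrow k < w (jcol k))%N -> 'D_v (fun q => Sig q 0 k) q = 0) ->
    forall k, (jrow k < w (jcol k))%N -> 'D_(jshift v) (fun q => Sig q 0 k) q = 0.
  move=> Uq Sq H; have T : slice_tangent (aff q) (v *m G).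
    move=> l kl; have := (lowSig (dpsi_at q v)).1 _ l kl; rewrite mxE; apply=> k lk.
    by rewrite -DSig // H.
  move=> k kl; rewrite DSig //; apply: (lowSig (dpsi_at q (jshift v))).2 kl => l kl; rewrite mxE.
  rewrite (_ : jshift v *m G = jshift (v *m G)); first exact: slice_tangent_shift.
  apply/rowP => kk; case/mxvec_indexP: kk => i b; rewrite !GE !mxvecE !mxE mxvecK.
  rewrite mxvecK; case: i => -[|i] ir /=; last first.
    by rewrite [RHS]mxE; apply: eq_bigr => a _; rewrite [in LHS]mxE.
  by rewrite big1 // => a _; rewrite mxE mul0r.
pose D1 := [set y : 'rV[R]_n | D (x0 + y *m B)].
have oD1 : open D1.
  have -> : D1 = setT `&` (fun y => x0 + y *m B) @^-1` D by rewrite setTI.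
  by apply: open_smooth_preimage => //; [exact: openT | move=> b; apply: smoothE_mulmx; exact: openT].
have D10 : D1 0 by rewrite /D1 /= mul0mx addr0.
have [V1 [X1 [X1' [V1D V10 dX1 HX]]]] :=
  normal_form_chart w_weight.2 oU1 U10 sSig Sig0 DSig0 SP Sk1 Ss1 oD1 D10.
have [oV1 oXV1 XK1 sX1 sX1'] := dX1.
pose V := (fun x => (x - x0) *m L) @^-1` V1.
have sm b O : open O -> smoothE O (fun x : 'rV[R]_n => ((x - x0) *m L) 0 b).
  move=> oO; rewrite (_ : (fun x => _) = (fun x => (- (x0 *m L) + x *m L) 0 b)); last first.
    by apply/funext => x; rewrite mulmxBl addrC.
  exact: smoothE_mulmx.
have oV : open V.
  have -> : V = setT `&` (fun x => (x - x0) *m L) @^-1` V1 by rewrite setTI.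
  by apply: open_smooth_preimage => //; [exact: openT | move=> b; apply: sm; exact: openT].
exists w, V, (fun x => X1 ((x - x0) *m L)), (fun y => x0 + X1' y *m B); split.
- exact: w_weight.
- move=> x /V1D; rewrite /D1 /= -mulmxA LB mulmx1 addrC subrK //.
- by rewrite /V /= subrr mul0mx.
- have imE : (fun x => X1 ((x - x0) *m L)) @` V = X1 @` V1.
    apply/seteqP; split=> y [x Vx <-]; first by exists ((x - x0) *m L).
    exists (x0 + x *m B); first by rewrite /V /= addrC addKr -mulmxA BL mulmx1.
    by rewrite addrC addKr -mulmxA BL mulmx1.
  split=> //; rewrite ?imE //.
  + by move=> x Vx; rewrite XK1 // -mulmxA LB mulmx1 addrC subrK.
  + move=> b; apply: (smoothE_comp oV oV1 _ _ (sX1 b)) => // c; exact: sm.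
  + move=> b.
    exact: (smoothE_comp (h := X1') oXV1 openT (fun _ _ => I) sX1' (smoothE_mulmx _ _ _ openT)).
- move=> q Vq; pose q2 := (q - p0) *m G'.
  have jm : vec_mx q2 = jmap (fun x => (x - x0) *m L) (vec_mx q) by rewrite /q2 G'E mxvecK jet_affine.
  have jb : jbase (vec_mx q2) = (jbase (vec_mx q) - x0) *m L by rewrite jm jbase_jmap.
  have Vq2 : V1 (jbase (vec_mx q2)) by rewrite jb.
  have := HX q2 Vq2; rewrite /S1 /= /aff /q2 -mulmxA G'G mulmx1 addrC subrK => ->.
  have je b : jet (fun x => X1 ((x - x0) *m L) 0 b) (vec_mx q) = jet (fun x => X1 x 0 b) (vec_mx q2).
    by rewrite jm; apply: (jet_comp oV oV1 _ _ (sX1 b)) => // c; exact: sm.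
  by split=> H b j jb'; have := H b j jb'; rewrite je.
Qed.

End adapted_coordinates.

(** * Adapted charts *)

Section adapted_charts.
Context {R : realType} {n : nat} {M : manifold R n} {r : nat}.
Local Notation jdim := (r.+1 * n)%N.
Implicit Types (c : chart R n M) (f g : C^oo M) (m : M) (u D : C^oo M -> trunc R r)
  (Q : set (C^oo M -> trunc R r)) (N : set M) (w : 'I_n -> nat).

Lemma zero_jet_inj m m' : zero_jet r m = zero_jet r m' -> m = m'.
Proof.
move=> E; apply: (@base_unique _ _ _ _ (zero_jet r m)); first exact: zero_jet_base.
by rewrite E; exact: zero_jet_base.
Qed.

Lemma kappa0_base u m : base_point u m -> kappa 0 u = zero_jet r m.
Proof.
move=> bu; apply/funext => f; apply: trunc_eq => i ir.
have := kappaE 0 u f i; rewrite /jet_lift => ->.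
have := zero_jet_base (r := r) m f; rewrite /jet_lift; case: i ir => [|i] ir.
  by rewrite expr0 mul1r => ->; exact: bu.
by move=> _; rewrite expr0n mul0r /zero_jet /= coefC.
Qed.

Lemma graded_base N Q u m : graded_subbundle_along N Q -> Q u -> base_point u m -> N m.
Proof.
move=> [_ _ QN] Qu bu; have : (kappa 0 @` Q) (kappa 0 u) by exists u.
by rewrite QN (kappa0_base bu) => -[m' Nm' /zero_jet_inj <-].
Qed.

Lemma graded_base_exists N Q u : graded_subbundle_along N Q -> Q u -> exists m, base_point u m /\ N m.
Proof.
move=> gQ Qu; have [[QT _] _ _] := gQ; have [m bu] := TrM_base_point (QT _ Qu).
by exists m; split=> //; exact: graded_base gQ Qu bu.
Qed.

Lemma graded_zero_jet N Q m : graded_subbundle_along N Q -> (Q (zero_jet r m) <-> N m).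
Proof.
move=> gQ; split=> [Qm|Nm]; first exact: graded_base gQ Qm (zero_jet_base m).
have [_ Qk QN] := gQ; have : (zero_jet r @` N) (zero_jet r m) by exists m.
by rewrite -QN => -[u Qu <-]; exact: Qk.
Qed.

Definition adapted Q c w := [/\ smooth_chart c, weight_sequence r w &
  forall u m, TrM u -> base_point u m -> chart_dom c m ->
    (Q u <-> forall a, trunc_ord (w a) (u (Xc c m a)))].

Lemma TrM_prod u I (s : seq I) (F : I -> C^oo M) : TrM u -> u (\prod_(i <- s) F i) = \prod_(i <- s) u (F i).
Proof.
move=> [_ [u1 uM]]; elim: s => [|i s IH]; first by rewrite !big_nil.
by rewrite !big_cons uM IH.
Qed.

Lemma TrM_sum u I (s : seq I) (F : I -> C^oo M) : TrM u -> u (\sum_(i <- s) F i) = \sum_(i <- s) u (F i).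
Proof.
move=> [ul _]; have [uD _ _ u0] := linear_props ul; elim: s => [|i s IH]; first by rewrite !big_nil.
by rewrite !big_cons uD IH.
Qed.

Lemma TrM_exp u f k : TrM u -> u (f ^+ k) = u f ^+ k.
Proof. by move=> [_ [u1 uM]]; elim: k => [|k IH]; rewrite ?expr0 ?u1 // [f ^+ _]exprS [u f ^+ _]exprS uM IH. Qed.

Lemma smooth_funX f k m : (f ^+ k) m = f m ^+ k.
Proof. by elim: k => [|k IH]; rewrite ?expr0 ?smooth_fun1E // !exprS smooth_funM IH. Qed.

Lemma weighted_ideal_ord c w i f u m : smooth_chart c -> TrM u -> base_point u m -> chart_dom c m ->
  weighted_ideal c w i f -> (forall a, trunc_ord (w a) (u (Xc c m a))) -> trunc_ord i (u f).
Proof.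
move=> sc tu bu Dm [k [s [g [si sg fE]]]] H; have oD := chart_dom_open c.
pose G l := extend (chart_dom c) (g l) m.
have E : \forall x \near m, f x = (\sum_(l < k) G l * \prod_a Xc c m a ^+ s l a) x.
  have n1 : \forall x \near m, forall l, G l x = g l x.
    by apply: filter_forall => l; exact: extendP oD Dm (sg l).
  have n2 : \forall x \near m, forall a, Xc c m a x = chart_map c x 0 a.
    by apply: filter_forall => a; exact: XcP.
  have n3 := near_dom Dm; apply: filterS3 n1 n2 n3 => x H1 H2 Dx.
  rewrite fE // smooth_fun_sum; apply: eq_bigr => l _.
  rewrite smooth_funM smooth_fun_prod H1; congr (_ * _); apply: eq_bigr => a _.
  by rewrite smooth_funX H2.
rewrite (TrM_germ tu bu E) (TrM_sum _ _ tu); apply: trunc_ord_sum => l.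
have [_ [_ uM]] := tu; rewrite uM (TrM_prod _ _ tu) -[i]add0n.
apply: trunc_ordM; first exact: trunc_ord0.
apply: (trunc_ordW (si l)); apply: trunc_ord_prod => a.
by rewrite (TrM_exp _ _ tu); exact: trunc_ordX.
Qed.

(** The product with [b], extended by 0, is a multiple of [f] on [U] and zero off [K]; the sheaf
    property joins the two. *)
Lemma ideal_sheaf_extend (I : set M -> set (M -> R)) U (b : C^oo M) K (f : M -> R) : ideal_sheaf I ->
  open U -> closed K -> K `<=` U -> (forall x, ~ K x -> b x = 0) -> I U f ->
  exists F : C^oo M, I setT F /\ forall x, U x -> F x = b x * f x.
Proof.
move=> sI oU cK KU b0 If.
have bf0 x : U x -> ~ K x -> ((b : M -> R) * f) x = 0 by move=> _ /b0 E; rewrite /GRing.mul /= E mul0r.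
have sb : smooth_on U b by exact: smooth_fun_on.
have sbf : smooth_on U ((b : M -> R) * f) by apply: smooth_onM => //; exact: ideal_sheaf_smooth sI _ _ oU If.
have sF := smooth_extz oU cK sbf bf0 KU.
exists (SmoothFun sF); split; last by move=> x Ux /=; rewrite extzE.
apply: (ideal_sheaf_glue sI) => [|x _]; first exact: openT.
have [Ux|nUx] := pselect (U x).
  exists U; split=> //; apply: (ideal_sheaf_ext sI oU _ (ideal_sheaf_mul sI oU sb If)).
  by move=> y Uy /=; rewrite extzE.
have oK : open (~` K) by exact: closed_openC.
exists (~` K); split=> //; first by move=> /KU.
apply: (ideal_sheaf_ext sI oK _ (ideal_sheaf_zero sI oK)) => y nKy /=.
have [Uy|nUy] := pselect (U y); first by rewrite extzE // bf0.
by rewrite extz_out.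
Qed.

Lemma trunc_coef_Tp c p f i : (Tp c p f : trunc R r)`_i = if (i <= r)%N then (jet (f \o chart_inv c) p)`_i else 0.
Proof.
by case: leqP => ir; rewrite ?(trunc_coef_out _ ir) // coef_ptrunc.
Qed.

Lemma chart_pd_linear c a (k : R) f g x : smooth_chart c -> chart_dom c x ->
  chart_pd c a (k *: f + g : C^oo M) x = k * chart_pd c a f x + chart_pd c a g x.
Proof.
move=> sc Dx; have -> : chart_pd c a (k *: f + g : C^oo M) x = chart_pd c a (cstf k * f + g : C^oo M) x.
  congr (chart_pd c a (smooth_val _) x); apply: smooth_fun_ext => y.
  by rewrite !smooth_funD smooth_funZ smooth_funM cstfE.
rewrite [LHS](@chart_pdD _ _ _ _ _ (cstf k * f) g) // [X in X + _](@chart_pdM _ _ _ _ _ (cstf k) f) //.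
have -> : chart_pd c a (cstf k) x = chart_pd c a (fun=> k) x.
  by congr (chart_pd c a _ x); apply/funext => y; rewrite cstfE.
by rewrite chart_pd_cst mul0r add0r cstfE.
Qed.

(** Coordinate derivatives applied under [u] form a frame over the truncated polynomials: a tangent
    vector may take arbitrary values on the coordinates. *)
Lemma frame_tangent c m u (V : 'I_n -> trunc R r) : TrM u -> base_point u m -> smooth_chart c -> chart_dom c m ->
  tangent_TrM u (fun f => \sum_a V a * u (pdx c m f a)) /\
  forall b, \sum_a V a * u (pdx c m (Xc c m b) a) = V b.
Proof.
move=> tu bu sc Dm; have [ul [u1 uM]] := tu; have [uD uZ _ u0] := linear_props ul.
have nD := near_dom Dm.
have pdg f a := pdxP f a sc Dm.
have pdD (k : R) f g a : u (pdx c m (k *: f + g : C^oo M) a) = k *: u (pdx c m f a) + u (pdx c m g a).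
  rewrite -uZ -uD; apply: (TrM_germ tu bu).
  have n1 : \forall x \near m, [/\ pdx c m (k *: f + g : C^oo M) a x = chart_pd c a (k *: f + g : C^oo M) x,
    pdx c m f a x = chart_pd c a f x & pdx c m g a x = chart_pd c a g x].
    by apply: filterS3 (pdg (k *: f + g) a) (pdg f a) (pdg g a) => x.
  apply: filterS2 n1 nD => x [-> E2 E3] Dx; rewrite smooth_funD smooth_funZ E2 E3.
  exact: chart_pd_linear.
split; [split|].
- move=> k f g; rewrite scaler_sumr -big_split; apply: eq_bigr => a _ /=.
  by rewrite pdD mulrDr scalerAr.
- move=> f g; rewrite mulr_suml mulr_sumr -big_split; apply: eq_bigr => a _ /=.
  have -> : u (pdx c m (f * g : C^oo M) a) = u (pdx c m f a * g + f * pdx c m g a).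
    apply: (TrM_germ tu bu).
    have n1 : \forall x \near m, [/\ pdx c m (f * g : C^oo M) a x = chart_pd c a (f * g : C^oo M) x,
      pdx c m f a x = chart_pd c a f x & pdx c m g a x = chart_pd c a g x].
      by apply: filterS3 (pdg (f * g) a) (pdg f a) (pdg g a) => x.
    apply: filterS2 n1 nD => x [-> E2 E3] Dx; rewrite smooth_funD !smooth_funM E2 E3.
    exact: chart_pdM.
  by rewrite uD !uM mulrDr mulrA mulrCA.
- move=> b; rewrite (bigD1 b) //= big1 ?addr0 => [|a ab].
    have -> : u (pdx c m (Xc c m b) b) = u 1; last by rewrite u1 mulr1.
    apply: (TrM_germ tu bu); have n2 := chart_pd_near b Dm (XcP b sc Dm).
    apply: filterS3 (pdg (Xc c m b) b) n2 nD => x -> -> Dx.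
    by rewrite chart_pd_coord // eqxx smooth_fun1E.
  have -> : u (pdx c m (Xc c m b) a) = u 0; last by rewrite u0 mulr0.
  apply: (TrM_germ tu bu); have n2 := chart_pd_near a Dm (XcP b sc Dm).
  apply: filterS3 (pdg (Xc c m b) a) n2 nD => x -> -> Dx.
  by rewrite chart_pd_coord // (negbTE ab).
Qed.

(** Both the derivation and the velocity expand to \sum_a D(x_a) u(d_a f): the former by
    [derivation_coords], the latter by the derivative formula for jets. So agreement on coordinates
    is enough. *)
Lemma chart_curve_tangent c (h : R -> 'rV[R]_jdim) (v : 'rV[R]_jdim) D m u : smooth_chart c ->
  (forall t, (chart_map c @` chart_dom c) (jbase (vec_mx (h t)))) ->
  (forall k, smooth1 (fun t => h t 0 k)) -> (forall k, is_derive (0 : R) 1 (fun t => h t 0 k) (v 0 k)) ->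
  u = Tp c (vec_mx (h 0)) -> base_point u m -> chart_dom c m -> tangent_TrM u D ->
  (forall a j, (j <= r)%N -> (D (Xc c m a))`_j = (jcoord (vec_mx v) a)`_j) ->
  (forall f i, smooth_fun1 (fun t => jet_lift f i (Tp c (vec_mx (h t)) : C^oo M -> trunc R r))) /\
  (forall f i, (D f)`_i = derive1 (fun t => jet_lift f i (Tp c (vec_mx (h t)) : C^oo M -> trunc R r)) 0).
Proof.
move=> sc hU sh dh uE bu Dm tD HD; have oI := chart_full_open (c := c).
have tu : TrM u by rewrite uE; exact: Tp_TrM.
have liftE f i : (fun t => jet_lift f i (Tp c (vec_mx (h t)) : C^oo M -> trunc R r)) =
    if (i <= r)%N then fun t => (jet (f \o chart_inv c) (vec_mx (h t)))`_i else fun=> 0.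
  by apply/funext => t; rewrite /jet_lift trunc_coef_Tp; case: leqP.
have sfc f := smooth_chart_comp f sc.
split=> f i; rewrite liftE.
  case: leqP => ir; apply: smooth_fun1P; last exact: (smoothE_cst 0 (open_setT (m := 1))).
  exact: (smooth1_curve (open_jdom oI) hU sh (smoothE_jet i oI (sfc f))).
case: leqP => ir; last by rewrite (trunc_coef_out _ ir) derive1E derive_cst.
rewrite derive1E.
have dhb k : differentiable (fun t => h t 0 k) (0 : R).
  by apply/derivable1_diffP; exact: is_derive_ex (dh k).
pose F (q : 'rV[R]_jdim) := (jet (f \o chart_inv c) (vec_mx q))`_i.
have dF : differentiable F (h 0).
  exact: smoothE_differentiable (open_jdom oI) (smoothE_jet i oI (sfc f)) (hU 0).
have [_ CR] := chain_rule (1 : R) dhb dF.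
transitivity ('D_v F (h 0)); last first.
  rewrite (derive_rVE _ dF); apply: etrans (esym CR); apply: eq_bigr => k _.
  by rewrite (is_derive_eqE (dh k)) mulrC.
rewrite /F (derive_jet_vec v oI (sfc f) (hU 0) ir).
rewrite (derivation_coords f tu bu sc Dm tD) trunc_coef_sum coef_sum; apply: eq_bigr => a _.
rewrite trunc_coefM //; apply: (eqXM (k := r)) => // j jr; first exact: HD.
rewrite (TrM_jet _ tu bu sc Dm jr).
have bb : jbase (vec_mx (h 0)) = chart_map c m.
  have bT := Tp_base sc (hU 0); rewrite -uE in bT.
  have [D0 E0] := chart_invKK (hU 0); by rewrite (base_unique bu bT) E0.
have -> : coords c m u = vec_mx (h 0) by rewrite uE coords_Tp.
rewrite (jet_near Dm bb (pdxP f a sc Dm)); congr (_`_j).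
have E y : (chart_map c @` chart_dom c) y -> (chart_pd c a f \o chart_inv c) y = 'D_(delta_mx 0 a) (f \o chart_inv c) y.
  by move=> [x Dx <-]; rewrite /= /chart_pd chart_invK.
by rewrite (jet_ext oI (hU 0) E).
Qed.

End adapted_charts.

(** * From weightings to the three conditions *)

Section from_weighting.
Context {R : realType} {n : nat} {M : manifold R n} {r : nat}.
Local Notation jdim := (r.+1 * n)%N.
Implicit Types (c : chart R n M) (f g : C^oo M) (m : M) (u v D : C^oo M -> trunc R r).

Lemma weighted_ideal_coord c w a : smooth_chart c ->
  weighted_ideal c w (w a) (fun x => chart_map c x 0 a).
Proof.
move=> sc; exists 1%N, (fun _ b => (b == a) : nat), (fun _ _ => 1); split.
- by move=> _; rewrite (bigD1 a) //= eqxx mul1n leq_addr.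
- by move=> _; exact: smooth_on_cst (chart_dom_open c).
- move=> y Dy; rewrite big_ord1 mul1r (bigD1 a) //= eqxx expr1 big1 ?mulr1 // => b ba.
  by rewrite (negbTE ba) expr0.
Qed.

Section weighting_to_charts.
Variables (N : set M) (F : nat -> set M -> set (M -> R)).
Hypotheses (wF : weighting r F) (FN : weighting_along N F).
Let Q := weighting_jets r F.

Lemma coordinate_extension c w m a : smooth_chart c -> chart_dom c m ->
  (forall i (f : M -> R), F i (chart_dom c) f <-> weighted_ideal c w i f) ->
  exists f, F (w a) setT f /\ \forall x \near m, f x = chart_map c x 0 a.
Proof.
move=> sc Dm FE; have oD := chart_dom_open c.
have [b [K [cK KD b0 b1]]] := bump_exists oD Dm.
have [f [Ff fE]] := ideal_sheaf_extend (weighting_sheaf wF (w a)) oD cK KD b0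
  ((FE _ _).2 (weighted_ideal_coord w a sc)).
by exists f; split=> //; apply: filterS2 b1 (near_dom Dm) => x bx Dx; rewrite fE // bx mul1r.
Qed.

Lemma weighting_adapted m : N m -> exists c w, [/\ chart_dom c m, adapted Q c w &
  forall i (f : M -> R), F i (chart_dom c) f <-> weighted_ideal c w i f].
Proof.
move=> Nm; have [[c [w [sc Dm ws FE]]]|[U [oU Um FE]]] := weighting_local wF m; last first.
  (* The trivial alternative is impossible at a point of [N]: it would put the constant 1 into the
     vanishing ideal of [N]. *)
  have s1 : smooth_on U (fun=> 1 : R) by exact: smooth_on_cst.
  have := (FE 1%N _).2 s1; rewrite (FN _ oU) => -[_ /(_ m Um Nm)] /eqP.
  by rewrite oner_eq0.
exists c, w; split=> //; split=> // u m' tu bu Dm'.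
split=> [[_ Qu] a j ja|H].
  have [f [Ff fx]] := coordinate_extension a sc Dm' FE.
  rewrite (TrM_germ tu bu (_ : \forall x \near m', Xc c m' a x = f x)).
    by apply: (Qu f _ _ Ff); rewrite ja; exact: ws.2.
  by apply: filterS2 fx (XcP a sc Dm') => x -> ->.
split=> // f i j Ff /andP[ji ir].
have oD := chart_dom_open c.
have := ideal_sheaf_restr (weighting_sheaf wF i) openT oD (subsetT _) Ff.
by move=> /FE/(weighted_ideal_ord sc tu bu Dm')/(_ H); exact.
Qed.

End weighting_to_charts.

Section necessity.
Variable Q : set (C^oo M -> trunc R r).
Hypotheses (QT : Q `<=` @TrM _ _ M r) (r0 : (0 < r)%N).
(** The order of [f] is bounded below along all of [Q], since a curve in [Q] may leave the region
    where [f] is a coordinate. *)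
Hypothesis Qloc : forall u, Q u -> exists c w m, [/\ base_point u m, chart_dom c m, adapted Q c w &
  forall a, exists f, (\forall x \near m, f x = chart_map c x 0 a) /\
    forall u', Q u' -> trunc_ord (w a) (u' f)].

Lemma trunc_Xn0 (x : trunc R r) : 'qX ^+ r * x = x`_0 *: 'qX ^+ r.
Proof.
apply: trunc_eq => i ir; rewrite trunc_coefXnM // trunc_coefZ.
have := @trunc_coefXnM R r 1 r _ ir; rewrite mulr1 => ->.
have [ri|ri] := leqP r i; last by rewrite mulr0.
have -> : (i - r)%N = 0%N by apply/eqP; rewrite subn_eq0.
by rewrite trunc_coef1 mulr1.
Qed.

Lemma coef_qXr i : ('qX ^+ r : trunc R r)`_i = (i == r)%:R.
Proof.
have [ir|ri] := leqP i r; last by rewrite (trunc_coef_out _ ri) gtn_eqF.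
have := @trunc_coefXnM R r 1 r _ ir; rewrite mulr1 => ->; rewrite trunc_coef1.
by rewrite [in RHS]eqn_leq ir /=; case: leqP => //= ri; rewrite subn_eq0 ir.
Qed.

Lemma TrM_top u m (t : C^oo M -> R) : TrM u -> base_point u m -> tangent_vector m t ->
  TrM (fun f => u f + t f *: 'qX ^+ r).
Proof.
move=> [ul [u1 uM]] bu [tl tM]; have [uD uZ _ _] := linear_props ul.
have t1 : t 1 = 0.
  have := tM (1 : C^oo M) (1 : C^oo M); rewrite smooth_fun1E mul1r mulr1 mul1r => /eqP.
  by rewrite -[X in X == _]addr0 (inj_eq (addrI _)) eq_sym => /eqP.
split.
  by move=> k f g /=; rewrite uD uZ tl scalerDl scalerDr scalerA !addrA; congr (_ + _); rewrite addrAC.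
split; first by rewrite u1 t1 scale0r addr0.
move=> f g; rewrite uM tM mulrDr !mulrDl -!addrA; congr (_ + _).
have bE h : (u h)`_0 = h m := bu h.
rewrite -!scalerAl -!scalerAr !trunc_Xn0 [u f * _]mulrC trunc_Xn0 coef_qXr.
(* The product of the two terms in epsilon^r vanishes because [r] is positive. *)
rewrite (ltn_eqF r0) scale0r scaler0 scaler0 addr0 !scalerA !bE -scalerDl.
by rewrite [t f * _]mulrC [LHS](_ : _ = (g m * t f + t g * f m) *: 'qX ^+ r) // [t g * _]mulrC.
Qed.

Lemma necessity_TM : TM_invariant Q.
Proof.
move=> u m t Qu bu tt; have [c [w [m' [bu' Dm ad _]]]] := Qloc Qu.
have E := base_unique bu bu'; rewrite -{m' bu'}E in Dm.
have [sc ws H] := ad; have tu := QT Qu; have tu' := TrM_top tu bu tt.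
have bu' : base_point (fun f => u f + t f *: 'qX ^+ r) m.
  by move=> f; rewrite /jet_lift trunc_coefD trunc_coefZ coef_qXr (ltn_eqF r0) mulr0 addr0; exact: bu.
apply/(H _ m tu' bu' Dm) => a j ja.
have ja' : (j < r)%N := leq_trans ja (ws.2 a).
rewrite trunc_coefD trunc_coefZ coef_qXr (ltn_eqF ja') mulr0 addr0.
exact: ((H _ m tu bu Dm).1 Qu a j ja).
Qed.

Lemma tangent_at_order c w m u v : adapted Q c w -> Q u -> base_point u m -> chart_dom c m ->
  (forall a, exists f, (\forall x \near m, f x = chart_map c x 0 a) /\
    forall u', Q u' -> trunc_ord (w a) (u' f)) ->
  tangent_at Q u v -> forall a, trunc_ord (w a) (v (Xc c m a)).
Proof.
move=> [sc ws _] Qu bu Dm Hf [tv [g [Qg g0 sg dg]]] a j ja; have [f [fx Hfa]] := Hf a.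
rewrite (tangent_germ (QT Qu) bu tv (_ : \forall x \near m, Xc c m a x = f x)); last first.
  by apply: filterS2 fx (XcP a sc Dm) => x -> ->.
rewrite dg (_ : (fun t => _) = fun=> 0) ?derive1E ?derive_cst //.
by apply/funext => t; exact: Hfa.
Qed.

(** In an adapted chart [Q] is given by linear equations on jet coordinates, so a bounded line with
    velocity [v] stays in [Q]. *)
Lemma order_tangent_at c w m u v : adapted Q c w -> Q u -> base_point u m -> chart_dom c m ->
  tangent_TrM u v -> (forall a, trunc_ord (w a) (v (Xc c m a))) -> tangent_at Q u v.
Proof.
move=> [sc ws H] Qu bu Dm tv Hv; split=> //; have tu := QT Qu.
have oI := chart_full_open (c := c).
pose p : 'M[R]_(r.+1, n) := coords c m u.
pose V : 'M[R]_(r.+1, n) := \matrix_(j, a) (v (Xc c m a))`_j.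
have bp : jdom (chart_map c @` chart_dom c) (mxvec p).
  by rewrite /jdom /= mxvecK (jbase_coords bu sc Dm); exists m.
have /near_normP[e e0 He] : nbhs (mxvec p) (jdom (chart_map c @` chart_dom c)).
  by apply: open_nbhs_nbhs; split=> //; exact: open_jdom.
have [h [h0 hb sh dh hc]] := bounded_curve (mxvec p) (mxvec V) e0.
have hU t : (chart_map c @` chart_dom c) (jbase (vec_mx (h t))) by apply: He.
have uE : u = Tp c (vec_mx (h 0)) by rewrite h0 mxvecK; exact: TrM_Tp.
have HV a j : (j <= r)%N -> (v (Xc c m a))`_j = (jcoord (vec_mx (mxvec V)) a)`_j.
  by move=> jr; rewrite mxvecK /jcoord coef_poly ltnS jr mxE inordK.
have [s1 s2] := chart_curve_tangent sc hU sh dh uE bu Dm tv HV.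
exists (fun t => Tp c (vec_mx (h t))); split=> // t.
have tT : TrM (Tp c (vec_mx (h t)) : C^oo M -> trunc R r) by exact: Tp_TrM.
have bT := Tp_base (r := r) sc (hU t).
have [Dt Et] := chart_invKK (hU t).
apply/(H _ _ tT bT Dt) => a j ja.
have jr : (j < r.+1)%N by rewrite ltnS (leq_trans (ltnW ja)) ?ws.2.
rewrite (Tp_coord sc Dt (esym Et) (XcP a sc Dt)) //.
have := vec_mx_entry (h t) (mxvec_index (Ordinal jr) a); rewrite jrowE jcolE /= => <-.
have pj : (u (Xc c m a))`_j = 0 by apply: ((H _ m tu bu Dm).1 Qu a).
by rewrite hc mxvecE mxE //; exact: Hv.
Qed.

Lemma necessity_Ar : tangent_Ar_invariant Q.
Proof.
move=> u v x Qu tv; have [c [w [m [bu Dm ad Hf]]]] := Qloc Qu.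
have ov := tangent_at_order ad Qu bu Dm Hf tv.
have [[vl vM] _] := tv; have [vD vZ _ _] := linear_props vl.
apply: (order_tangent_at ad Qu bu Dm).
  split; first by move=> k f g /=; rewrite vD vZ mulrDr scalerAr.
  by move=> f g /=; rewrite vM mulrDr mulrA; congr (_ + _); rewrite mulrCA.
move=> a; rewrite -[w a]add0n; apply: trunc_ordM; [exact: trunc_ord0 | exact: ov].
Qed.

Lemma tangent_at_0 u : Q u -> tangent_at Q u (fun=> 0).
Proof.
move=> Qu; split.
  by split=> [k f g|f g]; rewrite ?scaler0 ?addr0 // mul0r mulr0 addr0.
exists (fun=> u); split=> // f i; last by rewrite derive1E derive_cst trunc_coef0.
by apply: smooth_fun1P; exact: (smoothE_cst _ (open_setT (m := 1))).
Qed.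

(** * Coordinate vector fields, cut off to global ones *)

Section cut_off_frame.
Variables (c : chart R n M) (beta : C^oo M) (K : set M).
Hypotheses (sc : smooth_chart c) (cK : closed K) (KD : K `<=` chart_dom c).
Hypothesis beta0 : forall x, ~ K x -> beta x = 0.

Lemma cut_off_ex a f : exists g, forall x, g x = extz (chart_dom c) ((beta : M -> R) * chart_pd c a f) x.
Proof.
have oD := chart_dom_open c.
have s1 : smooth_on (chart_dom c) (chart_pd c a f).
  have := smooth_chart_pd a sc openT (@smooth_fun_on _ _ _ setT f).
  by apply: smooth_on_sub => x.
have s2 : smooth_on (chart_dom c) ((beta : M -> R) * chart_pd c a f).
  by apply: smooth_onM => //; exact: smooth_fun_on.
have z x : chart_dom c x -> ~ K x -> ((beta : M -> R) * chart_pd c a f) x = 0.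
  by move=> _ /beta0 E; rewrite /GRing.mul /= E mul0r.
by exists (SmoothFun (smooth_extz oD cK s2 z KD)).
Qed.

Definition cut_off_field a f : C^oo M := projT1 (cid (cut_off_ex a f)).

Lemma cut_off_fieldE a f x : chart_dom c x -> cut_off_field a f x = beta x * chart_pd c a f x.
Proof. by move=> Dx; rewrite /cut_off_field; case: cid => g /= ->; rewrite extzE. Qed.

Lemma cut_off_field_out a f x : ~ K x -> cut_off_field a f x = 0.
Proof.
move=> nK; have [Dx|nD] := pselect (chart_dom c x).
  by rewrite cut_off_fieldE // beta0 // mul0r.
by rewrite /cut_off_field; case: cid => g /= ->; rewrite extz_out.
Qed.

Lemma cut_off_vector_field a : vector_field (cut_off_field a).
Proof.
split=> [k f g|f g]; apply: smooth_fun_ext => x.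
  rewrite smooth_funD smooth_funZ; have [Dx|nD] := pselect (chart_dom c x).
    by rewrite !cut_off_fieldE // chart_pd_linear //; ring.
  have nK : ~ K x by move=> /KD.
  by rewrite !cut_off_field_out // mulr0 addr0.
rewrite smooth_funD !smooth_funM; have [Dx|nD] := pselect (chart_dom c x).
  rewrite !cut_off_fieldE // [X in _ * X](_ : _ = chart_pd c a ((f : M -> R) * g) x) // chart_pdM //.
  ring.
have nK : ~ K x by move=> /KD.
by rewrite !cut_off_field_out // mul0r mulr0 addr0.
Qed.

(** At jets based outside the chart the lift is 0. Inside, it changes only the coordinate [a], and
    there by a multiple of epsilon^j with [j] at least [w a]. *)
Lemma cut_off_lift_tangent w a j : adapted Q c w -> (w a <= j)%N -> lift_tangent_to Q (cut_off_field a) j.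
Proof.
move=> ad wj u Qu; have tu := QT Qu; have [ul [u1 uM]] := tu; have [uD uZ _ u0] := linear_props ul.
have [c' [w' [m [bu _ _ _]]]] := Qloc Qu.
have [Dm|nD] := pselect (chart_dom c m); last first.
  have nK : \forall x \near m, ~ K x.
    by apply: open_nbhs_nbhs; split; [exact: closed_openC | move=> /KD].
  have -> : lift_vf (cut_off_field a) j u = fun=> 0; last exact: tangent_at_0.
  apply/funext => f; rewrite /lift_vf (_ : u _ = 0) ?mulr0 // -u0; apply: (TrM_germ tu bu).
  by apply: filterS nK => x nK; rewrite cut_off_field_out.
have [Xl XM] := cut_off_vector_field a.
apply: (order_tangent_at ad Qu bu Dm).
  split=> [k f g|f g]; rewrite /lift_vf.
    by rewrite Xl uD uZ mulrDr scalerAr.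
  by rewrite XM uD !uM mulrDr mulrA; congr (_ + _); rewrite mulrCA.
move=> b; rewrite /lift_vf; have nX := chart_pd_near a Dm (XcP b sc Dm).
have [ab|ab] := eqVneq a b; last first.
  rewrite (_ : u _ = 0) ?mulr0; first by move=> l _; rewrite trunc_coef0.
  rewrite -u0; apply: (TrM_germ tu bu); apply: filterS2 nX (near_dom Dm) => x E Dx.
  by rewrite cut_off_fieldE // E chart_pd_coord // (negbTE ab) mulr0.
move=> l lw; have [lr|rl] := leqP l r; last by rewrite trunc_coef_out.
by rewrite trunc_coefXnM // leqNgt (leq_trans lw) // -ab.
Qed.

End cut_off_frame.

Lemma trunc_expand (x : trunc R r) : x = \sum_(j < r.+1) x`_j *: 'qX ^+ j.
Proof.
apply: trunc_eq => i ir; rewrite trunc_coef_sum.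
have E (j : 'I_r.+1) : (x`_j *: 'qX ^+ j : trunc R r)`_i = if j == i :> nat then x`_i else 0.
  rewrite trunc_coefZ; have := @trunc_coefXnM R r 1 j _ ir; rewrite mulr1 => ->.
  rewrite trunc_coef1 subn_eq0 eqn_leq; case: leqP => ji; rewrite ?mulr0 //=.
  by case: leqP => ij; rewrite ?mulr0 // mulr1; congr (x`__); apply/eqP; rewrite eqn_leq ji.
rewrite (eq_bigr _ (fun j _ => E j)) (bigD1 (Ordinal (ir : (i < r.+1)%N))) //= eqxx big1 ?addr0 // => j ji.
by case: eqP => // E1; case/eqP: ji; exact: val_inj.
Qed.

Lemma necessity_spanned : tangent_spanned_by_lifts Q.
Proof.
move=> u v Qu tv; have [c [w [m [bu Dm ad Hf]]]] := Qloc Qu.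
have ov := tangent_at_order ad Qu bu Dm Hf tv; have [sc ws _] := ad; have tu := QT Qu.
have [ul _] := tu; have [_ _ _ u0] := linear_props ul.
have [beta [K [cK KD b0 b1]]] := bump_exists (chart_dom_open c) Dm.
pose Y a := cut_off_field sc cK KD b0 a.
(* For [j < w a] the coefficient of epsilon^j in the value of [v] on x_a is 0, so the zero field can
   stand in. *)
pose X (p : 'I_n * 'I_r.+1) : C^oo M -> C^oo M := if (w p.1 <= p.2)%N then Y p.1 else fun=> 0.
pose ev (l : 'I_#|{: 'I_n * 'I_r.+1}|) : 'I_n * 'I_r.+1 := enum_val l.
exists #|{: 'I_n * 'I_r.+1}|, (fun l => X (ev l)), (fun l => (ev l).2),
  (fun l => (v (Xc c m (ev l).1))`_(ev l).2); split.
  move=> l; move: (ev l) => [a j]; rewrite /X /=; case: leqP => wj.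
    by split; [exact: cut_off_vector_field | exact: (cut_off_lift_tangent _ _ _ _ ad wj)].
  split; first by split=> [k f g|f g]; rewrite ?scaler0 ?addr0 // mul0r mulr0 addr0.
  move=> u' Qu'; have [ul' _] := QT Qu'; have [_ _ _ u0'] := linear_props ul'.
  have -> : lift_vf (fun=> 0) j u' = fun=> 0; last exact: tangent_at_0.
  by apply/funext => f; rewrite /lift_vf u0' mulr0.
pose G (p : 'I_n * 'I_r.+1) : C^oo M -> trunc R r := (v (Xc c m p.1))`_p.2 *: lift_vf (X p) p.2 u.
rewrite -(big_enum_val (A := {: 'I_n * 'I_r.+1}) G) /=.
apply/funext => f; rewrite fct_sumE -(pair_bigA _ (fun a j => G (a, j) f)) /=.
have tv' : tangent_TrM u v by case: tv.
rewrite (derivation_coords f tu bu sc Dm tv'); apply: eq_bigr => a _.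
rewrite {1}[v _]trunc_expand mulr_suml; apply: eq_bigr => j _.
rewrite /G /= -[RHS]/((v (Xc c m a))`_j *: lift_vf (X (a, j)) j u f) -scalerAl.
have [wj|jw] := leqP (w a) j; last by rewrite ov // !scale0r.
congr (_ *: (_ * _)); rewrite /X /= wj; apply: (TrM_germ tu bu).
apply: filterS3 (pdxP f a sc Dm) b1 (near_dom Dm) => x -> bx Dx.
by rewrite cut_off_fieldE // bx mul1r.
Qed.

End necessity.

Lemma weighting_necessary N (F : nat -> set M -> set (M -> R)) : (0 < r)%N ->
  weighting r F -> weighting_along N F -> graded_subbundle_along N (weighting_jets r F) ->
  let Q := weighting_jets r F in
  [/\ TM_invariant Q, tangent_Ar_invariant Q & tangent_spanned_by_lifts Q].
Proof.
move=> r0 wF FN gQ Q; have QT : Q `<=` @TrM _ _ M r by move=> u [].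
have Qloc u : Q u -> exists c w m, [/\ base_point u m, chart_dom c m, adapted Q c w &
    forall a, exists f, (\forall x \near m, f x = chart_map c x 0 a) /\
      forall u', Q u' -> trunc_ord (w a) (u' f)].
  move=> Qu; have [m [bu Nm]] := graded_base_exists gQ Qu.
  have [c [w [Dm ad FE]]] := weighting_adapted wF FN Nm.
  exists c, w, m; split=> // a; have [sc ws _] := ad.
  have [f [Ff fx]] := coordinate_extension wF a sc Dm FE.
  exists f; split=> // u' [_ Qu'] j ja; apply: (Qu' f _ _ Ff).
  by rewrite ja; exact: ws.2.
by split; [exact: necessity_TM | exact: necessity_Ar | exact: necessity_spanned].
Qed.

End from_weighting.

(** * Weighted order of vanishing *)

Section vanishing_order.
Context {R : realType} {n : nat}.
Implicit Types (O : set 'rV[R]_n) (f g h : 'rV[R]_n -> R) (s : seq 'I_n) (w : 'I_n -> nat).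

Definition ders s f := foldl (fun f b => 'd_b f) f s.

Definition wt w s := (\sum_(b <- s) w b)%N.

Definition weight_locus w (x : 'rV[R]_n) := forall a, (0 < w a)%N -> x 0 a = 0.

(** Derivatives in directions of weight 0 are tangent to the locus and would add no condition. *)
Definition wvan O w i f := forall s, all (fun b => (0 < w b)%N) s -> (wt w s < i)%N ->
  forall x, O x -> weight_locus w x -> ders s f x = 0.

Lemma derive_extE O f g b : open O -> (forall x, O x -> f x = g x) ->
  forall x, O x -> 'D_(delta_mx 0 b) f x = 'D_(delta_mx 0 b) g x.
Proof.
move=> oO fg x Ox; apply: near_eq_derive.
have : nbhs x O by exact: open_nbhs_nbhs.
by apply: filterS => y Oy; exact: fg.
Qed.

Lemma ders_ext O s f g : open O -> (forall x, O x -> f x = g x) ->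
  forall x, O x -> ders s f x = ders s g x.
Proof.
move=> oO; elim: s f g => [|b s IH] f g fg //=; apply: IH => x Ox.
exact: derive_extE oO fg x Ox.
Qed.

Lemma ders0 s x : ders s (fun=> 0) x = 0.
Proof.
elim: s => [|b s IH] //=; rewrite -[RHS]IH; congr (ders s _ x).
by apply/funext => y; rewrite derive_cst.
Qed.

Lemma wvan_ext O w i f g : open O -> (forall x, O x -> f x = g x) -> wvan O w i f -> wvan O w i g.
Proof.
move=> oO fg H s ps ws x Ox Zx; rewrite -(H s ps ws x Ox Zx).
by apply/esym; exact: ders_ext oO fg x Ox.
Qed.

Lemma wvan_le O w i j f : (j <= i)%N -> wvan O w i f -> wvan O w j f.
Proof. by move=> ji H s ps ws; apply: H => //; exact: leq_trans ji. Qed.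

Lemma wvan_sub O O' w i f : O' `<=` O -> wvan O w i f -> wvan O' w i f.
Proof. by move=> OO H s ps ws x Ox; apply: H => //; exact: OO. Qed.

Lemma wvan_d O w i b f : (0 < w b)%N -> wvan O w i f -> wvan O w (i - w b) ('d_b f).
Proof.
move=> wb H s ps ws; apply: (H (b :: s)); first by rewrite /= wb.
by rewrite /wt big_cons addnC -ltn_subRL; move: ws; rewrite /wt; lia.
Qed.

Lemma wvan_val O w i f x : wvan O w i f -> (0 < i)%N -> O x -> weight_locus w x -> f x = 0.
Proof. by move=> H i0; apply: (H [::]) => //; rewrite /wt big_nil. Qed.

Lemma dersD O s f g x : open O -> smoothE O f -> smoothE O g -> O x ->
  ders s (fun x => f x + g x) x = ders s f x + ders s g x.
Proof.
move=> oO; elim: s f g => [|b s IH] f g sf sg Ox //=.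
have E y : O y -> 'D_(delta_mx 0 b) (fun x => f x + g x) y = 'D_(delta_mx 0 b) f y + 'D_(delta_mx 0 b) g y.
  by move=> Oy; rewrite -deriveD //; exact: smoothE_derivable oO _ Oy.
by rewrite (ders_ext s oO E Ox) IH //; exact: smoothE_d.
Qed.

Lemma wvanD O w i f g : open O -> smoothE O f -> smoothE O g ->
  wvan O w i f -> wvan O w i g -> wvan O w i (fun x => f x + g x).
Proof.
move=> oO sf sg Hf Hg s ps ws x Ox Zx.
by rewrite (dersD s oO sf sg Ox) (Hf s) // (Hg s) // addr0.
Qed.

Lemma wvanM O w i j f g : open O -> smoothE O f -> smoothE O g ->
  wvan O w i f -> wvan O w j g -> wvan O w (i + j) (fun x => f x * g x).
Proof.
move=> oO sf sg Hf Hg s; elim: s i j f g sf sg Hf Hg => [|b s IH] i j f g sf sg Hf Hg.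
  move=> _ ws x Ox Zx /=; have [i0|i0] := posnP i; last by rewrite (wvan_val Hf) // mul0r.
  by rewrite (wvan_val Hg) ?mulr0 //; move: ws; rewrite /wt big_nil i0.
move=> /= /andP[wb ps] ws x Ox Zx.
have E y : O y -> 'D_(delta_mx 0 b) (fun x => f x * g x) y =
    'D_(delta_mx 0 b) f y * g y + f y * 'D_(delta_mx 0 b) g y.
  by move=> Oy; rewrite derive_mul //; exact: smoothE_derivable oO _ Oy.
have sdf := smoothE_d b sf; have sdg := smoothE_d b sg.
have s1 := smoothEM oO sdf sg; have s2 := smoothEM oO sf sdg.
rewrite (ders_ext s oO E Ox) (dersD s oO s1 s2 Ox).
rewrite (IH (i - w b)%N j _ _ sdf sg (wvan_d wb Hf) Hg) //; last by move: ws; rewrite /wt big_cons; lia.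
rewrite (IH i (j - w b)%N _ _ sf sdg Hf (wvan_d wb Hg)) ?addr0 //.
by move: ws; rewrite /wt big_cons; lia.
Qed.

Lemma derive_line0 m (F : 'rV[R]_m -> R) q v : (forall t : R, F (t *: v + q) = 0) -> 'D_v F q = 0.
Proof.
move=> H; apply: is_derive_eqE; apply: is_derive_affine => t.
by rewrite H mulr0 addr0 -[q]add0r -(scale0r v) H.
Qed.

(* The jets [p] in the hypothesis are stable under adding multiples of e_b epsilon^(w b). *)
Lemma jet_wvan r O w i h : open O -> smoothE O h -> (forall a, (w a <= r)%N) -> (i <= r.+1)%N ->
  (forall p : 'M[R]_(r.+1, n), O (jbase p) -> (forall b j, (j < w b)%N -> (jcoord p b)`_j = 0) ->
     forall j, (j < i)%N -> (jet h p)`_j = 0) -> wvan O w i h.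
Proof.
move=> oO + wr + + s; elim: s i h => [|b s IH] i h sh ir H.
  move=> _ i0 x Ox Zx; pose p : 'M[R]_(r.+1, n) := vec_mx (jemb ord0 x).
  have bp : jbase p = x by exact: jbase_jemb0.
  have := H p; rewrite bp => /(_ Ox) H1; have := H1 _ 0%N; rewrite jet0 bp; apply; last first.
    by move: i0; rewrite /wt big_nil.
  move=> c j jw; rewrite /p; case: j jw => [|j] jw; first by rewrite jcoord0 bp Zx.
  rewrite coef_poly; case: ltnP => // jr; rewrite mxE jembE -val_eqE /= inordK //.
move=> /= /andP[wb ps] ws; apply: (IH (i - w b)%N) => //; first exact: smoothE_d.
- by apply: leq_trans (leq_subr _ _) ir.
- move=> p Op Hp j ji; pose l := (j + w b)%N.
  have li : (l < i)%N by rewrite /l; move: ji; lia.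
  have lr : (l <= r)%N by rewrite -ltnS; exact: leq_trans li ir.
  have wbr : (w b < r.+1)%N by rewrite ltnS wr.
  pose v : 'rV[R]_(r.+1 * n) := jemb (Ordinal wbr) (delta_mx 0 b).
  have Oq : O (jbase (vec_mx (mxvec p))) by rewrite mxvecK.
  have Ec c : eqX r (jcoord (vec_mx v) c) (if c == b then 'X^(w b) else 0).
    move=> k kr; rewrite coef_poly ltnS kr mxE jembE mxE eqxx /= -val_eqE /= inordK //.
    by case: (c == b); rewrite ?coef0 ?coefXn; case: (k == w b).
  have E := derive_jet_vec v oO sh Oq lr.
  rewrite (derive_line0 (F := fun q => (jet h (vec_mx q))`_l)) in E; last first.
    move=> t; rewrite linearD linearZ /= mxvecK; apply: H => //.
      rewrite (_ : jbase _ = jbase p) //; apply/rowP => c; rewrite !mxE jembE -val_eqE /=.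
      by rewrite (ltn_eqF wb) mulr0 add0r.
    move=> c k kw; have kr : (k < r.+1)%N by rewrite ltnS (leq_trans (ltnW kw)).
    have pk : p (inord k) c = 0 by have := Hp c k kw; rewrite coef_poly kr.
    rewrite coef_poly kr mxE pk addr0 mxE [vec_mx v _ _]mxE jembE -val_eqE /= inordK // mxE eqxx /=.
    case: eqP => [kE|]; rewrite ?mulr0 //.
    by case: eqP => [cb|]; [move: kw; rewrite cb kE ltnn | rewrite mulr0].
  have E2 : eqX r (\sum_a jcoord (vec_mx v) a * jet ('d_a h) (vec_mx (mxvec p))) ('X^(w b) * jet ('d_b h) p).
    apply: (eqX_trans (Q := \sum_a if a == b then 'X^(w b) * jet ('d_b h) p else 0)).
      apply: eqX_sum => a; rewrite mxvecK; case: (eqVneq a b) (Ec a) => [->|ab] Ea.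
        by apply: eqXM Ea _; exact: eqX_refl.
      by rewrite -[X in eqX _ _ X](mul0r (jet ('d_a h) p)); apply: eqXM Ea _; exact: eqX_refl.
    by rewrite -big_mkcond big_pred1_eq; exact: eqX_refl.
  have := E2 l lr; rewrite -E coefXnM /l ltnNge leq_addl /= addnK => /esym //.
- by move: ws; rewrite /wt big_cons; lia.
Qed.

End vanishing_order.

Section weighted_Hadamard.
Context {R : realType} {n : nat}.
Variables (O : set 'rV[R]_n) (w : 'I_n -> nat).
Let P (a : 'I_n) := (0 < w a)%N.
Hypotheses (oO : open O) (sO : star P O).
Implicit Types (f g : 'rV[R]_n -> R).

Definition monomial_sum i f := exists k (s : 'I_k -> 'I_n -> nat) (g : 'I_k -> 'rV[R]_n -> R),
  [/\ forall l, (i <= \sum_a s l a * w a)%N, forall l, smoothE O (g l) &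
      forall x, O x -> f x = \sum_(l < k) g l x * \prod_a x 0 a ^+ s l a].

Lemma monomial_sum_ext i f g : (forall x, O x -> f x = g x) -> monomial_sum i f -> monomial_sum i g.
Proof.
move=> fg [k [s [h [si sh E]]]]; exists k, s, h; split=> // x Ox.
by rewrite -fg // E.
Qed.

Lemma monomial_sum0 i : monomial_sum i (fun=> 0).
Proof.
exists 0%N, (fun _ _ => 0%N), (fun _ _ => 0); split=> [[]//|[]//|x _].
by rewrite big_ord0.
Qed.

Lemma monomial_sumD i f g : monomial_sum i f -> monomial_sum i g -> monomial_sum i (fun x => f x + g x).
Proof.
move=> [k1 [s1 [h1 [si1 sh1 E1]]]] [k2 [s2 [h2 [si2 sh2 E2]]]].
exists (k1 + k2)%N, (fun l => match fintype.split l with inl j => s1 j | inr j => s2 j end),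
  (fun l => match fintype.split l with inl j => h1 j | inr j => h2 j end); split.
- by move=> l; case: fintype.split => j.
- by move=> l; case: fintype.split => j.
- move=> x Ox; rewrite E1 // E2 // big_split_ord /=; congr (_ + _); apply: eq_bigr => l _.
    by rewrite (unsplitK (inl l)).
  by rewrite (unsplitK (inr l)).
Qed.

Lemma monomial_sum_sum i (Q : pred 'I_n) (F : 'I_n -> 'rV[R]_n -> R) :
  (forall a, Q a -> monomial_sum i (F a)) -> monomial_sum i (fun x => \sum_(a | Q a) F a x).
Proof.
move=> H; elim: (index_enum _) => [|a s IH].
  by apply: monomial_sum_ext (monomial_sum0 i) => x _; rewrite big_nil.
have [Qa|Qa] := boolP (Q a); last by apply: monomial_sum_ext IH => x _; rewrite big_cons (negbTE Qa).
by apply: monomial_sum_ext (monomial_sumD (H a Qa) IH) => x _; rewrite big_cons Qa.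
Qed.

Lemma monomial_sum_mulx i a f : monomial_sum (i - w a) f -> monomial_sum i (fun x => x 0 a * f x).
Proof.
move=> [k [s [h [si sh E]]]]; exists k, (fun l b => (s l b + (b == a))%N), h; split=> //.
  move=> l; have := si l; rewrite leq_subLR => H; apply: leq_trans H _.
  under [leqRHS]eq_bigr => b _ do rewrite mulnDl.
  rewrite big_split /= addnC leq_add2l (bigD1 a) //= eqxx mul1n leq_addr //.
move=> x Ox; rewrite E // mulr_sumr; apply: eq_bigr => l _; rewrite mulrCA; congr (_ * _).
under [RHS]eq_bigr => b _ do rewrite exprD.
rewrite big_split /= mulrC; congr (_ * _); rewrite (bigD1 a) //= eqxx expr1 big1 ?mulr1 // => b ba.
by rewrite (negbTE ba) expr0.
Qed.

Lemma ders_hint s j f : smoothE O f -> exists j', forall x, O x -> ders s (hint j P f) x = hint j' P (ders s f) x.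
Proof.
elim: s j f => [|b s IH] j f sf; first by exists j.
have [j' H] := IH (j + P b)%N _ (smoothE_d b sf); exists j' => x Ox /=.
rewrite -H //; apply: (ders_ext s oO) => // y Oy.
exact: derive_hint oO sO sf Oy.
Qed.

(** Points of the locus are fixed by [scl P t], so derivatives of the integral there are multiples
    of the derivatives of [f]. *)
Lemma wvan_hint i f : smoothE O f -> wvan O w i f -> wvan O w i (hint 0 P f).
Proof.
move=> sf H s ps ws x Ox Zx; have [j' ->] := ders_hint s 0 sf => //.
apply: hint_fixed; last exact: H.
move=> t; apply/rowP => a; rewrite mxE; case: ifP => // Pa.
by rewrite Zx ?mulr0.
Qed.

(** In Hadamard's formula the value on the locus is 0, and the coefficient of x_a inherits order
    [i - w a] from ['d_a f]; the induction hypothesis applies because [w a] is positive. *)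
Lemma wvan_monomial_sum i f : smoothE O f -> wvan O w i f -> monomial_sum i f.
Proof.
elim/ltn_ind: i f => i IH f sf H; have [i0|i0] := posnP i.
  exists 1%N, (fun _ _ => 0%N), (fun _ => f); split=> //; first by rewrite i0.
  by move=> x _; rewrite big_ord1 big1 ?mulr1.
have s01 : 0 <= (0 : R) <= 1 by rewrite lexx ler01.
have key : monomial_sum i (fun x => \sum_(a | P a) x 0 a * hint 0 P ('d_a f) x).
  apply: monomial_sum_sum => a Pa; apply: monomial_sum_mulx; apply: IH.
  - by rewrite ltn_subrL i0 andbT.
  - exact: hint_smooth oO sO (smoothE_d a sf).
  - by apply: wvan_hint; [exact: smoothE_d | exact: wvan_d].
apply: monomial_sum_ext key => x Ox; rewrite (hadamard oO sO sf Ox) (wvan_val H i0) ?add0r //.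
  exact: sO.
by move=> a Pa; rewrite mxE /P Pa mul0r.
Qed.

End weighted_Hadamard.

(** * From the three conditions to weightings *)

Section chart_changes.
Context {R : realType} {n : nat} {M : manifold R n}.
Implicit Types (c d : chart R n M).

Lemma continuous_smoothE_map (O : set 'rV[R]_n) (X : 'rV[R]_n -> 'rV[R]_n) x : smoothE_map O X -> O x ->
  {for x, continuous X}.
Proof. by move=> sX Ox; apply: continuous_rV => b; exact: smoothE_cont (sX b) Ox. Qed.

Lemma diffeo_sub (V B : set 'rV[R]_n) X X' : diffeo V X X' -> open B -> B `<=` X @` V ->
  diffeo (V `&` X @^-1` B) X X' /\ X @` (V `&` X @^-1` B) = B.
Proof.
move=> [oV oXV K sX sX'] oB BV.
have E : X @` (V `&` X @^-1` B) = B.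
  apply/seteqP; split=> y; first by move=> [x [_ Bx] <-].
  by move=> By; have [x Vx xy] := BV y By; exists x => //; split=> //; rewrite /= xy.
split=> //; split; rewrite ?E //.
- exact: open_smooth_preimage.
- by move=> x [Vx _]; exact: K.
- by move=> a; apply: smoothE_sub (sX a) => x [].
- by move=> a; apply: smoothE_sub (sX' a).
Qed.

Lemma chart_restrict c V X X' : smooth_chart c -> V `<=` chart_map c @` chart_dom c -> diffeo V X X' ->
  exists c', [/\ smooth_chart c', forall m, chart_dom c' m <-> chart_dom c m /\ V (chart_map c m) &
    forall m, chart_map c' m = X (chart_map c m)].
Proof.
move=> sc VI dX; have [oV oXV K sX sX'] := dX.
pose D := chart_dom c `&` chart_map c @^-1` V.
have iE : (X \o chart_map c) @` D = X @` V.
  apply/seteqP; split=> y [x Hx <-]; first by case: Hx => _ Vx; exists (chart_map c x).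
  by have [m Dm mx] := VI x Hx; exists m; rewrite /D /= mx.
have oD : open D.
  rewrite openE => m [Dm Vm]; have cm := chart_cont Dm.
  have n1 : nbhs m (chart_map c @^-1` V) by apply: cm; exact: open_nbhs_nbhs.
  have n2 : nbhs m (chart_dom c) by apply: open_nbhs_nbhs; split=> //; exact: chart_dom_open.
  exact: filterI n2 n1.
have oI : open ((X \o chart_map c) @` D) by rewrite iE.
have cmap m : D m -> {for m, continuous (X \o chart_map c)}.
  move=> [Dm Vm]; apply: continuous_comp; first exact: chart_cont.
  exact: continuous_smoothE_map sX Vm.
have cinv y : ((X \o chart_map c) @` D) y -> {for y, continuous (chart_inv c \o X')}.
  rewrite iE => XVy; have [x Vx xy] := XVy; apply: continuous_comp; first exact: continuous_smoothE_map sX' XVy.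
  by rewrite -xy K //; apply: chart_inv_cont; exact: VI.
have Kc m : D m -> (chart_inv c \o X') ((X \o chart_map c) m) = m.
  by move=> [Dm Vm] /=; rewrite K // chart_invK.
pose c' := Chart oD oI cmap cinv Kc.
exists c'; split=> // d ad; have [cd dc] := sc d ad; split=> a.
  apply: (smoothE_comp (U := chart_map c @` (chart_dom c `&` chart_dom d)) _ _ _ _ (cd a)).
  - by rewrite setIC; exact: (chart_img_open (c := c') (chart_dom_open d)).
  - by rewrite setIC; exact: (chart_img_open (c := c) (chart_dom_open d)).
  - by move=> _ [m [[Dm Vm] Dd] <-] /=; rewrite K //; exists m.
  - move=> b; apply: smoothE_sub (sX' b) => _ [m [[Dm Vm] Dd] <-] /=.
    by exists (chart_map c m).
apply: (smoothE_comp (U := V) _ oV _ _ (sX a)).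
- by rewrite setIC; exact: (chart_img_open (c := d) oD).
- by move=> _ [m [Dd [Dm Vm]] <-] /=; rewrite chart_invK.
- by move=> b; apply: smoothE_sub (dc b) => _ [m [Dd [Dm Vm]] <-]; exists m.
Qed.

End chart_changes.

Section jets_in_a_chart.
Context {R : realType} {n : nat} {M : manifold R n} {r : nat}.
Local Notation jdim := (r.+1 * n)%N.
Variables (N : set M) (Q : set (C^oo M -> trunc R r)).
Hypotheses (r0 : (0 < r)%N) (gQ : graded_subbundle_along N Q).
Hypotheses (TMI : TM_invariant Q) (ArI : tangent_Ar_invariant Q).
Implicit Types (c : chart R n M) (u : C^oo M -> trunc R r).

Let QT : Q `<=` @TrM _ _ M r.
Proof. by have [[]] := gQ. Qed.

(** The very set that [TrM_submanifold] requires to be a submanifold. *)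
Definition jet_slice c : set 'rV[R]_jdim :=
  [set mxvec p | p in [set p | exists2 u, Q u & jet_coordinates c u p]].

Lemma jet_sliceP c q : smooth_chart c -> (jet_slice c q <->
  (chart_map c @` chart_dom c) (jbase (vec_mx q)) /\ Q (Tp c (vec_mx q))).
Proof.
move=> sc; split.
  move=> [p [u Qu jc] <-]; rewrite mxvecK.
  have [m [bu Dm ->]] := (jet_coordinatesP p (QT Qu) sc).1 jc.
  split; first by exists m => //; rewrite jbase_coords.
  by rewrite -TrM_Tp //; exact: QT.
move=> [Iq Qq]; exists (vec_mx q); last by rewrite vec_mxK.
exists (Tp c (vec_mx q)) => //; have [D1 E1] := chart_invKK Iq.
apply/(jet_coordinatesP _ (QT Qq) sc); exists (chart_inv c (jbase (vec_mx q))).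
by split=> //; [exact: Tp_base | rewrite coords_Tp].
Qed.

Lemma jet_slice_coords c m u : smooth_chart c -> TrM u -> base_point u m -> chart_dom c m ->
  (jet_slice c (mxvec (coords c m u)) <-> Q u).
Proof.
move=> sc tu bu Dm; rewrite (jet_sliceP _ sc) mxvecK -(TrM_Tp tu bu sc Dm) (jbase_coords bu sc Dm).
by split=> [[]|Qu] //; split=> //; exists m.
Qed.

Lemma jet_slice_point c q : smooth_chart c -> jet_slice c q -> exists u m,
  [/\ Q u, base_point u m, chart_dom c m & q = mxvec (coords c m u)].
Proof.
move=> sc /(jet_sliceP _ sc)[Iq Qq]; have [D1 E1] := chart_invKK Iq.
exists (Tp c (vec_mx q)), (chart_inv c (jbase (vec_mx q))); split=> //; first exact: Tp_base.
by rewrite coords_Tp // vec_mxK.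
Qed.

Lemma XcE c m a : smooth_chart c -> chart_dom c m -> Xc c m a m = chart_map c m 0 a.
Proof. by move=> sc Dm; exact: nbhs_singleton (XcP a sc Dm). Qed.

Lemma coords_zero_jet c m : smooth_chart c -> chart_dom c m ->
  mxvec (coords c m (zero_jet r m)) = jemb ord0 (chart_map c m).
Proof.
move=> sc Dm; congr mxvec; apply/matrixP => j a; rewrite !mxE /zero_jet /= coefC -val_eqE /= XcE //.
Qed.

Lemma jet_slice_kappa c t q : smooth_chart c -> jet_slice c q -> jet_slice c (wscl jrow t q).
Proof.
move=> sc /(jet_slice_point sc)[u [m [Qu bu Dm ->]]].
have [_ Qk _] := gQ; have Qtu := Qk t u Qu.
rewrite -[wscl _ _ _]vec_mxK vec_mx_wscl mxvecK -coords_kappa.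
by apply/jet_slice_coords => //; [exact: QT | exact: kappa_base].
Qed.

Lemma chart_pd_tangent c m (x : 'rV[R]_n) : smooth_chart c -> chart_dom c m ->
  tangent_vector m (fun f : C^oo M => \sum_a x 0 a * chart_pd c a f m).
Proof.
move=> sc Dm; split=> [k f g|f g].
  rewrite mulr_sumr -big_split; apply: eq_bigr => a _ /=; rewrite chart_pd_linear //; ring.
rewrite mulr_suml mulr_sumr -big_split; apply: eq_bigr => a _ /=.
rewrite [X in _ * X](_ : _ = chart_pd c a ((f : M -> R) * g) m) // chart_pdM //; ring.
Qed.

Lemma jet_slice_top c q (x : 'rV[R]_n) : smooth_chart c -> jet_slice c q -> jet_slice c (q + jemb ord_max x).
Proof.
move=> sc /(jet_slice_point sc)[u [m [Qu bu Dm ->]]].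
have tt := chart_pd_tangent x sc Dm; have := TMI Qu bu tt.
set u' := (fun f => _) => Qu'.
have bu' : base_point u' m.
  by move=> f; rewrite /jet_lift trunc_coefD trunc_coefZ coef_qXr (ltn_eqF r0) mulr0 addr0; exact: bu.
rewrite (_ : _ + _ = mxvec (coords c m u')); first by apply/jet_slice_coords => //; exact: QT.
apply/rowP => k; case/mxvec_indexP: k => j a; rewrite mxE jembE !mxvecE !mxE trunc_coefD trunc_coefZ coef_qXr.
congr (_ + _); rewrite -val_eqE /=; case: eqP => _; last by rewrite mulr0.
rewrite mulr1 (bigD1 a) //= big1 ?addr0 => [|b ba].
  have E := nbhs_singleton (chart_pd_near a Dm (XcP a sc Dm)).
  by rewrite E chart_pd_coord // eqxx mulr1.
have E := nbhs_singleton (chart_pd_near b Dm (XcP a sc Dm)).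
by rewrite E chart_pd_coord // (negbTE ba) mulr0.
Qed.

(** The curve defines a tangent vector of [Q]; by (ii) its product with epsilon is the velocity of a
    curve [g] in [Q], which has to be read in the chart again. *)
Lemma jet_slice_shift c q v h : smooth_chart c -> scurve (jet_slice c) q v h ->
  exists h', dcurve (jet_slice c) q (jshift v) h'.
Proof.
move=> sc [[Sh h0 dh] sh].
have hU t : (chart_map c @` chart_dom c) (jbase (vec_mx (h t))) by have [] := (jet_sliceP _ sc).1 (Sh t).
have hQ t : Q (Tp c (vec_mx (h t))) by have [] := (jet_sliceP _ sc).1 (Sh t).
pose u := Tp c (vec_mx (h 0)) : C^oo M -> trunc R r.
pose m := chart_inv c (jbase (vec_mx (h 0))).
have [Dm Em] := chart_invKK (hU 0); have bu : base_point u m by exact: Tp_base.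
have tu : TrM u := QT (hQ 0).
have [tD HD] := frame_tangent (fun a => ptrunc (jcoord (vec_mx v) a)) tu bu sc Dm.
set D := (fun f => _) in tD.
have HD' a j : (j <= r)%N -> (D (Xc c m a))`_j = (jcoord (vec_mx v) a)`_j.
  by move=> jr; rewrite /D HD coef_ptrunc.
have [sm dr] := chart_curve_tangent sc hU sh dh erefl bu Dm tD HD'.
have tQ : tangent_at Q u D by split=> //; exists (fun t => Tp c (vec_mx (h t))).
have [_ [g [Qg g0 sg dg]]] := ArI 'qX (hQ 0) tQ.
have nX : \forall x \near m, chart_dom c x /\ forall a, Xc c m a x = chart_map c x 0 a.
  by apply: filterI; [exact: near_dom | apply: filter_forall => a; exact: XcP].
have [U [oU Um HU]] := near_open nX.
have [b [K [cK KU b0 b1]]] := bump_exists oU Um.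
(* The base point of [g t] may leave the region where the functions [Xc c m a] are coordinates. This
   is detected by the bump function [b], and there the constant [q] is used instead; near [t = 0]
   this does not happen. *)
pose h' t : 'rV[R]_jdim := if jet_lift b 0 (g t) != 0 then mxvec (\matrix_(j, a) (g t (Xc c m a))`_j) else q.
have b0m : jet_lift b 0 (g 0) = 1 by rewrite g0 bu (nbhs_singleton b1).
exists h'; split.
- move=> t; rewrite /h'; case: ifP => [nb|_]; last by rewrite -h0.
  have [m' [bm' _]] := graded_base_exists gQ (Qg t).
  have Um' : U m'.
    by apply: KU; apply: contrapT => /b0 E; move: nb; rewrite bm' E eqxx.
  have [Dm' _] := HU m' Um'; have tg := QT (Qg t).
  rewrite (_ : mxvec _ = mxvec (coords c m' (g t))); first by apply/jet_slice_coords.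
  congr mxvec; apply/matrixP => j a; rewrite !mxE; congr (_`_j).
  suff -> : g t (Xc c m a) = g t (Xc c m' a) by [].
  apply: (TrM_germ tg bm'); have nU : nbhs m' U by exact: open_nbhs_nbhs.
  by apply: filterS2 nU (XcP a sc Dm') => x /HU[_ ->] ->.
- rewrite /h' b0m oner_eq0 /= -[RHS]h0 -[RHS]vec_mxK; congr mxvec.
  rewrite -(coords_Tp sc Dm (esym Em)); apply/matrixP => j a; rewrite !mxE g0 //.
- move=> k; case/mxvec_indexP: k => j a.
  have db := sg b 0%N 0%N 0; rewrite /= in db.
  have cb : {for 0, continuous (fun t => jet_lift b 0 (g t))}.
    by apply: differentiable_continuous; apply/derivable1_diffP.
  have nb : \forall t \near (0 : R), jet_lift b 0 (g t) != 0.
    have := (continuous_normP _ _).1 cb 2^-1; rewrite invr_gt0 ltr0n => /(_ isT).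
    apply: filterS => t; rewrite b0m => H; apply/eqP => E; move: H; rewrite E subr0 normr1.
    lra.
  have dj := sg (Xc c m a) j 0%N 0; rewrite /= in dj.
  have nE : \forall t \near (0 : R), jet_lift (Xc c m a) j (g t) = h' t 0 (mxvec_index j a).
    by apply: filterS nb => t nbt; rewrite /h' nbt mxvecE mxE.
  apply: DeriveDef; first exact: near_eq_derivable nE dj.
  rewrite -(near_eq_derive _ nE) -derive1E -dg mxvecE mxE.
  have := @trunc_coefXnM R r (D (Xc c m a)) 1 j; rewrite expr1 -ltnS => -> //.
  case: j {dj nE} => -[|j] jr //=; rewrite subn1 /= HD'; last by rewrite -ltnS ltnW.
  by rewrite coef_poly (ltnW jr).
Qed.

End jets_in_a_chart.

Lemma TrM_zero_jet {R : realType} {n : nat} {M : manifold R n} r (m : M) : TrM (zero_jet r m).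
Proof.
have E (f : C^oo M) : zero_jet r m f = f m *: 1.
  by apply: trunc_eq => i ir; rewrite trunc_coefZ trunc_coef1 /zero_jet /= coefC; case: eqP; rewrite ?mulr1 ?mulr0.
split; first by move=> k f g; rewrite !E smooth_funD smooth_funZ scalerDl scalerA.
by split=> [|f g]; rewrite !E ?smooth_fun1E ?scale1r // smooth_funM -scalerAl mul1r scalerA.
Qed.

Section sufficiency.
Context {R : realType} {n : nat} {M : manifold R n} {r : nat}.
Local Notation jdim := (r.+1 * n)%N.
Variables (N : set M) (Q : set (C^oo M -> trunc R r)).
Hypotheses (r0 : (0 < r)%N) (cN : closed N) (gQ : graded_subbundle_along N Q).
Hypotheses (TMI : TM_invariant Q) (ArI : tangent_Ar_invariant Q).
Implicit Types (c : chart R n M) (u : C^oo M -> trunc R r) (w : 'I_n -> nat) (U : set M).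

Let QT : Q `<=` @TrM _ _ M r.
Proof. by have [[]] := gQ. Qed.

(** The shape of the image is what Hadamard's lemma requires on the entire chart. *)
Definition box_chart c w := adapted Q c w /\ star (fun a => (0 < w a)%N) (chart_map c @` chart_dom c).

Lemma adapted_locus c w m : adapted Q c w -> chart_dom c m -> (N m <-> weight_locus w (chart_map c m)).
Proof.
move=> [sc ws H] Dm; rewrite -(graded_zero_jet m gQ).
have tz := TrM_zero_jet r m.
rewrite (H _ m tz (zero_jet_base m) Dm).
have E a j : (zero_jet r m (Xc c m a))`_j = if j == 0%N then chart_map c m 0 a else 0.
  by rewrite /zero_jet /= coefC XcE.
split=> [H1 a wa|H1 a j ja]; first by have := H1 a 0%N wa; rewrite E.
by rewrite E; case: eqP => // j0; apply: H1; rewrite -j0.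
Qed.

Lemma box_chart_exists m : N m -> exists c w, box_chart c w /\ chart_dom c m.
Proof.
move=> Nm; have [c ac Dm] := atlas_cover m; have sc := atlas_smooth_chart ac.
have Sp0 : jet_slice Q c (jemb ord0 (chart_map c m)).
  rewrite -coords_zero_jet //; apply/(jet_slice_coords gQ) => //; last exact/(graded_zero_jet m gQ).
  - by apply: QT; exact/(graded_zero_jet m gQ).
  - exact: zero_jet_base.
have [[_ sub] _ _] := gQ; have [U [psi [psi' [k0 [dpsi Up0 SU]]]]] := sub c ac _ Sp0.
have [w [V [X [X' [ws VI Vm dX HX]]]]] := adapted_map dpsi SU Up0 Sp0
  (fun t q => @jet_slice_kappa _ _ _ _ _ _ gQ c t q sc) (fun q x => @jet_slice_top _ _ _ _ _ _ r0 gQ TMI c q x sc)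
  (fun q v g => @jet_slice_shift _ _ _ _ _ _ gQ ArI c q v g sc) (chart_full_open (c := c))
  (ex_intro2 _ _ m Dm erefl : (chart_map c @` chart_dom c) (chart_map c m)).
have [oV oXV XK sX sX'] := dX.
have HQ u m' : TrM u -> base_point u m' -> chart_dom c m' -> V (chart_map c m') ->
    (Q u <-> forall b j, (j < w b)%N -> (jet (fun x => X x 0 b) (coords c m' u))`_j = 0).
  move=> tu bu Dm' Vm'; have H1 := HX (mxvec (coords c m' u)).
  rewrite mxvecK (jbase_coords bu sc Dm') in H1.
  exact: iff_trans (iff_sym (jet_slice_coords gQ sc tu bu Dm')) (H1 Vm').
have Xm a : (0 < w a)%N -> X (chart_map c m) 0 a = 0.
  move=> wa; have Qz : Q (zero_jet r m) by exact/(graded_zero_jet m gQ).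
  have := (HQ _ m (QT Qz) (zero_jet_base m) Dm Vm).1 Qz a 0%N wa.
  by rewrite jet0 (jbase_coords (zero_jet_base m) sc Dm).
have : nbhs (X (chart_map c m)) (X @` V) by apply: open_nbhs_nbhs; split=> //; exists (chart_map c m).
move=> /near_normP[e e0 He].
(* The coordinates of positive weight vanish at the centre, so shrinking them moves points of the
   ball towards the centre. *)
pose B : set 'rV[R]_n := [set y | `|y - X (chart_map c m)| < e].
have oB : open B.
  rewrite (_ : B = ball (X (chart_map c m)) e); first exact: ball_open.
  by apply/funext => y; rewrite -ball_normE /B /ball_ /= distrC.
have BV : B `<=` X @` V by move=> y By; exact: He.
have [dX2 imB] := diffeo_sub dX oB BV.
have V2I : V `&` X @^-1` B `<=` chart_map c @` chart_dom c by move=> x [/VI].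
have [c' [sc' Dc' mc']] := chart_restrict sc V2I dX2.
have Bm : B (X (chart_map c m)) by rewrite /B /= subrr normr0.
have img : chart_map c' @` chart_dom c' = B.
  rewrite -imB; apply/seteqP; split=> y [x Dx <-].
    by move/Dc': Dx => [Dx Vx]; exists (chart_map c x); rewrite ?mc'.
  have [m' Dm' mx] := V2I x Dx; exists m'; first by apply/Dc'; rewrite mx.
  by rewrite mc' mx.
exists c', w; split; last by apply/Dc'; split=> //; split.
split; last first.
  rewrite img => y t By /andP[t0 t1]; rewrite /B /=; apply: le_lt_trans By.
  apply: rV_norm_le => // a; apply: le_trans (rV_norm_coord _ a); rewrite !mxE.
  case: ifP => wa //; rewrite Xm // !subr0 normrM ler_piMl // ger0_norm //.
split=> // u m' tu bu Dcm'; have [Dm' [Vm' _]] := (Dc' m').1 Dcm'.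
rewrite (HQ u m' tu bu Dm' Vm').
have E b j : (j <= r)%N -> (u (Xc c' m' b))`_j = (jet (fun x => X x 0 b) (coords c m' u))`_j.
  move=> jr; rewrite (TrM_jet _ tu bu sc Dm' jr).
  have bb := jbase_coords bu sc Dm'.
  rewrite (jet_near Dm' bb (XcP b sc' Dcm')).
  congr (_`_j); rewrite (jet_ext (g := fun x => X x 0 b) (chart_full_open (c := c))) //.
    by rewrite bb; exists m'.
  by move=> _ [x Dx <-] /=; rewrite mc' chart_invK.
split=> H a j ja; have jr : (j <= r)%N by apply: leq_trans (ltnW ja) (ws.2 a).
  by rewrite E // H.
by rewrite -E // H.
Qed.

(** Imposing the order in all box charts at once gives a global filtration without any gluing. That
    one chart suffices to compute it rests on [filt_coord]. *)
Definition filt i U (f : M -> R) := smooth_on U f /\ forall c w, box_chart c w ->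
  wvan (chart_map c @` (U `&` chart_dom c)) w i (f \o chart_inv c).

Let box_smooth c w : box_chart c w -> smooth_chart c.
Proof. by move=> [[]]. Qed.

Lemma filt0 U f : smooth_on U f -> filt 0 U f.
Proof. by move=> sf; split=> // c w _ s _; rewrite ltn0. Qed.

Lemma filt_le i j U f : (j <= i)%N -> filt i U f -> filt j U f.
Proof. by move=> ji [sf H]; split=> // c w bc; apply: wvan_le ji _; exact: H. Qed.

Lemma filt_ext i U f g : open U -> (forall y, U y -> f y = g y) -> filt i U f -> filt i U g.
Proof.
move=> oU fg [sf H]; split; first exact: smooth_on_ext oU fg sf.
move=> c w bc; apply: wvan_ext (H c w bc); first exact: chart_img_open.
by move=> _ [m [Um Dm] <-] /=; rewrite chart_invK // fg.
Qed.

Lemma filtD i U f g : open U -> filt i U f -> filt i U g -> filt i U (f + g).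
Proof.
move=> oU [sf Hf] [sg Hg]; split; first exact: smooth_onD.
move=> c w bc; have sc := box_smooth bc; apply: wvanD (Hf c w bc) (Hg c w bc).
- exact: chart_img_open.
- exact: smooth_on_chart.
- exact: smooth_on_chart.
Qed.

Lemma filtM i j U f g : open U -> filt i U f -> filt j U g -> filt (i + j) U (f * g).
Proof.
move=> oU [sf Hf] [sg Hg]; split; first exact: smooth_onM.
move=> c w bc; have sc := box_smooth bc; apply: wvanM (Hf c w bc) (Hg c w bc).
- exact: chart_img_open.
- exact: smooth_on_chart.
- exact: smooth_on_chart.
Qed.

Lemma filt_zero i U : open U -> filt i U 0.
Proof.
move=> oU; split; first exact: (smooth_on_cst 0 oU).
by move=> c w bc s _ _ x _ _; exact: ders0.
Qed.

Lemma filt_restrict i U V f : V `<=` U -> filt i U f -> filt i V f.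
Proof.
move=> VU [sf H]; split; first exact: smooth_on_sub VU sf.
by move=> c w bc; apply: wvan_sub (H c w bc) => _ [m [Vm Dm] <-]; exists m => //; split=> //; exact: VU.
Qed.

Lemma filt_sheaf i : ideal_sheaf (filt i).
Proof.
split.
- by move=> U f g; exact: filt_ext.
- by move=> U f _ [].
- by move=> U; exact: filt_zero.
- by move=> U f g; exact: filtD.
- by move=> U a f oU sa Hf; have := filtM oU (filt0 sa) Hf.
- by move=> U V f _ _; exact: filt_restrict.
- move=> U f oU H; split.
    by apply: smooth_on_glue => x Ux; have [V [oV Vx VU [sf _]]] := H x Ux; exists V, f.
  move=> c w bc s ps ws _ [m [Um Dm] <-] Zm; have [V [oV Vm VU [_ Hf]]] := H m Um.
  by apply: (Hf c w bc s ps ws) => //; exists m.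
Qed.

Lemma filt_sum i U I (s : seq I) (F : I -> M -> R) : open U -> (forall k, filt i U (F k)) ->
  filt i U (\sum_(k <- s) F k).
Proof.
move=> oU H; elim: s => [|k s IH]; first by rewrite big_nil; exact: filt_zero.
by rewrite big_cons; exact: filtD.
Qed.

Lemma filt_exp i k U f : open U -> filt i U f -> filt (k * i) U (f ^+ k).
Proof.
move=> oU H; elim: k => [|k IH]; first by rewrite mul0n expr0; exact/filt0/(smooth_on_cst 1 oU).
by rewrite exprS mulSn; exact: filtM.
Qed.

Lemma filt_prod U I (s : seq I) (i : I -> nat) (F : I -> M -> R) : open U -> (forall k, filt (i k) U (F k)) ->
  filt (\sum_(k <- s) i k) U (\prod_(k <- s) F k).
Proof.
move=> oU H; elim: s => [|k s IH]; first by rewrite !big_nil; exact/filt0/(smooth_on_cst 1 oU).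
by rewrite !big_cons; exact: filtM.
Qed.

(** Jets in the second chart that satisfy its linear equations belong to [Q], hence satisfy those of
    the first chart; [jet_wvan] converts this into an order of vanishing of x_a. *)
Lemma filt_coord c w a : adapted Q c w -> filt (w a) (chart_dom c) (fun x => chart_map c x 0 a).
Proof.
move=> [sc ws H]; split; first exact: smooth_on_coord.
move=> c' w' [[sc' ws' H'] _].
have oI : open (chart_map c' @` (chart_dom c `&` chart_dom c')) by apply: chart_img_open; exact: chart_dom_open.
apply: (jet_wvan (r := r)) => //.
- apply: smooth_on_chart => //; [exact: chart_dom_open | exact: smooth_on_coord].
- exact: ws'.2.
- by apply: leq_trans (ws.2 a) _.
move=> p [m [Dm Dm'] mp] Hp j ja.
have Ip : (chart_map c' @` chart_dom c') (jbase p) by exists m.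
have tu : TrM (Tp c' p : C^oo M -> trunc R r) by exact: Tp_TrM.
have bu := Tp_base (r := r) sc' Ip; rewrite -mp chart_invK // in bu.
have jr : (j <= r)%N by apply: leq_trans (ltnW ja) (ws.2 a).
have Qu : Q (Tp c' p).
  apply/(H' _ m tu bu Dm') => b k kb.
  have kr : (k <= r)%N by apply: leq_trans (ltnW kb) (ws'.2 b).
  by rewrite (Tp_coord sc' Dm' (esym mp) (XcP b sc' Dm')) // Hp.
have := (H _ m tu bu Dm).1 Qu a j ja; rewrite (TrM_jet _ tu bu sc' Dm') // coords_Tp //.
by rewrite (jet_near Dm' (esym mp) (XcP a sc Dm)).
Qed.

(** One direction is the weighted form of Hadamard's lemma in [c]; the other holds because the
    coordinates have order [w a] and orders add up under products. *)
Lemma filt_ideal c w i f : box_chart c w -> (filt i (chart_dom c) f <-> weighted_ideal c w i f).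
Proof.
move=> bc; have [ad sO] := bc; have [sc ws _] := ad; have oD := chart_dom_open c.
have oI := chart_full_open (c := c).
split=> [[sf Hf]|[k [s [g [si sg fE]]]]].
  have sfc := smooth_on_chart sc oD sf; rewrite setIid in sfc.
  have Hw := Hf c w bc; rewrite setIid in Hw.
  have [k [s [h [si sh E]]]] := wvan_monomial_sum oI sO sfc Hw.
  exists k, s, (fun l => h l \o chart_map c); split=> //.
    move=> l; apply: smooth_on_sub (smooth_on_pullback sc oI (sh l)) => m Dm.
    by split=> //; exists m.
  move=> y Dy; have := E (chart_map c y); rewrite /= chart_invK // => -> //.
  by exists y.
apply: (filt_ext oD (f := \sum_(l < k) g l * \prod_a (fun x => chart_map c x 0 a) ^+ s l a)).
  move=> y Dy; rewrite fE // fct_sumE; apply: eq_bigr => l _.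
  rewrite -[LHS]/(g l y * (\prod_a (fun x : M => chart_map c x 0 a) ^+ s l a) y); congr (_ * _).
  rewrite fct_prodE; apply: eq_bigr => a _.
  by elim: (s l a) => [|q IH]; rewrite ?expr0 // !exprS -IH.
have Hl l : filt i (chart_dom c) (g l * \prod_a (fun x => chart_map c x 0 a) ^+ s l a).
  apply: (filt_le (si l)); rewrite -[(\sum_a _)%N]add0n; apply: (filtM oD); first exact/filt0/sg.
  have Ha a := filt_exp (s l a) oD (filt_coord a ad).
  exact: (filt_prod (index_enum 'I_n) oD Ha).
exact: (filt_sum (index_enum 'I_k) oD Hl).
Qed.

Lemma filt_weighting : weighting r filt.
Proof.
split.
- exact: filt_sheaf.
- by move=> U f oU; split=> [[]|]; [|exact: filt0].
- by move=> i U oU f; exact: filt_le.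
- move=> m; have [Nm|nN] := pselect (N m).
    have [c [w [bc Dm]]] := box_chart_exists Nm; left; exists c, w.
    have [[sc ws _] _] := bc; split=> // i f; exact: filt_ideal.
  right; exists (~` N); split=> //; first exact: closed_openC.
  move=> i f; split=> [[]//|sf]; split=> // c w bc s ps ws _ [m' [nN' Dm'] <-] Zm.
  by case: nN'; apply/(adapted_locus (bc.1) Dm').
Qed.

Lemma filt_along : weighting_along N filt.
Proof.
move=> U f oU; split=> [[sf H]|[sf H]]; split=> //.
  move=> y Uy Ny; have [c [w [bc Dy]]] := box_chart_exists Ny.
  have Zy := (adapted_locus bc.1 Dy).1 Ny.
  have := wvan_val (H c w bc) isT _ Zy; rewrite /= chart_invK //; apply.
  by exists y.
move=> c w bc [|b s]; last by move=> /= /andP[wb _]; rewrite /wt big_cons ltnS leqn0 addn_eq0 gtn_eqF.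
move=> _ _ _ [y [Uy Dy] <-] Zy /=; rewrite chart_invK //; apply: H => //.
exact/(adapted_locus bc.1 Dy).
Qed.

Lemma filt_jets : Q = weighting_jets r filt.
Proof.
apply/seteqP; split=> u.
  move=> Qu; split; first exact: QT.
  move=> f i j Ff /andP[ji ir]; have [m [bu Nm]] := graded_base_exists gQ Qu.
  have [c [w [bc Dm]]] := box_chart_exists Nm; have [[sc ws H] _] := bc.
  have tu := QT Qu; have := filt_restrict (subsetT (chart_dom c)) Ff.
  move=> /(filt_ideal _ _ bc)/(weighted_ideal_ord sc tu bu Dm); apply=> //.
  exact/(H _ m tu bu Dm).
move=> [tu Hu]; have [m bu] := TrM_base_point tu.
have [Nm|nN] := pselect (N m); last first.
  have oN : open (~` N) by exact: closed_openC.
  (* A jet based off [N] is excluded by a function that vanishes near [N], hence lies in every ideal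
     of the filtration, but equals 1 at the base point. *)
  have [b [K [cK KN b0 b1]]] := bump_exists oN nN.
  have Fb : filt r setT b.
    split; first exact: smooth_fun_on.
    move=> c w bc s ps ws _ [y [_ Dy] <-] Zy.
    have Ny := (adapted_locus bc.1 Dy).2 Zy.
    have oK : open (~` K) by exact: closed_openC.
    have oO := chart_img_open (c := c) oK.
    rewrite (ders_ext (O := chart_map c @` (~` K `&` chart_dom c)) s oO (g := fun=> 0)) ?ders0 //.
      by move=> _ [x [nK Dx] <-] /=; rewrite chart_invK // b0.
    by exists y => //; split=> // /KN.
  have := Hu b r 0%N Fb; rewrite r0 leqnn bu (nbhs_singleton b1) => /(_ isT) /eqP.
  by rewrite oner_eq0.
have [c [w [bc Dm]]] := box_chart_exists Nm; have [[sc ws H] _] := bc.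
apply/(H _ m tu bu Dm) => a j ja.
have [b [K [cK KD b0 b1]]] := bump_exists (chart_dom_open c) Dm.
have [f [Ff fE]] := ideal_sheaf_extend (filt_sheaf (w a)) (chart_dom_open c) cK KD b0 (filt_coord a bc.1).
rewrite (TrM_germ tu bu (_ : \forall x \near m, Xc c m a x = f x)).
  by apply: (Hu f _ _ Ff); rewrite ja; exact: ws.2.
apply: filterS3 b1 (XcP a sc Dm) (near_dom Dm) => x bx -> Dx.
by rewrite fE // bx mul1r.
Qed.

End sufficiency.

Theorem theorem8p4 (R : realType) (n : nat) (M : manifold R n) (N : set M)
    (r : nat) (Q : set (C^oo M -> trunc R r)) :
  (0 < r)%N -> closed N -> submanifold N -> graded_subbundle_along N Q ->
  (exists F : nat -> set M -> set (M -> R),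
     [/\ weighting r F, weighting_along N F &
         Q = weighting_jets r F]) <->
  [/\ TM_invariant Q, tangent_Ar_invariant Q & tangent_spanned_by_lifts Q].
Proof.
move=> r0 cN _ gQ; split=> [[F [wF FN QE]]|[TMI ArI _]].
  by move: gQ; rewrite QE => gQ; exact: weighting_necessary r0 wF FN gQ.
exists (filt Q); split.
- exact: filt_weighting r0 cN gQ TMI ArI.
- exact: filt_along r0 gQ TMI ArI.
- exact: filt_jets r0 cN gQ TMI ArI.
Qed.
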